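(* Let $p$ be a prime and let $G$ be a virtually free pro-$p$ group. Then $G$ acts (continuously) on a pro-$p$ tree with finite vertex stabilizers.
   Context: A virtually free pro-$p$ group is a pro-$p$ group containing an open free pro-$p$ subgroup. No finite generation or countability assumption is made. A profinite graph is a profinite space $\Gamma$ with a non-empty closed subset $V(\Gamma)$ (vertices) and continuous maps $d_0,d_1:\Gamma\to V(\Gamma)$ that are the identity on $V(\Gamma)$; $E(\Gamma)=\Gamma\setminus V(\Gamma)$ is the set of edges. Let $(E^*(\Gamma),* )=(\Gamma/V(\Gamma),* )$ be the pointed profinite space obtained by collapsing $V(\Gamma)$ to the distinguished point $*$. For a profinite space $X$, $\mathbb{Z}_p[[X]]=\varprojlim \mathbb{Z}_p[X_i]$ over the finite discrete quotients $X_i$ of $X$, and for a pointed profinite space $(X,* )=\varprojlim (X_i,* )$, $\mathbb{Z}_p[[X,*]]=\varprojlim \mathbb{Z}_p[X_i,*]$, where $\mathbb{Z}_p[X_i,*]$ is the free $\mathbb{Z}_p$-module on $X_i$ modulo $*=0$. $\Gamma$ is a pro-$p$ tree if the sequence $$0\to \mathbb{Z}_p[[E^*(\Gamma),*]]\xrightarrow{\ \delta\ }\mathbb{Z}_p[[V(\Gamma)]]\xrightarrow{\ \varepsilon\ }\mathbb{Z}_p\to 0$$ is exact, where $\delta(\bar e)=d_1(e)-d_0(e)$ and $\varepsilon(v)=1$ for $v\in V(\Gamma)$. A pro-$p$ group $G$ acts on a profinite graph $\Gamma$ if it acts continuously on the space $\Gamma$ commuting with $d_0,d_1$. *)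

(* Defs.v *)
From HB Require Import structures.
From mathcomp Require Import all_boot all_algebra generic_quotient.
From mathcomp Require Import all_classical.
From mathcomp Require Import topology.

Set Implicit Arguments.
Unset Strict Implicit.
Unset Printing Implicit Defensive.

Import GRing.Theory.
Local Open Scope classical_set_scope.
Local Open Scope card_scope.
Local Open Scope quotient_scope.

Definition profinite_space (T : topologicalType) :=
  [/\ compact [set: T], hausdorff_space T & totally_disconnected [set: T]].

HB.mixin Record isTopologicalGroup G of Group G & Topological G := {
  mulg_continuous : continuous (fun xy : G * G => (xy.1 * xy.2)%g);
  invg_continuous : continuous (fun x : G => (x^-1)%g)
}.

#[short(type="topGroupType")]
HB.structure Definition TopologicalGroup :=
  {G of Group G & Topological G & isTopologicalGroup G}.

Record subgroup (G : groupType) := Subgroup {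
  elts :> set G;
  subgroup1 : elts 1%g;
  subgroupF : forall x y, elts x -> elts y -> elts (x / y)%g
}.

Definition normal_subgroup (G : groupType) (N : subgroup G) :=
  forall x g, elts N x -> elts N (x ^ g)%g.

Definition lcosets (G : groupType) (H : subgroup G) : set (set G) :=
  [set [set (x * h)%g | h in H] | x in [set: G]].

Definition subgroup_type (G : groupType) (H : subgroup G) : Type :=
  set_type H.

Section SubgroupType.
Context {G : topGroupType} (H : subgroup G).
Local Notation sT := (subgroup_type H).

HB.instance Definition _ := SubChoice.copy sT (set_type H).
HB.instance Definition _ := Topological.copy sT (set_type H).

Lemma subgroup_type_closed : group_closed [pred x : G | x \in (H : set G)].
Proof.
split; first by rewrite inE; exact: subgroup1.
by move=> x y; rewrite !inE; exact: subgroupF.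
Qed.

HB.instance Definition _ := SubChoice_isSubGroup.Build G _ sT
  subgroup_type_closed.

Let val_continuous : continuous (\val : sT -> G).
Proof. exact: initial_continuous. Qed.

Lemma subgroup_mulg_continuous :
  continuous (fun xy : sT * sT => (xy.1 * xy.2)%g).
Proof.
apply: (@continuous_comp_initial sT _ _ \val) => -[x y] /=.
have val2 : (\val z.1, \val z.2) @[z --> (x, y)] --> (\val x, \val y).
  apply: cvg_pair => /=.
    by apply: (@cvg_comp _ _ _ fst \val) (@val_continuous x); exact: cvg_fst.
  by apply: (@cvg_comp _ _ _ snd \val) (@val_continuous y); exact: cvg_snd.
exact: (cvg_comp _ _ val2 (@mulg_continuous G (\val x, \val y))).
Qed.

Lemma subgroup_invg_continuous : continuous (fun x : sT => (x^-1)%g).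
Proof.
apply: (@continuous_comp_initial sT _ _ \val) => x /=.
exact: (cvg_comp _ _ (@val_continuous x) (@invg_continuous G (\val x))).
Qed.

HB.instance Definition _ := isTopologicalGroup.Build sT
  subgroup_mulg_continuous subgroup_invg_continuous.

End SubgroupType.

Definition pro_p_group (p : nat) (G : topGroupType) :=
  profinite_space G /\
  forall N : subgroup G, open (N : set G) -> normal_subgroup N ->
    exists k : nat, lcosets N #= `I_(p ^ k).

(** [F] is the free pro-p group on the pointed profinite space [(X, x0)].
    A set converging to 1 is the case where [X] is its one-point
    compactification, and an unpointed profinite space is handled by adding
    an isolated base point. *)
Definition free_pro_p_on (p : nat) (X : topologicalType) (x0 : X)
    (F : topGroupType) (iota : X -> F) :=
  [/\ continuous iota, iota x0 = 1%g &
    forall (H : topGroupType) (phi : X -> H),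
      pro_p_group p H -> continuous phi -> phi x0 = 1%g ->
      exists psi : {multiplicative F -> H},
        [/\ continuous psi, forall x, psi (iota x) = phi x &
          forall psi' : {multiplicative F -> H}, continuous psi' ->
            (forall x, psi' (iota x) = phi x) -> psi' =1 psi]].

Definition free_pro_p_group (p : nat) (F : topGroupType) :=
  pro_p_group p F /\
  exists (X : topologicalType) (x0 : X) (iota : X -> F),
    profinite_space X /\ free_pro_p_on p x0 iota.

Definition virtually_free_pro_p_group (p : nat) (G : topGroupType) :=
  pro_p_group p G /\
  exists H : subgroup G,
    open (H : set G) /\ free_pro_p_group p (subgroup_type H).

Local Open Scope ring_scope.

(** Z_p as the inverse limit of the rings Z/p^(n+1); the exponent starts at 1
    because ['Z_1] is not the trivial ring. *)
Record padic (p : nat) := Padic {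
  residue :> forall n, 'Z_(p ^ n.+1);
  residue_compat : forall n, inZp (residue n.+1) = residue n
}.

HB.instance Definition _ p := gen_eqMixin (padic p).
HB.instance Definition _ p := gen_choiceMixin (padic p).

HB.instance Definition _ p := Topological.copy (padic p)
  (initial_topology (@residue p : padic p ->
    prod_topology (fun n => discrete_topology 'Z_(p ^ n.+1)))).

Section Reduction.
Variables (m n : nat).
Hypothesis mn : (m.+2 %| n.+2)%N.
Let red (x : 'I_n.+2) : 'I_m.+2 := inZp x.

Lemma red0 : red 0 = 0.
Proof. by apply: val_inj; rewrite /= mod0n. Qed.

Lemma red1 : red 1 = 1.
Proof. by apply: val_inj. Qed.

Lemma redD x y : red (x + y) = red x + red y.
Proof. by apply: val_inj; rewrite /= modn_dvdm// modnDm. Qed.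

Lemma redM x y : red (x * y) = red x * red y.
Proof. by apply: val_inj; rewrite /= modn_dvdm// modnMm. Qed.

Lemma redN x : red (- x) = - red x.
Proof. by apply/eqP; rewrite -addr_eq0 -redD addNr red0. Qed.

End Reduction.

Section PadicRing.
Context {p : nat}.
Implicit Types x y z : padic p.

Lemma padicP x y : (forall n, x n = y n) -> x = y.
Proof.
case: x y => [f fP] [g gP] /= fg.
have {}fg : f = g by apply: functional_extensionality_dep.
by rewrite -fg in gP *; congr Padic; exact: Prop_irrelevance.
Qed.

Lemma Zp_trunc_dvd n :
  ((Zp_trunc (p ^ n.+1)).+2 %| (Zp_trunc (p ^ n.+2)).+2)%N.
Proof.
have [p2|p_gt1] := leqP p 1.
  by have [->|->] : p = 0%N \/ p = 1%N by [case: p p2 => [|[]]; auto];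
    rewrite ?exp0n ?exp1n.
have p1 k : (1 < p ^ k.+1)%N by rewrite -(expn0 p) ltn_exp2l.
by rewrite !Zp_cast ?p1// dvdn_exp2l.
Qed.

Fact padic0_compat n : inZp (0%R : 'Z_(p ^ n.+2)) = 0 :> 'Z_(p ^ n.+1).
Proof. exact: red0. Qed.

Fact padic1_compat n : inZp (1%R : 'Z_(p ^ n.+2)) = 1 :> 'Z_(p ^ n.+1).
Proof. exact: red1. Qed.

Fact padic_opp_compat x n : inZp (- x n.+1)%R = - x n.
Proof. by rewrite -(residue_compat x n); exact: redN (Zp_trunc_dvd n) _. Qed.

Fact padic_add_compat x y n : inZp (x n.+1 + y n.+1)%R = x n + y n.
Proof.
rewrite -(residue_compat x n) -(residue_compat y n).
exact: redD (Zp_trunc_dvd n) _ _.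
Qed.

Fact padic_mul_compat x y n : inZp (x n.+1 * y n.+1)%R = x n * y n.
Proof.
rewrite -(residue_compat x n) -(residue_compat y n).
exact: redM (Zp_trunc_dvd n) _ _.
Qed.

Definition padic0 := @Padic p (fun=> 0) padic0_compat.
Definition padic1 := @Padic p (fun=> 1) padic1_compat.
Definition padic_opp x := @Padic p (fun n => - x n) (padic_opp_compat x).
Definition padic_add x y :=
  @Padic p (fun n => x n + y n) (padic_add_compat x y).
Definition padic_mul x y :=
  @Padic p (fun n => x n * y n) (padic_mul_compat x y).

Fact padic_addA : associative padic_add.
Proof. by move=> x y z; apply: padicP => n /=; rewrite addrA. Qed.
Fact padic_addC : commutative padic_add.
Proof. by move=> x y; apply: padicP => n /=; rewrite addrC. Qed.
Fact padic_add0 : left_id padic0 padic_add.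
Proof. by move=> x; apply: padicP => n /=; rewrite add0r. Qed.
Fact padic_addN : left_inverse padic0 padic_opp padic_add.
Proof. by move=> x; apply: padicP => n /=; rewrite addNr. Qed.

HB.instance Definition _ := GRing.isZmodule.Build (padic p)
  padic_addA padic_addC padic_add0 padic_addN.

Fact padic_mulA : associative padic_mul.
Proof. by move=> x y z; apply: padicP => n /=; rewrite mulrA. Qed.
Fact padic_mulC : commutative padic_mul.
Proof. by move=> x y; apply: padicP => n /=; rewrite mulrC. Qed.
Fact padic_mul1 : left_id padic1 padic_mul.
Proof. by move=> x; apply: padicP => n /=; rewrite mul1r. Qed.
Fact padic_mulD : left_distributive padic_mul padic_add.
Proof. by move=> x y z; apply: padicP => n /=; rewrite mulrDl. Qed.
Fact padic1_neq0 : padic1 != padic0.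
Proof. by apply/eqP => /(congr1 (fun x : padic p => x 0%N)). Qed.

HB.instance Definition _ := GRing.Zmodule_isComNzRing.Build (padic p)
  padic_mulA padic_mulC padic_mul1 padic_mulD padic1_neq0.

End PadicRing.

(** Up to homeomorphism, a finite discrete quotient of [X] is a continuous
    surjection onto some ['I_n]. *)
Record finite_quotient (X : topologicalType) := FiniteQuotient {
  quo_card : nat;
  quo_map :> X -> 'I_quo_card;
  quo_continuous : continuous (quo_map : X -> discrete_topology 'I_quo_card);
  quo_surj : range quo_map = setT
}.

Definition is_base (X : topologicalType) (base : option X)
    (q : finite_quotient X) (k : 'I_(quo_card q)) : bool :=
  if base is Some x0 then q x0 == k else false.

(** The inverse limit over the finite discrete quotients [q : X -> 'I_n] of
    - the free modules Z_p['I_n], if [base] is [None];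
    - their quotients Z_p['I_n, q x0] by [q x0 = 0], if [base] is [Some x0].
    An element of Z_p['I_n] is given by its coefficients ['I_n -> padic p], an
    element of Z_p['I_n, q x0] by its only representative whose coefficient at
    [q x0] is 0.  The transition map attached to [f] with [f \o q = r] sends
    the basis element [j] to [f j], which is dropped if it is the base
    point. *)
Record completed_module (p : nat) (X : topologicalType) (base : option X) :=
  CompletedModule {
  coef :> forall q : finite_quotient X, 'I_(quo_card q) -> padic p;
  coef_base : forall (q : finite_quotient X) (k : 'I_(quo_card q)),
    is_base base k -> @coef q k = 0;
  coef_compat : forall (q r : finite_quotient X)
    (f : 'I_(quo_card q) -> 'I_(quo_card r)), (forall x, f (q x) = r x) ->
    forall k, ~~ is_base base k -> @coef r k = \sum_(j | f j == k) @coef q j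
}.

(** Z_p[[X]] and Z_p[[X, x0]] *)
Notation Zp_free p X := (completed_module p (@None X)).
Notation Zp_free_pointed p x0 := (completed_module p (Some x0)).

HB.instance Definition _ p X base := gen_eqMixin (@completed_module p X base).
HB.instance Definition _ p X base :=
  gen_choiceMixin (@completed_module p X base).

HB.instance Definition _ p X base :=
  Topological.copy (@completed_module p X base)
    (initial_topology (@coef p X base : @completed_module p X base ->
      prod_topology (fun q : finite_quotient X =>
        prod_topology (fun _ : 'I_(quo_card q) => padic p)))).

Section CompletedModule.
Context {p : nat} {X : topologicalType} {base : option X}.
Local Notation M := (@completed_module p X base).
Implicit Types u v w : M.

Lemma completed_moduleP u v : (forall q k, u q k = v q k) -> u = v.
Proof.
case: u v => [f f0 fP] [g g0 gP] /= fg.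
have {}fg : f = g.
  by apply: functional_extensionality_dep => q; apply/funext => k.
rewrite -fg in g0 gP *.
by rewrite (Prop_irrelevance f0 g0) (Prop_irrelevance fP gP).
Qed.

Program Definition cm_zero : M := @CompletedModule p X base (fun _ _ => 0) _ _.
Next Obligation. by []. Qed.
Next Obligation. by move=> q r f _ k _; rewrite big1. Qed.

Program Definition cm_opp u : M :=
  @CompletedModule p X base (fun q k => - u q k) _ _.
Next Obligation. by move=> u q k kb; rewrite /= coef_base// oppr0. Qed.
Next Obligation.
by move=> u q r f fqr k kb; rewrite /= (coef_compat _ fqr kb) sumrN.
Qed.

Program Definition cm_add u v : M :=
  @CompletedModule p X base (fun q k => u q k + v q k) _ _.
Next Obligation. by move=> u v q k kb; rewrite /= !coef_base// addr0. Qed.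
Next Obligation.
by move=> u v q r f fqr k kb; rewrite /= !(coef_compat _ fqr kb) big_split.
Qed.

Program Definition cm_scale (a : padic p) u : M :=
  @CompletedModule p X base (fun q k => a * u q k) _ _.
Next Obligation. by move=> a u q k kb; rewrite /= coef_base// mulr0. Qed.
Next Obligation.
by move=> a u q r f fqr k kb; rewrite /= (coef_compat _ fqr kb) mulr_sumr.
Qed.

Fact cm_addA : associative cm_add.
Proof. by move=> u v w; apply: completed_moduleP => q k /=; rewrite addrA. Qed.
Fact cm_addC : commutative cm_add.
Proof. by move=> u v; apply: completed_moduleP => q k /=; rewrite addrC. Qed.
Fact cm_add0 : left_id cm_zero cm_add.
Proof. by move=> u; apply: completed_moduleP => q k /=; rewrite add0r. Qed.
Fact cm_addN : left_inverse cm_zero cm_opp cm_add.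
Proof. by move=> u; apply: completed_moduleP => q k /=; rewrite addNr. Qed.

HB.instance Definition _ := GRing.isZmodule.Build M
  cm_addA cm_addC cm_add0 cm_addN.

Fact cm_scaleA a b u : cm_scale a (cm_scale b u) = cm_scale (a * b) u.
Proof. by apply: completed_moduleP => q k /=; rewrite mulrA. Qed.
Fact cm_scale1 : left_id 1 cm_scale.
Proof. by move=> u; apply: completed_moduleP => q k /=; rewrite mul1r. Qed.
Fact cm_scaleDr : right_distributive cm_scale +%R.
Proof. by move=> a u v; apply: completed_moduleP => q k /=; rewrite mulrDr. Qed.
Fact cm_scaleDl u : {morph cm_scale^~ u : a b / a + b}.
Proof. by move=> a b; apply: completed_moduleP => q k /=; rewrite mulrDl. Qed.

HB.instance Definition _ := GRing.Zmodule_isLmodule.Build (padic p) M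
  cm_scaleA cm_scale1 cm_scaleDr cm_scaleDl.

(** The image of [x] in Z_p[[X]] or in Z_p[[X, x0]]; it is 0 if [x] is the base
    point. *)
Program Definition basis_elt (x : X) : M := @CompletedModule p X base
  (fun q k => if is_base base k then 0 else (q x == k)%:R) _ _.
Next Obligation. by move=> x q k /= ->. Qed.
Next Obligation.
move=> x q r f fqr k kb; rewrite /= (negPf kb) -fqr.
rewrite (eq_bigr (fun j => (q x == j)%:R)); last first.
  move=> j /eqP fj; case: ifP => // jb; move: kb; rewrite -fj.
  by move: jb; rewrite /is_base; case: base => // x0 /eqP <-; rewrite fqr eqxx.
have [fk|fk] := eqVneq (f (q x)) k.
  rewrite (bigD1 (q x)) /= ?fk ?eqxx// big1 ?addr0// => j /andP[_].
  by rewrite eq_sym => /negPf ->.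
rewrite big1// => j /eqP fj; have [qj|//] := eqVneq (q x) j.
by rewrite qj fj eqxx in fk.
Qed.

End CompletedModule.

Section Collapse.
Context {T : topologicalType} (A : set T).

Definition collapse_rel : rel T :=
  fun x y => (x == y) || ((x \in A) && (y \in A)).

Fact collapse_refl : reflexive collapse_rel.
Proof. by move=> x; rewrite /collapse_rel eqxx. Qed.
Fact collapse_sym : symmetric collapse_rel.
Proof. by move=> x y; rewrite /collapse_rel eq_sym andbC. Qed.
Fact collapse_trans : transitive collapse_rel.
Proof.
move=> y x z /orP[/eqP -> // | /andP[xA yA]] /orP[/eqP <-|/andP[_ zA]].
  by rewrite /collapse_rel xA yA orbT.
by rewrite /collapse_rel xA zA orbT.
Qed.

Canonical collapse_equiv :=
  EquivRel collapse_rel collapse_refl collapse_sym collapse_trans.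

Definition collapse : topologicalType :=
  quotient_topology {eq_quot collapse_rel}%qT.

Definition collapse_pi (x : T) : collapse :=
  \pi_({eq_quot collapse_rel}%qT)%qT x.

End Collapse.

Record profinite_graph := ProfiniteGraph {
  graph :> topologicalType;
  graph_profinite : profinite_space graph;
  vertices : set graph;
  vertices_closed : closed vertices;
  vertices_nonempty : vertices !=set0;
  d0 : graph -> set_type vertices;
  d1 : graph -> set_type vertices;
  d0_continuous : continuous d0;
  d1_continuous : continuous d1;
  d0_vertex : forall v : set_type vertices, d0 (\val v) = v;
  d1_vertex : forall v : set_type vertices, d1 (\val v) = v
}.

Definition edges (Gamma : profinite_graph) : set Gamma :=
  ~` (@vertices Gamma).

(** (E^*(Gamma), * ) is [(edge_space Gamma, edge_base Gamma)]; [edge_class e] is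
    the class of [e] in it. *)
Definition edge_space (Gamma : profinite_graph) : topologicalType :=
  collapse (@vertices Gamma).

Definition edge_class (Gamma : profinite_graph) (e : Gamma) :
  edge_space Gamma := collapse_pi (@vertices Gamma) e.

Definition edge_base (Gamma : profinite_graph) : edge_space Gamma :=
  edge_class (sval (cid (@vertices_nonempty Gamma))).

(** The continuous linear maps [delta] and [eps] are determined by their values
    on the basis elements, which span dense submodules. *)
Definition pro_p_tree (p : nat) (Gamma : profinite_graph) :=
  exists (delta : {linear Zp_free_pointed p (edge_base Gamma) ->
                          Zp_free p (set_type (@vertices Gamma))})
         (eps : {scalar Zp_free p (set_type (@vertices Gamma))}),
    [/\ continuous delta /\ (forall e, edges e ->
          delta (basis_elt (edge_class e)) =
          basis_elt (d1 e) - basis_elt (d0 e)),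
        continuous eps /\ (forall v, eps (basis_elt v) = 1),
        injective delta,
        range delta = eps @^-1` [set 0] &
        range eps = setT].

Definition graph_action (G : topGroupType) (Gamma : profinite_graph)
    (act : G -> Gamma -> Gamma) :=
  [/\ forall x, act 1%g x = x,
      forall g h x, act (g * h)%g x = act g (act h x),
      continuous (fun gx : G * Gamma => act gx.1 gx.2),
      forall g x, \val (d0 (act g x)) = act g (\val (d0 x)) &
      forall g x, \val (d1 (act g x)) = act g (\val (d1 x))].

(* Main.v *)
Require Import Defs.
From Stdlib Require List.
From HB Require Import structures.
From mathcomp Require Import all_boot all_algebra all_fingroup all_solvable.
From mathcomp Require Import all_classical topology.

(** Let N be an open normal subgroup of the virtually free pro-p group G that
    lies in an open free subgroup H, and K = G/N. The Cayley tree of H, coinduced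
    to G, gives a contractible box complex V on which G acts and N acts freely.
    Smith theory for the finite p-group K, applied to the fixed subcomplexes of
    V/N, yields a K-invariant basis S of the pro-p fundamental group F of V/N
    relative to all of its vertices, so that F is free on S. The Cayley graph
    of F with respect to S and 1 is a pro-p tree. Twisting the action of G by
    the class l(v0, g v0) of a path from the base point makes g act by
    f |-> l(v0, g v0) (g f), and the stabilizers of this action meet N
    trivially, so they embed into K. *)

Set Implicit Arguments.
Unset Strict Implicit.
Unset Printing Implicit Defensive.

Import GRing.Theory.

(** The obstacle is that G neither permutes a given basis of N nor acts on the tree of H.
    Coinduction repairs the action at the price of a product of |G : H| trees, so the quotient by N
    is only known to have no cohomology from degree 2 on. Smith theory carries this vanishing to the
    simplices fixed by any subgroup A of K. In degree 1 it then yields the two facts that build the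
    basis: homomorphisms extend invariantly from the group of a fixed subcomplex, and invariant ones
    that vanish on all smaller fixed subcomplexes are traces. The basis is assembled one conjugacy
    class of stabilizers at a time, from K down to 1.

    All vertices are kept because K need not fix one: the fundamental group at a single vertex would
    only carry an outer action, whereas the universal group of the path classes carries a genuine
    one, and it is still free. No finiteness of rank is available, so bases must converge to 1;
    lifting a dual basis to such a family takes Zorn's lemma and compactness. Topology is encoded by
    directed systems of finite levels, local constancy meaning dependence on one level only. *)

Lemma subrBB (U : zmodType) (a b c d : U) :
  (a - b - (c - d) = a - c - (b - d))%R.
Proof. by rewrite !opprB [(d - c)%R]addrC addrACA [(- b + d)%R]addrC. Qed.

(** * Ordered cochains on lists of vertices, and the prism operator *)

Section ListCochains.
Local Open Scope ring_scope.
Variables (V : Type) (E : zmodType).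
Implicit Types (F : seq V -> E) (s : seq V).

(** The simplicial coboundary: unfolding gives the alternating sum of [F] over the faces of [s], the
    face without the head coming first with sign plus. A cochain is defined on lists of every
    length, so no degree has to be carried in types. *)
Fixpoint cobd F s : E :=
  if s is x :: s' then F s' - cobd (fun t => F (x :: t)) s' else 0.

Inductive face : seq V -> seq V -> Prop :=
| face_head x s : face s (x :: s)
| face_tail x s t : face t s -> face (x :: t) (x :: s).

Inductive degenerate : seq V -> Prop :=
| degenerate_head x s : degenerate (x :: x :: s)
| degenerate_tail x s : degenerate s -> degenerate (x :: s).

Lemma face_size t s : face t s -> (size t).+1 = size s.
Proof. by elim=> //= x s' t' _ ->. Qed.

Lemma cobd_local F F' s : (forall t, face t s -> F t = F' t) ->
  cobd F s = cobd F' s.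
Proof.
elim: s F F' => //= x s IH F F' FF'; rewrite FF'; last exact: face_head.
by congr (_ - _); apply: IH => t ts; apply: FF'; apply: face_tail.
Qed.

Lemma cobd0 s : cobd (fun=> 0) s = 0.
Proof. by elim: s => //= x s ->; rewrite subr0. Qed.

Lemma cobdD F F' s : cobd (fun t => F t + F' t) s = cobd F s + cobd F' s.
Proof.
elim: s F F' => [|x s IH] F F' /=; first by rewrite addr0.
by rewrite IH opprD addrACA.
Qed.

Lemma cobdN F s : cobd (fun t => - F t) s = - cobd F s.
Proof.
elim: s F => [|x s IH] F /=; first by rewrite oppr0.
by rewrite IH opprB addrC opprK.
Qed.

Lemma cobdB F F' s : cobd (fun t => F t - F' t) s = cobd F s - cobd F' s.
Proof. by rewrite cobdD cobdN. Qed.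

Lemma cobd_sum (I : Type) (r : seq I) (P : pred I) (F : I -> seq V -> E) s :
  cobd (fun t => \sum_(i <- r | P i) F i t) s = \sum_(i <- r | P i) cobd (F i) s.
Proof.
elim: r => [|i r IH].
  by rewrite big_nil -[RHS](cobd0 s); apply: cobd_local => t _; rewrite big_nil.
rewrite big_cons -IH; case: ifP => Pi.
  by rewrite -cobdD; apply: cobd_local => t _; rewrite big_cons Pi.
by apply: cobd_local => t _; rewrite big_cons Pi.
Qed.

Lemma cobdK F s : cobd (cobd F) s = 0.
Proof.
elim: s F => //= x s IH F.
by rewrite cobdB IH subr0 subrr.
Qed.

(** The two faces that delete one of two equal neighbours coincide and cancel; every other face is
    still degenerate. *)
Lemma cobd_degenerate F s : degenerate s ->
  (forall t, face t s -> degenerate t -> F t = 0) -> cobd F s = 0.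
Proof.
move=> sd; elim: sd F => {s} [x s|x s sd IH] F F0 /=.
  rewrite opprB addrCA subrr addr0 -[RHS](cobd0 s).
  apply: cobd_local => t ts; apply: F0; last exact: degenerate_head.
  by do 2!apply: face_tail.
rewrite F0 //; last exact: face_head.
rewrite IH ?subr0// => t ts td.
by apply: F0; [apply: face_tail | apply: degenerate_tail].
Qed.

Lemma degenerate_cat s1 x s2 : degenerate (s1 ++ x :: x :: s2).
Proof.
by elim: s1 => /= [|y s1 IH]; [apply: degenerate_head|apply: degenerate_tail].
Qed.

Lemma degenerateP s :
  degenerate s <-> exists s1 x s2, s = s1 ++ x :: x :: s2.
Proof.
split=> [|[s1 [x [s2 ->]]]]; last exact: degenerate_cat.
elim=> {s} [x s|x s _ [s1 [y [s2 ->]]]]; first by exists [::], x, s.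
by exists (x :: s1), y, s2.
Qed.

(** The triangulation of a prism: with pairs (w_i, v_i), this is the alternating sum over i of [F]
    at w_0, ..., w_i, v_i, ..., v_n. It is the homotopy between the bottom [map fst l] and the top
    [map snd l]. *)
Fixpoint prism (l : seq (V * V)) F : E :=
  if l is (w, v) :: l' then
    F (w :: v :: map snd l') - prism l' (fun t => F (w :: t))
  else 0.

Lemma prismB l F F' : prism l (fun t => F t - F' t) = prism l F - prism l F'.
Proof.
elim: l F F' => [|[w v] l IH] F F' /=; first by rewrite subr0.
by rewrite IH subrBB.
Qed.

Lemma prism_eq l F F' :
  (forall l1 w v l2, l = l1 ++ (w, v) :: l2 ->
     F (map fst l1 ++ w :: v :: map snd l2) =
     F' (map fst l1 ++ w :: v :: map snd l2)) ->
  prism l F = prism l F'.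
Proof.
elim: l F F' => [|[w v] l IH] F F' //= FF'.
rewrite (FF' [::] w v l)//; congr (_ - _); apply: IH => l1 w' v' l2 ll.
by apply: (FF' ((w, v) :: l1)); rewrite ll.
Qed.

Lemma prism0 l : prism l (fun=> 0) = 0.
Proof. by elim: l => // -[w v] l /= ->; rewrite subr0. Qed.

Lemma prism_eq0 l F :
  (forall l1 w v l2, l = l1 ++ (w, v) :: l2 ->
     F (map fst l1 ++ w :: v :: map snd l2) = 0) ->
  prism l F = 0.
Proof. by move=> F0; rewrite -(prism0 l); apply: prism_eq. Qed.

End ListCochains.

Section ListCochainMaps.
Local Open Scope ring_scope.
Variables (V W : Type) (E : zmodType).

Lemma cobd_map (h : V -> W) (F : seq W -> E) s :
  cobd F (map h s) = cobd (fun t => F (map h t)) s.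
Proof. by elim: s F => //= x s IH F; rewrite IH. Qed.

Lemma degenerate_map (h : V -> W) s : degenerate s -> degenerate (map h s).
Proof.
by elim=> /= [x t|x t _ IH]; [apply: degenerate_head|apply: degenerate_tail].
Qed.

Lemma face_map (h : V -> W) s t : face t s -> face (map h t) (map h s).
Proof. by elim=> /= *; [apply: face_head|apply: face_tail]. Qed.

Lemma prism_map (h : V -> W) (F : seq W -> E) l :
  prism (map (fun wv => (h wv.1, h wv.2)) l) F = prism l (fun t => F (map h t)).
Proof.
elim: l F => [|[w v] l IH] F //=; rewrite IH; congr (F _ - _).
by rewrite -!map_comp.
Qed.

End ListCochainMaps.

Section PrismIdentity.
Local Open Scope ring_scope.
Variables (V : Type) (E : zmodType).

(** The chain homotopy formula. With the recursive definitions no signs are manipulated: the head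
    pair splits off and the induction hypothesis is applied to the contraction of [F] with [w]. *)
Lemma prism_cobd (F : seq V -> E) l :
  prism l (cobd F) + cobd (fun l' => prism l' F) l =
  F (map snd l) - F (map fst l).
Proof.
elim: l F => [|[w v] l IH] F /=; first by rewrite addr0 subrr.
rewrite prismB cobdB; have := IH (fun t => F (w :: t)).
rewrite -(cobd_map snd (fun t => F (w :: v :: t))).
set a := prism l (cobd _); set b := cobd (fun _ => prism _ _) l.
set X := F (v :: _); set Y := F (w :: _); set Z := F (w :: _).
set P := prism l F; set c := cobd _ (map _ _) => ab.
have -> : X - (Y - c) - (P - a) + (P - (c - b)) = X - (Y - c) + (a + b - c).
  by rewrite -addrA [- (P - a)]opprB subrKA [- (c - b)]opprB !addrA.
by rewrite ab [Y - Z - c]addrAC subrKA.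
Qed.

(* Two consecutive equal pairs give two equal terms of the prism, one of which
   is degenerate at the top and the other at the bottom. *)
Lemma prism_degenerate (F : seq V -> E) l :
  (forall s, degenerate s -> F s = 0) -> degenerate l -> prism l F = 0.
Proof.
move=> F0 ld; elim: ld F F0 => {l} [[w v] l|[w v] l ld IH] F F0 /=.
  rewrite [F _]F0; last by apply: degenerate_tail; exact: degenerate_head.
  rewrite [F _]F0; last exact: degenerate_head.
  rewrite sub0r sub0r opprK; apply: prism_eq0 => *; apply: F0.
  exact: degenerate_head.
rewrite F0; last by do 2!apply: degenerate_tail; exact: degenerate_map.
by rewrite IH ?subr0// => s sd; apply: F0; exact: degenerate_tail.
Qed.
End PrismIdentity.

(** * Profinite groups given by finite levels *)

(** A profinite group presented by a directed, jointly injective system of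
    homomorphisms onto finite p-groups. *)
Record lgroup (p : nat) := LGroup {
  lcar :> groupType;
  level : Type;
  level0 : level;
  lquo : level -> finGroupType;
  lpi : forall i, lcar -> lquo i;
  lpiM : forall i, {morph lpi i : x y / (x * y)%g};
  lpi_pelt : forall i x, exists k, (lpi i x ^+ (p ^ k) = 1)%g;
  lpi_directed : forall i j, exists k, forall x,
    lpi k x = 1%g -> lpi i x = 1%g /\ lpi j x = 1%g;
  lpi_separated : forall x, (forall i, lpi i x = 1%g) -> x = 1%g;
  lpi_compact : forall s : level -> lcar, exists x, forall i, exists j,
    (forall y, lpi j y = 1%g -> lpi i y = 1%g) /\ lpi i (s j) = lpi i x
}.
Arguments lpi {p l} i x.
Arguments level {p} l.
Arguments level0 {p} l.

Section LGroup.
Local Open Scope group_scope.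
Variables (p : nat) (F : lgroup p).
Implicit Types (x y z : F) (i j k : level F).

Definition finer j i := forall x, lpi j x = 1 -> lpi i x = 1.

Lemma lpi1 i : lpi i (1 : F) = 1.
Proof. by apply: (@mulgI _ (lpi i 1)); rewrite -lpiM !mulg1. Qed.

Lemma lpiV i x : lpi i x^-1 = (lpi i x)^-1.
Proof. by apply: (@mulgI _ (lpi i x)); rewrite -lpiM !mulgV lpi1. Qed.

Lemma lpi_eq i x y : lpi i x = lpi i y <-> lpi i (x^-1 * y) = 1.
Proof.
rewrite lpiM lpiV; split=> [->|h]; first by rewrite mulVg.
by apply: (@mulgI _ (lpi i x)^-1); rewrite h mulVg.
Qed.

Lemma finer_eq j i x y : finer j i -> lpi j x = lpi j y -> lpi i x = lpi i y.
Proof. by move=> ji /lpi_eq/ji/lpi_eq. Qed.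

Lemma finer_refl i : finer i i. Proof. by []. Qed.

Lemma finer_trans j i k : finer i j -> finer j k -> finer i k.
Proof. by move=> ij jk x /ij/jk. Qed.

Lemma finer2 i j : exists k, finer k i /\ finer k j.
Proof.
have [k kP] := lpi_directed i j.
by exists k; split=> x /kP[].
Qed.

Lemma finer_fin (T : finType) (a : T -> level F) : exists k, forall t, finer k (a t).
Proof.
suff [k kP] : exists k, forall t, t \in enum T -> finer k (a t).
  by exists k => t; apply: kP; rewrite mem_enum.
elim: (enum T) => [|t s [k kP]]; first by exists (level0 F).
have [l [lk lt]] := finer2 k (a t).
by exists l => u; rewrite inE => /orP[/eqP ->//|/kP/(finer_trans lk)].
Qed.

Lemma lpi_inj x y : (forall i, lpi i x = lpi i y) -> x = y.
Proof.
move=> xy; apply: (@mulgI _ x^-1); rewrite mulVg; apply/esym/lpi_separated => i.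
exact/lpi_eq.
Qed.

Definition lcont (gT : finGroupType) (th : F -> gT) :=
  {morph th : x y / x * y} /\ exists i, forall x, lpi i x = 1 -> th x = 1.

Lemma lcont_eq (gT : finGroupType) (th : F -> gT) :
  lcont th -> exists i, forall x y, lpi i x = lpi i y -> th x = th y.
Proof.
move=> [thM [i thi]]; have th1 : th 1 = 1.
  by apply: (@mulgI _ (th 1)); rewrite -thM !mulg1.
exists i => x y /lpi_eq/thi; rewrite thM => h.
have hV : th x^-1 = (th x)^-1.
  by apply: (@mulgI _ (th x)); rewrite -thM !mulgV th1.
by apply: (@mulgI _ (th x)^-1); rewrite -hV h -thM mulVg th1.
Qed.

(** Pro-p freeness on the pointed set (Z, 1), tested on finite p-groups only. The p-group [W] lies
    inside an arbitrary finite group, so concrete permutation groups serve as targets. Uniqueness is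
    asked for all finite targets: it says that [Z] generates topologically. *)
Definition free_on (Z : F -> Prop) :=
  [/\ Z 1,
    forall (gT : finGroupType) (W : {group gT}) (phi : F -> gT), p.-group W ->
      (forall z, Z z -> phi z \in W) -> phi 1 = 1 ->
      (exists i, forall z z', Z z -> Z z' -> lpi i z = lpi i z' ->
         phi z = phi z') ->
      exists th, [/\ lcont th, forall x, th x \in W &
        forall z, Z z -> th z = phi z] &
    forall (gT : finGroupType) (th th' : F -> gT), lcont th -> lcont th' ->
      (forall z, Z z -> th z = th' z) -> th =1 th'].

End LGroup.

Section PGroup.
Local Open Scope group_scope.

Lemma pgroup_pelt (p : nat) (gT : finGroupType) (W : {group gT}) :
  prime p -> (forall x, x \in W -> exists k, (x ^+ (p ^ k) = 1)%g) ->
  p.-group W.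
Proof.
move=> p_pr Wp; apply/pgroupP => q q_pr qW.
have [x xW xq] := Cauchy q_pr qW; have [k /eqP] := Wp x xW.
rewrite -order_dvdn xq.
by rewrite Euclid_dvdX// => /andP[+ _]; rewrite dvdn_prime2// => /eqP ->; rewrite inE.
Qed.

End PGroup.

(** * Wreath products, and exactness of the Cayley tree *)

Section Wreath.
Local Open Scope group_scope.
Variables (E : finZmodType) (gT : finGroupType).
Implicit Types (a b : gT -> E) (y : gT).

Fact wperm_inj a y : injective (fun ex : E * gT => ((ex.1 + a ex.2)%R, ex.2 * y)).
Proof.
move=> [e x] [e' x'] [ee xx]; have {}xx := mulIg _ _ _ xx.
by move: ee; rewrite -xx => ee; rewrite (GRing.addIr _ ee).
Qed.

(** The element (a, y) of the wreath product of E by a group, realised as a permutation. By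
    [wperm_mul] the first components multiply as a crossed homomorphism, so a homomorphism into this
    group records a function together with its increments. *)
Definition wperm a y : {perm E * gT} := perm (@wperm_inj a y).

Lemma wpermE a y e x : wperm a y (e, x) = ((e + a x)%R, x * y).
Proof. by rewrite permE. Qed.

Lemma wperm_mul a b y y' :
  wperm a y * wperm b y' = wperm (fun x => (a x + b (x * y)%g)%R) (y * y').
Proof.
by apply/permP => -[e x]; rewrite permM !wpermE addrA mulgA.
Qed.

Lemma wperm_eq a b y : a =1 b -> wperm a y = wperm b y.
Proof. by move=> ab; apply/permP => -[e x]; rewrite !wpermE ab. Qed.

Lemma wperm1 : wperm (fun=> 0%R) 1 = 1.
Proof. by apply/permP => -[e x]; rewrite wpermE perm1 addr0 mulg1. Qed.

Lemma wperm1X a n : wperm a 1 ^+ n = wperm (fun x => (a x *+ n)%R) 1.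
Proof.
elim: n => [|n IH]; first by rewrite expg0 -wperm1.
rewrite expgS IH wperm_mul mulg1; apply: wperm_eq => x.
by rewrite mulg1 mulrS.
Qed.

Lemma wpermX a y n : exists b, wperm a y ^+ n = wperm b (y ^+ n).
Proof.
elim: n => [|n [b IH]]; first by exists (fun=> 0%R); rewrite wperm1.
by exists (fun x => (a x + b (x * y)%g)%R); rewrite expgS IH wperm_mul -expgS.
Qed.

Variables (p : nat) (Y : {group gT}).
Hypotheses (p_pr : prime p) (Yp : p.-group Y).
Hypothesis Ep : exists k, forall e : E, (e *+ (p ^ k) = 0)%R.

Definition wreath := [set s : {perm E * gT} | [exists ay : {ffun gT -> E} * gT,
  (ay.2 \in Y) && (s == wperm ay.1 ay.2)]].

Lemma wreathP s :
  reflect (exists a y, y \in Y /\ s = wperm a y) (s \in wreath).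
Proof.
rewrite inE; apply: (iffP existsP) => [[[a y] /= /andP[yY /eqP ->]]|].
  by exists a, y.
move=> [a [y [yY ->]]]; exists ([ffun x => a x], y) => /=; rewrite yY /=.
by apply/eqP/wperm_eq => x; rewrite ffunE.
Qed.

Fact wreath_group_set : group_set wreath.
Proof.
apply/group_setP; split.
  by apply/wreathP; exists (fun=> 0%R), 1; rewrite group1 wperm1.
move=> s t /wreathP[a [y [yY ->]]] /wreathP[b [y' [y'Y ->]]].
by apply/wreathP; rewrite wperm_mul; eexists _, _; split; last reflexivity;
  rewrite groupM.
Qed.
Canonical wreath_group := Group wreath_group_set.

Lemma wreath_pgroup : p.-group wreath.
Proof.
apply: pgroup_pelt => // s /wreathP[a [y [yY ->]]].
have [k Ek] := Ep.
have [n yn] : exists n, y ^+ (p ^ n) = 1.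
  have /p_natP[n yn] : p.-nat #[y] by exact: mem_p_elt yY.
  by exists n; rewrite -yn expg_order.
have [b ab] := wpermX a y (p ^ n); exists (n + k)%N.
rewrite expnD expgM ab yn wperm1X -[RHS]wperm1; apply: wperm_eq => x.
exact: Ek.
Qed.

End Wreath.

Section Tree.
Local Open Scope group_scope.
Variables (p : nat) (p_pr : prime p) (F : lgroup p) (Z : F -> Prop).
Hypothesis F_free : free_on Z.

Definition limage i := [set y | `[< exists x : F, lpi i x = y >]].

Fact limage_group_set i : group_set (limage i).
Proof.
apply/group_setP; split; first by rewrite !inE; exists 1; rewrite lpi1.
move=> y y'; rewrite !inE => -[x <-] [x' <-].
by exists (x * x'); rewrite lpiM.
Qed.
Canonical limage_group i := Group (limage_group_set i).

Lemma mem_limage i (x : F) : lpi i x \in limage i.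
Proof. by rewrite !inE; exists x. Qed.

Lemma limage_pgroup i : p.-group (limage i).
Proof.
by apply: pgroup_pelt => // y; rewrite !inE => -[x <-]; exact: lpi_pelt.
Qed.

Lemma lpi_lcont i : lcont (@lpi p F i).
Proof. by split; [exact: lpiM | exists i]. Qed.

(** The function induced by [u] on the level [i]; [t0] is used off the image, as [lpi i] need not be
    onto. *)
Definition lift_fun (T : Type) (t0 : T) (u : F -> T) i (y : lquo i) : T :=
  if pselect (exists x : F, lpi i x = y) is left h then u (sval (cid h)) else t0.

Lemma lift_funE (T : Type) (t0 : T) (u : F -> T) i (x : F) :
  (forall x y, lpi i x = lpi i y -> u x = u y) -> lift_fun t0 u (lpi i x) = u x.
Proof.
move=> ui; rewrite /lift_fun; case: pselect => [h|[]]; last by exists x.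
by apply: ui; case: cid.
Qed.

Lemma lift_fun0 (T : Type) (t0 : T) (u : F -> T) i y :
  y \notin limage i -> lift_fun t0 u y = t0.
Proof.
by move=> yI; rewrite /lift_fun; case: pselect => // h; case/negP: yI; rewrite !inE.
Qed.

(** Let w be the indicator of the fibre of [u] through [t]. Both x |-> (w(- x) - w, x) and x |-> (0,
    x) are homomorphisms into a wreath product, and they agree on [Z] by hypothesis, hence
    everywhere. Coefficients mod 2 do for every p, since uniqueness holds for all finite targets. *)
Lemma tree_connected (T : Type) (u : F -> T) :
  (exists i, forall x y, lpi i x = lpi i y -> u x = u y) ->
  (forall t z, Z z -> u (t * z) = u t) -> forall t t', u t = u t'.
Proof.
move=> [i ui] uZ t t'; have [_ _ uniq] := F_free.
pose w (y : lquo i) : 'Z_2 :=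
  lift_fun 0%R (fun x => (`[< u x = u t >])%:R%R) y.
have wE x : w (lpi i x) = (`[< u x = u t >])%:R%R.
  by rewrite /w lift_funE// => {}x y /ui ->.
have w0 y : y \notin limage i -> w y = 0%R by exact: lift_fun0.
pose th (x : F) := wperm (fun y => (w (y * lpi i x)%g - w y)%R) (lpi i x).
pose th' (x : F) := wperm (fun y => 0%R : 'Z_2) (lpi i x).
have thM : {morph th : x y / x * y}.
  move=> x y; rewrite {1}/th lpiM wperm_mul; apply: wperm_eq => c.
  by rewrite mulgA [RHS]addrC subrKA.
have th'M : {morph th' : x y / x * y}.
  by move=> x y; rewrite {1}/th' lpiM wperm_mul; apply: wperm_eq => c; rewrite addr0.
have E : th =1 th'.
  apply: uniq.
  - split=> //; exists i => x x1; rewrite /th x1 -[RHS]wperm1.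
    by apply: wperm_eq => c; rewrite mulg1 subrr.
  - by split=> //; exists i => x x1; rewrite /th' x1 wperm1.
  - move=> z Zz; apply: wperm_eq => c.
    have [cI|cI] := boolP (c \in limage i); last first.
      by rewrite !w0 ?subrr// groupMr// mem_limage.
    by move: cI; rewrite !inE => -[x <-]; rewrite -lpiM !wE uZ// subrr.
have /permP/(_ (0%R, lpi i t)) := E (t^-1 * t').
rewrite !wpermE -lpiM mulVKg => /(congr1 fst).
rewrite [X in X = _]add0r [X in _ = X]addr0 => h; have {h} := subr0_eq h.
rewrite !wE (asboolT (erefl (u t))).
by case: asboolP => [->//|_ /(congr1 val)].
Qed.

(** A function on the edges (t, tz) of the Cayley graph is integrated by freeness: z |-> (psi(-, z),
    z) extends to a homomorphism into the wreath product, and its first component read at the point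
    1 is a potential. The wreath product is a p-group because E has exponent a power of p. *)
Lemma tree_exact (E : finZmodType) (psi : F -> F -> E) :
  (exists k, forall e : E, (e *+ (p ^ k) = 0)%R) ->
  (exists i, forall t t' z z', Z z -> Z z' -> lpi i t = lpi i t' ->
     lpi i z = lpi i z' -> psi t z = psi t' z') ->
  (forall t, psi t 1 = 0%R) ->
  exists u, (exists i, forall x y, lpi i x = lpi i y -> u x = u y) /\
    forall t z, Z z -> (u (t * z)%g - u t)%R = psi t z.
Proof.
move=> Ep [i psii] psi1; have [Z1 ext uniq] := F_free.
pose psi' z (y : lquo i) := lift_fun 0%R (psi^~ z) y.
have psi'E t z : Z z -> psi' z (lpi i t) = psi t z.
  by move=> Zz; rewrite /psi' lift_funE// => x y xy; exact: psii.
pose phi z := wperm (psi' z) (lpi i z).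
have [||||th [[thM thc] thW thZ]] := ext _ (wreath_group E (limage_group i)) phi.
- by apply: wreath_pgroup => //; exact: limage_pgroup.
- by move=> z Zz; apply/wreathP; eexists _, _; split; [exact: mem_limage|].
- rewrite /phi lpi1 -[RHS]wperm1; apply: wperm_eq => y.
  by rewrite /psi' /lift_fun; case: pselect.
- exists i => z z' Zz Zz' zz'; rewrite /phi zz'; apply: wperm_eq => y.
  by rewrite /psi' /lift_fun; case: pselect => // h; apply: psii.
(* The second component of [th] is a homomorphism that agrees with [lpi i] on [Z], so uniqueness
   identifies the two. *)
have thE x : exists a, th x = wperm a (lpi i x).
  pose pr (s : {perm E * lquo i}) := (s (0%R, 1)).2.
  suff prE : (fun x => pr (th x)) =1 lpi i.
    have /wreathP[a [y [_ ay]]] := thW x; exists a; rewrite ay -prE /pr ay.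
    by rewrite wpermE mul1g.
  have prM : {morph (fun x => pr (th x)) : x y / x * y}.
    move=> x' y' /=; rewrite thM; have /wreathP[a [y [_ ->]]] := thW x'.
    have /wreathP[b [y2 [_ ->]]] := thW y'.
    by rewrite wperm_mul /pr !wpermE !mul1g.
  apply: uniq; [split=> //|exact: lpi_lcont|].
    by have [j thj] := thc; exists j => x' /thj ->; rewrite /pr perm1.
  by move=> z Zz; rewrite /= thZ// /pr wpermE mul1g.
pose a x y := (th x (0%R, y)).1.
have aE x : th x = wperm (a x) (lpi i x).
  have [b bx] := thE x; rewrite {1}bx; apply: wperm_eq => y.
  by rewrite /a bx wpermE add0r.
exists (fun x => a x 1); split.
  have [j thj] := lcont_eq (conj thM thc).
  by exists j => x y /thj xy; rewrite /a xy.
move=> t z Zz; rewrite /a thM permM [th t](aE t) wpermE mul1g thZ// wpermE /=.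
by rewrite psi'E// add0r addrAC subrr add0r.
Qed.

End Tree.

(** * Pointwise relations between lists *)

Section SeqRel.
Variables (V : Type) (r : V -> V -> Prop).

Fixpoint srel (s t : seq V) : Prop :=
  match s, t with
  | [::], [::] => True
  | x :: s', y :: t' => r x y /\ srel s' t'
  | _, _ => False
  end.

Lemma srel_size s t : srel s t -> size s = size t.
Proof. by elim: s t => [|x s IH] [|y t] //= [_ /IH ->]. Qed.

Lemma srel_refl : (forall x, r x x) -> forall s, srel s s.
Proof. by move=> rr; elim=> //= x s. Qed.

Lemma srel_sym : (forall x y, r x y -> r y x) -> forall s t, srel s t -> srel t s.
Proof. by move=> rs; elim=> [|x s IH] [|y t] //= [/rs ? /IH]. Qed.

Lemma srel_trans : (forall x y z, r x y -> r y z -> r x z) ->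
  forall s t u, srel s t -> srel t u -> srel s u.
Proof.
move=> rt; elim=> [|x s IH] [|y t] [|z u] //= [xy st] [yz tu].
by split; [exact: rt yz|exact: IH tu].
Qed.

Lemma srel_nth x0 s t : size s = size t ->
  (forall k, k < size s -> r (nth x0 s k) (nth x0 t k)) -> srel s t.
Proof.
elim: s t => [|x s IH] [|y t] //= [st] rst; split; first exact: (rst 0%N).
by apply: IH => // k ks; exact: (rst k.+1).
Qed.

Lemma srel_cobd (E : zmodType) (F F' : seq V -> E) s t : srel s t ->
  (forall u v, srel u v -> F u = F' v) -> cobd F s = cobd F' t.
Proof.
elim: s t F F' => [|x s IH] [|y t] //= F F' [xy st] FF'.
by rewrite (FF' s t)//; congr (_ - _)%R; apply: IH => // u v uv; apply: FF'.
Qed.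

End SeqRel.

Lemma srel_map (V W : Type) (r : V -> V -> Prop) (r' : W -> W -> Prop)
    (h h' : V -> W) s t : (forall x y, r x y -> r' (h x) (h' y)) ->
  srel r s t -> srel r' (map h s) (map h' t).
Proof. by move=> hr; elim: s t => [|x s IH] [|y t] //= [/hr ? /IH]. Qed.

Lemma srel_sub (V : Type) (r r' : V -> V -> Prop) s t :
  (forall x y, r x y -> r' x y) -> srel r s t -> srel r' s t.
Proof. by move=> rr; elim: s t => [|x s IH] [|y t] //= [/rr ? /IH]. Qed.

Lemma srel_prism (V : Type) (r : V -> V -> Prop) (E : zmodType)
    (F F' : seq V -> E) l l' :
  srel (fun x y => r x.1 y.1 /\ r x.2 y.2) l l' ->
  (forall u v, srel r u v -> F u = F' v) -> prism l F = prism l' F'.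
Proof.
elim: l l' F F' => [|[w v] l IH] [|[w' v'] l'] //= F F' [[ww vv] ll] FF'.
rewrite (FF' _ (w' :: v' :: map snd l')); last first.
  by do 2!split=> //; apply: srel_map ll => x y [].
by congr (_ - _)%R; apply: IH => // s t st; apply: FF'.
Qed.

Lemma map_eq_cat (V W : Type) (h : V -> W) s l1 y l2 : map h s = l1 ++ y :: l2 ->
  exists s1 x s2, [/\ s = s1 ++ x :: s2, l1 = map h s1, y = h x & l2 = map h s2].
Proof.
elim: s l1 => [|x s IH] [|y' l1] //=.
  by case=> <- <-; exists [::], x, s.
by case=> <- /IH[s1 [x' [s2 [-> -> -> ->]]]]; exists (x :: s1), x', s2.
Qed.

Lemma map_const_seq (V W : Type) (w : W) (s : seq V) :
  map (fun=> w) s = nseq (size s) w.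
Proof. by elim: s => //= x s ->. Qed.

Lemma nseq_shift (V : Type) k (x : V) s :
  nseq k x ++ x :: s = x :: nseq k x ++ s.
Proof. by elim: k => //= k ->. Qed.

(** * Continuous cochains, and the product of a complex with a tree *)

Section Exactness.
Local Open Scope ring_scope.
Variables (L X N : Type) (E : zmodType) (nX : N -> X -> X).
Variables (relX : L -> X -> X -> Prop) (simp : seq X -> Prop).

(** These are the normalised continuous cochains of the quotient of X by N, written as invariant
    functions upstairs. *)
Definition nice_cochain (f : seq X -> E) :=
  [/\ forall n s, f (map (nX n) s) = f s,
      exists i, forall s t, srel (relX i) s t -> f s = f t &
      forall s, degenerate s -> f s = 0].

(** [m] is a length of lists, hence one more than the cohomological degree. The cocycle condition
    and the conclusion are only about simplices in [simp], but the cochains are defined on all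
    lists. *)
Definition exact_at m := forall f : seq X -> E, nice_cochain f ->
  (forall s, simp s -> size s = m.+1 -> cobd f s = 0) ->
  exists g, nice_cochain g /\
    forall s, simp s -> size s = m -> f s = cobd g s.

End Exactness.

Section Step.
Local Open Scope ring_scope.
Variables (p : nat) (F : lgroup p) (Z : F -> Prop) (E : zmodType).
Hypothesis Z1 : Z 1%g.
Hypothesis tree : forall psi : F -> F -> E,
  (exists i, forall t t' z z', Z z -> Z z' -> lpi i t = lpi i t' ->
     lpi i z = lpi i z' -> psi t z = psi t' z') ->
  (forall t, psi t 1%g = 0%R) ->
  exists u, (exists i, forall x y, lpi i x = lpi i y -> u x = u y) /\
    forall t z, Z z -> (u (t * z)%g - u t)%R = psi t z.
Hypothesis connected : forall u : F -> E,
  (exists i, forall x y, lpi i x = lpi i y -> u x = u y) ->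
  (forall t z, Z z -> u (t * z)%g = u t) -> forall t t', u t = u t'.
Variables (A N : Type) (a0 : A) (nA : N -> A -> A) (nF : N -> F -> F).
Variables (relA : level F -> A -> A -> Prop) (simp : seq A -> Prop) (s : A -> F).
Hypothesis relA_refl : forall i a, relA i a a.
Hypothesis relA_finer : forall i j a a', finer j i -> relA j a a' -> relA i a a'.
Hypothesis relA_fin : forall i, exists (T : finType) (h : A -> T),
  forall a a', h a = h a' -> relA i a a'.
Hypothesis nFM : forall n x y, nF n (x * y)%g = (nF n x * y)%g.
Hypothesis s_eq : forall n a, s (nA n a) = nF n (s a).
Hypothesis s_rel : forall i a a', relA i a a' -> lpi i (s a) = lpi i (s a').
Hypothesis simp_dup : forall b1 a b2,
  simp (b1 ++ a :: b2) -> simp (b1 ++ a :: a :: b2).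
Hypothesis simp_face : forall b b', face b b' -> simp b' -> simp b.

(** The ordered simplices, with repetitions, of the Cayley graph of F: a list stays at [t] and then
    possibly moves once along an edge to [t * z]. *)
Definition jump (tl : seq F) := exists t z i j, Z z /\
  tl = nseq i t ++ nseq j (t * z)%g.

Definition step_act n (x : A * F) := (nA n x.1, nF n x.2).
Definition step_rel i (x y : A * F) := relA i x.1 y.1 /\ lpi i x.2 = lpi i y.2.
Definition step_simp (l : seq (A * F)) := simp (map fst l) /\ jump (map snd l).

Lemma jump_const k t : jump (nseq k t).
Proof. by exists t, 1%g, k, 0%N; rewrite cats0. Qed.

Lemma jump_head t r : jump (t :: r) ->
  exists z i j, Z z /\ t :: r = nseq i.+1 t ++ nseq j (t * z)%g.
Proof.
move=> [t0 [z [[|i] [j [Zz e]]]]].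
  exists 1%g, (size r), 0%N; split=> //; rewrite cats0 /=; congr cons.
  by case: j e => //= j [-> ->]; rewrite size_nseq.
by move: (e) => /= [tt _]; exists z, i, j; split=> //; rewrite e tt.
Qed.

Lemma jump_dup t r b1 y b2 : jump (t :: r) -> t :: r = b1 ++ y :: b2 ->
  jump (nseq (size b1) t ++ t :: y :: b2).
Proof.
move=> /jump_head[z [i [j [Zz ->]]]] e.
have -> : y :: b2 = drop (size b1) (nseq i.+1 t ++ nseq j (t * z)%g).
  by rewrite e drop_size_cat.
rewrite drop_cat size_nseq !drop_nseq -cat1s; case: ifP => _.
  exists t, z, (size b1 + (1 + (i.+1 - size b1)))%N, j; split=> //.
  by rewrite !nseqD -!catA.
exists t, z, (size b1 + 1)%N, (j - (size b1 - i.+1))%N; split=> //.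
by rewrite nseqD -catA.
Qed.

(** Two potentials with equal increments differ by a constant. Below, each property of a potential
    (invariance, local constancy, normalisation) is proved by comparing it with a second potential
    at one point. *)
Lemma tree_unique (u v : F -> E) x :
  (exists i, forall x y, lpi i x = lpi i y -> u x = u y) ->
  (exists i, forall x y, lpi i x = lpi i y -> v x = v y) ->
  (forall t z, Z z -> u (t * z)%g - u t = v (t * z)%g - v t) ->
  u x = v x -> u =1 v.
Proof.
move=> [i ui] [j vj] uv uvx y; apply/eqP; rewrite -subr_eq0; apply/eqP.
have [k [ki kj]] := finer2 i j.
rewrite (@connected (fun y => u y - v y) _ _ y x); first by rewrite uvx subrr.
  by exists k => a b ab; rewrite (ui a b) ?(vj a b)//; exact: finer_eq ab.
by move=> t z Zz; apply/eqP; rewrite -subr_eq0 subrBB uv// subrr.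
Qed.

(** The slice A x {t}; [step_pairs] is the prism over the edge from [t] to [t'], and [step_psi]
    integrates a cochain over that prism. *)
Definition step_at (t : F) (b : seq A) := map (fun a => (a, t)) b.
Definition step_pairs (t t' : F) (b : seq A) :=
  map (fun a => ((a, t), (a, t'))) b.
Definition step_psi (f : seq (A * F) -> E) b t z :=
  prism (step_pairs t (t * z)%g b) f.

Section Cocycle.
Variables (m : nat) (f : seq (A * F) -> E).
Hypothesis f_nice : nice_cochain step_act step_rel f.
Hypothesis f_cocycle : forall l, step_simp l -> size l = m.+3 -> cobd f l = 0.

Local Notation Psi := (step_psi f).

Let prism_diag (f' : seq (A * F) -> E) (l : seq (A * F)) :
  (forall l', degenerate l' -> f' l' = 0) ->
  prism (map (fun x => (x, x)) l) f' = 0.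
Proof.
move=> f'0; apply: prism_eq0 => l1 w v l2 e.
have [b1 [x [b2 [_ _ [-> ->] _]]]] := map_eq_cat e.
exact/f'0/degenerate_cat.
Qed.

(** By the prism formula the restrictions of a cocycle to the two slices over an edge of the tree
    are cohomologous, with the prism integral as explicit difference. *)
Lemma step_psi_jump b t z : Z z -> simp b -> size b = m.+2 ->
  f (step_at (t * z)%g b) - f (step_at t b) = cobd (fun b' => Psi b' t z) b.
Proof.
move=> Zz sb bm; have := prism_cobd f (step_pairs t (t * z)%g b).
rewrite prism_eq0 ?add0r => [|l1 w v l2 e'].
  by rewrite cobd_map -!map_comp => ->.
have [b1 [a [b2 [e -> [-> ->] ->]]]] := map_eq_cat e' => {e'}.
apply: f_cocycle; last first.
  by move: bm; rewrite e !size_cat /= !size_map => <-; rewrite !addnS.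
split; first by rewrite map_cat /= -!map_comp !map_id; apply: simp_dup; rewrite -e.
exists t, z, (size b1).+1, (size b2).+1; split=> //.
rewrite map_cat /= -!map_comp (eq_map (g := fun=> t))// map_const_seq.
by rewrite (eq_map (g := fun=> (t * z)%g))// map_const_seq nseq_shift.
Qed.

Let Psi_lc : exists i, forall b b' t t' z z', srel (relA i) b b' ->
  lpi i t = lpi i t' -> lpi i z = lpi i z' -> Psi b t z = Psi b' t' z'.
Proof.
have [_ [i fi] _] := f_nice; exists i => b b' t t' z z' bb tt zz.
apply: srel_prism fi; apply: srel_map bb => x y xy; split; split=> //=.
by rewrite !lpiM tt zz.
Qed.

Let Psi1 b t : Psi b t 1%g = 0.
Proof.
have [_ _ fd] := f_nice; rewrite /step_psi mulg1.
by rewrite -(prism_diag (step_at t b) fd) -map_comp.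
Qed.

Let Psi_act n b t z : Psi (map (nA n) b) (nF n t) z = Psi b t z.
Proof.
have [fN _ _] := f_nice.
have e : step_pairs (nF n t) (nF n t * z)%g (map (nA n) b) =
    map (fun wv => (step_act n wv.1, step_act n wv.2)) (step_pairs t (t * z)%g b).
  by rewrite /step_pairs -nFM -!map_comp; apply: eq_map.
by rewrite /step_psi e prism_map; apply: prism_eq => *; rewrite fN.
Qed.

Let Psi_degenerate b t z : degenerate b -> Psi b t z = 0.
Proof.
by move=> bd; have [_ _ fd] := f_nice; apply: prism_degenerate => //; exact: degenerate_map.
Qed.

(** The prism integrals, as functions on the edges of the tree, are integrated for each list [b].
    Potentials are normalised to vanish at [s] of the head of [b]; since [s] is equivariant and
    continuous, the uniqueness of potentials makes the whole family invariant and locally constant.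
    An equivariant [s] is how the freeness of the action of N enters. *)
Lemma step_potential : exists U : seq A -> F -> E,
  [/\ forall b t z, size b = m.+1 -> Z z -> U b (t * z)%g - U b t = Psi b t z,
      exists i, forall b b' t t', srel (relA i) b b' -> lpi i t = lpi i t' ->
        U b t = U b' t',
      forall n b t, U (map (nA n) b) (nF n t) = U b t &
      forall b t, degenerate b -> U b t = 0].
Proof.
have [i Pi] := Psi_lc.
have solve b : exists u, (exists i, forall x y, lpi i x = lpi i y -> u x = u y) /\
    forall t z, Z z -> u (t * z)%g - u t = Psi b t z.
  apply: tree; last exact: Psi1.
  by exists i => t t' z z' _ _ tt zz; apply: Pi => //; exact: srel_refl.
(* At level [i] there are finitely many lists of size [m.+1]. One potential per code is chosen, so
   that a single level [j] works for all of them. *)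
have [T [h hrel]] := relA_fin i.
pose code (b : seq A) : {ffun 'I_m.+1 -> T} := [ffun k : 'I_m.+1 => h (nth a0 b k)].
have codeP b b' : size b = m.+1 -> size b' = m.+1 -> code b = code b' ->
    srel (relA i) b b'.
  move=> bm b'm bb; apply: (@srel_nth _ _ a0); first by rewrite bm b'm.
  move=> k; rewrite bm => km; apply: hrel.
  by move/ffunP/(_ (Ordinal km)): bb; rewrite !ffunE.
pose rep c := if pselect (exists b, size b = m.+1 /\ code b = c) is left e
  then sval (cid e) else [::].
have repP b : size b = m.+1 -> srel (relA i) (rep (code b)) b.
  move=> bm; rewrite /rep; case: pselect => [e|[]]; last by exists b.
  by case: cid => /= b' [b'm bb]; exact: codeP.
pose u0 c := sval (cid (solve (rep c))).
have u0P c := svalP (cid (solve (rep c))).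
pose lv c := sval (cid (u0P c).1).
have lvP c : forall x y, lpi (lv c) x = lpi (lv c) y -> u0 c x = u0 c y.
  exact: svalP (cid (u0P c).1).
have [j0 j0P] := finer_fin lv; have [j [ji jj0]] := finer2 i j0.
(* The value at [s a] is subtracted for the normalisation. Other sizes are sent to 0, so that
   invariance and normalisation hold for all lists. *)
pose U b t := if b is a :: _ then
  if size b == m.+1 then u0 (code b) t - u0 (code b) (s a) else 0 else 0.
have U1 b t z : size b = m.+1 -> Z z -> U b (t * z)%g - U b t = Psi b t z.
  move=> bm Zz; rewrite /U; case: b bm => // a b bm.
  rewrite bm eqxx subrBB subrr subr0 (u0P _).2//.
  by apply: Pi => //; exact: repP.
have Ulc b x y : lpi j x = lpi j y -> U b x = U b y.
  move=> xy; rewrite /U; case: b => // a b; case: ifP => // _.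
  by congr (_ - _); apply: lvP; apply: (finer_eq _ xy); exact: finer_trans (j0P _).
have U0 b a : size (a :: b) = m.+1 -> U (a :: b) (s a) = 0.
  by move=> bm; rewrite /U bm eqxx subrr.
have Usz b t : size b != m.+1 -> U b t = 0.
  by rewrite /U; case: b => // a b; case: ifP.
exists U; split=> //.
- exists j => b b' t t' bb tt; have bb' := srel_size bb.
  have [bm|bm] := eqVneq (size b) m.+1; last by rewrite !Usz// -bb'.
  rewrite (Ulc b' t' t)//; apply: (@tree_unique (U b) (U b') (s (head a0 b))).
  + by exists j; exact: Ulc.
  + by exists j; exact: Ulc.
  + move=> x z Zz; rewrite !U1// -?bb'//; apply: Pi => //.
    by apply: srel_sub bb => x' y; exact: relA_finer.
  + case: b b' bb bb' bm => // a b [|a' b'] // [aa bb] bb' bm.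
    by rewrite U0// (Ulc _ _ (s a')) ?U0 -?bb'//; exact: s_rel.
- move=> n b t.
  have [bm|bm] := eqVneq (size b) m.+1; last by rewrite !Usz// ?size_map.
  apply: (@tree_unique (fun t => U (map (nA n) b) (nF n t)) (U b) (s (head a0 b))).
  + exists j => x y xy; apply: Ulc.
    by rewrite -[x]mul1g -[y]mul1g !nFM !lpiM xy.
  + by exists j; exact: Ulc.
  + by move=> x z Zz; rewrite nFM !U1 ?size_map// Psi_act.
  + by case: b bm => // a b bm; rewrite -s_eq !U0//= size_map.
- move=> b t bd.
  have [bm|bm] := eqVneq (size b) m.+1; last by rewrite !Usz.
  apply: (@tree_unique (U b) (fun=> 0) (s (head a0 b))).
  + by exists j; exact: Ulc.
  + by exists j.
  + by move=> x z Zz; rewrite U1// Psi_degenerate// subrr.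
  + by case: b bm {bd} => // a b bm; rewrite U0.
Qed.

End Cocycle.

(** A Künneth argument for A x tree: correcting [f] by [U] makes its slices independent of the point
    of the tree, exactness for A kills the common slice [q], and what remains vanishes on slices and
    on prisms over edges, so that contracting each simplex to the slice of its first vertex exhibits
    it as a coboundary. *)
Lemma step_exact m : exact_at E nA relA simp m.+2 ->
  exact_at E step_act step_rel step_simp m.+2.
Proof.
move=> exA f f_nice fcoc; have [fN [i fi] fd] := f_nice.
have [U [U1 [j Uj] UN Ud]] := step_potential m f_nice.
have at_fst t b : map fst (step_at t b) = b by rewrite -map_comp map_id.
(* Evaluating at the equivariant point [s a] makes [q] invariant by construction; by [q_indep] any
   other point gives the same value on simplices. *)
pose q b := if b is a :: _ then
  f (step_at (s a) b) - cobd (fun b' => U b' (s a)) b else 0.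
have q_nice : nice_cochain nA relA q.
  split.
  - move=> n [|a b] //; rewrite /q map_cons s_eq -map_cons cobd_map.
    congr (_ - _); last by apply: cobd_local => b' _; rewrite UN.
    by rewrite -[RHS](fN n) /step_at -!map_comp; congr f; apply: eq_map.
  - have [k [ki kj]] := finer2 i j; exists k => b b' bb.
    case: b b' bb => [|a b] [|a' b'] // bb; have sa := s_rel bb.1.
    rewrite /q; congr (_ - _).
      apply: fi; apply: srel_map bb => x y xy; split=> /=.
        exact: relA_finer xy.
      exact: finer_eq sa.
    apply: srel_cobd bb _ => u v uv; apply: Uj; last exact: finer_eq sa.
    by apply: srel_sub uv => x y; exact: relA_finer.
  - move=> b bd; case: b bd => // a b bd; rewrite /q fd; last exact: degenerate_map.
    by rewrite cobd_degenerate ?subrr// => b' _ /Ud ->.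
have q_indep b t : simp b -> size b = m.+2 ->
    f (step_at t b) - cobd (fun b' => U b' t) b = q b.
  move=> sb bm; case: b sb bm => // a b sb bm.
  apply: (@connected (fun t => f (step_at t (a :: b)) - cobd (U^~ t) (a :: b))).
    have [k [ki kj]] := finer2 i j; exists k => x y xy; congr (_ - _).
      apply: fi; apply: srel_map (srel_refl (relA_refl k) _) => x' y' x'y'.
      by split; [exact: relA_finer x'y'|exact: finer_eq xy].
    apply: cobd_local => b' _; apply: Uj; last exact: finer_eq xy.
    exact: srel_refl.
  move=> x z Zz; apply/eqP; rewrite -subr_eq0 subrBB.
  rewrite (step_psi_jump fcoc)// -cobdB subr_eq0; apply/eqP/cobd_local.
  by move=> b' /face_size bb; rewrite U1//; move: bb; rewrite bm => -[].
have [q' [q'_nice qq']] : exists q', nice_cochain nA relA q' /\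
    forall b, simp b -> size b = m.+2 -> q b = cobd q' b.
  apply: exA => // b sb bm.
  have -> : cobd q b = cobd (fun b => f (step_at 1%g b) - cobd (U^~ 1%g) b) b.
    apply: cobd_local => b' bb; rewrite q_indep//; first exact: simp_face sb.
    by have := face_size bb; rewrite bm => -[].
  rewrite cobdB cobdK subr0 -(cobd_map (fun a => (a, 1%g))) fcoc ?size_map//.
  by split; [rewrite at_fst|rewrite -map_comp map_const_seq; exact: jump_const].
have [q'N [i' q'i] q'd] := q'_nice.
(* The correction depends on the A-coordinates and on the F-coordinate of the first vertex only.
   Hence it vanishes as soon as the A-coordinates are degenerate, which gives [f'_jump]. *)
pose g (l : seq (A * F)) := if l is (a, t) :: _ then
  U (map fst l) t + q' (map fst l) else 0.
have gd l : degenerate (map fst l) -> g l = 0.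
  by case: l => // -[a t] l ld; rewrite /g Ud// q'd// addr0.
have g_at t b : b <> [::] -> g (step_at t b) = U b t + q' b.
  by case: b => // a b _; rewrite /g /= (at_fst t b).
have g_nice : nice_cochain step_act step_rel g.
  split.
  - move=> n [|[a t] l] //; rewrite /g /= -map_comp (eq_map (g := nA n \o fst))//.
    rewrite (map_comp (nA n) fst) -(map_cons (nA n)).
    by rewrite UN q'N.
  - have [k [ki kj]] := finer2 i' j; exists k => l l' ll.
    case: l l' ll => [|[a t] l] [|[a' t'] l'] // ll; rewrite /g.
    have ff r : finer k r -> srel (relA r) (map fst ((a, t) :: l)) (map fst ((a', t') :: l')).
      by move=> kr; apply: srel_map ll => x y [xy _]; exact: relA_finer xy.
    congr (_ + _); last by apply: q'i; exact: ff.
    by apply: Uj; [exact: ff|case: ll => [[_ tt] _]; exact: finer_eq tt].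
  - by move=> l ld; apply: gd; exact: degenerate_map.
pose f' l := f l - cobd g l.
have f'd l : degenerate l -> f' l = 0.
  move=> ld; rewrite /f' fd// cobd_degenerate ?subrr// => l' _ l'd.
  by case: g_nice => _ _; apply.
have f'N n l : f' (map (step_act n) l) = f' l.
  rewrite /f' fN cobd_map; congr (_ - _); apply: cobd_local => l' _.
  by case: g_nice => gN _ _; rewrite gN.
have [j' f'j] : exists j', forall l l', srel (step_rel j') l l' -> f' l = f' l'.
  have [_ [k gk] _] := g_nice; have [r [ri rk]] := finer2 i k; exists r => l l' ll.
  have sub r' : finer r r' -> forall u v, srel (step_rel r) u v -> srel (step_rel r') u v.
    move=> rr u v; apply: srel_sub => x y [xy xy']; split; last exact: finer_eq xy'.
    exact: relA_finer xy.
  rewrite /f'; congr (_ - _); first by apply: fi; exact: sub ll.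
  by apply: srel_cobd ll _ => u v uv; apply: gk; exact: sub uv.
have f'coc l : step_simp l -> size l = m.+3 -> cobd f' l = 0.
  by move=> ls lm; rewrite cobdB cobdK subr0 fcoc.
have f'_at t b : simp b -> size b = m.+2 -> f' (step_at t b) = 0.
  move=> sb bm; rewrite /f' cobd_map.
  have -> : cobd (fun b' => g [seq (i, t) | i <- b']) b =
      cobd (U^~ t) b + cobd q' b.
    rewrite -cobdD; apply: cobd_local => b' bb; apply: g_at => b'0.
    by move: (face_size bb); rewrite b'0 bm.
  by rewrite -qq'// -(q_indep b t)// [_ + (_ - _)]addrC subrK subrr.
(* The prism integral of [cobd g] is the increment of [g] between the slices, that is of [U], since
   [q'] cancels; by construction this is the prism integral of [f]. *)
have f'_jump b t z : Z z -> size b = m.+1 -> prism (step_pairs t (t * z)%g b) f' = 0.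
  move=> Zz bm; rewrite prismB; have := prism_cobd g (step_pairs t (t * z)%g b).
  have -> : cobd (fun l => prism l g) (step_pairs t (t * z)%g b) = 0.
    rewrite cobd_map -[RHS](cobd0 _ b); apply: cobd_local => b' _.
    apply: prism_eq0 => l1 w v l2 e.
    have [b1 [a [b2 [_ -> [-> ->] ->]]]] := map_eq_cat e.
    by apply: gd; rewrite map_cat /=; exact: degenerate_cat.
  rewrite addr0 => ->.
  rewrite -!map_comp (eq_map (g := fun a => (a, (t * z)%g)))//.
  rewrite [X in _ - (_ - g X)](_ : _ = step_at t b); last exact: eq_map.
  have b0 : b <> [::] by move=> b0; rewrite b0 in bm.
  by rewrite !g_at// [U _ t + _]addrC addrKA U1// subrr.
(* The prism from the projection of [l] to the slice at [t] up to [l] itself; in [k], [t] is the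
   F-coordinate of the head of the list. *)
pose P (t : F) (l : seq (A * F)) := map (fun x => ((x.1, t), x)) l.
pose k (l : seq (A * F)) := if l is (a, t) :: _ then prism (P t l) f' else 0.
have k_nice : nice_cochain step_act step_rel k.
  split.
  - move=> n [|[a t] l] //; 
    change (prism (P (nF n t) (map (step_act n) ((a, t) :: l))) f' = k ((a, t) :: l)).
    have -> : P (nF n t) (map (step_act n) ((a, t) :: l)) =
       map (fun wv => (step_act n wv.1, step_act n wv.2)) (P t ((a, t) :: l)).
      by rewrite /P -!map_comp; apply: eq_map.
    by rewrite prism_map; apply: prism_eq => *; rewrite f'N.
  - exists j' => l l' ll; case: l l' ll => [|[a t] l] [|[a' t'] l'] // ll.
    have tt := ll.1.2; rewrite /k; apply: srel_prism f'j; apply: srel_map ll.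
    by move=> x y [xy xy2]; do 2!split.
  - case=> // -[a t] l ld; rewrite /k prism_degenerate//.
    exact: degenerate_map.
exists (fun l => k l + g l); split.
  have [kN [r kr] kd] := k_nice; have [gN [r' gr] gd'] := g_nice.
  split=> [n l||l ld]; [by rewrite kN gN| |by rewrite kd ?gd' ?addr0//].
  have [r2 [r2r r2r']] := finer2 r r'; exists r2 => l l' ll.
  rewrite (kr l l') ?(gr l l')//; apply: srel_sub ll => x y [xy xy'];
    by split; [exact: relA_finer xy|exact: finer_eq xy'].
move=> l [ls lj] lm; rewrite cobdD; apply/eqP; rewrite -subr_eq; apply/eqP.
case: l ls lj lm => // -[a t] l ls lj lm.
change (f' ((a, t) :: l) = cobd k ((a, t) :: l)).
have := prism_cobd f' (P t ((a, t) :: l)).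
rewrite prism_eq0; last first.
  move=> l1 w v l2 e; have [b1 [x [b2 [lb -> [-> ->] ->]]]] := map_eq_cat e.
  rewrite -!map_comp map_id; apply: f'coc; last first.
    by rewrite -lm lb !size_cat size_map /= !addnS.
  split.
    rewrite map_cat /= -map_comp (eq_map (g := fst))//; apply: simp_dup.
    by have := ls; rewrite lb map_cat.
  rewrite map_cat /= -map_comp map_const_seq -(size_map snd b1).
  apply: (@jump_dup _ (map snd l)) => //.
  by have := congr1 (map snd) lb; rewrite /= map_cat.
have -> : map snd (P t ((a, t) :: l)) = (a, t) :: l.
  by rewrite -map_comp (eq_map (g := id)) ?map_id.
have -> : map fst (P t ((a, t) :: l)) = step_at t (map fst ((a, t) :: l)).
  by rewrite /step_at -!map_comp; apply: eq_map.
rewrite add0r.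
rewrite f'_at ?size_map// subr0 => <-; rewrite cobd_map /=; congr (_ - _).
(* Only the face without the head may use another base slice. If the F-coordinate jumps right after
   the head, that face lies in the slice of [t * z]: its own prism is degenerate, and the prism from
   [t] vanishes by [f'_jump]. *)
case: l lj lm {ls} => // -[a' t'] l lj lm.
have [z [i0 [j0 [Zz e]]]] := jump_head lj; rewrite /k.
move: e; case: i0 => [|i0]; last by case=> <- _.
case: j0 => [//|j0] [-> e].
have -> : (a', (t * z)%g) :: l = step_at (t * z)%g (a' :: map fst l).
  rewrite /step_at /= -map_comp; congr cons; elim: l j0 e {lj lm} => //= -[x y] l IH.
  by case=> //= j0 [-> /IH <-].
rewrite [X in _ = X]prism_eq0; last first.
  rewrite /P /step_at -map_comp => l1 w v l2 e3.
  have [b1 [x [b2 [_ -> [-> ->] ->]]]] := map_eq_cat e3.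
  exact: (f'd _ (degenerate_cat _ (x, (t * z)%g) _)).
have e4 : P t (step_at (t * z)%g (a' :: map fst l)) =
    step_pairs t (t * z)%g (a' :: map fst l).
  by rewrite /P /step_at -map_comp; apply: eq_map.
rewrite /P in e4; rewrite e4 f'_jump//.
by move: lm => /= [<-]; rewrite size_map.
Qed.
End Step.

(** * Products of trees: simplices, dimension and exactness *)

Section JumpLists.
Variables (p : nat) (F : lgroup p) (Z : F -> Prop).
Hypothesis Z1 : Z 1%g.

Lemma face_nseq_cat (V : Type) i j (x y : V) b : face b (nseq i x ++ nseq j y) ->
  exists i' j', b = nseq i' x ++ nseq j' y.
Proof.
have one k (z : V) c : face c (nseq k z) -> exists k', c = nseq k' z.
  elim: k c => [|k IH] c /= h; inversion h; subst; first by exists k.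
  by have [k' ->] := IH _ H1; exists k'.+1.
elim: i b => [|i IH] b /= h; first by have [k ->] := one _ _ _ h; exists 0%N, k.
inversion h; subst; first by exists i, j.
by have [i' [j' ->]] := IH _ H1; exists i'.+1, j'.
Qed.

Lemma nseq_cat_dup (V : Type) i j (x y : V) b1 z b2 :
  nseq i x ++ nseq j y = b1 ++ z :: b2 ->
  exists i' j', b1 ++ z :: z :: b2 = nseq i' x ++ nseq j' y.
Proof.
have one k (w : V) : forall c1, nseq k w = c1 ++ z :: b2 ->
    exists k', c1 ++ z :: z :: b2 = nseq k' w.
  elim: k => [|k IH] [|w' c1] //=; first by case=> <- <-; exists k.+2.
  by case=> <- /IH[k' ->]; exists k'.+1.
elim: i b1 => [|i IH] b1 /=; first by move/one=> [k ->]; exists 0%N, k.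
case: b1 => [|x' b1] /= [<-]; first by move=> <-; exists i.+2, j.
by move=> /IH[i' [j' ->]]; exists i'.+1, j'.
Qed.

Lemma jump_face b b' : face b b' -> jump Z b' -> jump Z b.
Proof.
move=> h [t [z [i [j [Zz e]]]]]; rewrite e in h.
by have [i' [j' ->]] := face_nseq_cat h; exists t, z, i', j'.
Qed.

Lemma jump_dup_cat b1 y b2 : jump Z (b1 ++ y :: b2) -> jump Z (b1 ++ y :: y :: b2).
Proof.
move=> [t [z [i [j [Zz e]]]]].
by have [i' [j' ->]] := nseq_cat_dup (esym e); exists t, z, i', j'.
Qed.

Lemma jump_mul h b : jump Z b -> jump Z (map (fun t => h * t)%g b).
Proof.
move=> [t [z [i [j [Zz ->]]]]]; exists (h * t)%g, z, i, j; split=> //.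
by rewrite map_cat !map_nseq mulgA.
Qed.

End JumpLists.

Section Changes.
Variable V : Type.
Implicit Types (x y : V) (s : seq V).

(** This count is additive over coordinates up to an inequality, at most 1 on a [jump] list, and
    equal to the length on a nondegenerate list: it bounds the dimension of a product of trees. *)
Fixpoint changes x s : nat :=
  if s is y :: s' then (`[< x <> y >] + changes y s')%N else 0%N.

Lemma changes_size x s : ~ degenerate (x :: s) -> changes x s = size s.
Proof.
elim: s x => //= y s IH x nd; rewrite IH; last by move/(degenerate_tail x).
by case: asboolP => // /contrapT xy; case: nd; rewrite xy; exact: degenerate_head.
Qed.

Lemma changes_jump x y i j b s : nseq i x ++ nseq j y = b :: s -> changes b s <= 1.
Proof.
have one k z c : changes z (nseq k z ++ c) = changes z c.
  by elim: k => //= k ->; case: asboolP.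
have one' k z : changes z (nseq k z) = 0%N by rewrite -[nseq _ _]cats0 one.
case: i => [|i] /=; first by case: j => //= j [<- <-]; rewrite one'.
case=> <- <-; rewrite one; case: j => //= j; rewrite one' addn0; exact: leq_b1.
Qed.

End Changes.

Lemma changes_pair (A B : Type) (x : A * B) s :
  changes x s <= changes x.1 (map fst s) + changes x.2 (map snd s).
Proof.
elim: s x => //= y s IH x; rewrite addnACA leq_add//.
case: asboolP => // xy; case: asboolP => //= /contrapT e1.
case: asboolP => //= /contrapT e2; case: xy.
by case: x y e1 e2 => [? ?] [? ?] /= -> ->.
Qed.

Section Box.
Local Open Scope ring_scope.
Variables (p : nat) (p_pr : prime p) (F : lgroup p) (Z : F -> Prop).
Hypothesis F_free : free_on Z.
Variables (E : finZmodType).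
Hypothesis Ep : exists k, forall e : E, (e *+ (p ^ k) = 0)%R.

(** Nested pairs rather than tuples, so that [step_exact] adds one tree at each step of an induction
    on [k]. *)
Fixpoint box k : Type := if k is k'.+1 then (box k' * F)%type else unit.

Fixpoint box_rel k : level F -> box k -> box k -> Prop :=
  if k is k'.+1 then step_rel (@box_rel k') else fun _ _ _ => True.

Fixpoint box_simp k : seq (box k) -> Prop :=
  if k is k'.+1 then step_simp Z (@box_simp k') else fun _ => True.

Section Action.
Variables (N : Type) (nF : nat -> N -> F -> F).
Fixpoint box_act k : N -> box k -> box k :=
  if k is k'.+1 then step_act (@box_act k') (nF k') else fun _ x => x.
End Action.

Fixpoint box_nth k : box k -> nat -> F :=
  if k is k'.+1 then fun x j => if j == k' then x.2 else box_nth x.1 j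
  else fun _ _ => 1%g.

Fixpoint box_mk k (f : nat -> F) : box k :=
  if k is k'.+1 then (box_mk k' f, f k') else tt.

Lemma box_nth_mk k f j : (j < k)%N -> box_nth (box_mk k f) j = f j.
Proof.
elim: k => //= k IH; rewrite ltnS leq_eqVlt; case: eqP => [->//|_] /= jk.
exact: IH.
Qed.

Lemma box_ext k (x y : box k) : (forall j, (j < k)%N -> box_nth x j = box_nth y j) ->
  x = y.
Proof.
elim: k x y => [[] [] //|k IH [x t] [y u] xy]; congr pair; last first.
  by have := xy k (ltnSn k); rewrite /= eqxx.
apply: IH => j jk; have := xy j (ltnW jk).
by rewrite /= (ltn_eqF jk).
Qed.

Lemma box_relP k i (x y : box k) : box_rel i x y <->
  forall j, (j < k)%N -> lpi i (box_nth x j) = lpi i (box_nth y j).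
Proof.
elim: k x y => [[] [] //|k IH [x t] [y u]] /=; split=> [[/IH xy tu] j|xy].
  by rewrite ltnS leq_eqVlt; case: eqP => // _ /= /xy.
split; last by have := xy k (ltnSn k); rewrite /= eqxx.
by apply/IH => j jk; have := xy j (ltnW jk); rewrite /= (ltn_eqF jk).
Qed.

Lemma box_simpP k (s : seq (box k)) : box_simp s <->
  forall j, (j < k)%N -> jump Z (map (fun x => box_nth x j) s).
Proof.
elim: k s => [|k IH] s //=; split=> [[/IH ss sj] j|sj].
  rewrite ltnS leq_eqVlt; case: eqP => // _ /= /ss.
  by rewrite -map_comp.
split; last by have := sj k (ltnSn k); rewrite /= eqxx.
apply/IH => j jk; have := sj j (ltnW jk).
by rewrite (ltn_eqF jk) -map_comp.
Qed.

Lemma box_rel_refl k i (x : box k) : box_rel i x x.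
Proof. exact/box_relP. Qed.

Lemma box_rel_finer k i j (x y : box k) : finer j i -> box_rel j x y -> box_rel i x y.
Proof. by move=> ji /box_relP xy; apply/box_relP => l /xy; exact: finer_eq. Qed.

Lemma box_rel_fin k i : exists (T : finType) (h : box k -> T),
  forall x y, h x = h y -> box_rel i x y.
Proof.
elim: k => [|k [T [h hP]]]; first by exists unit, id.
exists (T * lquo i)%type, (fun x => (h x.1, lpi i x.2)) => x y [/hP xy ?].
by split.
Qed.

Lemma box_simp_face k (b b' : seq (box k)) : face b b' -> box_simp b' -> box_simp b.
Proof.
move=> bb /box_simpP sb; apply/box_simpP => j /sb; apply: jump_face.
exact: face_map.
Qed.

Lemma box_simp_dup k (b1 : seq (box k)) x b2 :
  box_simp (b1 ++ x :: b2) -> box_simp (b1 ++ x :: x :: b2).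
Proof.
move/box_simpP=> sb; apply/box_simpP => j /sb; rewrite !map_cat /=.
exact: jump_dup_cat.
Qed.

Lemma box_simp_nseq k n (x : box k) : box_simp (nseq n x).
Proof.
have [Z1 _ _] := F_free.
by apply/box_simpP => j _; rewrite map_nseq; exact: jump_const.
Qed.

Lemma box_connected k (T : Type) (u : box k -> T) :
  (exists i, forall x y, box_rel i x y -> u x = u y) ->
  (forall x y, box_simp [:: x; y] -> u x = u y) -> forall x y, u x = u y.
Proof.
have [Z1 _ _] := F_free.
elim: k u => [|k IH] u [i ui] us; first by case=> -[].
have fix_t t (x y : box k) : u (x, t) = u (y, t).
  apply: (IH (fun x => u (x, t))) => [|{}x {}y xy].
    by exists i => {}x {}y xy; apply: ui; split.
  by apply: us; split=> //=; exact: (jump_const Z1 2).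
move=> [x t] [y t']; rewrite (fix_t t x y).
apply: (tree_connected F_free (u := fun t => u (y, t))).
  by exists i => a b ab; apply: ui; split=> //; exact: box_rel_refl.
move=> {}t z Zz; apply/esym/us; split=> /=; first exact: (box_simp_nseq 2).
by exists t, z, 1%N, 1%N.
Qed.

Lemma box_changes k x (s : seq (box k)) : box_simp (x :: s) -> (changes x s <= k)%N.
Proof.
elim: k x s => [|k IH] x s.
  move=> _; elim: s x => //= -[] s IH []; case: asboolP => [//|_].
  exact: IH.
move=> [ss [t [z [i [j [_ e]]]]]]; apply: leq_trans (changes_pair _ _) _.
by rewrite -addn1 leq_add//; [exact: IH|exact: changes_jump (esym e)].
Qed.

Lemma box_dim k (s : seq (box k)) : box_simp s -> (k.+1 < size s)%N -> degenerate s.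
Proof.
case: s => // x s ss sk; apply: contrapT => nd.
have cs := changes_size nd.
by have := box_changes ss; rewrite cs leqNgt -ltnS sk.
Qed.

Let tree := fun psi => @tree_exact p p_pr F Z F_free E psi Ep.
Let connected := @tree_connected p F Z F_free E.

Lemma box_step (N : Type) (nF : nat -> N -> F -> F) k m (s : box k -> F) :
  (forall j n x y, nF j n (x * y)%g = (nF j n x * y)%g) ->
  (forall n a, s (box_act nF n a) = nF k n (s a)) ->
  (forall i a a', box_rel i a a' -> lpi i (s a) = lpi i (s a')) ->
  exact_at E (@box_act N nF k) (@box_rel k) (@box_simp k) m.+2 ->
  exact_at E (@box_act N nF k.+1) (@box_rel k.+1) (@box_simp k.+1) m.+2.
Proof.
move=> nFM s_eq s_rel exk; have [Z1 _ _] := F_free.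
apply: (step_exact Z1 tree connected (box_mk k (fun=> 1%g))
  _ _ _ _ s_eq s_rel _ _ exk).
- exact: box_rel_refl.
- exact: box_rel_finer.
- exact: box_rel_fin.
- exact: nFM.
- exact: box_simp_dup.
- exact: box_simp_face.
Qed.

(** Without a group action any constant map serves as [s], and the induction starts at a point: the
    product of trees is acyclic in all degrees from 1 on. *)
Lemma box_exact k m :
  exact_at E (box_act (fun _ (_ : unit) x => x) (k := k)) (@box_rel k) (@box_simp k) m.+2.
Proof.
have act1 k' (x : box k') : box_act (fun _ (_ : unit) x => x) tt x = x.
  by elim: k' x => //= k' IH [x t]; rewrite /step_act IH.
elim: k => [|k IH]; last by apply: (box_step (s := fun=> 1%g)) => // -[].
move=> f [_ _ fd] _; exists (fun=> 0); split.
  by split=> //; exists (level0 F).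
by move=> [|[] [|[] s]] // _ _; rewrite cobd0 fd//; exact: degenerate_head.
Qed.

(** Equivariantly, degree 1 does not vanish in general, since it sees the cohomology of N. From
    degree 2 on a single tree has only degenerate simplices, which starts the induction; further
    factors are added with the equivariant map that reads coordinate 0 and converts it by [sk] to
    the action on the new coordinate. *)
Lemma box_exact_act (N : Type) (nF : nat -> N -> F -> F) (sk : nat -> F -> F) k m :
  (forall j n x y, nF j n (x * y)%g = (nF j n x * y)%g) ->
  (forall j n x, sk j (nF 0%N n x) = nF j n (sk j x)) ->
  (forall j i x y, lpi i x = lpi i y -> lpi i (sk j x) = lpi i (sk j y)) ->
  exact_at E (@box_act N nF k.+1) (@box_rel k.+1) (@box_simp k.+1) m.+3.
Proof.
move=> nFM sk_eq sk_rel; elim: k => [|k IH].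
  move=> f [_ _ fd] _; exists (fun=> 0); split.
    by split=> //; exists (level0 F).
  move=> s ss sm; rewrite cobd0 fd//; apply: (box_dim ss); by rewrite sm.
apply: (box_step (s := fun x => sk k.+1 (box_nth x 0))) => //.
  move=> n x; rewrite -sk_eq; congr (sk _ _).
  by elim: k x {IH} => [|k IH] [x t] //=; exact: IH.
by move=> i x y /box_relP/(_ 0%N isT); exact: sk_rel.
Qed.

End Box.

(** * Normal subgroups of prime index *)

Section PrimeIndex.
Local Open Scope group_scope.
Variables (p : nat) (p_pr : prime p) (gT : finGroupType) (B C : {group gT}).
Hypotheses (CB : C <| B) (iCB : #|B : C| = p).

Let BN : B \subset 'N(C). Proof. exact: normal_norm. Qed.

Lemma prime_index_coset x y : x \in B :\: C -> y \in B ->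
  exists2 i, i < p & x ^+ i * y \in C.
Proof.
move=> /finset.setDP[xB xC] yB.
have xN := fintype.subsetP BN _ xB; have yN := fintype.subsetP BN _ yB.
have oBC : #|B / C| = p by rewrite card_quotient.
have xBC : coset C x \in B / C by exact: mem_quotient.
have ox : #[coset C x] = p.
  apply/prime_nt_dvdP => //; last by rewrite -oBC order_dvdG.
  rewrite order_eq1; apply: contra xC => /eqP xC.
  by rewrite coset_idr.
have gen : <[coset C x]> = B / C.
  by apply/eqP; rewrite eqEcard cycle_subG xBC oBC -ox leqnn.
have : coset C y^-1 \in <[coset C x]> by rewrite gen mem_quotient ?groupV.
move=> /cyclePmin[i]; rewrite ox => ip /eqP; rewrite morphV// => /eqP yx.
exists i => //; rewrite coset_idr ?groupM ?groupX// morphM ?groupX// morphX//.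
by rewrite -yx mulVg.
Qed.

Lemma prime_index_expP x : x \in B -> x ^+ p \in C.
Proof.
move=> xB; have xN := fintype.subsetP BN _ xB.
apply: coset_idr; rewrite ?groupX// morphX//.
have : coset C x \in B / C by exact: mem_quotient.
by move/expg_cardG; rewrite card_quotient// iCB.
Qed.

Lemma prime_index_exp x i : x \in B :\: C -> x ^+ i \in C -> p %| i.
Proof.
move=> /finset.setDP[xB xC] xiC; have xp := prime_index_expP xB.
apply: contraNT xC; rewrite -prime_coprime// => /eqP co.
have [k [l kl]] : exists k l, (i * k = l * p + 1)%N.
  have [i0|i0] := posnP i; first by move: co; rewrite i0 gcdn0 => p1; have := prime_gt1 p_pr; rewrite p1.
  have [km kn e _] := egcdnP p i0; exists km, kn.
  by rewrite mulnC e gcdnC co.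
have : x ^+ (i * k) \in C by rewrite expgM groupX.
rewrite kl expgnDr mulnC expgM expg1 groupMl//.
exact: groupX.
Qed.

Lemma prime_index_mem x y : x \in B :\: C -> y \in B ->
  exists i, exists2 c, c \in C & y = c * x ^+ i.
Proof.
move=> xD yB; have /finset.setDP[xB xC] := xD.
have [|i _ iC] := @prime_index_coset x^-1 y _ yB.
  by apply/finset.setDP; rewrite !groupV.
exists i, ((x^-1 ^+ i * y) ^ (x^-1 ^+ i)).
  by rewrite memJ_norm// groupX// (fintype.subsetP BN) ?groupV.
by rewrite conjgE !expVgn invgK !mulgA mulgV mul1g mulgVK.
Qed.

End PrimeIndex.

(** * Smith theory for locally constant cochains *)

Section Smith.
Local Open Scope ring_scope.
Variables (p : nat) (p_pr : prime p) (gT : finGroupType).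
Variables (V L : Type) (act : gT -> V -> V).
Variables (rel : L -> seq V -> seq V -> Prop) (ok : seq V -> Prop).
Local Notation "g *@ s" := (map (act g) s) (at level 24, right associativity).
Hypothesis l0 : L.
Hypothesis rel_refl : forall i s, rel i s s.
Hypothesis rel_sym : forall i s t, rel i s t -> rel i t s.
Hypothesis rel_trans : forall i s t u, rel i s t -> rel i t u -> rel i s u.
Hypothesis rel_size : forall i s t, rel i s t -> size s = size t.
Hypothesis rel_directed : forall i j, exists k, forall s t,
  rel k s t -> rel i s t /\ rel j s t.
Hypothesis rel_act : forall i g s t, rel i s t -> rel i (g *@ s) (g *@ t).
Hypothesis act_1 : forall i s, rel i (1%g *@ s) s.
Hypothesis act_M : forall i g h s, rel i ((g * h)%g *@ s) (g *@ h *@ s).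
Hypothesis rel_cobd : forall i (f : seq V -> 'F_p),
  (forall s t, rel i s t -> f s = f t) ->
  forall s t, rel i s t -> cobd f s = cobd f t.
Hypothesis rel_face : forall i g s t, face t s ->
  rel i (g *@ s) s -> rel i (g *@ t) t.
Hypothesis rel_compact : forall n (s : L -> seq V), (forall i, size (s i) = n) ->
  exists x, size x = n /\ forall i, exists j,
    (forall s t, rel j s t -> rel i s t) /\ rel i (s j) x.
Hypothesis degenerate_closed : forall s,
  (forall i, exists2 t, degenerate t & rel i s t) -> degenerate s.
Hypothesis ok_dim : exists D, forall s, ok s -> (D < size s)%N -> degenerate s.

Implicit Types (f h : seq V -> 'F_p) (s t : seq V) (R P Q : seq V -> Prop).
Implicit Types (B C : {group gT}).

Definition lc f := exists i, forall s t, rel i s t -> f s = f t.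
Definition rclosed R := forall s, (forall i, exists2 t, R t & rel i s t) -> R s.
Definition faced R := forall s t, face t s -> R s -> R t.
Definition act_stable B R := forall b s, b \in B -> R s -> R (b *@ s).

Lemma lc_act f g : lc f -> lc (fun s => f (g *@ s)).
Proof. by move=> [i fi]; exists i => s t st; apply: fi; exact: rel_act. Qed.

Lemma lc2 f h : lc f -> lc h -> exists k,
  forall s t, rel k s t -> f s = f t /\ h s = h t.
Proof.
move=> [i fi] [j hj]; have [k kP] := rel_directed i j.
by exists k => s t /kP[/fi ? /hj ?].
Qed.

Lemma lcD f h : lc f -> lc h -> lc (fun s => f s + h s).
Proof. by move=> fl /(lc2 fl)[k kP]; exists k => s t /kP[-> ->]. Qed.

Lemma lcN f : lc f -> lc (fun s => - f s).
Proof. by move=> [i fi]; exists i => s t /fi ->. Qed.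

Lemma lcM f h : lc f -> lc h -> lc (fun s => f s * h s).
Proof. by move=> fl /(lc2 fl)[k kP]; exists k => s t /kP[-> ->]. Qed.

Lemma lc_sum (I : Type) (r : seq I) (f : I -> seq V -> 'F_p) :
  (forall i, lc (f i)) -> lc (fun s => \sum_(i <- r) f i s).
Proof.
move=> fl; elim: r => [|i r IH]; first by exists l0 => s t _; rewrite !big_nil.
have [k kP] := lc2 (fl i) IH; exists k => s t /kP[e1 e2].
by rewrite !big_cons e1 e2.
Qed.

Lemma lc_cobd f : lc f -> lc (cobd f).
Proof. by move=> [i fi]; exists i; exact: rel_cobd. Qed.

Lemma lc_actM f (g g' : gT) s : lc f -> f ((g * g')%g *@ s) = f (g *@ g' *@ s).
Proof. by move=> [i fi]; apply: fi; exact: act_M. Qed.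

Lemma lc_act1 f s : lc f -> f (1%g *@ s) = f s.
Proof. by move=> [i fi]; apply: fi; exact: act_1. Qed.

Lemma rel_actV i g s t : rel i (g *@ s) t -> rel i s (g^-1%g *@ t).
Proof.
move=> /(rel_act g^-1%g) h; apply: rel_trans h; apply: rel_trans (act_M _ _ _ _).
by rewrite mulVg; exact/rel_sym/act_1.
Qed.

Lemma rel_fin (T : finType) (a : T -> L) : exists k, forall x s t,
  rel k s t -> rel (a x) s t.
Proof.
suff [k kP] : exists k, forall x, x \in enum T -> forall s t, rel k s t -> rel (a x) s t.
  by exists k => x; apply: kP; rewrite mem_enum.
elim: (enum T) => [|x r [k kP]]; first by exists l0.
have [k' k'P] := rel_directed k (a x).
exists k' => y; rewrite inE => /orP[/eqP ->|yr] s t /k'P[] // kst _.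
exact: kP.
Qed.

Lemma rclosedU P Q : rclosed P -> rclosed Q -> rclosed (fun s => P s \/ Q s).
Proof.
move=> cP cQ s sPQ; apply: contrapT => /not_orP[nP nQ].
have [i ni] : exists i, forall t, P t -> ~ rel i s t.
  apply: contrapT => h; apply: nP; apply: cP => i; apply: contrapT => h'.
  by apply: h; exists i => t Pt st; apply: h'; exists t.
have [j nj] : exists j, forall t, Q t -> ~ rel j s t.
  apply: contrapT => h; apply: nQ; apply: cQ => j; apply: contrapT => h'.
  by apply: h; exists j => t Pt st; apply: h'; exists t.
have [k kP] := rel_directed i j; have [t [Pt|Qt] /kP[si sj]] := sPQ k.
  exact: ni si.
exact: nj sj.
Qed.

Definition coch n B R P f := [/\ lc f,
  forall b s, b \in B -> R s -> size s = n -> f (b *@ s) = f s,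
  forall s, R s -> size s = n -> degenerate s -> f s = 0 &
  forall s, R s -> size s = n -> P s -> f s = 0].

(** In this section [R] is a subcomplex and [P] the part of it where cochains vanish: [coch n B R P]
    consists of the B-invariant relative cochains on lists of size [n]. *)
Definition cocycle n R f := forall s, R s -> size s = n.+1 -> cobd f s = 0.

(** Vanishing of the B-invariant relative cohomology in all degrees at least 2: size [n.+3] is
    degree [n.+2]. *)
Definition exact_on B R P := forall n f, coch n.+3 B R P f -> cocycle n.+3 R f ->
  exists h, coch n.+2 B R P h /\ forall s, R s -> size s = n.+3 -> f s = cobd h s.

Lemma coch_cobd n B R P f : act_stable B R -> faced R -> faced P ->
  coch n B R P f -> coch n.+1 B R P (cobd f).
Proof.
move=> BR fR fP [fl fB fd f0]; split; first exact: lc_cobd.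
- move=> b s bB Rs sn; rewrite cobd_map; apply: cobd_local => t ts.
  by apply: fB => //; [exact: fR ts _|have := face_size ts; rewrite sn => -[]].
- move=> s Rs sn sd; apply: cobd_degenerate => // t ts.
  by apply: fd; [exact: fR ts _|have := face_size ts; rewrite sn => -[]].
- move=> s Rs sn Ps; rewrite -[RHS](cobd0 _ s); apply: cobd_local => t ts.
  by apply: f0; [exact: fR ts _|have := face_size ts; rewrite sn => -[]|exact: fP ts _].
Qed.

Lemma coch_sub n B C R P f : C \subset B -> coch n B R P f -> coch n C R P f.
Proof. by move=> /fintype.subsetP CB [fl fB fd f0]; split=> // b s /CB; exact: fB. Qed.

Lemma cochD n B R P f h : coch n B R P f -> coch n B R P h ->
  coch n B R P (fun s => f s + h s).
Proof.
move=> [fl fB fd f0] [hl hB hd h0]; split; first exact: lcD.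
- by move=> b s bB Rs sn; rewrite fB ?hB.
- by move=> s Rs sn sd; rewrite fd ?hd ?addr0.
- by move=> s Rs sn sd; rewrite f0 ?h0 ?addr0.
Qed.

Lemma cochN n B R P f : coch n B R P f -> coch n B R P (fun s => - f s).
Proof.
move=> [fl fB fd f0]; split; first exact: lcN.
- by move=> b s bB Rs sn; rewrite fB.
- by move=> s Rs sn sd; rewrite fd ?oppr0.
- by move=> s Rs sn sd; rewrite f0 ?oppr0.
Qed.

Lemma coch_sum (I : Type) (r : seq I) n B R P (f : I -> seq V -> 'F_p) :
  (forall i, coch n B R P (f i)) -> coch n B R P (fun s => \sum_(i <- r) f i s).
Proof.
move=> fc; split; first by apply: lc_sum => i; case: (fc i).
- by move=> b s bB Rs sn; apply: eq_bigr => i _; case: (fc i) => _ ->.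
- by move=> s Rs sn sd; rewrite big1// => i _; case: (fc i) => _ _ ->.
- by move=> s Rs sn sd; rewrite big1// => i _; case: (fc i) => _ _ _ ->.
Qed.

(** Compactness in the form used below: conditions that weaken with the level, each satisfiable, are
    approximated at every level by one limit list. *)
Lemma rel_cluster n (P : L -> seq V -> Prop) :
  (forall i j s, (forall t u, rel j t u -> rel i t u) -> P j s -> P i s) ->
  (forall i, exists s, size s = n /\ P i s) ->
  exists x, size x = n /\ forall i, exists s, P i s /\ rel i s x.
Proof.
move=> Pm Pex; pose s i := sval (cid (Pex i)).
have sP i : size (s i) = n /\ P i (s i) := svalP (cid (Pex i)).
have [x [xn xP]] := rel_compact (fun i => (sP i).1).
exists x; split=> // i; have [j [ji sx]] := xP i.
by exists (s j); split=> //; apply: Pm ji _; case: (sP j).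
Qed.

(* The negligible set Q is where the extension is required to vanish. *)
Lemma coch_extend n B T Q f : lc f -> rclosed T -> rclosed Q ->
  act_stable B T -> act_stable B Q ->
  (forall b s, b \in B -> T s -> size s = n -> f (b *@ s) = f s) ->
  (forall s, T s -> Q s -> size s = n -> f s = 0) ->
  exists h, [/\ lc h, forall b s, b \in B -> h (b *@ s) = h s,
    forall s, T s -> size s = n -> h s = f s &
    forall s, Q s -> size s = n -> h s = 0].
Proof.
move=> [i fi] cT cQ BT BQ fB fQ.
(* The support of [f] on [T] stays away from [Q] at some level: otherwise a cluster point would lie
   in both [T] and [Q], where [f] is 0, yet be a limit of lists where the locally constant [f] is
   not. *)
have [j jQ] : exists j, forall t q, T t -> size t = n -> Q q -> rel j t q ->
    f t = 0.
  apply: contrapT => H.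
  have [||x [xn xP]] := @rel_cluster n
    (fun j t => T t /\ f t <> 0 /\ exists2 q, Q q & rel j t q).
  - by move=> k l t kl [Tt [ft [q Qq tq]]]; do 2!split=> //; exists q => //; exact: kl.
  - move=> k; apply: contrapT => h; apply: H; exists k => t q Tt tn Qq tq.
    by apply: contrapT => ft; apply: h; exists t; do 3!split=> //; exists q.
  - have Tx : T x.
      by apply: cT => k; have [t [[Tt _] tx]] := xP k; exists t => //; exact: rel_sym.
    have Qx : Q x.
      apply: cQ => k; have [t [[_ [_ [q Qq tq]]] tx]] := xP k; exists q => //.
      exact: rel_trans (rel_sym tx) tq.
    have [t [[_ [ft _]] /fi tx]] := xP i; apply: ft.
    by rewrite tx; exact: fQ.
have [k kP] := rel_directed i j.
have ki s t : rel k s t -> rel i s t by case/kP.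
(* The extension copies [f] from B-translates of nearby lists of [T] and is 0 away from them.
   Invariance of [f] on [T] makes the copied value unambiguous. *)
pose near s t := [/\ T t, size t = n & exists2 b, b \in B & rel k (b *@ t) s].
pose h s := if pselect (exists t, near s t) is left e then f (sval (cid e)) else 0.
have hE s t : near s t -> h s = f t.
  move=> st; rewrite /h; case: pselect => [e|[]]; last by exists t.
  case: cid => u /= [Tu un [b bB bu]]; case: st => Tt tn [c cB ct].
  have : rel k u ((b^-1 * c)%g *@ t).
    apply: rel_sym; apply: rel_trans (act_M _ _ _ _) _; apply: rel_sym.
    apply: rel_trans (rel_actV bu) _; apply: rel_act; exact: rel_sym.
  by move/ki/fi ->; rewrite fB// groupM ?groupV.
have near_rel s s' t : rel k s s' -> near s t -> near s' t.
  by move=> ss [Tt tn [b bB bt]]; split=> //; exists b => //; exact: rel_trans bt ss.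
have h_rel s s' : rel k s s' -> h s = h s'.
  move=> ss; have [[t st]|ns] := pselect (exists t, near s t).
    by rewrite (hE _ _ st) (hE s' t)//; exact: near_rel st.
  rewrite /h; case: pselect => // _; case: pselect => // -[t s't].
  by case: ns; exists t; apply: near_rel s't; exact: rel_sym.
have near_act b s t : b \in B -> near s t -> near (b *@ s) t.
  move=> bB [Tt tn [c cB ct]]; split=> //; exists (b * c)%g; first exact: groupM.
  by apply: rel_trans (act_M _ _ _ _) _; exact: rel_act.
exists h; split; first by exists k.
- move=> b s bB; have [[t st]|ns] := pselect (exists t, near s t).
    by rewrite (hE _ _ st) (hE _ t)//; exact: near_act.
  rewrite /h; case: pselect => [[t bst]|_]; case: pselect => // -[].
  exists t; have := near_act b^-1%g _ _ _ bst; rewrite groupV => /(_ bB).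
  apply: near_rel; apply: rel_trans (rel_sym (act_M _ _ _ _)) _.
  by rewrite mulVg; exact: act_1.
- move=> s Ts sn; apply: hE; split=> //; exists 1%g; [exact: group1|exact: act_1].
- move=> s Qs sn; have [[t st]|ns] := pselect (exists t, near s t).
    rewrite (hE _ _ st); case: st => Tt tn [b bB bt].
    apply: (jQ t (b^-1%g *@ s)) => //; first by apply: BQ; rewrite ?groupV.
    by case/kP: (rel_actV bt).
  by rewrite /h; case: pselect.
Qed.


Section IndexP.
Variables (B C : {group gT}) (b : gT).
Hypotheses (CB : (C <| B)%g) (iCB : #|B : C|%g = p) (bD : b \in B :\: C).
Variables R P : seq V -> Prop.
Hypotheses (R_closed : rclosed R) (R_faced : faced R) (BR : act_stable B R).
Hypothesis R_ok : forall s, R s -> ok s.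
Hypotheses (P_closed : rclosed P) (P_faced : faced P) (BP : act_stable B P).

(** The simplices whose image modulo C is fixed by the group B / C of order p: b s lies in the
    C-orbit of s exactly when some element of B outside C fixes s. *)
Definition moved_fixed s := exists2 x, x \in B :\: C & forall i, rel i (x *@ s) s.

Let bB : b \in B. Proof. by case/finset.setDP: bD. Qed.
Let CsubB : C \subset B. Proof. exact: normal_sub. Qed.
Let Fp0 : (p%:R : 'F_p) = 0. Proof. by rewrite pchar_Fp_0. Qed.

(** The two Smith operators of B / C acting on C-invariant cochains: b - 1 for [true], the norm 1 +
    b + ... + b^(p-1) for [false]. Their composites are zero. *)
Definition smith_op (e : bool) f s : 'F_p :=
  if e then f (b *@ s) - f s else \sum_(i < p) f ((b ^+ i)%g *@ s).

Lemma coch_shift n f g : g \in B -> coch n C R P f ->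
  coch n C R P (fun s => f (g *@ s)).
Proof.
move=> gB [fl fC fd f0]; split; first exact: lc_act.
- move=> c s cC Rs sn; rewrite -lc_actM//.
  have -> : (g * c = (c ^ g^-1) * g)%g by rewrite conjgE invgK !mulgA mulgVK.
  rewrite lc_actM// fC ?size_map//; last exact: BR.
  by rewrite memJ_norm// (fintype.subsetP (normal_norm CB))// groupV.
- by move=> s Rs sn sd; apply: fd; rewrite ?size_map//; [exact: BR|exact: degenerate_map].
- by move=> s Rs sn sd; apply: f0; rewrite ?size_map//; [exact: BR|exact: BP].
Qed.

Lemma coch_op n e f : coch n C R P f -> coch n C R P (smith_op e f).
Proof.
move=> fc; case: e; rewrite /smith_op.
  by apply: cochD; [exact: coch_shift|exact: cochN].
by apply: coch_sum => i; apply: coch_shift => //; exact: groupX.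
Qed.

Lemma cobd_op e f s : cobd (smith_op e f) s = smith_op e (cobd f) s.
Proof.
case: e; rewrite /smith_op; first by rewrite cobdB cobd_map.
by rewrite cobd_sum; apply: eq_bigr => i _; rewrite cobd_map.
Qed.

Lemma op_local n e f h : (forall s, R s -> size s = n -> f s = h s) ->
  forall s, R s -> size s = n -> smith_op e f s = smith_op e h s.
Proof.
move=> fh s Rs sn; case: e; rewrite /smith_op.
  by rewrite !fh ?size_map//; exact: BR.
by apply: eq_bigr => i _; rewrite fh ?size_map//; apply: BR => //; exact: groupX.
Qed.

Lemma opD e f h s :
  smith_op e (fun t => f t + h t) s = smith_op e f s + smith_op e h s.
Proof.
by case: e; rewrite /smith_op; [rewrite opprD addrACA|rewrite big_split].
Qed.

Lemma opN e f s : smith_op e (fun t => - f t) s = - smith_op e f s.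
Proof.
case: e; rewrite /smith_op; first by rewrite opprB addrC opprK.
by rewrite sumrN.
Qed.

(** B is generated by C and the element outside C that fixes [s], so C-invariance at [s] is already
    B-invariance. *)
Lemma moved_fixed_act n f s g : coch n C R P f -> R s -> size s = n ->
  moved_fixed s -> g \in B -> f (g *@ s) = f s.
Proof.
move=> [fl fC _ _] Rs sn [x xD xs] gB.
have [xB _] := finset.setDP xD.
have [i [c cC ->]] := prime_index_mem p_pr CB iCB xD gB.
have Xs : forall k, f ((x ^+ k)%g *@ s) = f s /\ forall j, rel j ((x ^+ k)%g *@ s) s.
  elim=> [|k [_ IH]]; first by split; [exact: lc_act1|move=> j; exact: act_1].
  suff h : forall j, rel j ((x ^+ k.+1)%g *@ s) s.
    by split=> //; case: fl => j fj; exact: fj.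
  move=> j; rewrite expgS; apply: rel_trans (act_M _ _ _ _) _.
  by apply: rel_trans (rel_act x (IH j)) _.
rewrite lc_actM// fC ?size_map//; first by case: (Xs i).
by apply: BR => //; exact: groupX.
Qed.

Lemma op_moved_fixed n e f s : coch n C R P f -> R s -> size s = n ->
  moved_fixed s -> smith_op e f s = 0.
Proof.
move=> fc Rs sn xs; have fx := fun g => moved_fixed_act fc Rs sn xs (g := g).
case: e; rewrite /smith_op; first by rewrite fx// subrr.
rewrite (eq_bigr (fun=> f s)) => [|i _]; last by apply: fx; exact: groupX.
by rewrite sumr_const card_ord -mulr_natr Fp0 mulr0.
Qed.

Lemma op_shift n f s : coch n C R P f -> R s -> size s = n ->
  \sum_(i < p) f ((b ^+ i.+1)%g *@ s) = \sum_(i < p) f ((b ^+ i)%g *@ s).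
Proof.
move=> [fl fC _ _] Rs sn.
suff sum_shift q : (0 < q)%N -> (b ^+ q)%g \in C ->
    \sum_(i < q) f ((b ^+ i.+1)%g *@ s) = \sum_(i < q) f ((b ^+ i)%g *@ s).
  by apply: sum_shift; [exact: prime_gt0|exact: (prime_index_expP CB iCB bB)].
case: q => // q _ bC.
rewrite [LHS]big_ord_recr [RHS]big_ord_recl addrC /=; congr (_ + _).
by rewrite fC// lc_act1.
Qed.

Lemma op_op n e f s : coch n C R P f -> R s -> size s = n ->
  smith_op e (smith_op (~~ e) f) s = 0.
Proof.
move=> fc Rs sn; have [fl _ _ _] := fc.
have key : \sum_(i < p) f ((b ^+ i)%g *@ b *@ s) = \sum_(i < p) f ((b ^+ i)%g *@ s).
  rewrite -(op_shift fc Rs sn); apply: eq_bigr => i _.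
  by rewrite -lc_actM// -expgSr.
case: e; rewrite /smith_op /=; first by rewrite key subrr.
rewrite sumrB -[X in _ - X]key (eq_bigr (fun i : 'I_p => f ((b ^+ i)%g *@ b *@ s))) ?subrr//.
by move=> i _; rewrite -!lc_actM// -expgS -expgSr.
Qed.

Definition free_level j s := forall x, x \in B :\: C -> ~ rel j (x *@ s) s.

(* e is the indicator function of a fundamental domain for B modulo C on the
   part where B \ C acts without fixed points at level j. *)
Lemma fundamental_domain j : exists e : seq V -> 'F_p,
  [/\ forall s t, rel j s t -> e s = e t,
      forall c s, c \in C -> e (c *@ s) = e s &
      forall s, free_level j s -> \sum_(i < p) e ((b ^+ i)%g *@ s) = 1].
Proof.
pose orb s t := exists2 x, x \in B & rel j (x *@ s) t.
have orb_refl s : orb s s by exists 1%g; [exact: group1|exact: act_1].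
have orb_sym s t : orb s t -> orb t s.
  move=> [x xB st]; exists x^-1%g; first by rewrite groupV.
  by apply: rel_sym; apply: rel_actV.
have orb_trans s t u : orb s t -> orb t u -> orb s u.
  move=> [x xB st] [y yB tu]; exists (y * x)%g; first exact: groupM.
  apply: rel_trans (act_M _ _ _ _) _; apply: rel_trans (rel_act _ st) tu.
pose pick (S : seq V -> Prop) := if pselect (exists t, S t) is left h
  then sval (cid h) else [::].
pose rho s := pick (orb s).
have rhoP s : orb s (rho s).
  rewrite /rho /pick; case: pselect => [h|[]]; last by exists s.
  by case: cid.
have rho_eq s t : orb s t -> rho s = rho t.
  move=> st; congr pick; apply/funext => u; apply/propext; split; last exact: orb_trans.
  by apply: orb_trans; exact: orb_sym.
have rel_orb s t : rel j s t -> orb s t.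
  by move=> st; exists 1%g; [exact: group1|exact: rel_trans (act_1 _ _) st].
have free_orb s t : orb s t -> free_level j s -> free_level j t.
  move=> [x xB st] fs y yD yt; apply: (fs (y ^ x)%g).
    have [yB yC] := finset.setDP yD; apply/finset.setDP; split; first exact: groupJ.
    by rewrite memJ_norm// (fintype.subsetP (normal_norm CB)).
  rewrite conjgE; apply: rel_trans (act_M _ _ _ _) _.
  apply: rel_trans (rel_act _ (act_M _ _ _ _)) _.
  have h2 : rel j (x^-1%g *@ y *@ x *@ s) (x^-1%g *@ x *@ s).
    by apply: rel_act; apply: rel_trans (rel_act _ st) _; apply: rel_trans yt (rel_sym st).
  apply: rel_trans h2 _; apply: rel_trans (rel_sym (act_M _ _ _ _)) _.
  by rewrite mulVg; exact: act_1.
(* Inside each B-orbit the chosen representative [rho s] singles out one C-orbit; its p translates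
   by powers of [b] make up the B-orbit. *)
pose dom s := free_level j s /\ exists2 c, c \in C & rel j (c *@ rho s) s.
pose e s : 'F_p := (`[< dom s >])%:R.
have dom_rel s t : rel j s t -> dom s -> dom t.
  move=> st [fs [c cC cs]]; have os := rel_orb _ _ st.
  split; first exact: free_orb os fs.
  by exists c => //; rewrite -(rho_eq _ _ os); exact: rel_trans cs st.
have dom_C c s : c \in C -> dom s -> dom (c *@ s).
  move=> cC [fs [d dC ds]]; have os : orb s (c *@ s).
    by exists c => //; exact: (fintype.subsetP CsubB).
  split; first exact: free_orb os fs.
  exists (c * d)%g; first exact: groupM.
  rewrite -(rho_eq _ _ os).
  by apply: rel_trans (act_M _ _ _ _) _; exact: rel_act.
exists e; split.
- move=> s t st; congr ((_ : bool)%:R); apply/asboolP/asboolP; apply: dom_rel => //.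
  exact: rel_sym.
- move=> c s cC; congr ((_ : bool)%:R); apply/asboolP/asboolP; last exact: dom_C.
  move/(@dom_C c^-1%g); rewrite groupV => /(_ cC); apply: dom_rel.
  by apply: rel_trans (rel_sym (act_M _ _ _ _)) _; rewrite mulVg; exact: act_1.
move=> s fs; have [y yB ys] := orb_sym _ _ (rhoP s).
have orb_b k : orb s ((b ^+ k)%g *@ s) by exists (b ^+ k)%g; [exact: groupX|].
have [i ip iC] := prime_index_coset p_pr CB iCB bD yB.
rewrite (bigD1 (Ordinal ip))//= big1 ?addr0 => [|k].
  rewrite /e asboolT//; split; first exact: free_orb (orb_b _) fs.
  exists (b ^+ i * y)%g => //; rewrite -(rho_eq _ _ (orb_b i)).
  by apply: rel_trans (act_M _ _ _ _) _; exact: rel_act.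
move=> ki; rewrite /e asboolF// => -[_ [c cC]].
rewrite -(rho_eq _ _ (orb_b k)) => ck.
have cs : rel j ((b ^+ k)^-1%g *@ c *@ rho s) s.
  by apply: rel_sym; apply: rel_actV; exact: rel_sym.
have ds : rel j ((y^-1 * ((b ^+ k)^-1 * c))%g *@ rho s) (rho s).
  apply: rel_trans (act_M _ _ _ _) _.
  apply: rel_trans (rel_act _ (act_M _ _ _ _)) _.
  apply: rel_trans (rel_act _ cs) _; exact/rel_sym/rel_actV.
have kB : (b ^+ k)%g \in B by exact: groupX.
have [|dC] := boolP ((y^-1 * ((b ^+ k)^-1 * c))%g \in C); last first.
  have := free_orb _ _ (rhoP s) fs; apply; last exact: ds.
  by rewrite inE dC !groupM ?groupV// (fintype.subsetP CsubB).
rewrite mulgA groupMr// -invMg groupV => kC.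
have {kC iC} : (b ^+ i * y * (b ^+ k * y)^-1)%g \in C by rewrite groupM ?groupV.
rewrite invMg mulgA mulgK => bC.
(* Two exponents below p whose translates both lie in the domain would give a power of [b] in C with
   exponent strictly between 0 and p. *)
have {bC} key : (b ^+ maxn i k * (b ^+ minn i k)^-1)%g \in C.
  have [ik|ik] := leqP i k => //.
  by rewrite -[X in X \in _]invgK groupV invMg invgK.
have : (b ^+ (maxn i k - minn i k))%g \in C.
  by rewrite expgnFr// geq_min leq_maxl.
move/(prime_index_exp p_pr CB iCB bD)/dvdn_leq; rewrite [X in _ -> is_true X]leqNgt.
have -> : (maxn i k - minn i k < p)%N.
  by rewrite (leq_ltn_trans (leq_subr _ _))// gtn_max ip ltn_ord.
have ki' : (i : nat) <> k by move=> ik; case/eqP: ki; exact: val_inj.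
by rewrite subn_gt0 /minn /maxn; case: (ltngtP i k) ki' => // ik _; rewrite ik => /(_ isT).
Qed.


Lemma moved_fixed_stable : act_stable B moved_fixed.
Proof.
move=> g s gB [x xD xs]; exists (x ^ g^-1)%g.
  have [xB xC] := finset.setDP xD; apply/finset.setDP; split.
    by rewrite groupJ ?groupV.
  by rewrite memJ_norm// (fintype.subsetP (normal_norm CB)) ?groupV.
move=> i; rewrite conjgE invgK; apply: rel_trans (act_M _ _ _ _) _; apply: rel_act.
apply: rel_trans (act_M _ _ _ _) _; apply: rel_trans (rel_act _ _) (xs i).
apply: rel_trans (rel_sym (act_M _ _ _ _)) _.
by rewrite mulVg; exact: act_1.
Qed.

Lemma moved_fixed_closed : rclosed moved_fixed.
Proof.
move=> s sM; apply: contrapT => ns.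
have /choice[a aP] : forall x, exists i, x \in B :\: C -> ~ rel i (x *@ s) s.
  move=> x; apply: contrapT => h; apply: ns; exists x.
    by apply: contrapT => xD; apply: h; exists l0.
  by move=> i; apply: contrapT => xi; apply: h; exists i.
have [k kP] := rel_fin a; have [t [x xD xt] st] := sM k.
apply: (aP x xD); apply: kP; apply: rel_trans (rel_act _ st) _.
exact: rel_trans (xt k) (rel_sym st).
Qed.

Lemma moved_fixed_faced : faced moved_fixed.
Proof. by move=> s t ts [x xD xs]; exists x => // i; apply: rel_face ts _. Qed.

(** By compactness, a locally constant cochain that vanishes on the fixed simplices is supported
    where B outside C already moves every simplex at a single finite level. *)
Lemma support_free n f : lc f -> (forall s, R s -> size s = n ->
    moved_fixed s -> f s = 0) ->
  exists j, forall s, R s -> size s = n -> f s <> 0 -> free_level j s.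
Proof.
move=> [i fi] f0.
have /choice[a aP] : forall x, exists j, forall s, R s -> size s = n -> f s <> 0 ->
    x \in B :\: C -> ~ rel j (x *@ s) s.
  move=> x; apply: contrapT => H.
  have [xD|xD] := boolP (x \in B :\: C); last first.
    by apply: H; exists l0 => s _ _ _; rewrite (negPf xD).
  have [||y [yn yP]] := @rel_cluster n
      (fun j s => [/\ R s, f s <> 0 & rel j (x *@ s) s]).
  - by move=> k l s kl [Rs fs xs]; split=> //; exact: kl.
  - move=> k; apply: contrapT => h; apply: H; exists k => s Rs sn fs _ xs.
    by apply: h; exists s.
  - have Ry : R y by apply: R_closed => k; have [s [[Rs _ _] sy]] := yP k;
      exists s => //; exact: rel_sym.
    have [s [[_ fs _] /fi sy]] := yP i; apply: fs; rewrite sy; apply: f0 => //.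
    exists x => // k; have [t [[_ _ xt] ty]] := yP k.
    apply: rel_trans (rel_act _ (rel_sym ty)) _; exact: rel_trans xt ty.
have [j jP] := rel_fin a; exists j => s Rs sn fs x xD xs.
by apply: (aP x s) => //; exact: jP.
Qed.

(** Cochains supported off the fixed simplices behave like a free module over F_p[B / C], on which
    the kernel of each Smith operator is the image of the other. The indicator [u] of a fundamental
    domain makes this explicit. *)
Lemma smith_split n e f : coch n C R P f ->
  (forall s, R s -> size s = n -> moved_fixed s -> f s = 0) ->
  (forall s, R s -> size s = n -> smith_op e f s = 0) ->
  exists k, [/\ coch n C R P k,
    forall s, R s -> size s = n -> moved_fixed s -> k s = 0 &
    forall s, R s -> size s = n -> f s = smith_op (~~ e) k s].
Proof.
move=> fc fM ef; have [fl fC fd f0] := fc; have [j jP] := support_free fl fM.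
have [u [uj uC u1]] := fundamental_domain j.
have ul : lc u by exists j.
have RX i s : R s -> R ((b ^+ i)%g *@ s) by apply: BR; exact: groupX.
have uf s : R s -> size s = n -> (\sum_(i < p) u ((b ^+ i)%g *@ s)) * f s = f s.
  move=> Rs sn; have [fs|/eqP fs] := eqVneq (f s) 0; first by rewrite fs mulr0.
  by rewrite u1 ?mul1r//; exact: jP.
case: e ef => ef.
  (* If (b - 1) f = 0, the norm of u f is the norm of u times f, that is f. *)
  exists (fun s => u s * f s); split.
  - split; first exact: lcM.
    + by move=> c s cC Rs sn; rewrite uC// fC.
    + by move=> s Rs sn sd; rewrite fd// mulr0.
    + by move=> s Rs sn sd; rewrite f0// mulr0.
  - by move=> s Rs sn sM; rewrite fM// mulr0.
  - move=> s Rs sn; rewrite -[LHS]uf// mulr_suml; apply: eq_bigr => i _.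
    congr (_ * _); elim: (val i) => [|k ->]; first by rewrite lc_act1.
    rewrite expgS lc_actM//; apply/eqP; rewrite eq_sym -subr_eq0.
    by apply/eqP; apply: (ef _ (RX k s Rs)); rewrite size_map.
(* The preimage under b - 1 is the sum over i of (1 + b + ... + b^(i-1)) h_i. Applying b - 1
   telescopes to the sum of b^i h_i, which is the norm of u times f, minus the sum of the h_i, which
   is u times the norm of f, hence 0. *)
pose h (i : nat) s := u s * f ((b ^+ (p - i))%g *@ s).
have hc i : coch n C R P (h i).
  have [gl gC gd g0] := coch_shift (groupX (p - i) bB) fc.
  split; first exact: lcM.
  - by move=> c s cC Rs sn; rewrite /h uC// gC.
  - by move=> s Rs sn sd; rewrite /h gd// mulr0.
  - by move=> s Rs sn sd; rewrite /h g0// mulr0.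
exists (fun s => \sum_(i < p) \sum_(k < i) h i ((b ^+ k)%g *@ s)); split.
- apply: coch_sum => i; apply: coch_sum => k; apply: coch_shift => //; exact: groupX.
- move=> s Rs sn sM; rewrite big1// => i _; rewrite big1// => k _.
  rewrite /h fM ?mulr0 ?size_map//; first by apply: BR; [exact: groupX|exact: RX].
  by apply: moved_fixed_stable; [exact: groupX|apply: moved_fixed_stable => //; exact: groupX].
- move=> s Rs sn; rewrite /smith_op /= -sumrB.
  have tel (g : seq V -> 'F_p) m : lc g ->
      \sum_(k < m) g ((b ^+ k)%g *@ b *@ s) - \sum_(k < m) g ((b ^+ k)%g *@ s) =
      g ((b ^+ m)%g *@ s) - g s.
    move=> gl; elim: m => [|k IH]; first by rewrite !big_ord0 lc_act1// !subrr.
    rewrite !big_ord_recr /= opprD addrACA IH -lc_actM// -expgSr.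
    by rewrite addrC addrA subrK.
  rewrite (eq_bigr (fun i : 'I_p => h i ((b ^+ i)%g *@ s) - h i s)); last first.
    by move=> i _; apply: tel; case: (hc i).
  rewrite sumrB.
  have -> : \sum_(i < p) h i s = 0.
    rewrite -mulr_sumr [X in _ * X](_ : _ = 0) ?mulr0// -[RHS](ef s Rs sn).
    rewrite /smith_op -(op_shift fc Rs sn) (reindex_inj rev_ord_inj) /=.
    by apply: eq_bigr => i _; rewrite subKn// -subSn// subSS subKn// ltnW.
  rewrite subr0 -[LHS]uf// mulr_suml; apply: eq_bigr => i _; rewrite /h; congr (_ * _).
  rewrite -lc_actM// -expgnDr subnK ?(ltnW (ltn_ord i))// fC ?lc_act1//.
  exact: (prime_index_expP CB iCB bB).
Qed.

Hypothesis exC : exact_on C R P.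

(** The Smith staircase. The coboundary of [f] is killed by one operator, hence is the other
    operator applied to some [k] one degree higher, where the same problem arises with the operators
    exchanged. The staircase stops because all simplices above the dimension are degenerate, whence
    the induction on [D - n]. *)
Lemma smith_correct n e f : coch n.+2 C R P f ->
  cocycle n.+2 R (smith_op e f) ->
  (forall s, R s -> size s = n.+3 -> moved_fixed s -> cobd f s = 0) ->
  exists f', [/\ coch n.+2 C R P f', cocycle n.+2 R f',
    forall s, R s -> size s = n.+2 -> smith_op e f' s = smith_op e f s &
    forall s, R s -> size s = n.+2 -> moved_fixed s -> f' s = f s].
Proof.
have [D DP] := ok_dim; have [m] := ubnP (D - n); elim: m n e f => // m IH n e f.
rewrite ltnS => nm fc efZ dfM.
have CR : act_stable C R by move=> c s /(fintype.subsetP CsubB); exact: BR.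
have [Dn|nD] := leqP D n.
  exists f; split=> // s Rs sn; rewrite -[RHS](cobd0 _ s); apply: cobd_local => t ts.
  have tn : size t = n.+2 by have := face_size ts; rewrite sn => -[].
  have Rt := R_faced ts Rs; case: fc => _ _ fd _; apply: fd => //.
  by apply: DP; [exact: R_ok|rewrite tn ltnS (leq_trans Dn)].
have dfc := coch_cobd CR R_faced P_faced fc.
have [|k [kc kM dfk]] := smith_split (e := e) dfc dfM.
  by move=> s Rs sn; rewrite -cobd_op; exact: efZ.
have [|||k' [k'c k'Z ekk k'M]] := IH n.+1 (~~ e) k _ kc.
- by apply: leq_trans nm; rewrite subnS prednK ?subn_gt0.
- move=> s Rs sn; rewrite -[RHS](cobdK f s); apply: cobd_local => t ts.
  rewrite dfk//; first exact: R_faced ts Rs.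
  by have := face_size ts; rewrite sn => -[].
- move=> s Rs sn sM; rewrite -[RHS](cobd0 _ s); apply: cobd_local => t ts.
  apply: kM; [exact: R_faced ts Rs| |exact: moved_fixed_faced ts sM].
  by have := face_size ts; rewrite sn => -[].
have [h [hc k'h]] := exC k'c k'Z.
(* The corrected [k'] is the coboundary of [h], so the operator applied to [h] has the same
   coboundary as [f]. It is killed by [smith_op e] and vanishes on fixed simplices, so nothing else
   changes. *)
exists (fun s => f s - smith_op (~~ e) h s); split.
- by apply: cochD fc _; apply: cochN; exact: coch_op.
- move=> s Rs sn; rewrite cobdB cobd_op dfk// -ekk//.
  apply/eqP; rewrite subr_eq0; apply/eqP.
  by apply: (@op_local n.+3) => // t Rt tn; exact: k'h.
- move=> s Rs sn; rewrite opD opN (op_op _ hc)//; first by rewrite oppr0 addr0.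
- by move=> s Rs sn sM; rewrite (op_moved_fixed _ hc)// subr0.
Qed.

Let CR : act_stable C R. Proof. by move=> c s /(fintype.subsetP CsubB); exact: BR. Qed.

Lemma coch_tau n f : coch n B R P f -> forall s, R s -> size s = n ->
  smith_op true f s = 0.
Proof. by move=> [_ fB _ _] s Rs sn; rewrite /smith_op fB// subrr. Qed.

Lemma tau_coch n f : coch n C R P f ->
  (forall s, R s -> size s = n -> smith_op true f s = 0) -> coch n B R P f.
Proof.
move=> [fl fC fd f0] ft; split=> // g s gB Rs sn.
have [i [c cC ->]] := prime_index_mem p_pr CB iCB bD gB.
have RX k : R ((b ^+ k)%g *@ s) by apply: BR => //; exact: groupX.
rewrite lc_actM// fC ?size_map//; elim: i => [|i IH]; first by rewrite lc_act1.
rewrite expgS lc_actM// -IH; apply/eqP; rewrite -subr_eq0; apply/eqP.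
by apply: ft; rewrite ?size_map.
Qed.

Lemma coch_fixed_extend n f : lc f ->
  (forall c s, c \in C -> R s -> moved_fixed s -> size s = n -> f (c *@ s) = f s) ->
  (forall s, R s -> moved_fixed s -> size s = n -> degenerate s \/ P s -> f s = 0) ->
  exists h, coch n B R P h /\
    forall s, R s -> moved_fixed s -> size s = n -> h s = f s.
Proof.
move=> fl fC f0.
pose T s := R s /\ moved_fixed s.
have BT : act_stable B T.
  by move=> g s gB [Rs sM]; split; [exact: BR|exact: moved_fixed_stable].
have fB g s : g \in B -> T s -> size s = n -> f (g *@ s) = f s.
  move=> gB [Rs [x xD xs]] sn; have [xB _] := finset.setDP xD.
  have [i [c cC ->]] := prime_index_mem p_pr CB iCB xD gB.
  have Xs k j : rel j ((x ^+ k)%g *@ s) s.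
    elim: k => [|k IH]; first exact: act_1.
    rewrite expgS; apply: rel_trans (act_M _ _ _ _) _.
    by apply: rel_trans (rel_act x IH) _.
  rewrite lc_actM// fC ?size_map//; first by case: fl => j fj; apply: fj.
    by apply: BR => //; exact: groupX.
  apply: moved_fixed_stable; first exact: groupX.
  by exists x.
have [||||||h [hl hB hf h0]] := @coch_extend n B T (fun s => degenerate s \/ P s) f fl.
- move=> s sT; split; first by apply: R_closed => i; have [t [Rt _] st] := sT i; exists t.
  by apply: moved_fixed_closed => i; have [t [_ tM] st] := sT i; exists t.
- exact: rclosedU.
- exact: BT.
- by move=> g s gB [sd|Ps]; [left; exact: degenerate_map|right; exact: BP].
- exact: fB.
- by move=> s [Rs sM] q sn; exact: f0.
have hc : coch n B R P h.
  split=> //; first by move=> g s gB _ _; exact: hB.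
    by move=> s Rs sn sd; apply: h0 => //; left.
  by move=> s Rs sn sd; apply: h0 => //; right.
exists h; split=> // s Rs sM sn.
exact: hf.
Qed.

(** Restriction to the fixed simplices is onto at the level of cocycles: any invariant extension has
    a coboundary vanishing there and is killed by b - 1, so the staircase turns it into a cocycle
    without changing it on the fixed part. *)
Lemma smith_extend n f : lc f ->
  (forall c s, c \in C -> R s -> moved_fixed s -> size s = n.+2 -> f (c *@ s) = f s) ->
  (forall s, R s -> moved_fixed s -> size s = n.+2 -> degenerate s \/ P s -> f s = 0) ->
  (forall s, R s -> moved_fixed s -> size s = n.+3 -> cobd f s = 0) ->
  exists f', [/\ coch n.+2 B R P f', cocycle n.+2 R f' &
    forall s, R s -> moved_fixed s -> size s = n.+2 -> f' s = f s].
Proof.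
move=> fl fC f0 fZ.
have [h [hc hf]] := coch_fixed_extend fl fC f0.
have [||f' [f'c f'Z f't f'M]] := smith_correct (e := true) (coch_sub CsubB hc).
- move=> s Rs sn; rewrite -[RHS](cobd0 _ s); apply: cobd_local => t ts.
  rewrite (coch_tau hc)//; first exact: R_faced ts Rs.
  by have := face_size ts; rewrite sn => -[].
- move=> s Rs sn sM; rewrite -[RHS](fZ s Rs sM sn); apply: cobd_local => t ts.
  apply: hf; [exact: R_faced ts Rs|exact: moved_fixed_faced ts sM|].
  by have := face_size ts; rewrite sn => -[].
exists f'; split=> //.
  by apply: tau_coch f'c _ => s Rs sn; rewrite f't// (coch_tau hc).
by move=> s Rs sM sn; rewrite f'M// hf.
Qed.

(** A B-invariant cocycle vanishing on the fixed simplices is the norm of a C-invariant cochain by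
    [smith_split]; the staircase makes that cochain a cocycle with the same norm. *)
Lemma smith_transfer n f : coch n.+2 B R (fun s => P s \/ moved_fixed s) f ->
  cocycle n.+2 R f ->
  exists y, [/\ coch n.+2 C R P y, cocycle n.+2 R y &
    forall s, R s -> size s = n.+2 -> f s = smith_op false y s].
Proof.
move=> [fl fB fd f0] fZ.
have fc : coch n.+2 B R P f by split=> // s Rs sn Ps; apply: f0 => //; left.
have [||k [kc kM fk]] := smith_split (e := true) (coch_sub CsubB fc).
- by move=> s Rs sn sM; apply: f0 => //; right.
- exact: coch_tau.
have [||y [yc yZ yk _]] := smith_correct (e := false) kc.
- move=> s Rs sn; rewrite -[RHS](fZ s Rs sn); apply: cobd_local => t ts.
  rewrite -fk//; first exact: R_faced ts Rs.
  by have := face_size ts; rewrite sn => -[].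
- move=> s Rs sn sM; rewrite -[RHS](cobd0 _ s); apply: cobd_local => t ts.
  apply: kM; [exact: R_faced ts Rs| |exact: moved_fixed_faced ts sM].
  by have := face_size ts; rewrite sn => -[].
by exists y; split=> // s Rs sn; rewrite yk// fk.
Qed.

Lemma op_coch n e f : coch n C R P f -> coch n B R P (smith_op e f) \/ e = true.
Proof.
case: e => fc; [by right|left]; apply: tau_coch (coch_op _ fc) _ => s Rs sn.
exact: (@op_op n true).
Qed.

(** Write the cocycle as the norm of a C-invariant cocycle, integrate the latter by exactness for C,
    and take norms; norms vanish automatically on fixed simplices. *)
Lemma exact_on_relative : exact_on B R (fun s => P s \/ moved_fixed s).
Proof.
move=> n f fc fZ; have [y [yc yZ fy]] := smith_transfer fc fZ.
have [h [hc yh]] := exC yc yZ; exists (smith_op false h); split.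
  have [[hl hB hd h0]|//] := op_coch false hc; split=> // s Rs sn [Ps|sM].
    exact: h0.
  exact: (op_moved_fixed _ hc).
move=> s Rs sn; rewrite fy// cobd_op; apply: (op_local (n := n.+3)) => //.
Qed.

(** Extend the cocycle to all of [R] by [smith_extend], integrate it there by exactness for C, and
    restrict. *)
Lemma exact_on_fixed : exact_on C (fun s => R s /\ moved_fixed s) P.
Proof.
move=> n f [fl fC fd f0] fZ.
have [|||f' [f'c f'Z ff']] := @smith_extend n.+1 f fl.
- by move=> c s cC Rs sM sn; exact: fC.
- by move=> s Rs sM sn [sd|Ps]; [exact: fd|exact: f0].
- by move=> s Rs sM sn; exact: fZ.
have [h [[hl hC hd h0] f'h]] := exC (coch_sub CsubB f'c) f'Z.
exists h; split; last by move=> s [Rs sM] sn; rewrite -ff'// f'h.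
split=> //; first by move=> c s cC [Rs _]; exact: hC.
- by move=> s [Rs _]; exact: hd.
- by move=> s [Rs _]; exact: h0.
Qed.

(** The long exact sequence of the pair formed by [R] and its fixed simplices: integrate on the
    fixed part, extend the primitive invariantly, and integrate the difference as a relative
    cocycle. *)
Lemma exact_on_up : exact_on B R P.
Proof.
move=> n f fc fZ; have [fl fB fd f0] := fc.
have fcF : coch n.+3 C (fun s => R s /\ moved_fixed s) P f.
  split=> //; first by move=> c s cC [Rs _]; apply: fB => //; exact: (fintype.subsetP CsubB).
  - by move=> s [Rs _]; exact: fd.
  - by move=> s [Rs _]; exact: f0.
have [|h [[hl hC hd h0] fh]] := exact_on_fixed fcF; first by move=> s [Rs _]; exact: fZ.
have [||h' [h'c hh']] := @coch_fixed_extend n.+2 h hl.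
- by move=> c s cC Rs sM; exact: hC.
- by move=> s Rs sM sn [sd|Ps]; [exact: hd|exact: h0].
have dh'c := coch_cobd BR R_faced P_faced h'c.
have [||m [[ml mB md m0] fm]] := @exact_on_relative n (fun s => f s - cobd h' s).
- have [gl gB gd g0] := cochD fc (cochN dh'c).
  split=> // s Rs sn [Ps|sM]; first exact: g0.
  rewrite fh//; apply/eqP; rewrite subr_eq0; apply/eqP; apply: cobd_local => t ts.
  rewrite hh'//; [exact: R_faced ts Rs|exact: moved_fixed_faced ts sM|].
  by have := face_size ts; rewrite sn => -[].
- by move=> s Rs sn; rewrite cobdB cobdK subr0 fZ.
exists (fun s => m s + h' s); split.
  by apply: cochD h'c; split=> // s Rs sn Ps; apply: m0 => //; left.
by move=> s Rs sn; rewrite cobdD -fm// subrK.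
Qed.


End IndexP.

Hypothesis gTp : (p.-group [set: gT])%g.
Hypothesis ok_closed : rclosed ok.
Hypothesis ok_faced : faced ok.
Hypothesis ok_act : forall g s, ok s -> ok (g *@ s).

Definition stab s : {set gT} := [set x | `[< forall i, rel i (x *@ s) s >]].

Lemma stabP x s : reflect (forall i, rel i (x *@ s) s) (x \in stab s).
Proof. by rewrite /stab finset.inE; apply: asboolP. Qed.

Fact stab_group_set s : group_set (stab s).
Proof.
apply/group_setP; split; first by apply/stabP => i; exact: act_1.
move=> x y /stabP xs /stabP ys; apply/stabP => i.
by apply: rel_trans (act_M _ _ _ _) _; apply: rel_trans (rel_act _ (ys i)) _.
Qed.
Canonical stab_group s := Group (stab_group_set s).

Lemma stab_act g s x : x \in stab s -> (x ^ g^-1)%g \in stab (g *@ s).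
Proof.
move/stabP=> xs; apply/stabP => i; rewrite conjgE invgK.
apply: rel_trans (act_M _ _ _ _) _; apply: rel_act.
apply: rel_trans (act_M _ _ _ _) _; apply: rel_trans (rel_act _ _) (xs i).
apply: rel_trans (rel_sym (act_M _ _ _ _)) _.
by rewrite mulVg; exact: act_1.
Qed.

Definition fixed (A : {set gT}) s := ok s /\ A \subset stab s.

Lemma fixed_closed (A : {set gT}) : rclosed (fixed A).
Proof.
move=> s sA; split; first by apply: ok_closed => i; have [t [ot _] st] := sA i; exists t.
apply/fintype.subsetP => x xA; apply/stabP => i.
have [t [_ /fintype.subsetP/(_ x xA)/stabP xt] st] := sA i.
apply: rel_trans (rel_act _ st) _; exact: rel_trans (xt i) (rel_sym st).
Qed.

Lemma stab_face s t : face t s -> stab s \subset stab t.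
Proof.
move=> ts; apply/fintype.subsetP => x /stabP xs; apply/stabP => i.
exact: rel_face ts (xs i).
Qed.

Lemma fixed_faced (A : {set gT}) : faced (fixed A).
Proof.
move=> s t ts [os As]; split; first exact: ok_faced ts os.
exact: fintype.subset_trans As (stab_face ts).
Qed.

Lemma fixed_act (A : {set gT}) g s : fixed A s -> fixed (A :^ g^-1)%g (g *@ s).
Proof.
move=> [os /fintype.subsetP As]; split; first exact: ok_act.
by apply/fintype.subsetP => y /imsetP[x /As xs ->]; exact: stab_act.
Qed.

Lemma fixed_stable B (A : {set gT}) : (B \subset 'N(A))%g -> act_stable B (fixed A).
Proof.
move=> /fintype.subsetP BN b s bB /(@fixed_act _ b).
by have /normP -> : (b^-1 \in 'N(A))%g by rewrite groupV BN.
Qed.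

Lemma fixed_sub (A A' : {set gT}) s : A' \subset A -> fixed A s -> fixed A' s.
Proof. by move=> AA [os As]; split=> //; exact: fintype.subset_trans As. Qed.

Lemma coch_fixed n (A : {set gT}) B C R P f : (forall s, R s -> fixed A s) -> C \subset A ->
  coch n B R P f -> coch n C R P f.
Proof.
move=> RA /fintype.subsetP CA [fl _ fd f0]; split=> // c s /CA cA Rs _.
have [_ /fintype.subsetP/(_ c cA)/stabP cs] := RA s Rs.
by case: fl => i fi; apply: fi; exact: cs.
Qed.

Lemma exact_on_trivial (A : {set gT}) B C R P : (forall s, R s -> fixed A s) ->
  B \subset A -> C \subset A -> exact_on B R P -> exact_on C R P.
Proof.
move=> RA BA CA ex n f fc fZ; have [h [hc fh]] := ex n f (coch_fixed RA BA fc) fZ.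
by exists h; split=> //; exact: coch_fixed RA CA hc.
Qed.

Lemma exact_on_ext B R R' P P' : (forall s, R s <-> R' s) ->
  (forall s, R s -> (P s <-> P' s)) -> exact_on B R P -> exact_on B R' P'.
Proof.
move=> RR PP; have -> : R' = R by apply/funext => s; apply/propext; split=> /RR.
move=> ex n f [fl fB fd f0] fZ.
have [|h [[hl hB hd h0] fh]] := ex n f _ fZ.
  by split=> // s Rs sn /(PP s Rs); exact: f0.
by exists h; split=> //; split=> // s Rs sn /(PP s Rs); exact: h0.
Qed.

(** The source of all inductions on group order below: in a p-group every proper subgroup lies in a
    normal subgroup of index p. *)
Lemma pgroup_max (A B : {group gT}) : A \proper B ->
  exists M : {group gT}, [/\ A \subset M, (M <| B)%g & #|B : M|%g = p].
Proof.
move=> /andP[AB nBA]; have Bp : (p.-group B)%g by exact: pgroupS (finset.subsetT _) gTp.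
have [AB'|[M mM AM]] := maximal_exists AB; first by rewrite AB' subxx in nBA.
by exists M; split=> //; [exact: p_maximal_normal Bp mM|exact: p_maximal_index Bp mM].
Qed.

Lemma pgroup_min (A B : {group gT}) : (A <| B)%g -> A \proper B ->
  exists M : {group gT}, [/\ (A <| M)%g, (M <| B)%g & #|M : A|%g = p].
Proof.
move=> nAB /andP[AB nBA]; have Bp : (p.-group B)%g by exact: pgroupS (finset.subsetT _) gTp.
have [|Q [_ nQ Qp]] := normal_pgroup (quotient_pgroup A Bp) (normal_refl (B / A)%G) (r := 1).
  rewrite lognE p_pr cardG_gt0 /= card_quotient ?normal_norm//.
  have : (p.-nat #|B : A|)%g by exact: pnat_dvd (dvdn_indexg _ _) Bp.
  case/p_natP=> // -[|k] e; last by rewrite e expnS dvdn_mulr.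
  by move/eqP: e; rewrite expn0 indexg_eq1 (negPf nBA).
have [M QM AM nM] := inv_quotientN nAB nQ.
have nAM : (A <| M)%g by apply: normalS nAB => //; exact: normal_sub.
exists M; split=> //; rewrite -card_quotient ?normal_norm//.
by rewrite -QM Qp expn1.
Qed.

Lemma ex_moved (B C : {group gT}) : (C <| B)%g -> #|B : C|%g = p ->
  exists b, b \in B :\: C.
Proof.
move=> CB iCB; apply/finset.set0Pn; rewrite finset.setD_eq0; apply/negP => BC.
by move: iCB; rewrite (eqP (_ : #|B : C|%g == 1%N)) ?indexg_eq1// => p1;
  have := prime_gt1 p_pr; rewrite -p1.
Qed.

Lemma moved_fixedE (A B C : {group gT}) s : A \subset C -> (C <| B)%g -> fixed A s ->
  moved_fixed B C s <-> exists2 x, x \in B :\: C & fixed (A <*> <[x]>)%g s.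
Proof.
move=> AC CB [os As]; split=> -[x xD].
  move=> xs; exists x => //; split=> //.
  by rewrite join_subG As cycle_subG; apply/stabP.
move=> [_ xs]; exists x => //; apply/stabP.
by apply: (fintype.subsetP xs); rewrite mem_gen// inE cycle_id orbT.
Qed.

Lemma moved_fixed_prime (A B : {group gT}) s : (A <| B)%g -> #|B : A|%g = p ->
  fixed A s -> (moved_fixed B A s <-> fixed B s).
Proof.
move=> AB iAB fA; split=> [[x xD xs]|[_ /fintype.subsetP fB]]; last first.
  have [b bD] := ex_moved AB iAB; exists b => //; apply/stabP/fB.
  by case/finset.setDP: bD.
have [os As] := fA; split=> //; apply/fintype.subsetP => y yB.
have [i [c cA ->]] := prime_index_mem p_pr AB iAB xD yB.
rewrite groupM ?groupX//; first exact: (fintype.subsetP As).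
exact/stabP.
Qed.

Local Notation none := (fun _ : seq V => False).
Hypothesis ok_exact : exact_on 1%G ok none.

Let none_faced : faced none. Proof. by []. Qed.
Let none_closed : rclosed none. Proof. by move=> s /(_ l0)[]. Qed.

Lemma fixed_ok (A : {set gT}) s : fixed A s -> ok s. Proof. by case. Qed.

(** Smith's theorem for p-groups, by induction on the order: for C normal of index p in A, the group
    A / C acts on the C-fixed simplices, and its fixed simplices there are the A-fixed ones. *)
Lemma fixed_exact (A : {group gT}) : exact_on 1%G (fixed A) none.
Proof.
have [m] := ubnP #|A|; elim: m A => // m IH A Am.
have [A1|A1] := eqVneq A 1%G.
  apply: exact_on_ext ok_exact => // s; rewrite A1; split=> [os|[]//].
  by split=> //; exact: sub1G.
have [|C [_ CA iC]] := @pgroup_max 1%G A.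
  by rewrite proper1G; apply: contra A1 => /eqP A1; apply/eqP/val_inj.
have [b bD] := ex_moved CA iC.
have Cm : (#|C| < m)%N.
  rewrite -ltnS (leq_trans _ Am)// ltnS -(Lagrange (normal_sub CA)) iC.
  by rewrite ltn_Pmulr ?prime_gt1.
have exC : exact_on C (fixed C) none.
  exact: (exact_on_trivial (fun s (h : fixed C s) => h) (sub1G C) (fintype.subxx C) (IH C Cm)).
have := @exact_on_fixed A C b CA iC bD (fixed C) none (@fixed_closed C)
  (@fixed_faced C) (fixed_stable (normal_norm CA)) (@fixed_ok C) none_closed.
move=> /(_ (fun _ _ _ => id) (fun _ _ _ => id) exC) ex.
have {}ex : exact_on C (fixed A) none.
  apply: exact_on_ext ex => // s; split=> [[fC mC]|fA].
    exact/(moved_fixed_prime CA iC fC).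
  have fC : fixed C s by apply: fixed_sub fA; exact: normal_sub.
  by split=> //; apply/(moved_fixed_prime CA iC fC).
exact: (exact_on_trivial (fun s (h : fixed A s) => h) (normal_sub CA) (sub1G A) ex).
Qed.

Lemma fixed_exact_rel (A A1 D : {group gT}) : (A <| A1)%g -> #|A1 : A|%g = p ->
  A1 \subset D -> (D \subset 'N(A))%g -> (D \subset 'N(A1))%g ->
  exact_on D (fixed A) (fixed A1).
Proof.
move=> AA1 iA; have [m] := ubnP #|D|; elim: m D => // m IH D Dm A1D DA DA1.
have [DE|nD] := eqVneq D A1.
  rewrite {D Dm A1D DA DA1}DE; have [b bD] := ex_moved AA1 iA.
  have := @exact_on_relative A1 A b AA1 iA bD (fixed A) none (@fixed_closed A)
    (@fixed_faced A) (fixed_stable (normal_norm AA1)) (@fixed_ok A).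
  move=> /(_ (fun _ _ _ => id) (fun _ _ _ => id)) ex.
  have exA := exact_on_trivial (fun s (h : fixed A s) => h) (sub1G A)
    (fintype.subxx A) (@fixed_exact A).
  apply: exact_on_ext (ex exA) => // s fA; have mE := moved_fixed_prime AA1 iA fA.
  by split=> [[//|/mE]|/mE]; [|right].
have [|C [A1C CD iC]] := @pgroup_max A1 D.
  by rewrite finset.properEneq A1D andbT eq_sym.
have [b bD] := ex_moved CD iC.
have Cm : (#|C| < m)%N.
  rewrite -ltnS (leq_trans _ Dm)// ltnS -(Lagrange (normal_sub CD)) iC.
  by rewrite ltn_Pmulr ?prime_gt1.
have CsD := normal_sub CD.
have := @exact_on_up D C b CD iC bD (fixed A) (fixed A1) (@fixed_closed A)
  (@fixed_faced A) (fixed_stable DA) (@fixed_ok A) (@fixed_closed A1) (@fixed_faced A1)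
  (fixed_stable DA1).
by apply; apply: IH => //; exact: fintype.subset_trans CsD _.
Qed.

(** Any D-invariant extension has a coboundary that is a relative cocycle for the pair of fixed
    subcomplexes of A and A1; it is integrated by a relative cochain, and subtracting this leaves
    the values on the A1-fixed simplices unchanged. *)
Lemma fixed_extend1 n (A A1 D : {group gT}) f : (A <| A1)%g -> #|A1 : A|%g = p ->
  A1 \subset D -> (D \subset 'N(A))%g -> (D \subset 'N(A1))%g ->
  coch n.+2 D (fixed A1) none f -> cocycle n.+2 (fixed A1) f ->
  exists h, [/\ coch n.+2 D (fixed A) none h, cocycle n.+2 (fixed A) h &
    forall s, fixed A1 s -> size s = n.+2 -> h s = f s].
Proof.
move=> AA1 iA A1D DA DA1 [fl fD fd _] fZ.
have [||h [hl hD hf h0]] := @coch_extend n.+2 D (fixed A1) (@degenerate V) f fl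
    (@fixed_closed A1) degenerate_closed (fixed_stable DA1) _ fD.
- by move=> g s gD; exact: degenerate_map.
- by move=> s sA1 sd sn; exact: fd.
have hc : coch n.+2 D (fixed A) none h.
  by split=> // [g s gD _ _|s _ sn sd]; [exact: hD|exact: h0].
have [yl yD yd _] := coch_cobd (fixed_stable DA) (@fixed_faced A) none_faced hc.
have [||m [[ml mD md m0] ym]] := fixed_exact_rel AA1 iA A1D DA DA1 (n := n) (f := cobd h).
- split=> // s _ sn sA1; rewrite -[RHS](fZ s sA1 sn); apply: cobd_local => t ts.
  rewrite hf//; first exact: fixed_faced ts sA1.
  by have := face_size ts; rewrite sn => -[].
- by move=> s _ _; rewrite cobdK.
exists (fun s => h s - m s); split.
- by apply: cochD hc _; apply: cochN; split.
- by move=> s sA sn; rewrite cobdB ym// subrr.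
- move=> s sA1 sn; rewrite hf// m0 ?subr0//.
  by apply: fixed_sub sA1; exact: normal_sub.
Qed.

Lemma fixed_extend n (A B : {group gT}) f : (A <| B)%g ->
  coch n.+2 1%G (fixed B) none f -> cocycle n.+2 (fixed B) f ->
  exists h, [/\ coch n.+2 B (fixed A) none h, cocycle n.+2 (fixed A) h &
    forall s, fixed B s -> size s = n.+2 -> h s = f s].
Proof.
move=> AB fc fZ; have [m] := ubnP #|B : A|%g; elim: m A AB => // m IH A AB Bm.
have [AE|nA] := eqVneq A B.
  by exists f; split=> //; rewrite AE//; exact: (coch_fixed (fun s (h : fixed B s) => h) (fintype.subxx B) fc).
have [|A1 [AA1 A1B iA]] := @pgroup_min A B AB.
  by rewrite finset.properEneq nA normal_sub.
have [|h [hc hZ hf]] := IH A1 A1B.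
  rewrite -ltnS (leq_trans _ Bm)// ltnS.
  rewrite -(Lagrange_index (normal_sub A1B) (normal_sub AA1)) iA.
  by rewrite ltn_Pmulr ?prime_gt1 ?indexg_gt0.
have [h' [h'c h'Z h'h]] := fixed_extend1 AA1 iA (normal_sub A1B) (normal_norm AB)
  (normal_norm A1B) hc hZ.
exists h'; split=> // s sB sn; rewrite h'h ?hf//.
by apply: fixed_sub sB; exact: normal_sub.
Qed.

Lemma cocycle_extend_ok n (A : {group gT}) f : coch n.+2 1%G (fixed A) none f ->
  cocycle n.+2 (fixed A) f ->
  exists h, [/\ coch n.+2 1%G ok none h, cocycle n.+2 ok h &
    forall s, fixed A s -> size s = n.+2 -> h s = f s].
Proof.
move=> fc fZ; have [h [hc hZ hf]] := fixed_extend (normal1 A) fc fZ.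
have ok1 : fixed 1%G = ok.
  apply/funext => s; apply/propext; split=> [[]//|os].
  by split=> //; exact: sub1G.
rewrite ok1 in hc hZ; exists h; split=> //.
by apply: coch_sub hc; exact: sub1G.
Qed.

(** First extend B-invariantly from the B-fixed to the A-fixed simplices along a chain of steps of
    index p, then to everything. The second extension keeps only the values, so invariance is
    claimed on A-fixed simplices alone. Size 2 gives the hypothesis [extend] of the basis
    construction. *)
Theorem cocycle_extend n (A B : {group gT}) f : (A <| B)%g ->
  coch n.+2 1%G (fixed B) none f -> cocycle n.+2 (fixed B) f ->
  exists h, [/\ coch n.+2 1%G ok none h, cocycle n.+2 ok h,
    forall b s, b \in B -> fixed A s -> size s = n.+2 -> h (b *@ s) = h s &
    forall s, fixed B s -> size s = n.+2 -> h s = f s].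
Proof.
move=> AB fc fZ; have [h [hc hZ hf]] := fixed_extend AB fc fZ.
have [h' [h'c h'Z h'h]] := cocycle_extend_ok (coch_sub (sub1G _) hc) hZ.
exists h'; split=> // [b s bB sA sn|s sB sn].
  rewrite !h'h ?size_map//; first by case: hc => _ + _ _; apply.
  exact: (fixed_stable (normal_norm AB) bB sA).
rewrite h'h ?hf//; apply: fixed_sub sB; exact: normal_sub.
Qed.

(** The singular part for the action of C / A on the A-fixed simplices: those with a stabilizer in C
    larger than A. *)
Definition fixed_more (A C : {set gT}) s := exists B' : {group gT},
  [/\ A \proper B', B' \subset C & fixed B' s].

Lemma fixed_more_faced (A C : {set gT}) : faced (fixed_more A C).
Proof. by move=> s t ts [D [AD DC sD]]; exists D; split=> //; exact: fixed_faced sD. Qed.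

Lemma fixed_more_stable (A : {set gT}) B C : (B \subset 'N(A))%g -> (B \subset 'N(C))%g ->
  act_stable B (fixed_more A C).
Proof.
move=> /fintype.subsetP BA /fintype.subsetP BC b s bB [D [AD DC sD]].
exists (D :^ b^-1)%G; split; last exact: fixed_act.
- have /normP <- : (b^-1 \in 'N(A))%g by rewrite groupV BA.
  by rewrite finset.properEcard !cardJg conjSg; case/fintype.properP: AD => AD [x xD xA];
   rewrite AD proper_card//; apply/fintype.properP; split=> //; exists x.
- have /normP <- : (b^-1 \in 'N(C))%g by rewrite groupV BC.
  by rewrite conjSg.
Qed.

(** Induction on C: passing from D to C, of index p over it, enlarges the singular part exactly by
    the simplices fixed by an element of C outside D, so [exact_on_relative] applies. *)
Lemma fixed_exact_more (A C : {group gT}) : A \subset C -> (C \subset 'N(A))%g ->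
  exact_on C (fixed A) (fixed_more A C).
Proof.
have [m] := ubnP #|C|; elim: m C => // m IH C Cm AC CA.
have [CE|nC] := eqVneq C A.
  have := exact_on_trivial (fun s (h : fixed A s) => h) (sub1G A) (fintype.subxx A) (@fixed_exact A).
  rewrite CE; apply: exact_on_ext => // s sA; split=> // -[D [AD DA _]].
  by move: AD; rewrite fintype.properE DA andbF.
have [|D [AD DC iD]] := @pgroup_max A C.
  by rewrite finset.properEneq AC andbT eq_sym.
have [b bD] := ex_moved DC iD.
have Dm : (#|D| < m)%N.
  rewrite -ltnS (leq_trans _ Cm)// ltnS -(Lagrange (normal_sub DC)) iD.
  by rewrite ltn_Pmulr ?prime_gt1.
have DsC := normal_sub DC.
have DA : (D \subset 'N(A))%g by exact: fintype.subset_trans DsC CA.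
have := @exact_on_relative C D b DC iD bD (fixed A) (fixed_more A D) (@fixed_closed A)
  (@fixed_faced A) (fixed_stable CA) (@fixed_ok A)
  (@fixed_more_faced A D) (fixed_more_stable CA (normal_norm DC)) (IH D Dm AD DA).
apply: exact_on_ext => // s sA; split.
  move=> [[D' [AD' D'D sD']]|]; first by exists D'; split=> //; exact: fintype.subset_trans DsC.
  move/(moved_fixedE AD DC sA) => [x xD xs]; exists (A <*> <[x]>)%G; split=> //.
    rewrite fintype.properE joing_subl /=; apply: contra (proj2 (finset.setDP xD)) => xA.
    apply: (fintype.subsetP AD); apply: (fintype.subsetP xA).
    by rewrite mem_gen// inE cycle_id orbT.
  by rewrite join_subG AC cycle_subG; case/finset.setDP: xD.
move=> [D' [AD' D'C sD']].
have [D'D|nD'D] := boolP (D' \subset D); first by left; exists D'.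
right; apply/(moved_fixedE AD DC sA).
have [x xD' xD] := fintype.subsetPn nD'D; exists x.
  by apply/finset.setDP; split=> //; exact: (fintype.subsetP D'C).
by apply: fixed_sub sD'; rewrite join_subG cycle_subG xD' proper_sub.
Qed.

(** A cocycle that vanishes on the singular part for B vanishes on the simplices fixed by elements
    outside C, hence is a norm from C by [smith_transfer]; the C-invariant cocycle is then extended
    to all simplices. *)
Theorem cocycle_transfer n (A B C : {group gT}) b f : A \subset C -> (C <| B)%g ->
  #|B : C|%g = p -> b \in B :\: C -> (B \subset 'N(A))%g ->
  coch n.+2 B (fixed A) (fixed_more A B) f -> cocycle n.+2 (fixed A) f ->
  exists h, [/\ coch n.+2 1%G ok none h, cocycle n.+2 ok h,
    forall c s, c \in C -> fixed A s -> size s = n.+2 -> h (c *@ s) = h s &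
    forall s, fixed A s -> size s = n.+2 -> f s = \sum_(i < p) h ((b ^+ i)%g *@ s)].
Proof.
move=> AC CB iC bD BA fc fZ; have CsB := normal_sub CB.
have CA : (C \subset 'N(A))%g by exact: fintype.subset_trans CsB BA.
have AB : fixed_more A C = fixed_more A C by [].
have [|y [yc yZ fy]] := @smith_transfer B C b CB iC bD (fixed A) (fixed_more A C)
  (@fixed_closed A) (@fixed_faced A) (fixed_stable BA) (@fixed_ok A)
  (@fixed_more_faced A C)
  (fixed_more_stable BA (normal_norm CB)) (fixed_exact_more AC CA) n f _ fZ.
  have [fl fB fd f0] := fc; split=> // s sA sn [[D [AD DC sD]]|].
    by apply: f0 => //; exists D; split=> //; exact: fintype.subset_trans CsB.
  move/(moved_fixedE AC CB sA) => [x xD xs]; apply: f0 => //.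
  exists (A <*> <[x]>)%G; split=> //.
    rewrite fintype.properE joing_subl /=; apply: contra (proj2 (finset.setDP xD)) => xA.
    apply: (fintype.subsetP AC); apply: (fintype.subsetP xA).
    by rewrite mem_gen// inE cycle_id orbT.
  by rewrite join_subG (fintype.subset_trans AC CsB) cycle_subG; case/finset.setDP: xD.
have [yl yC yd y0] := yc.
have yc1 : coch n.+2 1%G (fixed A) none y.
  by apply: coch_sub (sub1G C) _; split.
have [h [hc hZ hy]] := cocycle_extend_ok yc1 yZ.
have [bB _] := finset.setDP bD.
exists h; split=> // [c s cC sA sn|s sA sn].
  by rewrite !hy ?size_map ?yC//; exact: (fixed_stable CA).
rewrite fy//; apply: eq_bigr => i _; rewrite hy ?size_map//.
by apply: (fixed_stable BA) => //; exact: groupX.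
Qed.

End Smith.

(** * Linear algebra in spaces of functions, in arbitrary dimension *)

Section Span.
Local Open Scope ring_scope.
Variables (K : fieldType) (T : Type) (X : T -> Prop).
Implicit Types (u v b : T -> K) (S U : (T -> K) -> Prop).

(** Functions are compared on [X] only, which handles restrictions to [X] without a subtype; the
    elements of [S] themselves stay functions on all of T. *)
Inductive span S : (T -> K) -> Prop :=
| span_zero u : (forall x, X x -> u x = 0) -> span S u
| span_cons a b u v : S b -> span S v ->
    (forall x, X x -> u x = a * b x + v x) -> span S u.

Lemma span_eq S u v : (forall x, X x -> u x = v x) -> span S u -> span S v.
Proof.
move=> uv su; case: su uv => {u} [u u0|a b u w Sb sw uw] uv.
  by apply: span_zero => x Xx; rewrite -uv// u0.
by apply: (span_cons (a := a) Sb sw) => x Xx; rewrite -uv// uw.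
Qed.

Lemma span_mem S b : S b -> span S b.
Proof.
move=> Sb; apply: (span_cons (a := 1) (v := fun=> 0) Sb); first exact: span_zero.
by move=> x _; rewrite mul1r addr0.
Qed.

Lemma spanD S u v : span S u -> span S v -> span S (fun x => u x + v x).
Proof.
move=> su sv; elim: su => {u} [u u0|a b u w Sb _ IH uw].
  by apply: span_eq sv => x Xx; rewrite u0// add0r.
by apply: (span_cons (a := a) Sb IH) => x Xx; rewrite uw// addrA.
Qed.

Lemma spanZ S c u : span S u -> span S (fun x => c * u x).
Proof.
elim=> {u} [u u0|a b u w Sb _ IH uw].
  by apply: span_zero => x Xx; rewrite u0// mulr0.
by apply: (span_cons (a := c * a) Sb IH) => x Xx; rewrite uw// mulrDr mulrA.
Qed.

Lemma spanB S u v : span S u -> span S v -> span S (fun x => u x - v x).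
Proof.
move=> su sv; have := spanD su (spanZ (-1) sv); apply: span_eq => x _.
by rewrite mulN1r.
Qed.

Lemma span_sub S S' u : (forall b, S b -> span S' b) -> span S u -> span S' u.
Proof.
move=> SS; elim=> {u} [u u0|a b u w Sb _ IH uw]; first exact: span_zero.
by apply: span_eq (spanD (spanZ a (SS _ Sb)) IH) => x Xx; rewrite uw.
Qed.

Definition rest S b : (T -> K) -> Prop := fun c => S c /\ c <> b.
Definition indep S := forall b, S b -> ~ span (rest S b) b.

Lemma span_split S b u : S b -> span S u ->
  exists a, span (rest S b) (fun x => u x - a * b x).
Proof.
move=> Sb; elim=> {u} [u u0|a c u w Sc _ [a' IH] uw].
  by exists 0; apply: span_zero => x Xx; rewrite u0// mul0r subr0.
have [cb|cb] := pselect (c = b).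
  exists (a + a'); apply: span_eq IH => x Xx.
  by rewrite uw// cb mulrDl [a * b x + _]addrC addrKA.
exists a'; apply: (span_cons (a := a) (b := c) _ IH) => // x Xx.
by rewrite uw// addrA.
Qed.

Lemma span_finite S u : span S u -> exists r : seq (T -> K),
  forall b, S b -> ~ List.In b r -> span (rest S b) u.
Proof.
elim=> {u} [u u0|a c u w Sc _ [r IH] uw].
  by exists [::] => b _ _; exact: span_zero.
exists (c :: r) => b Sb /= /not_orP[cb br].
by apply: (span_cons (a := a) (b := c) _ (IH b Sb br)).
Qed.

Lemma indep_coef S b a a' u : indep S -> S b ->
  span (rest S b) (fun x => u x - a * b x) ->
  span (rest S b) (fun x => u x - a' * b x) -> a = a'.
Proof.
move=> iS Sb sa sa'; apply/eqP; rewrite -subr_eq0; apply/negPn/negP => aa.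
apply: (iS b Sb); have := spanZ (a - a')^-1 (spanB sa' sa).
apply: span_eq => x _; by rewrite subrBB subrr sub0r opprB -mulrBl mulKf.
Qed.

(** Zorn's lemma on the sets of vectors added to [S]. A linear relation uses finitely many vectors,
    so it already holds in one member of a chain. *)
Theorem basis_extend S U : indep S -> (forall b, S b -> U b) ->
  exists S', [/\ forall b, S b -> S' b, forall b, S' b -> U b, indep S' &
    forall u, U u -> span S' u].
Proof.
move=> iS SU.
pose P := ([set Q : set (T -> K) | indep (fun b => S b \/ Q b) /\
  forall b, Q b -> U b])%classic.
have [F FP Ftot|Q [[iQ QU] Qmax]] := @Zorn_bigcup _ P.
  split; last by move=> b [Q FQ Qb]; have [_] := FP Q FQ; apply.
  have fin b u : (forall Q, F Q -> Q `<=` \bigcup_(Q in F) Q)%classic ->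
      span (rest (fun b => S b \/ (\bigcup_(Q in F) Q)%classic b) b) u ->
      span (rest S b) u \/ exists2 Q, F Q & span (rest (fun b => S b \/ Q b) b) u.
    move=> _; elim=> {u} [u u0|a c u w [Sc cb] _ IH uw].
      by left; exact: span_zero.
    have mono (Q Q' : set (T -> K)) v : (Q `<=` Q')%classic ->
        span (rest (fun b => S b \/ Q b) b) v -> span (rest (fun b => S b \/ Q' b) b) v.
      move=> QQ; apply: span_sub => d [[Sd|Qd] db]; apply: span_mem; split=> //.
        by left.
      by right; exact: QQ.
    have sub (Q : set (T -> K)) v : span (rest S b) v ->
        span (rest (fun b => S b \/ Q b) b) v.
      by apply: span_sub => d [Sd db]; apply: span_mem; split=> //; left.
    case: Sc => [Sc|[Q FQ Qc]].
      case: IH => [IH|[Q FQ IH]].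
        by left; apply: (span_cons (a := a) (b := c) _ IH).
      by right; exists Q => //; apply: (span_cons (a := a) (b := c) _ IH) => //; split=> //; left.
    right; case: IH => [IH|[Q' FQ' IH]].
      exists Q => //; apply: (span_cons (a := a) (b := c) _ (sub _ _ IH)) => //.
      by split=> //; right.
    have [QQ|QQ] := Ftot Q Q' FQ FQ'.
      exists Q' => //; apply: (span_cons (a := a) (b := c) _ IH) => //.
      by split=> //; right; exact: QQ.
    exists Q => //; apply: (span_cons (a := a) (b := c) _ (mono _ _ _ QQ IH)) => //.
    by split=> //; right.
  move=> b Sb /(@fin b b)[|sb|[Q FQ sb]].
  - by move=> Q FQ c Qc; exists Q.
  - case: Sb => [Sb|[Q FQ Qb]]; first exact: iS sb.
    have [iQ _] := FP Q FQ; apply: (iQ b); first by right.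
    by apply: span_sub sb => d [Sd db]; apply: span_mem; split=> //; left.
  - case: Sb => [Sb|[Q' FQ' Qb]].
      by have [iQ _] := FP Q FQ; apply: (iQ b) sb; left.
    have [QQ|QQ] := Ftot Q Q' FQ FQ'.
      have [iQ _] := FP Q' FQ'; apply: (iQ b); first by right.
      apply: span_sub sb => d [[Sd|Qd] db]; apply: span_mem; split=> //; first by left.
      by right; exact: QQ.
    by have [iQ _] := FP Q FQ; apply: (iQ b) sb; right; exact: QQ.
exists (fun b => S b \/ Q b); split=> //; first by left.
  by move=> b [/SU|/QU].
move=> u Uu; apply: contrapT => nu.
have uQ : ~ (S u \/ Q u) by move=> h; apply: nu; exact: span_mem.
apply: (Qmax (Q `|` [set u])%classic).
  split; first by move=> b Qb; left.
  by move=> /(_ u) h; apply: uQ; right; apply: h; right.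
split; last by move=> b [/QU//|->].
move=> b Sb sb.
have [bu|bu] := pselect (b = u).
  apply: nu; rewrite bu in sb; apply: span_sub sb => c [[Sc|[Qc|//]] _].
    by apply: span_mem; left.
  by apply: span_mem; right.
have Sb' : S b \/ Q b by case: Sb => [|[|//]]; [left|right].
have [|a sa] := @span_split _ u b _ sb.
  by split; [right; right|move=> ub; apply: bu].
have {}sa : span (rest (fun b => S b \/ Q b) b) (fun x => b x - a * u x).
  apply: span_sub sa => c [[[Sc|[Qc|//]] cb] cu]; apply: span_mem; split=> //.
    by left.
  by right.
have [a0|a0] := eqVneq a 0.
  apply: (iQ b Sb'); apply: span_eq sa => x _; by rewrite a0 mul0r subr0.
apply: nu; have : span (fun b => S b \/ Q b) (fun x => b x - a * u x).
  by apply: span_sub sa => c [Sc _]; exact: span_mem.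
move=> /(spanB (span_mem Sb'))/(spanZ a^-1); apply: span_eq => x _.
by rewrite subKr mulKf.
Qed.

End Span.

(** * Homomorphisms to F_p, duality and convergent lifts *)

Section Hom.
Local Open Scope ring_scope.
Variables (p : nat) (p_pr : prime p) (F : lgroup p).
Implicit Types (m : F -> 'F_p) (x y : F).

Definition lhom m := (forall x y, m (x * y)%g = m x + m y) /\
  exists i, forall x, lpi i x = 1%g -> m x = 0.

Lemma lhom1 m : lhom m -> m 1%g = 0.
Proof. by move=> [_ [i mi]]; apply: mi; exact: lpi1. Qed.

Lemma lhomV m x : lhom m -> m x^-1%g = - m x.
Proof.
move=> hm; have [mM _] := hm.
by apply/eqP; rewrite -addr_eq0 -mM mulVg lhom1.
Qed.

Lemma lhomX m x n : lhom m -> m (x ^+ n)%g = m x *+ n.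
Proof.
move=> hm; have [mM _] := hm; elim: n => [|n IH]; first by rewrite expg0 lhom1.
by rewrite expgS mM IH mulrS.
Qed.

Lemma lhom_eq m : lhom m -> exists i, forall x y, lpi i x = lpi i y -> m x = m y.
Proof.
move=> hm; have [mM [i mi]] := hm; exists i => x y /lpi_eq/mi.
by rewrite mM lhomV// addrC => /subr0_eq.
Qed.

Lemma lhomD m m' : lhom m -> lhom m' -> lhom (fun x => m x + m' x).
Proof.
move=> [mM [i mi]] [m'M [j mj]]; split=> [x y|]; first by rewrite mM m'M addrACA.
have [k [ki kj]] := finer2 i j.
by exists k => x kx; rewrite mi ?mj ?addr0//; [exact: kj|exact: ki].
Qed.

Lemma lhomZ c m : lhom m -> lhom (fun x => c * m x).
Proof.
move=> [mM [i mi]]; split=> [x y|]; first by rewrite mM mulrDr.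
by exists i => x /mi ->; rewrite mulr0.
Qed.

Lemma lhom0 : lhom (fun=> 0).
Proof. by split=> [x y|]; [rewrite addr0|exists (level0 F)]. Qed.

Lemma lhomB m m' : lhom m -> lhom m' -> lhom (fun x => m x - m' x).
Proof.
move=> hm hm'; have -> : (fun x => m x - m' x) = (fun x => m x + (-1) * m' x).
  by apply/funext => x; rewrite mulN1r.
by apply: lhomD => //; exact: lhomZ.
Qed.

Lemma lhom_sum (I : Type) (r : seq I) (m : I -> F -> 'F_p) :
  (forall i, lhom (m i)) -> lhom (fun x => \sum_(i <- r) m i x).
Proof.
move=> hm; elim: r => [|i r IH].
  have -> : (fun x => \sum_(i <- [::]) m i x) = fun=> 0 by apply/funext => x; rewrite big_nil.
  exact: lhom0.
have -> : (fun x => \sum_(j <- i :: r) m j x) = fun x => m i x + \sum_(j <- r) m j x.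
  by apply/funext => x; rewrite big_cons.
exact: lhomD.
Qed.

Definition lsubgroup (B : F -> Prop) :=
  [/\ B 1%g, forall x y, B x -> B y -> B (x * y)%g & forall x, B x -> B x^-1%g].

Lemma lsubgroupX B x n : lsubgroup B -> B x -> B (x ^+ n)%g.
Proof.
by move=> [B1 BM _] Bx; elim: n => [|n IH]//; rewrite expgS; exact: BM.
Qed.

Definition lclosed (B : F -> Prop) :=
  forall x, (forall i, exists2 y, B y & lpi i y = lpi i x) -> B x.

(* A functional on the homs that only depends on their restriction to B. *)
Definition functional (B : F -> Prop) (lam : (F -> 'F_p) -> 'F_p) :=
  [/\ forall m m', lhom m -> lhom m' -> lam (fun x => m x + m' x) = lam m + lam m',
      forall c m, lhom m -> lam (fun x => c * m x) = c * lam m &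
      forall m, lhom m -> (forall x, B x -> m x = 0) -> lam m = 0].

Lemma functionalB B lam m m' : functional B lam -> lhom m -> lhom m' ->
  lam (fun x => m x - m' x) = lam m - lam m'.
Proof.
move=> [lD lZ _] hm hm'; have -> : (fun x => m x - m' x) = (fun x => m x + (-1) * m' x).
  by apply/funext => x; rewrite mulN1r.
by rewrite lD ?lZ ?mulN1r//; exact: lhomZ.
Qed.

Lemma functional_eq B lam m m' : functional B lam -> lhom m -> lhom m' ->
  (forall x, B x -> m x = m' x) -> lam m = lam m'.
Proof.
move=> hl hm hm' mm; apply/eqP; rewrite -subr_eq0 -(functionalB hl)//.
have [_ _ ->] := hl; rewrite ?eqxx//; first exact: lhomB.
by move=> x Bx; rewrite mm// subrr.
Qed.

(** Homomorphisms are treated one at a time: a power of some [z] takes the right value at [m], and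
    the remaining equations are solved in the kernel of [m] on B, for the functional corrected by
    the element already found. *)
Lemma realize_seq (r : seq (F -> 'F_p)) (B : F -> Prop) lam : lsubgroup B ->
  functional B lam -> (forall m, List.In m r -> lhom m) ->
  exists2 y, B y & forall m, List.In m r -> m y = lam m.
Proof.
elim: r B lam => [|m r IH] B lam Bg hl hr; first by exists 1%g => //; case: Bg.
have hm : lhom m by apply: hr; left.
have hr' m' : List.In m' r -> lhom m' by move=> m'r; apply: hr; right.
have [m0|nm] := pselect (forall x, B x -> m x = 0).
  have [y By yr] := IH B lam Bg hl hr'; exists y => // m' [<-|/yr//].
  by rewrite m0//; case: hl => _ _ ->.
have [z Bz mz] : exists2 z, B z & m z != 0.
  apply: contrapT => h; apply: nm => x Bx; apply: contrapT => mx.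
  by apply: h; exists x => //; exact/eqP.
have [y0 By0 my0] : exists2 y0, B y0 & m y0 = lam m.
  exists (z ^+ (lam m / m z)%R)%g; first exact: lsubgroupX.
  rewrite lhomX// -mulr_natr natr_Zp mulrC divfK//.
pose B' x := B x /\ m x = 0.
have B'g : lsubgroup B'.
  have [B1 BM BV] := Bg; split; first by split=> //; exact: lhom1.
  - move=> x y [Bx mx] [By my]; split; first exact: BM.
    by have [-> _] := hm; rewrite mx my addr0.
  - by move=> x [Bx mx]; split; [exact: BV|rewrite lhomV// mx oppr0].
pose mu m' := lam m' - m' y0.
have hmu : functional B' mu.
  have [lD lZ l0] := hl; split.
  - by move=> u v hu hv; rewrite /mu lD// opprD addrACA.
  - by move=> c u hu; rewrite /mu lZ// mulrBr.
  - move=> u hu uB'; apply/eqP; rewrite subr_eq0; apply/eqP.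
    pose v x := u x - (u z / m z) * m x.
    have hv : lhom v by apply: lhomB => //; exact: lhomZ.
    have vB x : B x -> v x = 0.
      move=> Bx; pose k := (m x / m z)%R : 'F_p.
      have [B1 BM BV] := Bg; have [mM _] := hm; have [uM _] := hu.
      have mk (w : F -> 'F_p) : lhom w -> w (z ^+ k)%g = k * w z.
        by move=> hw; rewrite lhomX// -mulr_natl natr_Zp.
      have : u (x * (z ^+ k)^-1)%g = 0.
        apply: uB'; split; first by apply: BM => //; apply: BV; exact: lsubgroupX.
        by rewrite mM lhomV// mk// /k divfK// subrr.
      rewrite uM lhomV// mk// /v /k => <-.
      by congr (_ - _); rewrite mulrAC [RHS]mulrAC [m x * _]mulrC.
    have lv := l0 v hv vB.
    have -> : lam u = (u z / m z) * lam m.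
      apply/eqP; rewrite -subr_eq0 -lv (functionalB hl)//; last exact: lhomZ.
      by rewrite lZ.
    by have := vB y0 By0; rewrite /v my0 => /subr0_eq.
have [y [By my] yr] := IH B' mu B'g hmu hr'.
have [B1 BM BV] := Bg; exists (y0 * y)%g; first exact: BM.
move=> m' [<-|m'r]; first by have [-> _] := hm; rewrite my addr0.
by have [-> _] := hr' _ m'r; rewrite yr// /mu addrCA subrr addr0.
Qed.

(** Pontryagin reflexivity: a functional on the dual of B is evaluation at a point of B. Only
    finitely many homomorphisms factor through a given level, and compactness glues the solutions of
    all levels. *)
Lemma realize (B : F -> Prop) lam : lsubgroup B -> lclosed B -> functional B lam ->
  exists2 y, B y & forall m, lhom m -> m y = lam m.
Proof.
move=> Bg Bc hl.
have sol j : exists y, B y /\ forall m, lhom m ->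
    (forall x, lpi j x = 1%g -> m x = 0) -> m y = lam m.
  pose r := [seq m <- [seq (fun x : F => (phi : {ffun _ -> 'F_p}) (lpi j x)) |
      phi <- enum {ffun lquo j -> 'F_p}] | `[< lhom m >]].
  have [|y By yr] := @realize_seq r B lam Bg hl.
    by rewrite /r => m; elim: [seq _ | _ <- _] => //= m' r' IH;
      case: asboolP => //= hm' [<-//|/IH].
  exists y; split=> // m hm mj.
  apply: yr; rewrite /r.
  have [phi mE] : exists phi : {ffun lquo j -> 'F_p}, m = fun x => phi (lpi j x).
    exists [ffun z => lift_fun 0 m z]; apply/funext => x; rewrite ffunE lift_funE//.
    by move=> a b /lpi_eq/mj; have [mM _] := hm; rewrite mM lhomV// addrC => /subr0_eq.
  have : phi \in enum {ffun lquo j -> 'F_p} by rewrite mem_enum.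
  elim: (enum _) => //= phi' e IH; rewrite inE => /orP[/eqP <-|pe].
    by rewrite -mE; case: asboolP => //= _; left.
  by case: asboolP => //= _; [right|]; exact: IH.
pose s j := sval (cid (sol j)).
have sP j : B (s j) /\ forall m, lhom m ->
    (forall x, lpi j x = 1%g -> m x = 0) -> m (s j) = lam m := svalP (cid (sol j)).
have [y yP] := lpi_compact s; exists y.
  by apply: Bc => i; have [j [_ sy]] := yP i; exists (s j) => //; case: (sP j).
move=> m hm; have [i mi] := lhom_eq hm; have [j [ji sy]] := yP i.
rewrite -(mi _ _ sy); have [_ ->] := sP j => // x /ji x1.
by rewrite (mi x 1%g) ?lhom1// x1 lpi1.
Qed.


(** The finite intersection property for chains. At each level the member with the smallest image
    has its image contained in all others, so a cluster point of representatives is adherent to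
    every member. *)
Lemma closed_chain (C : Type) (c0 : C) (K : C -> F -> Prop) :
  (forall c, lclosed (K c)) -> (forall c, exists x, K c x) ->
  (forall c c', (forall x, K c x -> K c' x) \/ (forall x, K c' x -> K c x)) ->
  exists x, forall c, K c x.
Proof.
move=> Kc Kx Kt.
pose im j c : {set lquo j} := [set z | `[< exists2 x, K c x & lpi j x = z >]].
have imP j c z : reflect (exists2 x, K c x & lpi j x = z) (z \in im j c).
  by rewrite /im finset.inE; exact: asboolP.
have /choice[a aP] : forall j, exists c, forall c', im j c \subset im j c'.
  move=> j; have [n /asboolP[c cn] nmin] : exists2 n, `[< exists c, #|im j c| = n >] &
      forall n', `[< exists c, #|im j c| = n' >] -> (n <= n')%N.
    have ex : exists n, `[< exists c, #|im j c| = n >].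
      by exists #|im j c0|; apply/asboolP; exists c0.
    by case: (ex_minnP ex) => n nP nmin; exists n.
  exists c => c'; have [cc'|c'c] := Kt c c'.
    by apply/fintype.subsetP => z /imP[x Kx' <-]; apply/imP; exists x => //; exact: cc'.
  have sub : im j c' \subset im j c.
    by apply/fintype.subsetP => z /imP[x Kx' <-]; apply/imP; exists x => //; exact: c'c.
  have /eqP -> // : im j c' == im j c.
  by rewrite finset.eqEcard sub cn nmin//; apply/asboolP; exists c'.
have [x xP] := lpi_compact (fun j => sval (cid (Kx (a j)))).
exists x => c; apply: Kc => i; have [j [ji <-]] := xP i.
set y := sval _; have Ky : K (a j) y := svalP (cid (Kx (a j))).
have /imP[z Kz zy] := fintype.subsetP (aP j c) (lpi j y) (introT (imP _ _ _) (ex_intro2 _ _ y Ky erefl)).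
by exists z => //; exact: finer_eq zy.
Qed.

Lemma cofinite_forall (I : Type) (T : finType) (Q : T -> I -> Prop) :
  (forall t, exists r : seq I, forall i, ~ List.In i r -> Q t i) ->
  exists r : seq I, forall i, ~ List.In i r -> forall t, Q t i.
Proof.
move=> QP; suff [r rP] : exists r : seq I, forall i, ~ List.In i r ->
    forall t, t \in enum T -> Q t i.
  by exists r => i /rP h t; apply: h; rewrite mem_enum.
elim: (enum T) => [|t e [r rP]]; first by exists [::].
have [r' r'P] := QP t; exists (r' ++ r) => i ir u; rewrite inE => /orP[/eqP ->|ue].
  by apply: r'P => h; apply: ir; apply/List.in_or_app; left.
by apply: rP => // h; apply: ir; apply/List.in_or_app; right.
Qed.

Section LiftConverging.
Variables (I : Type) (B : F -> Prop) (lam : I -> (F -> 'F_p) -> 'F_p).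
Hypotheses (Bg : lsubgroup B) (Bc : lclosed B).
Hypothesis lamB : forall i, functional B (lam i).
Hypothesis lam_fin : forall m, lhom m ->
  exists r : seq I, forall i, ~ List.In i r -> lam i m = 0.

(* A coset family x_i L of lifts that meets every kernel for almost all i; the
   wanted lifts are the families with L = 1, that is the maximal ones. *)
Let good (Lx : (F -> Prop) * (I -> F)) := [/\ lsubgroup Lx.1, lclosed Lx.1,
  forall l, Lx.1 l -> B l /\ forall m, lhom m -> m l = 0,
  forall i, B (Lx.2 i) /\ forall m, lhom m -> m (Lx.2 i) = lam i m &
  forall j, exists r : seq I, forall i, ~ List.In i r ->
    exists2 l, Lx.1 l & lpi j (Lx.2 i * l)%g = 1%g].

Let below (s t : {Lx | good Lx}) : bool :=
  `[< (forall l, (sval t).1 l -> (sval s).1 l) /\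
      forall i, (sval s).1 (((sval s).2 i)^-1 * (sval t).2 i)%g >].

(** The initial L is the part of B killed by all homomorphisms, so any two lifts of a functional
    differ by L. *)
Let start : exists Lx, good Lx.
Proof.
have [B1 BM BV] := Bg.
pose L l := B l /\ forall m, lhom m -> m l = 0.
have /choice[x xP] : forall i, exists x, B x /\ forall m, lhom m -> m x = lam i m.
  by move=> i; have [x] := realize Bg Bc (lamB i); exists x.
exists (L, x); split=> //=.
- split; first by split=> // m /lhom1.
  + move=> l l' [Bl l0] [Bl' l'0]; split; first exact: BM.
    by move=> m hm; have [-> _] := hm; rewrite l0// l'0// addr0.
  + by move=> l [Bl l0]; split; [exact: BV|move=> m hm; rewrite lhomV// l0// oppr0].
- move=> l Ll; split.
    by apply: Bc => i; have [y [By _] yl] := Ll i; exists y.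
  move=> m hm; have [i mi] := lhom_eq hm; have [y [_ y0] yl] := Ll i.
  by rewrite -(mi _ _ yl) y0.
move=> j.
pose B' y := B y /\ lpi j y = 1%g.
have B'g : lsubgroup B'.
  split; first by split=> //; exact: lpi1.
  - by move=> a b [Ba a1] [Bb b1]; split; [exact: BM|rewrite lpiM a1 b1 mulg1].
  - by move=> a [Ba a1]; split; [exact: BV|rewrite lpiV a1 invg1].
have B'c : lclosed B'.
  move=> y yB; split; first by apply: Bc => i; have [z [Bz _] zy] := yB i; exists z.
  by have [z [_ z1] <-] := yB j.
(* Homomorphisms that factor through level [j] on B have finitely many restrictions, indexed by
   [phi]. Outside a finite set of indices [lam i] kills them all, so it is a functional on the
   kernel of the level in B and is realised there. *)
pose mf (phi : {ffun lquo j -> 'F_p}) :=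
  if pselect (exists m, lhom m /\ forall y, B y -> m y = phi (lpi j y)) is left h
  then sval (cid h) else fun=> 0.
have mfP phi : lhom (mf phi).
  rewrite /mf; case: pselect => [h|_]; last exact: lhom0.
  by case: (svalP (cid h)).
have [r rP] := @cofinite_forall I _ (fun phi i => lam i (mf phi) = 0)
  (fun phi => lam_fin (mfP phi)).
exists r => i /rP lam0.
have hl : functional B' (lam i).
  have [lD lZ _] := lamB i; split=> // m hm mB'.
  pose phi := [ffun z => if pselect (exists2 y, B y & lpi j y = z) is left h
     then m (s2val (cid2 h)) else 0] : {ffun lquo j -> 'F_p}.
  have mphi y : B y -> m y = phi (lpi j y).
    move=> By; rewrite ffunE; case: pselect => [h|[]]; last by exists y.
    case: cid2 => y' /= By' /lpi_eq yy.
    have : m (y'^-1 * y)%g = 0 by apply: mB'; split=> //; apply: BM => //; exact: BV.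
    by have [-> _] := hm; rewrite lhomV// addrC => /subr0_eq.
  rewrite -(lam0 phi); apply: (functional_eq (lamB i)) => // y By.
  rewrite mphi// /mf; case: pselect => [h|[]]; last by exists m.
  by have [_ ->] := svalP (cid h).
have [y [By y1] yl] := realize B'g B'c hl.
have [Bx xl] := xP i.
exists ((x i)^-1 * y)%g; last by rewrite mulKVg.
split; first by apply: BM => //; exact: BV.
move=> m hm; have [-> _] := hm.
by rewrite lhomV// xl// yl// addNr.
Qed.

(** The bound intersects the groups L and the cosets x_i L of the chain; compactness makes the
    intersections of cosets nonempty. [LooE] says that at each level the image of the intersection
    is attained by one member, which preserves convergence. *)
Let chain_bound (A : set {Lx | good Lx}) : total_on A below ->
  exists t, forall s, A s -> below s t.
Proof.
move=> Atot; have [[c0 Ac0]|nA] := pselect (exists c, A c); last first.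
  have [Lx gLx] := start; exists (exist _ Lx gLx) => s As.
  by case: nA; exists s.
pose C := {c | A c}.
pose L (c : C) := (sval (sval c)).1; pose x (c : C) := (sval (sval c)).2.
have gd (c : C) : good (sval (sval c)) := svalP (sval c).
have tot (c c' : C) : below (sval c) (sval c') \/ below (sval c') (sval c).
  by apply/orP; apply/orP; apply: Atot; exact: (svalP _).
pose Loo l := forall c, L c l.
have Lg c : lsubgroup (L c) by case: (gd c).
have Lc c : lclosed (L c) by case: (gd c).
have coset_closed c (y : F) : lclosed (fun z => L c (y^-1 * z)%g).
  move=> z zL; apply: Lc => i; have [w Lw wz] := zL i.
  by exists (y^-1 * w)%g => //; rewrite !lpiM wz.
have coset_sub c c' i y : below (sval c) (sval c') ->
    L c' ((x c' i)^-1 * y)%g -> L c ((x c i)^-1 * y)%g.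
  move=> /asboolP[LL xx] /LL Ly; have [_ LM _] := Lg c.
  by have := LM _ _ (xx i) Ly; rewrite mulgA mulgK.
have c00 : C by exists c0.
have /choice[xoo xooP] : forall i, exists y, forall c, L c ((x c i)^-1 * y)%g.
  move=> i; apply: (@closed_chain C c00 (fun c y => L c ((x c i)^-1 * y)%g)).
  - by move=> c; exact: coset_closed.
  - by move=> c; exists (x c i); rewrite mulVg; case: (Lg c).
  - by move=> c c'; have [h|h] := tot c c'; [right|left] => y; exact: coset_sub h.
have LooE j : exists c, forall l, L c l -> exists2 l', Loo l' & lpi j l' = lpi j l.
  apply: contrapT => H.
  have /choice[q qP] : forall c, exists l, L c l /\
      forall l', Loo l' -> lpi j l' <> lpi j l.
    move=> c; apply: contrapT => h; apply: H; exists c => l Ll.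
    apply: contrapT => h'; apply: h; exists l; split=> // l' Ll' ll.
    by apply: h'; exists l'.
  have [z zP] : exists z : lquo j, forall c, exists2 l, L c l &
      lpi j l = z /\ forall l', Loo l' -> lpi j l' <> z.
    apply: contrapT => nz.
    have /choice[g gP] : forall z : lquo j, exists c, forall l, L c l -> lpi j l = z ->
        exists2 l', Loo l' & lpi j l' = z.
      move=> z; apply: contrapT => h; apply: nz; exists z => c.
      apply: contrapT => h'; apply: h; exists c => l Ll lz.
      apply: contrapT => h2; apply: h'; exists l => //; split=> // l' Ll' l'z.
      by apply: h2; exists l'.
    have [c cP] : exists c, forall z l, L c l -> L (g z) l.
      suff [c cP] : exists c, forall z, z \in enum (lquo j) -> forall l, L c l -> L (g z) l.
        by exists c => z; apply: cP; rewrite mem_enum.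
      elim: (enum _) => [|z e [c cP]]; first by exists c00.
      have [/asboolP[h _]|/asboolP[h _]] := tot c (g z).
        by exists (g z) => z' ; rewrite inE => /orP[/eqP -> //|/cP ce] l /h/ce.
      by exists c => z'; rewrite inE => /orP[/eqP -> //|]; exact: cP.
    have [Lq qn] := qP c; have [l' Ll' l'q] := gP _ _ (cP _ _ Lq) erefl.
    exact: qn l'q.
  have [|||l lP] := @closed_chain C c00 (fun c l => L c l /\ lpi j l = z).
  - move=> c l lL; split; last by have [w [_ <-] <-] := lL j.
    by apply: Lc => i; have [w [Lw _] wl] := lL i; exists w.
  - by move=> c; have [l Ll [lz _]] := zP c; exists l.
  - move=> c c'; have [/asboolP[h _]|/asboolP[h _]] := tot c c'; [right|left] => l [/h Ll lz].
      by [].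
    by [].
  have [_ _ [_ nz]] := zP c00; apply: (nz l); first by move=> c; case: (lP c).
  by case: (lP c00).
have goo : good (Loo, xoo).
  split=> /=.
  - split; first by move=> c; case: (Lg c).
      by move=> a b La Lb c; have [_ LM _] := Lg c; exact: LM.
    by move=> a La c; have [_ _ LV] := Lg c; exact: LV.
  - by move=> l lL c; apply: Lc => i; have [w Lw wl] := lL i; exists w.
  - by move=> l /(_ c00); case: (gd c00) => _ _ + _ _; apply.
  - move=> i; have [_ _ LB xB _] := gd c00; have [Bx xl] := xB i.
    have [Bl l0] := LB _ (xooP i c00); have [_ BM _] := Bg.
    have -> : xoo i = (x c00 i * ((x c00 i)^-1 * xoo i))%g by rewrite mulKVg.
    split; first exact: BM.
    by move=> m hm; have [mM _] := hm; rewrite mM l0// xl// addr0.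
  - move=> j; have [c cP] := LooE j; have [_ _ _ _ cv] := gd c.
    have [r rP] := cv j; exists r => i /rP[l Ll xl].
    have [_ LM LV] := Lg c.
    have [l' Ll' l'l] : exists2 l', Loo l' & lpi j l' = lpi j ((xoo i)^-1 * (x c i * l))%g.
      apply: cP; have := LM _ _ (LV _ (xooP i c)) Ll.
      by rewrite invMg invgK mulgA.
    by exists l' => //; rewrite lpiM l'l -lpiM mulKVg.
exists (exist _ _ goo) => s As; apply/asboolP; split=> /=.
  by move=> l /(_ (exist _ s As)).
by move=> i; exact: (xooP i (exist _ s As)).
Qed.

(** In a maximal family L is trivial: intersecting L with the kernel of any level [j], and moving
    x_i into that kernel whenever its coset allows it, gives a smaller good family. With L trivial,
    convergence of cosets is convergence of the x_i. *)
Theorem lift_converging : exists s : I -> F, [/\ forall i, B (s i),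
  forall i m, lhom m -> m (s i) = lam i m &
  forall j, exists r : seq I, forall i, ~ List.In i r -> lpi j (s i) = 1%g].
Proof.
have [Lx0 gLx0] := start.
have [|||t tmax] := @ZL_preorder _ (exist _ Lx0 gLx0) below.
- move=> t; apply/asboolP; split=> // i; rewrite mulVg.
  by case: (svalP t) => -[].
- move=> r s t /asboolP[rs xrs] /asboolP[st xst]; apply/asboolP; split=> [l /st/rs//|i].
  have [_ LMs _] : lsubgroup (sval r).1 by case: (svalP r).
  by have := LMs _ _ (xrs i) (rs _ (xst i)); rewrite mulgA mulgK.
- exact: chain_bound.
have [Lg Lc LB xB cv] := svalP t; have [L1 LM LV] := Lg.
have L_triv l : (sval t).1 l -> l = 1%g.
  move=> Ll; apply: lpi_separated => j.
  pose L' l := (sval t).1 l /\ lpi j l = 1%g.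
  pose x' i := if pselect (exists2 l, (sval t).1 l & lpi j ((sval t).2 i * l)%g = 1%g)
    is left h then ((sval t).2 i * s2val (cid2 h))%g else (sval t).2 i.
  have x'L i : exists2 l, (sval t).1 l & x' i = ((sval t).2 i * l)%g.
    rewrite /x'; case: pselect => [h|_]; last by exists 1%g; rewrite ?mulg1.
    by case: cid2 => l' /= Ll' _; exists l'.
  have gL' : good (L', x').
    split=> /=.
    - split; first by split=> //; exact: lpi1.
        by move=> a b [La a1] [Lb b1]; split; [exact: LM|rewrite lpiM a1 b1 mulg1].
      by move=> a [La a1]; split; [exact: LV|rewrite lpiV a1 invg1].
    - move=> y yL; split; last by have [w [_ w1] <-] := yL j.
      by apply: Lc => i; have [w [Lw _] wy] := yL i; exists w.
    - by move=> y [/LB].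
    - move=> i; have [l' Ll' ->] := x'L i; have [Bx xl] := xB i.
      have [Bl l0] := LB _ Ll'; have [_ BM _] := Bg; split; first exact: BM.
      by move=> m hm; have [-> _] := hm; rewrite xl// l0// addr0.
    - move=> k; have [k' [k'k k'j]] := finer2 k j; have [r rP] := cv k'.
      exists r => i /rP[l' Ll' xl']; rewrite /x'; case: pselect => [h|[]]; last first.
        by exists l' => //; apply: k'j.
      case: cid2 => l2 /= Ll2 xl2; exists (l2^-1 * l')%g; last first.
        by apply: k'k; rewrite mulgA mulgK.
      split; first by apply: LM => //; exact: LV.
      have := k'j _ xl'; rewrite -{1}[l'](mulKVg l2) mulgA lpiM xl2 mul1g.
      by [].
  have /tmax/asboolP[h _] : below t (exist _ _ gL').
    apply/asboolP; split=> /= [y []//|i].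
    by have [l' Ll' ->] := x'L i; rewrite mulKg.
  by have [] := h _ Ll.
exists (sval t).2; split.
- by move=> i; case: (xB i).
- by move=> i; case: (xB i).
- move=> j; have [r rP] := cv j; exists r => i /rP[l /L_triv ->].
  by rewrite mulg1.
Qed.

End LiftConverging.
End Hom.

(** * Coordinate functionals and separation *)

Section Coordinates.
Local Open Scope ring_scope.
Variables (K : fieldType) (T : Type) (X : T -> Prop).
Implicit Types (u v b : T -> K) (S U : (T -> K) -> Prop).

Definition coordinates S (lam : (T -> K) -> (T -> K) -> K) :=
  forall b, S b -> [/\ forall u v, lam b (fun x => u x + v x) = lam b u + lam b v,
    forall c u, lam b (fun x => c * u x) = c * lam b u,
    lam b b = 1 &
    forall u, span X (rest S b) u -> lam b u = 0].

Lemma coord_exists S : indep X S -> (forall u, span X S u) ->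
  exists lam, coordinates S lam.
Proof.
move=> iS sS.
pose P b u a := span X (rest S b) (fun x => u x - a * b x).
pose lam b u := if pselect (exists a, P b u a) is left h then sval (cid h) else 0.
have lamP b u : S b -> P b u (lam b u).
  move=> Sb; rewrite /lam; case: pselect => [h|[]]; last exact: span_split.
  exact: svalP (cid h).
have lamE b u a : S b -> P b u a -> lam b u = a.
  by move=> Sb Pa; exact: indep_coef iS Sb (lamP b u Sb) Pa.
exists lam => b Sb; split.
- move=> u v; apply: lamE => //; have := spanD (lamP b u Sb) (lamP b v Sb).
  by apply: span_eq => x _; rewrite mulrDl opprD addrACA.
- move=> c u; apply: lamE => //; have := spanZ c (lamP b u Sb).
  by apply: span_eq => x _; rewrite mulrBr mulrA.
- by apply: lamE => //; apply: span_zero => x _; rewrite mul1r subrr.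
- move=> u su; apply: lamE => //; apply: span_eq su => x _.
  by rewrite mul0r subr0.
Qed.

(** A vector involves finitely many basis vectors; each vanishing coordinate removes one of them
    from the list. *)
Lemma coord_zero S S0 lam u : coordinates S lam -> (forall b, S0 b -> S b) ->
  span X S0 u -> (forall b, S0 b -> lam b u = 0) -> forall x, X x -> u x = 0.
Proof.
move=> lamP S0S su lu.
have [r sr] : exists r : seq (T -> K), span X (fun b => S0 b /\ List.In b r) u.
  elim: su {lu} => {u} [u u0|a b u w Sb _ [r IH] uw].
    by exists [::]; exact: span_zero.
  exists (b :: r); apply: (span_cons (a := a) (b := b) _ _ uw).
    by split=> //; left.
  by apply: span_sub IH => c [Sc cr]; apply: span_mem; split=> //; right.
elim: r sr => [|b r IH] sr.
  case: sr lu => {su} [v v0 _ //|a b v w [_ []]].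
have [Sb|nSb] := pselect (S0 b); last first.
  apply: IH; apply: span_sub sr => c [Sc [bc|cr]]; first by case: nSb; rewrite bc.
  by apply: span_mem.
have [|a sa] := @span_split _ _ X _ b _ _ sr; first by split=> //; left.
have [lD lZ l1 l0] := lamP b (S0S b Sb).
have : lam b (fun x => u x + (- a) * b x) = 0.
  apply: l0; have : span X (rest S b) (fun x => u x - a * b x).
    by apply: span_sub sa => c [[Sc _] cb]; apply: span_mem; split=> //; exact: S0S.
  by apply: span_eq => x _; rewrite mulNr.
rewrite lD lZ l1 lu// add0r mulr1 => /eqP; rewrite oppr_eq0 => /eqP a0.
apply: IH; have : span X (rest (fun c => S0 c /\ List.In c (b :: r)) b) u.
  by apply: span_eq sa => x _; rewrite a0 mul0r subr0.
apply: span_sub => c [[Sc [bc|cr]] cb]; first by case: cb.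
exact: span_mem.
Qed.

(** Extend a basis of [U] together with [u] to a basis of all functions and take the coordinate at
    [u]. *)
Lemma separating_form U u : (forall u, span X U u -> U u) -> ~ U u ->
  exists lam : (T -> K) -> K,
  [/\ forall u v, lam (fun x => u x + v x) = lam u + lam v,
      forall c u, lam (fun x => c * u x) = c * lam u,
      forall v, U v -> lam v = 0 & lam u = 1].
Proof.
move=> Us nu.
have [||S0 [_ S0U iS0 sS0]] := @basis_extend K T X (fun=> False) U; [by []|by []|].
have iS0u : indep X (fun b => S0 b \/ b = u).
  move=> b [Sb|->] sb; last first.
    apply: nu; apply: Us; apply: span_sub sb => c [[Sc|//] _].
    by apply: span_mem; exact: S0U.
  have [ub|ub] := pselect (b = u).
    by apply: nu; rewrite -ub; exact: S0U.
  have [|a sa] := @span_split _ _ X _ u b _ sb.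
    by split; [right|move=> ub'; exact: ub].
  have {}sa : span X (rest S0 b) (fun x => b x - a * u x).
    apply: span_sub sa => c [[[Sc|//] cb] cu].
    by apply: span_mem.
  have [a0|a0] := eqVneq a 0.
    by apply: (iS0 b Sb); apply: span_eq sa => x _; rewrite a0 mul0r subr0.
  apply: nu; apply: Us; have : span X U (fun x => b x - a * u x).
    by apply: span_sub sa => c [Sc _]; apply: span_mem; exact: S0U.
  move=> /(spanB (span_mem X (S0U _ Sb)))/(spanZ a^-1); apply: span_eq => x _.
  by rewrite subKr mulKf.
have [//|S [S0S _ iS sS]] := @basis_extend K T X _ (fun=> True) iS0u.
have [lam lamP] := coord_exists iS (fun u => sS u I).
have Su : S u by apply: S0S; right.
have [lD lZ l1 l0] := lamP u Su; exists (lam u); split=> //.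
move=> v /sS0 sv; apply: l0; apply: span_sub sv => c Sc; apply: span_mem.
split; first by apply: S0S; left.
by move=> cu; apply: nu; rewrite -cu; exact: S0U.
Qed.

End Coordinates.

(** * Finitely supported sums and fixed points of p-groups *)

Section FiniteSums.
Local Open Scope ring_scope.
Variables (R : nzRingType) (T : choiceType).
Implicit Types (q : T -> R) (r : seq T).

Definition finsupp q := exists r, forall t, q t != 0 -> t \in r.

Definition fsum q : R := if pselect (finsupp q) is left h
  then \sum_(t <- undup (sval (cid h))) q t else 0.

Lemma sum_support q r r' : uniq r -> uniq r' ->
  (forall t, q t != 0 -> t \in r) -> (forall t, q t != 0 -> t \in r') ->
  \sum_(t <- r) q t = \sum_(t <- r') q t.
Proof.
have flt r0 : \sum_(t <- r0) q t = \sum_(t <- [seq t <- r0 | q t != 0]) q t.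
  rewrite big_filter [RHS]big_mkcond /=; apply: eq_bigr => t _.
  by case: eqP.
move=> ur ur' qr qr'; rewrite flt [RHS]flt; apply: perm_big.
apply: uniq_perm; rewrite ?filter_uniq// => t; rewrite !mem_filter.
by case: (boolP (q t != 0)) => //= qt; rewrite qr// qr'.
Qed.

Lemma fsumE q r : uniq r -> (forall t, q t != 0 -> t \in r) ->
  fsum q = \sum_(t <- r) q t.
Proof.
move=> ur qr; rewrite /fsum; case: pselect => [h|[]]; last by exists r.
apply: sum_support; rewrite ?undup_uniq// => t qt.
by rewrite mem_undup; apply: (svalP (cid h)).
Qed.

Lemma finsupp_uniq q : finsupp q -> exists2 r, uniq r & forall t, q t != 0 -> t \in r.
Proof.
move=> [r qr]; exists (undup r); first exact: undup_uniq.
by move=> t; rewrite mem_undup; exact: qr.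
Qed.

Lemma fsum0 q : (forall t, q t = 0) -> fsum q = 0.
Proof.
by move=> q0; rewrite (@fsumE q [::])// ?big_nil// => t; rewrite q0 eqxx.
Qed.

Lemma fsumD q q' : finsupp q -> finsupp q' ->
  fsum (fun t => q t + q' t) = fsum q + fsum q'.
Proof.
move=> [r qr] [r' qr']; pose s := undup (r ++ r').
have us : uniq s by exact: undup_uniq.
have qs t : q t != 0 -> t \in s by move/qr => tr; rewrite mem_undup mem_cat tr.
have qs' t : q' t != 0 -> t \in s by move/qr' => tr; rewrite mem_undup mem_cat tr orbT.
rewrite (fsumE us qs) (fsumE us qs') -big_split /= (@fsumE _ s)// => t.
have [qt|/qs//] := eqVneq (q t) 0; rewrite qt add0r; exact: qs'.
Qed.

Lemma fsumZ c q : finsupp q -> fsum (fun t => c * q t) = c * fsum q.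
Proof.
move=> /finsupp_uniq[r ur qr]; rewrite (fsumE ur qr) mulr_sumr (@fsumE _ r)// => t.
by move=> cq; apply: qr; apply: contra_neq cq => ->; rewrite mulr0.
Qed.

Lemma fsum_reindex q (h h' : T -> T) : cancel h h' -> cancel h' h -> finsupp q ->
  fsum (fun t => q (h t)) = fsum q.
Proof.
move=> hK h'K /finsupp_uniq[r ur qr]; rewrite (fsumE ur qr) (@fsumE _ (map h' r)).
- by rewrite big_map; apply: eq_bigr => t _; rewrite h'K.
- by rewrite map_inj_uniq//; exact: can_inj h'K.
- by move=> t /qr tr; apply/mapP; exists (h t).
Qed.

Lemma fsum_point q s : (forall t, t != s -> q t = 0) -> fsum q = q s.
Proof.
move=> qs; rewrite (@fsumE q [:: s])//; first by rewrite big_seq1.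
by move=> t; apply: contraNT; rewrite inE => /qs ->.
Qed.

End FiniteSums.

Section FixedPoints.
Local Open Scope ring_scope.
Variables (p : nat) (p_pr : prime p) (gT : finGroupType).

(** Each level set of [q] at a nonzero value is a D-set without fixed points, so its cardinality is
    divisible by p. *)
Lemma sum_no_fixed (T : finType) (D : {group gT}) (to : {action gT &-> T})
    (q : T -> 'F_p) : (p.-group D)%g ->
  (forall d x, d \in D -> q (to x d) = q x) ->
  (forall x, (forall d, d \in D -> to x d = x) -> q x = 0) ->
  \sum_x q x = 0.
Proof.
move=> Dp qD q0.
rewrite (partition_big q xpredT)//= big1// => a _.
have [->|a0] := eqVneq a 0; first by rewrite big1// => x /eqP.
rewrite (eq_bigr (fun=> a)) => [|x /eqP//].
rewrite sumr_const -mulr_natr; set S := [set x | q x == a].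
have -> : #|[pred x | q x == a]| = #|S| by apply: eq_card => x; rewrite !inE.
have SD : [acts D, on S | to].
  by apply/actsP => d dD x; rewrite !inE qD.
have := pgroup_fix_mod Dp SD.
have -> : #|'Fix_(S | to)(D)%g| = 0%N.
  apply/eqP; rewrite cards_eq0; apply/eqP/setP => x.
  rewrite finset.in_setI finset.in_set0; apply/negP => /andP[xS /afixP fx].
  move/eqP: a0; apply; move: xS; rewrite finset.inE => /eqP <-.
  by apply: q0 => d dD; exact: fx.
rewrite mod0n => /eqP Sp; have /eqP -> : (#|S|%:R == 0 :> 'F_p).
  by rewrite -(dvdn_pcharf (pchar_Fp p_pr)).
by rewrite mulr0.
Qed.

Section Action.
Variables (T : choiceType) (act : gT -> T -> T) (D : {group gT}).
Hypothesis act1 : forall t, act 1%g t = t.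
Hypothesis actM : forall g h t, act (g * h)%g t = act g (act h t).

Lemma fsum_no_fixed (q : T -> 'F_p) : (p.-group D)%g -> finsupp q ->
  (forall d t, d \in D -> q (act d t) = q t) ->
  (forall t, (forall d, d \in D -> act d t = t) -> q t = 0) ->
  fsum q = 0.
Proof.
move=> Dp [r qr] qD q0.
(* The support is saturated under the whole group, which gives a finite set on which the group
   acts. *)
pose r' := undup [seq act g t | g <- enum gT, t <- r].
have r'P t : reflect (exists g u, u \in r /\ t = act g u) (t \in r').
  rewrite mem_undup; apply: (iffP allpairsP) => [[[g u] /= [_ ur ->]]|[g [u [ur ->]]]].
    by exists g, u.
  by exists (g, u); rewrite mem_enum.
have r'_act g t : t \in r' -> act g t \in r'.
  by move=> /r'P[h [u [ur ->]]]; apply/r'P; exists (g * h)%g, u.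
have rr' t : t \in r -> t \in r' by move=> tr; apply/r'P; exists 1%g, t.
pose to (x : seq_sub r') g := insubd x (act g^-1%g (val x)).
have toE x g : val (to x g) = act g^-1%g (val x).
  by rewrite /to val_insubd r'_act// (valP x).
have to1 : to^~ 1%g =1 id by move=> x; apply: val_inj; rewrite toE invg1.
have toM x : act_morph to x.
  by move=> g h; apply: val_inj; rewrite !toE invMg actM.
rewrite (@fsumE _ _ q r') ?undup_uniq//; last by move=> t /qr/rr'.
have -> : \sum_(t <- r') q t = \sum_(x : seq_sub r') q (val x).
  rewrite -(big_map val xpredT q); apply: perm_big; apply: uniq_perm.
  - exact: undup_uniq.
  - by rewrite map_inj_uniq ?index_enum_uniq//; exact: val_inj.
  - move=> t; apply/idP/mapP => [tr|[x _ ->]]; last exact: valP.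
    by exists (SeqSub tr) => //; rewrite mem_index_enum.
apply: (sum_no_fixed (to := TotalAction to1 toM) Dp) => /=.
  by move=> d x dD; rewrite toE qD ?groupV.
move=> x fx; apply: q0 => d dD; have := congr1 val (fx d^-1%g _).
by rewrite toE invgK groupV; apply.
Qed.

Definition difference (a : nat -> 'F_p) n := a n.+1 - a n.

(** The p-th power of the difference operator has the coefficients of (X - 1)^p, which is X^p - 1 in
    characteristic p. *)
Lemma difference_power (a : nat -> 'F_p) :
  iter p difference a 0%N = a p - a 0%N.
Proof.
pose Q k : {poly 'F_p} := ('X - 1) ^+ k.
have key k n : (k <= p)%N ->
    iter k difference a n = \sum_(i < p.+1) (Q k)`_i * a (n + i)%N.
  elim: k n => [|k IH] n kp.
    rewrite /Q expr0 big_ord_recl coef1 mul1r addn0 big1 ?addr0// => i _.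
    by rewrite coef1 mul0r.
  have sQ : size (Q k) = k.+1 by rewrite /Q -polyC1 size_exp_XsubC.
  rewrite iterS -[LHS]/(iter k difference a n.+1 - iter k difference a n).
  rewrite (IH n.+1 (ltnW kp)) (IH n (ltnW kp)).
  have -> : Q k.+1 = ('X - 1) * Q k by rewrite /Q exprS.
  have E i : (('X - 1) * Q k)`_i * a (n + i)%N =
      ('X * Q k)`_i * a (n + i)%N - (Q k)`_i * a (n + i)%N.
    by rewrite mulrBl mul1r coefB mulrBl.
  rewrite [RHS](eq_bigr _ (fun (i : 'I_p.+1) _ => E i)) sumrB; congr (_ - _).
  rewrite big_ord_recr /= [RHS]big_ord_recl coefXM mul0r add0r.
  rewrite [(Q k)`_p]nth_default ?sQ// mul0r addr0.
  by apply: eq_bigr => i _; rewrite coefXM addSnnS.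
rewrite key//.
have -> : Q p = 'X^p - 1.
  have pp : ([pchar {poly 'F_p}].-nat p)%N.
    rewrite (eq_pnat _ (pchar_poly _)).
    by rewrite pnatE// pchar_Fp.
  by rewrite /Q exprDn_pchar// exprNn_pchar// expr1n.
have E i : ('X^p - 1 : {poly 'F_p})`_i = (i == p)%:R - (i == 0%N)%:R.
  by rewrite coefB coefXn coef1.
rewrite (eq_bigr _ (fun (i : 'I_p.+1) _ => congr1 (fun c => c * a i) (E i))).
have p0 := prime_gt0 p_pr.
rewrite (bigD1 ord_max)//= (bigD1 ord0)/=; last by rewrite -val_eqE /= ltn_eqF.
rewrite !eqxx (gtn_eqF p0) (ltn_eqF p0) subr0 mul1r sub0r mulN1r.
rewrite big1 ?addr0// => i /andP[ip i0].
have -> : (i == p :> nat) = false by apply/negbTE; apply: contra ip => /eqP ep; apply/eqP/val_inj.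
have -> : (i == 0%N :> nat) = false by apply/negbTE; apply: contra i0 => /eqP e0; apply/eqP/val_inj.
by rewrite subrr mul0r.
Qed.

End Action.

(** Valid in infinite dimension: on the vectors fixed by a normal subgroup C of index p, the
    operator b - 1 satisfies (b - 1)^p = b^p - 1 = 0, so the last nonzero iterate is fixed by [b] as
    well. *)
Lemma fixed_vector (T : Type) (act : gT -> T -> T) (U : (T -> 'F_p) -> Prop)
    (D : {group gT}) : (p.-group [set: gT])%g ->
  (forall t, act 1%g t = t) ->
  (forall g h t, act (g * h)%g t = act g (act h t)) ->
  (forall u v, U u -> U v -> U (fun x => u x - v x)) ->
  (forall d u, d \in D -> U u -> U (fun x => u (act d x))) ->
  (exists2 u, U u & exists x, u x <> 0) ->
  exists u, [/\ U u, exists x, u x <> 0 &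
    forall d x, d \in D -> u (act d x) = u x].
Proof.
move=> gTp act1 actM UB UD [u0 Uu0 nu0].
have [m] := ubnP #|D|; elim: m D UD => // m IH D UD Dm.
have [D1|nD1] := eqVneq D 1%G.
  by exists u0; split=> // d x; rewrite D1 => /set1P ->; rewrite act1.
have [|C [_ CD iC]] := @pgroup_max p gT gTp 1%G D.
  by rewrite proper1G; apply: contra nD1 => /eqP D1; apply/eqP/val_inj.
have [b bD] := ex_moved p_pr CD iC; have [bB bC] := finset.setDP bD.
have [||u [Uu [x0 ux0] uC]] := IH C.
- by move=> d u dC; apply: UD; apply: (fintype.subsetP (normal_sub CD)).
- by rewrite -ltnS (leq_trans _ Dm)// ltnS -(Lagrange (normal_sub CD)) iC
    ltn_Pmulr ?prime_gt1.
pose tau (u : T -> 'F_p) x := u (act b x) - u x.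
have tauU k : U (iter k tau u).
  by elim: k => //= k Uk; apply: UB => //; exact: UD.
have bN := fintype.subsetP (normal_norm CD) b bB.
have tS k y : iter k.+1 tau u y = iter k tau u (act b y) - iter k tau u y by [].
have tauC k c x : c \in C -> iter k tau u (act c x) = iter k tau u x.
  elim: k c x => [|k IHk] c x cC; first exact: uC.
  rewrite !tS (IHk c x cC); congr (_ - _).
  rewrite -actM; have -> : (b * c = (c ^ b^-1) * b)%g by rewrite conjgE invgK !mulgA mulgVK.
  by rewrite actM IHk// memJ_norm// groupV.
have tau_p x : iter p tau u x = 0.
  have it k n : iter k tau u (act (b ^+ n)%g x) =
      iter k difference
        (fun n => u (act (b ^+ n)%g x)) n.
    elim: k n => // k IHk n; rewrite tS -actM -expgS (IHk n) (IHk n.+1).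
    by [].
  have := it p 0%N; rewrite expg0 act1 => ->.
  rewrite difference_power// expg0 act1 uC ?subrr//.
  exact: (prime_index_expP CD iC bB).
have [k [[x kx] kz]] : exists k, (exists x, iter k tau u x <> 0) /\
    forall x, iter k.+1 tau u x = 0.
  apply: contrapT => H.
  have nz k : exists x, iter k tau u x <> 0.
    elim: k => [|k IHk]; first by exists x0.
    apply: contrapT => h; apply: H; exists k; split=> // x.
    by apply: contrapT => hx; apply: h; exists x.
  by have [x] := nz p; rewrite tau_p.
exists (iter k tau u); split=> //; first by exists x.
have bk y : iter k tau u (act b y) = iter k tau u y by apply: subr0_eq; exact: kz.
move=> d y dD; have [i [c cC ->]] := prime_index_mem p_pr CD iC bD dD.
rewrite actM tauC//; elim: i => [|i IHi]; first by rewrite act1.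
by rewrite expgS actM bk.
Qed.

End FixedPoints.

Lemma fsum_sum (R : nzRingType) (T : choiceType) (I : Type) (r : seq I)
    (f : I -> T -> R) : (forall i, finsupp (f i)) ->
  fsum (fun t => \sum_(i <- r) f i t)%R = (\sum_(i <- r) fsum (f i))%R.
Proof.
move=> fs; suff: finsupp (fun t => \sum_(i <- r) f i t)%R /\
    fsum (fun t => \sum_(i <- r) f i t)%R = (\sum_(i <- r) fsum (f i))%R by case.
elim: r => [|i r [sr IH]].
  split; first by exists [::] => t; rewrite big_nil eqxx.
  by rewrite big_nil fsum0// => t; rewrite big_nil.
have E : (fun t => \sum_(j <- i :: r) f j t)%R = (fun t => f i t + \sum_(j <- r) f j t)%R.
  by apply/funext => t; rewrite big_cons.
rewrite E fsumD// IH big_cons; split=> //.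
have [a af] := fs i; have [b bf] := sr; exists (a ++ b) => t; rewrite mem_cat => h.
have [/eqP fi|/af ->//] := boolP (f i t == 0)%R.
by move: h; rewrite fi add0r => /bf ->; rewrite orbT.
Qed.

Lemma prime_index_sum (p : nat) (p_pr : prime p) (gT : finGroupType)
    (B C : {group gT}) b y : (C <| B)%g -> #|B : C|%g = p -> b \in B :\: C ->
  y \in B -> (\sum_(i < p) ((b ^+ i * y)%g \in C)%:R = 1 :> 'F_p)%R.
Proof.
move=> CB iC bD yB; have [i ip iC'] := prime_index_coset p_pr CB iC bD yB.
have bB := (finset.setDP bD).1.
rewrite (bigD1 (Ordinal ip))//= iC' big1 ?addr0// => k ki.
case: (boolP ((b ^+ k * y)%g \in C)) => // kC; case/eqP: ki; apply: val_inj => /=.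
have : ((b ^+ i * y) * (b ^+ k * y)^-1)%g \in C by rewrite groupM ?groupV.
rewrite invMg mulgA mulgK => bC.
have ltp (m n : nat) : m < p -> n < m -> (b ^+ m * (b ^+ n)^-1)%g \in C -> False.
  move=> mp nm; rewrite -expgnFr ?(ltnW nm)// => /(prime_index_exp p_pr CB iC bD).
  move=> /dvdn_leq; rewrite subn_gt0 => /(_ nm).
  by rewrite leqNgt (leq_ltn_trans (leq_subr _ _)).
case: (ltngtP (val k) i) => // [ki|ik]; first by case: (ltp i k).
case: (ltp k i) => //; rewrite -groupV invMg invgK; exact: bC.
Qed.

(** The sum over B is cut into the cosets C b^i; a given x belongs to exactly one of them. *)
Lemma sum_prime_index (p : nat) (p_pr : prime p) (gT : finGroupType)
    (B C : {group gT}) b (f : gT -> 'F_p) : (C <| B)%g -> #|B : C|%g = p ->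
  b \in B :\: C ->
  (\sum_(x in B) f x = \sum_(i < p) \sum_(y in C) f (y * b ^+ i)%g)%R.
Proof.
move=> CB iC bD; have bB := (finset.setDP bD).1.
have step i : (\sum_(y in C) f (y * b ^+ i)%g =
    \sum_(x in B) ((b ^+ i * x^-1)%g \in C)%:R * f x)%R.
  rewrite [RHS](reindex_inj (mulIg (b ^+ i)%g)) /= [RHS]big_mkcond [LHS]big_mkcond /=.
  apply: eq_bigr => y _; rewrite groupMr ?groupX// invMg mulKVg groupV.
  have [yC|yC] := boolP (y \in C); last by rewrite mul0r; case: ifP.
  by rewrite mul1r (fintype.subsetP (normal_sub CB)).
rewrite [RHS](eq_bigr _ (fun (i : 'I_p) _ => step i)) exchange_big /=.
apply: eq_bigr => x xB; rewrite -mulr_suml.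
by rewrite (prime_index_sum p_pr CB iC bD) ?mul1r// groupV.
Qed.

(** * A basis permuted by the finite p-group *)

Section PermBasis.
Local Open Scope ring_scope.
Variables (p : nat) (p_pr : prime p) (gT : finGroupType).
Hypothesis gTp : (p.-group [set: gT])%g.
Variables (F : lgroup p) (act : gT -> F -> F).
Hypothesis act1 : forall x, act 1%g x = x.
Hypothesis actG : forall g h x, act (g * h)%g x = act g (act h x).
Hypothesis actM : forall g x y, act g (x * y)%g = (act g x * act g y)%g.
Hypothesis act_c : forall g i, exists j, forall x, lpi j x = 1%g -> lpi i (act g x) = 1%g.
Variable Bf : {group gT} -> F -> Prop.
Hypothesis Bf_group : forall A, lsubgroup (Bf A).
Hypothesis Bf_closed : forall A, lclosed (Bf A).
Hypothesis Bf_all : forall x, Bf 1%G x.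
Hypothesis Bf_fix : forall (A : {group gT}) a x, Bf A x -> a \in A -> act a x = x.
Hypothesis Bf_act : forall (A : {group gT}) g x, Bf A x -> Bf (A :^ g^-1)%G (act g x).
Hypothesis Bf_sub : forall (A A' : {group gT}) x, A \subset A' -> Bf A' x -> Bf A x.

Implicit Types (m y z : F -> 'F_p) (A C D : {group gT}) (S : F -> Prop) (s t x u : F).

Definition inv_on D A m := forall d x, d \in D -> Bf A x -> m (act d x) = m x.

(** With [transfer] below, this is all that Smith theory contributes: [Bf A] stands for the group of
    the A-fixed subcomplex, [extend] makes restriction from [Bf A] to [Bf D] onto already on
    D-invariants, and [transfer] makes D-invariant homomorphisms that vanish on the more fixed
    subgroups norms from index p. *)
Hypothesis extend : forall A D m, (A <| D)%g -> lhom m ->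
  exists m', [/\ lhom m', inv_on D A m' & forall x, Bf D x -> m' x = m x].
Hypothesis transfer : forall A C D b m, A \subset C -> (C <| D)%g -> #|D : C|%g = p ->
  b \in D :\: C -> (D \subset 'N(A))%g -> lhom m -> inv_on D A m ->
  (forall D' : {group gT}, A \proper D' -> D' \subset D -> forall x, Bf D' x -> m x = 0) ->
  exists y, [/\ lhom y, inv_on C A y &
    forall x, Bf A x -> m x = \sum_(i < p) y (act (b ^+ i)%g x)].

Lemma actK g : cancel (act g) (act g^-1%g).
Proof. by move=> x; rewrite -actG mulVg act1. Qed.

Lemma actVK g : cancel (act g^-1%g) (act g).
Proof. by move=> x; rewrite -actG mulgV act1. Qed.

Lemma act_1 g : act g 1%g = 1%g.
Proof. by apply: (@mulgI _ (act g 1%g)); rewrite -actM !mulg1. Qed.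

Lemma lhom_act g m : lhom m -> lhom (fun x => m (act g x)).
Proof.
move=> [mM [i mi]]; split=> [x y|]; first by rewrite actM mM.
by have [j ij] := act_c g i; exists j => x /ij/mi.
Qed.

Lemma Bf_norm A g x : g \in ('N(A))%g -> Bf A x -> Bf A (act g x).
Proof.
move=> gN /(Bf_act g); have -> // : (A :^ g^-1)%G = A.
by apply/val_inj/normP; rewrite groupV.
Qed.

Definition fx (A : {set gT}) s := forall a, a \in A -> act a s = s.
Definition converging (T0 : F -> Prop) := forall i, exists r : seq F,
  forall s, T0 s -> lpi i s <> 1%g -> s \in r.
Definition lifts (T0 : F -> Prop) := forall s, T0 s -> exists m, lhom m /\
  forall t, T0 t -> m t = (t == s)%:R.
Definition res (T0 : F -> Prop) m t : 'F_p := if `[< T0 t >] then m t else 0.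

Lemma resE (T0 : F -> Prop) m t : T0 t -> res T0 m t = m t.
Proof. by move=> Tt; rewrite /res asboolT. Qed.

Lemma resN (T0 : F -> Prop) m t : ~ T0 t -> res T0 m t = 0.
Proof. by move=> Tt; rewrite /res asboolF. Qed.

Lemma lhom_finsupp (T0 : F -> Prop) m : converging T0 -> lhom m -> finsupp (res T0 m).
Proof.
move=> Tc [_ [i mi]]; have [r rP] := Tc i; exists r => t.
have [Tt|Tt] := pselect (T0 t); last by rewrite resN// eqxx.
by rewrite resE// => mt; apply: rP => // /mi m0; rewrite m0 eqxx in mt.
Qed.

Lemma finsuppM (q q' : F -> 'F_p) : finsupp q -> finsupp (fun t => q t * q' t).
Proof.
move=> [r qr]; exists r => t h; apply: qr; apply: contra_neq h => ->.
by rewrite mul0r.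
Qed.

Lemma finsupp_le (q q' : F -> 'F_p) : finsupp q ->
  (forall t, q t = 0 -> q' t = 0) -> finsupp q'.
Proof.
move=> [r qr] qq; exists r => t h; apply: qr; apply: contra_neq h; exact: qq.
Qed.

Lemma lift_comb (T0 : F -> Prop) (q : F -> 'F_p) : lifts T0 -> finsupp (res T0 q) ->
  exists m, lhom m /\ forall t, T0 t -> m t = q t.
Proof.
move=> lT /finsupp_uniq[r ur qr].
pose d s := if pselect (T0 s) is left h then sval (cid (lT s h)) else fun=> 0.
have dl s : lhom (d s).
  rewrite /d; case: pselect => [h|_]; last exact: lhom0.
  by case: (svalP (cid (lT s h))).
have dE s t : T0 s -> T0 t -> d s t = (t == s)%:R.
  move=> Ts Tt; rewrite /d; case: pselect => [h|//].
  by case: (svalP (cid (lT s h))) => _ ->.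
exists (fun x => \sum_(s <- r) res T0 q s * d s x); split.
  by apply: lhom_sum => s; exact: lhomZ.
move=> t Tt; have [tr|tr] := boolP (t \in r).
  rewrite (bigD1_seq t)//= dE// eqxx mulr1 resE// big1 ?addr0// => s st.
  have [Ts|Ts] := pselect (T0 s); last by rewrite resN// mul0r.
  by rewrite dE// eq_sym (negPf st) mulr0.
have qt : q t = 0 by apply/eqP; apply: contraNT tr => h; apply: qr; rewrite resE.
rewrite qt big_seq big1// => s sr.
have [Ts|Ts] := pselect (T0 s); last by rewrite resN// mul0r.
by rewrite dE//; case: eqP => [ts|_]; [rewrite ts sr in tr|rewrite mulr0].
Qed.

(* Either the restrictions to T0 of the homs realise all point masses, or some
   functional kills all of them; the p-group then fixes such a functional. *)
Lemma dual_fixed (D : {group gT}) (T0 : F -> Prop) : converging T0 ->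
  (forall g t, g \in D -> T0 t -> T0 (act g t)) ->
  lifts T0 \/ exists psi : F -> 'F_p, [/\ exists2 s, T0 s & psi s <> 0,
    forall t, ~ T0 t -> psi t = 0,
    forall g t, g \in D -> psi (act g t) = psi t &
    forall m, lhom m -> fsum (fun t => m t * psi t) = 0].
Proof.
move=> Tc TD; have [|/existsNP[s /not_implyP[Ts ns]]] := pselect (lifts T0); first by left.
right; pose del s : F -> 'F_p := fun t => (t == s)%:R.
pose UI (u : F -> 'F_p) := exists m, lhom m /\ forall t, T0 t -> u t = m t.
have UIs (u : F -> 'F_p) : span T0 UI u -> UI u.
  elim=> {u} [u u0|a b u v [m [hm bm]] _ [m' [hm' vm]] uv].
    by exists (fun=> 0); split=> //; exact: lhom0.
  exists (fun x => a * m x + m' x); split; first by apply: lhomD => //; exact: lhomZ.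
  by move=> t Tt; rewrite uv// bm// vm.
have nds : ~ UI (del s).
  by move=> [m [hm sm]]; apply: ns; exists m; split=> // t Tt; rewrite -sm.
have [lam [lD lZ lU l1]] := separating_form UIs nds.
have l_eq (u v : F -> 'F_p) : (forall t, T0 t -> u t = v t) -> lam u = lam v.
  move=> uv; apply/eqP; rewrite -subr_eq0 -mulN1r -lZ -lD; apply/eqP; apply: lU.
  by exists (fun=> 0); split; [exact: lhom0|move=> t Tt; rewrite uv// mulN1r subrr].
have l_sum r (c : F -> 'F_p) :
    lam (fun x => \sum_(t <- r) c t * del t x) = \sum_(t <- r) c t * lam (del t).
  elim: r => [|t r IH].
    rewrite big_nil; apply: lU; exists (fun=> 0); split; first exact: lhom0.
    by move=> t _; rewrite big_nil.
  rewrite big_cons -IH -lZ -lD; congr lam; apply/funext => x.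
  by rewrite big_cons.
pose psi0 t : 'F_p := res T0 (fun t => lam (del t)) t.
pose U (psi : F -> 'F_p) := (forall t, ~ T0 t -> psi t = 0) /\
  forall m, lhom m -> fsum (fun t => m t * psi t) = 0.
have fs m (psi : F -> 'F_p) : lhom m -> (forall t, ~ T0 t -> psi t = 0) ->
    finsupp (fun t => m t * psi t).
  move=> hm p0; apply: finsupp_le (lhom_finsupp Tc hm) _ => t.
  have [Tt|Tt] := pselect (T0 t); last by rewrite p0// mulr0.
  by rewrite resE// => ->; rewrite mul0r.
have [|||psi [[pT pm] [x px] pD]] := @fixed_vector p p_pr gT F act U D gTp act1 actG.
- move=> u v [uT um] [vT vm]; split=> [t Tt|m hm]; first by rewrite uT ?vT ?subrr.
  have -> : (fun t => m t * (u t - v t)) = fun t => m t * u t + (-1) * (m t * v t).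
    by apply/funext => t; rewrite mulrBr mulN1r.
  rewrite fsumD; [|exact: fs|].
    by rewrite fsumZ ?um ?vm ?mulr0 ?addr0//; exact: fs.
  by apply: finsupp_le (fs m v hm vT) _ => t ->; rewrite mulr0.
- move=> d u dD [uT um]; split=> [t Tt|m hm].
    by apply: uT => h; apply: Tt; rewrite -(actK d t); apply: TD => //; rewrite groupV.
  have hm' := lhom_act d^-1%g hm.
  rewrite -(um _ hm') -[RHS](fsum_reindex (actK d) (actVK d)); last exact: fs.
  by congr fsum; apply/funext => t; rewrite actK.
- exists psi0; last by exists s; rewrite /psi0 resE// l1; apply/eqP/oner_neq0.
  split=> [t Tt|m hm]; first exact: resN.
  have [r ur mr] := finsupp_uniq (lhom_finsupp Tc hm).
  rewrite (@fsumE _ _ _ r)//; last first.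
    move=> t h; apply: mr; apply: contra_neq h.
    have [Tt|Tt] := pselect (T0 t); first by rewrite resE// => ->; rewrite mul0r.
    by move=> _; rewrite /psi0 resN// mulr0.
  transitivity (lam (fun x => \sum_(t <- r) res T0 m t * del t x)).
    rewrite l_sum; apply: eq_bigr => t _.
    have [Tt|Tt] := pselect (T0 t); first by rewrite /psi0 !resE.
    by rewrite /psi0 !resN// ?mulr0 ?mul0r.
  transitivity (lam m); last by apply: lU; exists m.
  apply: l_eq => t Tt; rewrite -(resE m Tt); have [tr|tr] := boolP (t \in r).
    rewrite (bigD1_seq t)//= /del eqxx mulr1 big1 ?addr0// => u ut.
    by rewrite eq_sym (negPf ut) mulr0.
  have -> : res T0 m t = 0 by apply/eqP; apply: contraNT tr => h; exact: mr.
  rewrite big_seq big1// => u ur'; rewrite /del.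
  by case: eqP => [tu|_]; [rewrite tu ur' in tr|rewrite mulr0].
exists psi; split=> //.
by exists x => //; apply: contrapT => Tx; apply: px; exact: pT.
Qed.

Lemma norm_inv A C D b m : (C <| D)%g -> #|D : C|%g = p -> b \in D :\: C ->
  (D \subset 'N(A))%g -> inv_on C A m ->
  inv_on D A (fun x => \sum_(i < p) m (act (b ^+ i)%g x)).
Proof.
move=> CD iC bD /fintype.subsetP DA mC; have bB := (finset.setDP bD).1.
have BX i x : Bf A x -> Bf A (act (b ^+ i)%g x).
  by apply: Bf_norm; rewrite groupX// DA.
have invC c x : c \in C -> Bf A x ->
    \sum_(i < p) m (act (b ^+ i)%g (act c x)) = \sum_(i < p) m (act (b ^+ i)%g x).
  move=> cC Bx; apply: eq_bigr => i _; rewrite -actG.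
  have -> : (b ^+ i * c = (c ^ (b ^+ i)^-1) * b ^+ i)%g.
    by rewrite conjgE invgK !mulgA mulgVK.
  rewrite actG mC//; last exact: BX.
  by rewrite memJ_norm// groupV groupX// (fintype.subsetP (normal_norm CD)).
have invb x : Bf A x -> \sum_(i < p) m (act (b ^+ i)%g (act b x)) =
    \sum_(i < p) m (act (b ^+ i)%g x).
  move=> Bx.
  have bp : (b ^+ p)%g \in C by exact: (prime_index_expP CD iC bB).
  transitivity (\sum_(i < p) m (act (b ^+ i.+1)%g x)).
    by apply: eq_bigr => i _; rewrite -actG -expgSr.
  suff sh q : (0 < q)%N -> (b ^+ q)%g \in C ->
      \sum_(i < q) m (act (b ^+ i.+1)%g x) = \sum_(i < q) m (act (b ^+ i)%g x).
    by apply: sh => //; exact: prime_gt0.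
  case: q => // q _ bq.
  rewrite big_ord_recr [RHS]big_ord_recl addrC /=; congr (_ + _).
  by rewrite mC// act1.
move=> d x dD Bx; have [i [c cC ->]] := prime_index_mem p_pr CD iC bD dD.
rewrite actG invC//; last exact: BX.
elim: i => [|i IH]; first by rewrite act1.
by rewrite expgS actG invb//; exact: BX.
Qed.

(** The A-fixed members of [S] form a basis of [Bf A] dual to the homomorphisms of F: they lie in
    it, they detect homomorphisms, and each of them has a dual homomorphism. *)
Definition ok S A := [/\ forall s, S s -> fx A s -> Bf A s,
  forall m, lhom m -> (forall s, S s -> fx A s -> m s = 0) ->
    forall x, Bf A x -> m x = 0 &
  lifts (fun s => S s /\ fx A s)].

Section Step.
Variables (A : {group gT}) (S : F -> Prop).
Hypothesis S_act : forall g s, S s -> S (act g s).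
Hypothesis S_conv : converging S.
Hypothesis S_ok : forall D, A \proper D -> ok S D.
Hypothesis S_big : forall s, S s -> fx A s -> exists D : {group gT}, A \proper D /\ fx D s.

Let SA s := S s /\ fx A s.

Lemma SA_Bf s : SA s -> Bf A s.
Proof.
move=> [Ss As]; have [D [AD Ds]] := S_big Ss As.
by have [DB _ _] := S_ok AD; apply: Bf_sub (DB s Ss Ds); exact: proper_sub.
Qed.

Lemma SA_conv : converging SA.
Proof. by move=> i; have [r rP] := S_conv i; exists r => s [/rP]. Qed.

Lemma SA_norm g s : g \in ('N(A))%g -> SA s -> SA (act g s).
Proof.
move=> gN [Ss As]; split=> [|a aA]; first exact: S_act.
rewrite -actG; have -> : (a * g = g * a ^ g)%g by rewrite conjgE mulKVg.
by rewrite actG As// memJ_norm.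
Qed.

(** Otherwise some nonzero N(A)-invariant [psi] annihilates all homomorphisms. If [psi] is nonzero
    at [s], take D to be the normalizer of A in a larger group fixing [s]: this D is larger than A,
    and a D-invariant homomorphism that is dual to [s] on D-fixed members exists. Summing it against
    [psi] over D-orbits modulo p leaves only [psi s], which must then be 0. *)
Lemma lift_delta : lifts SA.
Proof.
have [//|[psi [[s Ss ps] pT pN pm]]] :=
  dual_fixed (D := 'N(A)%G) SA_conv (fun g t gN => SA_norm gN).
have [D0 [AD0 D0s]] := S_big Ss.1 Ss.2.
have D0p : (p.-group D0)%g by exact: pgroupS (finset.subsetT _) gTp.
pose D := 'N_D0(A)%G.
have AD : A \proper D by apply: nilpotent_proper_norm => //; exact: pgroup_nil D0p.
have nAD : (A <| D)%g.
  by rewrite /normal proper_sub//=; apply: subsetIr.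
have Ds : fx D s by move=> a /setIP[/D0s].
have [_ _ lD] := S_ok AD; have [m0 [hm0 m0s]] := lD s (conj Ss.1 Ds).
have [m [hm mD mm0]] := extend nAD hm0.
have DN : D \subset ('N(A))%g by exact: normal_norm.
have Dp : (p.-group D)%g by exact: pgroupS (finset.subsetT _) gTp.
have mps : finsupp (fun t => m t * psi t).
  apply: finsupp_le (lhom_finsupp SA_conv hm) _ => t.
  have [Tt|Tt] := pselect (SA t); last by rewrite pT// mulr0.
  by rewrite resE// => ->; rewrite mul0r.
have dls : finsupp (fun t => (t == s)%:R * (- psi s)).
  by exists [:: s] => t; rewrite inE; case: (t == s) => //; rewrite mul0r eqxx.
have : fsum (fun t => m t * psi t + (t == s)%:R * (- psi s)) = 0.
  apply: (@fsum_no_fixed p p_pr gT F act D act1 actG _ Dp).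
  - have [a af] := mps; have [b bf] := dls; exists (a ++ b) => t; rewrite mem_cat => h.
    have [/eqP fi|/af ->//] := boolP (m t * psi t == 0).
    by move: h; rewrite fi add0r => /bf ->; rewrite orbT.
  - move=> d t dD; rewrite pN ?(fintype.subsetP DN)//.
    have -> : (act d t == s) = (t == s).
      apply/eqP/eqP => [e|->]; last exact: Ds.
      by rewrite -(actK d t) e; apply: Ds; rewrite groupV.
    have [Tt|Tt] := pselect (SA t); last by rewrite pT// !mulr0.
    by rewrite mD//; exact: SA_Bf.
  - move=> t fxt; have [Tt|Tt] := pselect (SA t).
      have Dt : S t /\ fx D t by split=> //; case: Tt.
      rewrite mm0; last by have [h _ _] := S_ok AD; apply: h; case: Dt.
      rewrite m0s//; case: eqP => [->|_]; first by rewrite !mul1r subrr.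
      by rewrite !mul0r addr0.
    rewrite pT// mulr0 add0r; case: eqP => [ts|_]; last by rewrite mul0r.
    by rewrite ts in Tt.
rewrite fsumD// pm// add0r (@fsum_point _ _ _ s); last first.
  by move=> t /negPf ->; rewrite mul0r.
by rewrite eqxx mul1r => /eqP; rewrite oppr_eq0 => /eqP.
Qed.

Lemma stab_in_group_set D s : group_set [set d in D | act d s == s].
Proof.
apply/group_setP; split; first by rewrite finset.inE group1 act1 eqxx.
move=> a b; rewrite !finset.inE => /andP[aD /eqP as_] /andP[bD /eqP bs].
by rewrite groupM//= actG bs as_.
Qed.
Canonical stab_in D s := Group (stab_in_group_set D s).

(** Values at D-fixed points are realised by [extend]. After subtracting them, the support is
    removed orbit by orbit: the stabilizer of a moved point lies in some C of index p, and the norm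
    from C of a homomorphism that is the indicator of the C-orbit gives the indicator of the
    D-orbit. *)
Lemma lift_inv D (q : F -> 'F_p) : A \subset D -> (D \subset 'N(A))%g ->
  (forall d s, d \in D -> SA s -> q (act d s) = q s) -> finsupp (res SA q) ->
  exists m, [/\ lhom m, inv_on D A m & forall s, SA s -> m s = q s].
Proof.
have [n] := ubnP #|D|; elim: n D q => // n IH D q Dn AD DA qD qs.
have [DE|nDA] := eqVneq D A.
  have [m [hm mq]] := lift_comb lift_delta qs.
  by exists m; split=> // d x; rewrite DE => dA Bx; rewrite (Bf_fix Bx).
have pAD : A \proper D by rewrite finset.properEneq AD andbT eq_sym.
have [_ _ lD] := S_ok pAD.
have nAD : (A <| D)%g by rewrite /normal AD.
have sDA s : S s /\ fx D s -> SA s.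
  by move=> [Ss Ds]; split=> // a aA; apply: Ds; exact: (fintype.subsetP AD).
have [|m0 [hm0 m0q]] := @lift_comb (fun s => S s /\ fx D s) q lD.
  apply: finsupp_le qs _ => t; have [Dt|Dt] := pselect (S t /\ fx D t).
    by rewrite !resE//; exact: sDA.
  by move=> _; rewrite resN.
have [m' [hm' m'D m'm0]] := extend nAD hm0.
suff orbits : forall (r : seq F) (q1 : F -> 'F_p),
    (forall d s, d \in D -> SA s -> q1 (act d s) = q1 s) ->
    (forall s, S s -> fx D s -> q1 s = 0) ->
    (forall t, SA t -> q1 t != 0 -> t \in r) ->
    exists m, [/\ lhom m, inv_on D A m & forall s, SA s -> m s = q1 s].
  have [r rP] : finsupp (res SA (fun t => q t - m' t)).
    have [a af] := qs; have [b bf] := lhom_finsupp SA_conv hm'; exists (a ++ b) => t.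
    rewrite mem_cat; have [At|At] := pselect (SA t); last by rewrite resN// eqxx.
    move: (af t) (bf t); rewrite !resE// => qa mb h.
    have [/eqP q0|/qa ->//] := boolP (q t == 0).
    by rewrite mb ?orbT//; apply: contra_neq h => ->; rewrite q0 subrr.
  have [|||m1 [hm1 m1D m1q]] := orbits r (fun t => q t - m' t).
  - move=> d s dD As; rewrite qD// m'D//; exact: SA_Bf.
  - move=> s Ss Ds; rewrite m'm0 ?m0q ?subrr//.
    by have [h _ _] := S_ok pAD; exact: h.
  - by move=> t At h; apply: rP; rewrite resE.
  exists (fun x => m1 x + m' x); split; first exact: lhomD.
  - by move=> d x dD Bx; rewrite m1D// m'D.
  - by move=> s As; rewrite m1q// subrK.
move=> {q qD qs m0 m0q hm0 m' hm' m'D m'm0} r; have [k] := ubnP (size r).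
elim: k r => // k IHk r rk q qD qS qr.
have [[s [As qs]]|none] := pselect (exists s, SA s /\ q s <> 0); last first.
  exists (fun=> 0); split=> //; first exact: lhom0.
  by move=> s As; apply/esym; apply: contrapT => qs; apply: none; exists s.
pose E := stab_in D s.
have AE : A \subset E.
  apply/fintype.subsetP => a aA; rewrite finset.inE (fintype.subsetP AD)//=.
  by apply/eqP; case: As => _; apply.
have ED : E \proper D.
  rewrite fintype.properE; apply/andP; split.
    by apply/fintype.subsetP => a; rewrite finset.inE => /andP[].
  apply/negP => /fintype.subsetP DE; apply: qs; apply: qS; first by case: As.
  by move=> d /DE; rewrite finset.inE => /andP[_ /eqP].
have [C [EC CD iC]] := pgroup_max gTp ED.
have CsD := normal_sub CD; have AC := fintype.subset_trans AE EC.
have CA := fintype.subset_trans CsD DA.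
have [b bD] := ex_moved p_pr CD iC; have bB := (finset.setDP bD).1.
pose orbC t := exists2 c, c \in C & t = act c s.
have orbC_act c t : c \in C -> orbC (act c t) <-> orbC t.
  move=> cC; split=> [[c' c'C e]|[c' c'C ->]].
    exists (c^-1 * c')%g; first by rewrite groupM ?groupV.
    by rewrite actG -e actK.
  by exists (c * c')%g; [rewrite groupM|rewrite actG].
have [|||||mC [hmC mCC mCq]] := IH C (fun t => (`[< orbC t >])%:R).
- rewrite -ltnS (leq_trans _ Dn)// ltnS -(Lagrange CsD) iC.
  by rewrite ltn_Pmulr ?prime_gt1.
- exact: AC.
- exact: CA.
- move=> c t cC _; congr (_ : bool)%:R.
  by apply/asboolP/asboolP => /(orbC_act c t cC).
- exists [seq act c s | c <- enum C] => t h.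
  have [At|At] := pselect (SA t); last by rewrite resN// eqxx in h.
  move: h; rewrite resE//; case: asboolP => [[c cC ->] _|]; last by rewrite eqxx.
  by apply/mapP; exists c => //; rewrite mem_enum.
pose m2 x := \sum_(i < p) mC (act (b ^+ i)%g x).
have hm2 : lhom m2 by apply: lhom_sum => i; exact: lhom_act.
have m2D : inv_on D A m2 by exact: norm_inv CD iC bD DA mCC.
have SX i t : SA t -> SA (act (b ^+ i)%g t).
  by apply: SA_norm; rewrite groupX// (fintype.subsetP DA).
have m2q t : SA t -> m2 t = (`[< exists2 d, d \in D & t = act d s >])%:R.
  move=> At; rewrite /m2; under eq_bigr do rewrite (mCq _ (SX _ _ At)).
  case: asboolP => [[d dD td]|nd]; last first.
    rewrite big1// => i _; case: asboolP => // -[c cC e]; case: nd.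
    exists ((b ^+ i)^-1 * c)%g; last by rewrite actG -e actK.
    by rewrite groupM ?groupV ?groupX// (fintype.subsetP CsD).
  rewrite -[RHS](prime_index_sum p_pr CD iC bD dD); apply: eq_bigr => i _.
  congr (_ : bool)%:R; rewrite td -actG; apply/asboolP/idP => [[c cC e]|h]; last first.
    by exists (b ^+ i * d)%g.
  have hE : (c^-1 * (b ^+ i * d))%g \in E.
    rewrite finset.inE actG e actK eqxx andbT; apply: groupM.
      by rewrite groupV; exact: (fintype.subsetP CsD).
    by apply: groupM => //; exact: groupX.
  have := fintype.subsetP EC _ hE; by rewrite (groupMl _ (groupVr cC)).
have [||||m3 [hm3 m3D m3q]] := IHk [seq t <- r | t != s] _
    (fun t => q t - q s * (`[< exists2 d, d \in D & t = act d s >])%:R).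
- rewrite -ltnS (leq_trans _ rk)// ltnS size_filter ltn_neqAle count_size andbT.
  rewrite -all_count; apply/allPn; exists s; last by rewrite eqxx.
  by apply: qr => //; exact/eqP.
- move=> d t dD At; rewrite qD//; congr (_ - _ * (_ : bool)%:R).
  apply/asboolP/asboolP => [[d' d'D e]|[d' d'D ->]]; last first.
    by exists (d * d')%g; [rewrite groupM|rewrite actG].
  exists (d^-1 * d')%g; first by rewrite groupM ?groupV.
  by rewrite actG -e actK.
- move=> t St Dt; rewrite qS// sub0r; case: asboolP => [[d dD td]|_].
    by case: qs; rewrite -(qD d s dD As) -td qS.
  by rewrite mulr0 oppr0.
- move=> t At; rewrite mem_filter; have [->|ts] := eqVneq t s.
    rewrite asboolT ?mulr1 ?subrr ?eqxx//.
    by exists 1%g; rewrite ?group1 ?act1.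
  move=> h /=; apply: qr => //; apply: contra_neq h => q0; rewrite q0 sub0r.
  case: asboolP => [[d dD td]|_]; last by rewrite mulr0 oppr0.
  by rewrite -(qD d s dD As) -td q0 mul0r oppr0.
exists (fun x => m3 x + q s * m2 x); split.
- by apply: lhomD => //; exact: lhomZ.
- by move=> d x dD Bx; rewrite m3D// m2D.
- by move=> t At; rewrite m3q// m2q// subrK.
Qed.


(** For one representative of each N(A)-orbit a dual homomorphism invariant under its stabilizer is
    chosen by [lift_inv] and then transported along the orbit; invariance makes the transport
    independent of the carrying element. *)
Lemma equivariant_system : exists ms : F -> F -> 'F_p,
  [/\ forall t, lhom (ms t), forall t u, SA t -> SA u -> ms t u = (u == t)%:R &
    forall n t x, n \in ('N(A))%g -> SA t -> Bf A x -> ms (act n t) (act n x) = ms t x].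
Proof.
pose N := 'N(A)%G.
have /choice[mr mrP] : forall s, exists m, lhom m /\ (SA s ->
    inv_on (stab_in N s) A m /\ forall u, SA u -> m u = (u == s)%:R).
  move=> s; have [As|nAs] := pselect (SA s); last first.
    by exists (fun=> 0); split=> //; exact: lhom0.
  have [||||m [hm mD mq]] := @lift_inv (stab_in N s) (fun u => (u == s)%:R).
  - apply/fintype.subsetP => a aA; rewrite finset.inE (fintype.subsetP (normG A))//=.
    by apply/eqP; case: As => _; apply.
  - by apply/fintype.subsetP => a; rewrite finset.inE => /andP[].
  - move=> d u; rewrite finset.inE => /andP[dN /eqP ds] Au.
    congr (_ : bool)%:R; apply/eqP/eqP => [e|->]; last exact: ds.
    by rewrite -(actK d u) e -{1}ds actK.
  - exists [:: s] => t; rewrite inE; apply: contra_neqT => ts.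
    have [At|At] := pselect (SA t); last by rewrite resN.
    by rewrite resE// (negPf ts).
  by exists m; split.
pose orb t u := exists2 n, n \in N & u = act n t.
pose rho t := sval (cid (ex_intro (fun u => True) t I)).
pose pick (S : F -> Prop) := if pselect (exists t, S t) is left h
  then sval (cid h) else 1%g.
have pickP t : orb t (pick (orb t)).
  rewrite /pick; case: pselect => [h|[]]; first exact: svalP (cid h).
  by exists t, 1%g; rewrite ?group1 ?act1.
have orb_eq n t : n \in N -> orb (act n t) = orb t.
  move=> nN; apply/funext => u; apply/propext; split=> -[n' n'N ->].
    by exists (n' * n)%g; rewrite ?groupM// actG.
  by exists (n' * n^-1)%g; rewrite ?groupM ?groupV// actG actK.
have /choice[gs gsP] : forall t, exists n, n \in N /\ act n (pick (orb t)) = t.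
  move=> t; have [n nN e] := pickP t; exists n^-1%g; split; first by rewrite groupV.
  by rewrite e actK.
have pickSA t : SA t -> SA (pick (orb t)).
  by move=> At; have [n nN ->] := pickP t; exact: SA_norm.
exists (fun t x => mr (pick (orb t)) (act (gs t)^-1%g x)); split.
- by move=> t; apply: lhom_act; case: (mrP (pick (orb t))).
- move=> t u At Au; have [_ /(_ (pickSA t At))[_ ->]] := mrP (pick (orb t)).
    have [_ e] := gsP t; congr (_ : bool)%:R; apply/eqP/eqP => [h|->].
      by rewrite -e -h actVK.
    by rewrite -{2}e actK.
  by apply: SA_norm => //; have [gN _] := gsP t; rewrite groupV.
move=> n t x nN At Bx; rewrite orb_eq//; set r := pick (orb t).
have [g1N e1] := gsP t; have [g2N e2] := gsP (act n t).
rewrite orb_eq// -/r in e2; set g2 := gs (act n t) in g2N e2 *.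
have [_ /(_ (pickSA t At))[mD _]] := mrP r.
rewrite -(mD (g2^-1 * n * gs t)%g (act (gs t)^-1%g x)); last first.
- by apply: Bf_norm => //; rewrite groupV.
- rewrite finset.inE !groupM ?groupV//= !actG e1; apply/eqP.
  by rewrite -e2 actK.
by rewrite !actG actVK.
Qed.

(** Subtract from [y] the combination of the equivariant dual system with coefficients y(t). The
    norm of this combination has as coefficients the norms of [y] at the points t, so it vanishes
    when those do. *)
Lemma kill_projection y C : lhom y -> (C \subset 'N(A))%g -> inv_on C A y ->
  exists y', [/\ lhom y', forall t, SA t -> y' t = 0, inv_on C A y' &
    forall b, b \in ('N(A))%g -> (forall t, SA t -> \sum_(i < p) y (act (b ^+ i)%g t) = 0) ->
      forall x, Bf A x ->
      \sum_(i < p) y' (act (b ^+ i)%g x) = \sum_(i < p) y (act (b ^+ i)%g x)].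
Proof.
move=> hy CN yC; have [ms [hms msd msN]] := equivariant_system.
have [r ur yr] := finsupp_uniq (lhom_finsupp SA_conv hy).
pose q x t := res SA y t * ms t x.
have qs x : finsupp (q x) by apply: finsuppM; exists r.
have sumE x : \sum_(t <- r) q x t = fsum (q x).
  rewrite (@fsumE _ _ _ r)// => t h; apply: yr; apply: contra_neq h => e.
  by rewrite /q e mul0r.
have SAN g t : g \in ('N(A))%g -> SA (act g t) -> SA t.
  by move=> gN /(SA_norm (groupVr gN)); rewrite actK.
have key g x : g \in ('N(A))%g -> Bf A x ->
    fsum (q (act g x)) = fsum (fun t => res SA y (act g t) * ms t x).
  move=> gN Bx; rewrite -(fsum_reindex (actK g) (actVK g) (qs _)).
  congr fsum; apply/funext => t; rewrite /q.
  have [At|At] := pselect (SA t); first by rewrite msN.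
  by rewrite !resN ?mul0r// => /(SAN _ _ gN).
exists (fun x => y x - \sum_(t <- r) q x t); split.
- by apply: lhomB => //; apply: lhom_sum => t; exact: lhomZ.
- move=> t At; rewrite sumE (@fsum_point _ _ _ t).
    by rewrite /q resE// msd// eqxx mulr1 subrr.
  move=> u ut; rewrite /q; have [Au|Au] := pselect (SA u); last by rewrite resN// mul0r.
  by rewrite msd// eq_sym (negPf ut) mulr0.
- move=> c x cC Bx; rewrite yC// !sumE key//; last exact: (fintype.subsetP CN).
  congr (_ - fsum _); apply/funext => t; rewrite /q.
  have cN := fintype.subsetP CN c cC.
  have [At|At] := pselect (SA t); last by rewrite !resN// => /(SAN _ _ cN).
  rewrite !resE//; last exact: SA_norm.
  by rewrite yC//; exact: SA_Bf.
move=> b bN y0 x Bx; rewrite sumrB; set s2 := (X in _ - X); suff -> : s2 = 0 by rewrite subr0.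
have bX i : (b ^+ i)%g \in ('N(A))%g by exact: groupX.
rewrite /s2 (eq_bigr (fun i : 'I_p => fsum (fun t => res SA y (act (b ^+ i)%g t) * ms t x))).
  rewrite -fsum_sum => [|i]; last first.
    exists [seq act (b ^- i)%g t | t <- r] => t h; apply/mapP.
    exists (act (b ^+ i)%g t); last by rewrite actK.
    by apply: yr; apply: contra_neq h => ->; rewrite mul0r.
  apply: fsum0 => t; rewrite -mulr_suml.
  have [At|At] := pselect (SA t); last first.
    by rewrite big1 ?mul0r// => i _; rewrite resN// => /(SAN _ _ (bX i)).
  rewrite (eq_bigr (fun i : 'I_p => y (act (b ^+ i)%g t))) ?y0 ?mul0r// => i _.
  by rewrite resE//; exact: SA_norm.
by move=> i _; rewrite sumE key.
Qed.

Lemma act_coset g h u : g \in ('N(A))%g -> h \in ('N(A))%g -> coset A g = coset A h ->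
  Bf A u -> act g u = act h u.
Proof.
move=> gN hN gh Bu; have hA : (g^-1 * h)%g \in A.
  by apply: coset_idr; rewrite ?groupM ?groupV// morphM ?groupV// morphV//= gh mulVg.
by rewrite -[h](mulKVg g) actG (Bf_fix Bu hA).
Qed.

(** Transfer is iterated from D down to A through subgroups of index p. [kill_projection] restores
    the vanishing on the old members after each step, so that transfer applies again. *)
Lemma trace_onto D (x : F -> 'F_p) : A \subset D -> (D \subset 'N(A))%g -> lhom x -> inv_on D A x ->
  (forall t, SA t -> x t = 0) ->
  exists z, [/\ lhom z, forall t, SA t -> z t = 0 &
    forall u, Bf A u -> x u = \sum_(X in (D / A)%g) z (act (repr X) u)].
Proof.
have [n] := ubnP #|D|; elim: n D x => // n IH D x Dn AD DA hx xD x0.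
have [DE|nDA] := eqVneq D A.
  exists x; split=> // u Bu; rewrite DE trivg_quotient big_set1 repr_coset1.
  by rewrite act1.
have [|C [AC CD iC]] := @pgroup_max p gT gTp A D.
  by rewrite finset.properEneq AD andbT eq_sym.
have CsD := normal_sub CD; have CA := fintype.subset_trans CsD DA.
have [b bD] := ex_moved p_pr CD iC; have [bB bC] := finset.setDP bD.
have bN := fintype.subsetP DA b bB.
(* Vanishing on the old members gives vanishing on [Bf D'] for every larger D', because those
   members detect homomorphisms there. *)
have [|y [hy yC xy]] := transfer AC CD iC bD DA hx xD.
  move=> D' AD' D'D u Bu; have [_ inj _] := S_ok AD'.
  apply: inj u Bu => // s Ss D's; apply: x0; split=> // a aA.
  by apply: D's; exact: (fintype.subsetP (proper_sub AD')).
have [y' [hy' y'0 y'C y'y]] := kill_projection hy CA yC.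
have {}y'y u : Bf A u -> x u = \sum_(i < p) y' (act (b ^+ i)%g u).
  by move=> Bu; rewrite y'y ?xy// => t At; rewrite -xy ?x0//; exact: SA_Bf.
have [|z [hz z0 zy]] := IH C y' _ AC CA hy' y'C y'0.
  rewrite -ltnS (leq_trans _ Dn)// ltnS -(Lagrange CsD) iC.
  by rewrite ltn_Pmulr ?prime_gt1.
exists z; split=> // u Bu.
have CDA : (C / A <| D / A)%g by exact: quotient_normal.
have iCA : (#|D / A : C / A|)%g = p.
  by rewrite index_quotient_eq//; apply: fintype.subset_trans (subsetIr _ _) AC.
have bDA : coset A b \in ((D / A) :\: (C / A))%g.
  apply/finset.setDP; split; first exact: mem_quotient.
  apply/negP => /morphimP[c cN cC e]; case/negP: bC.
  have : (b * c^-1)%g \in A.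
    by apply: coset_idr; rewrite ?groupM ?groupV// morphM ?groupV// morphV//= e mulgV.
  by move/(fintype.subsetP AC); rewrite groupMr ?groupV.
rewrite (sum_prime_index p_pr _ CDA iCA bDA) y'y//; apply: eq_bigr => i _.
have bXN : (b ^+ i)%g \in ('N(A))%g by exact: groupX.
rewrite zy; last exact: Bf_norm.
apply: eq_bigr => X _; rewrite -actG; congr z; apply: act_coset => //.
- by rewrite groupM// repr_coset_norm.
- exact: repr_coset_norm.
- rewrite morphM ?repr_coset_norm// morphX//= coset_reprK.
  exact: (esym (coset_reprK (X * coset A b ^+ i)%g)).
Qed.

(** The new members are the translates of elements s_i of [Bf A] dual to a basis of the
    N(A)-invariant homomorphisms that vanish on old members. Each such homomorphism is a trace over
    N(A) / A, which forces the s_i to have stabilizer exactly A, so that their orbits under N(A) / A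
    are free. *)
Theorem step_new : exists S1 : F -> Prop, [/\ forall g s, S1 s -> S1 (act g s),
  converging S1,
  forall s, S1 s -> exists g, forall h, (act h s == s) = (h \in A :^ g)%g &
  ok (fun s => S s \/ S1 s) A].
Proof.
pose N := 'N(A)%G.
have AN : A \subset N by exact: normG.
pose U0 (u : F -> 'F_p) := [/\ lhom u, inv_on N A u & forall t, SA t -> u t = 0].
have [||S0 [_ S0U iS0 sS0]] := @basis_extend _ F (Bf A) (fun=> False) U0; [by []|by []|].
(* The larger basis spans all functions on [Bf A]; it only serves to define coordinate functionals
   on every homomorphism. *)
have [//|Sb [S0Sb _ iSb sSb]] := @basis_extend _ F (Bf A) _ (fun=> True) iS0.
have [lam lamP] := coord_exists iSb (fun m => sSb m I).
pose I0 := {classic {b : F -> 'F_p | S0 b}}.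
have LP (i : I0) := lamP (sval i) (S0Sb _ (svalP i)).
have [|m hm|s [sB sl sc]] := @lift_converging p F I0 (Bf A)
    (fun i => lam (sval i)) (Bf_group A) (@Bf_closed A).
- move=> i; have [lD lZ l1 l0] := LP i; split=> // m hm mB.
  by apply: l0; exact: span_zero.
- have [r rP] := span_finite (sSb m I).
  have [r' r'P] : exists r' : seq I0, forall i : I0, List.In (sval i) r -> List.In i r'.
    elim: r {rP} => [|b r [r' r'P]]; first by exists [::].
    have [Sb0|nSb0] := pselect (S0 b); last first.
      by exists r' => i /= [ib|/r'P//]; case: nSb0; rewrite ib; exact: svalP i.
    exists ((exist _ b Sb0 : I0) :: r') => i /= [ib|/r'P]; [left|by right].
    by case: i ib => b' Sb' /= bb; subst b'; congr exist; exact: Prop_irrelevance.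
  exists r' => i ir; have [_ _ _ l0] := LP i; apply: l0; apply: rP => [|h].
    exact/S0Sb/svalP.
  by apply: ir; exact: r'P.
have s1 i : sval i (s i) = 1.
  have [hi _ _] := S0U _ (svalP i); rewrite sl//.
  by have [_ _ ->] := LP i.
have s0 i j : i <> j -> sval i (s j) = 0.
  move=> ij; have [hi _ _] := S0U _ (svalP i); rewrite sl//.
  have [_ _ _ l0] := LP j; apply: l0; apply: span_mem; split; first exact/S0Sb/svalP.
  move=> e; apply: ij; case: i j e {hi} => b Sb0 [b' Sb0'] /= e; subst b'.
  by congr exist; exact: Prop_irrelevance.
have /choice[z zP] : forall i : I0, exists z, [/\ lhom z, forall t, SA t -> z t = 0 &
    forall u, Bf A u -> sval i u = \sum_(X in (N / A)%g) z (act (repr X) u)].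
  move=> i; have [hi iN i0] := S0U _ (svalP i); exact: trace_onto.
(* The value 1 of the i-th basis homomorphism at s_i is a sum over N / A. An element outside A
   fixing s_i would make the summand invariant under a fixed-point-free translation of N / A, and
   the sum 0 modulo p. *)
have stabN g i : g \in N -> act g (s i) = s i -> g \in A.
  move=> gN gs; apply: contrapT => /negP gA; have [hz _ /(_ _ (sB i))] := zP i.
  rewrite s1; pose h := coset A g.
  have hN : h \in (N / A)%g by exact: mem_quotient.
  pose f X := if X \in (N / A)%g then z i (act (repr X) (s i)) else 0.
  rewrite big_mkcond (sum_no_fixed p_pr (D := <[h]>%G) (to := 'R%act) (q := f)).
  - by move/eqP; rewrite oner_eq0.
  - apply: pgroupS (quotient_pgroup A (pgroupS (finset.subsetT N) gTp)).
    by rewrite cycle_subG.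
  - move=> d X /cycleP[k ->]; rewrite /f /= groupMr ?groupX//; case: ifP => // XN.
    congr (z i); rewrite (@act_coset _ (repr X * g ^+ k)%g)//.
    + rewrite actG; congr (act _ _); elim: k => [|k IH]; first by rewrite act1.
      by rewrite expgS actG IH.
    + exact: (repr_coset_norm (X * h ^+ k)%g).
    + by rewrite groupM ?groupX// repr_coset_norm.
    + rewrite morphM ?groupX ?repr_coset_norm// morphX//= coset_reprK.
      exact: (coset_reprK (X * h ^+ k)%g).
  - move=> X /(_ h (cycle_id h)) /= Xh; exfalso.
    have /eqP : h = 1%g by apply: (@mulgI _ X); rewrite Xh mulg1.
    by move/eqP/coset_idr => /(_ gN); move/negP: gA.
(* If the full stabilizer were larger than A, normalizers growing in p-groups would put a
   normalizing element outside A into it, against [stabN]. *)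
have stabK g i : act g (s i) = s i -> g \in A.
  pose E := stab_in [set: gT]%G (s i).
  have AE : A \subset E.
    apply/fintype.subsetP => a aA; rewrite finset.inE finset.in_setT /=.
    by apply/eqP; exact: Bf_fix (sB i) aA.
  have [EA|nEA] := eqVneq (A : {set gT}) E.
    by move=> gs; rewrite EA finset.inE finset.in_setT /=; exact/eqP.
  have AE' : A \proper E by rewrite finset.properEneq nEA.
  have Ep : (p.-group E)%g by exact: pgroupS (finset.subsetT _) gTp.
  have /fintype.properP[_ [x /setIP[xE xN] xA]] := nilpotent_proper_norm (pgroup_nil Ep) AE'.
  case/negP: xA; apply: (stabN _ i) => //.
  by move: xE; rewrite finset.inE => /andP[_ /eqP].
have normP' g : (forall a, a \in A -> (a ^ g)%g \in A) -> g \in N.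
  move=> gA; apply/normP/eqP; rewrite eqEcard cardJg leqnn andbT.
  by apply/fintype.subsetP => y /imsetP[a /gA aA ->].
have sgN g i j : act g (s i) = s j -> g \in N /\ i = j.
  move=> e; have gN : g \in N.
    apply: normP' => a aA; apply: (stabK _ i).
    by rewrite conjgE !actG e (Bf_fix (sB j) aA) -e actK.
  split=> //; apply: contrapT => ij; have [_ iN _] := S0U _ (svalP i).
  have := iN g _ gN (sB i); rewrite e s0// s1 => /esym/eqP.
  by rewrite oner_eq0.
have fxN g i : fx A (act g (s i)) -> g \in N.
  move=> fg; apply: normP' => a aA; apply: (stabK _ i).
  by rewrite conjgE !actG fg// actK.
pose S1 t := exists g i, t = act g (s i).
have sconv l : exists r : seq I0, forall i, ~ List.In i r ->
    forall g, lpi l (act g (s i)) = 1%g.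
  have /choice[a aP] := fun g => act_c g l; have [k kP] := finer_fin a.
  have [r rP] := sc k; exists r => i /rP si g; apply: aP; exact: kP.
have In_mem (r : seq I0) i : List.In i r -> i \in r.
  by elim: r => //= j r IH [->|/IH ir]; rewrite inE ?eqxx// ir orbT.
have S1c : converging S1.
  move=> l; have [r rP] := sconv l; exists [seq act g (s i) | i <- r, g <- enum gT].
  move=> t [g [i ->]] h; apply/allpairsP; exists (i, g); split=> //=; last first.
    by rewrite mem_enum.
  by apply: In_mem; apply: contrapT => /rP /(_ g).
pose S' t := S t \/ S1 t; pose S'A t := S' t /\ fx A t.
have S'AE t : S'A t -> SA t \/ exists n i, n \in N /\ t = act n (s i).
  move=> [[St|[g [i e]]] At]; [by left|right]; exists g, i; split=> //.
  by apply: (fxN _ i); rewrite -e.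
have S'As n i : n \in N -> S'A (act n (s i)).
  move=> nN; split; first by right; exists n, i.
  by move=> a aA; apply: (Bf_fix (A := A)) => //; exact: Bf_norm.
have S'N g t : g \in N -> S'A t -> S'A (act g t).
  move=> gN /S'AE[At|[n [i [nN ->]]]].
    by have [? ?] := SA_norm gN At; split=> //; left.
  by rewrite -actG; apply: S'As; rewrite groupM.
have S'c : converging S'A.
  move=> l; have [r rP] := S_conv l; have [r' r'P] := S1c l; exists (r ++ r') => t.
  by move=> [[St|St] _] h; rewrite mem_cat; [rewrite rP|rewrite r'P ?orbT].
exists S1; split=> //.
- by move=> g t [h [i ->]]; exists (g * h)%g, i; rewrite actG.
- move=> t [g [i ->]]; exists g^-1%g => h; rewrite mem_conjg invgK.
  apply/eqP/idP => [e|hA].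
    by apply: (stabK _ i); rewrite conjgE !actG e actK.
  have -> : (h = g * (h ^ g) * g^-1)%g by rewrite conjgE !mulgA mulgV mul1g mulgK.
  by move: (h ^ g)%g hA => k kA; rewrite !actG actK (Bf_fix (sB i) kA).
split.
- move=> t S't At; have [] := S'AE t (conj S't At); first exact: SA_Bf.
  by move=> [n [i [nN ->]]]; exact: Bf_norm.
- move=> m hm m0 x Bx; apply: contrapT => mx.
  (* Homomorphisms vanishing on all members, cut off outside [Bf A]: a nonzero one yields a nonzero
     N(A)-invariant one, whose coordinates are its values at the s_i, all of them 0. *)
  pose U (u : F -> 'F_p) := exists m, [/\ lhom m, forall t, S'A t -> m t = 0 &
    forall x, u x = if `[< Bf A x >] then m x else 0].
  have [|||u [[m' [hm' m'0 um']] [y uy] uN]] := @fixed_vector p p_pr gT F act U N gTp act1 actG.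
  + move=> u v [m1 [hm1 m10 um1]] [m2 [hm2 m20 um2]].
    exists (fun x => m1 x - m2 x); split; first exact: lhomB.
      by move=> t At; rewrite m10 ?m20 ?subrr.
    by move=> y; rewrite um1 um2; case: asboolP => // _; rewrite subrr.
  + move=> d u dN [m1 [hm1 m10 um1]]; exists (fun x => m1 (act d x)); split.
    * exact: lhom_act.
    * by move=> t At; rewrite m10//; exact: S'N.
    * move=> y; rewrite um1; congr (if (_ : bool) then _ else _).
      apply/asboolP/asboolP; last exact: Bf_norm.
      by move/(Bf_norm (groupVr dN)); rewrite actK.
  + exists (fun x => if `[< Bf A x >] then m x else 0); last by exists x; rewrite asboolT.
    by exists m; split=> // t [S't At]; exact: m0.
  have By : Bf A y by apply: contrapT => By; apply: uy; rewrite um' asboolF.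
  have um2 v : Bf A v -> u v = m' v by move=> Bv; rewrite um' asboolT.
  apply: uy; rewrite um2//.
  have U0m : U0 m'.
    split=> // [d v dN Bv|t [St At]]; last by apply: m'0; split=> //; left.
    by rewrite -!um2 ?uN//; exact: Bf_norm.
  apply: (coord_zero lamP S0Sb (sS0 _ U0m)) => // b Sb0.
  have := sl (exist _ b Sb0 : I0) m' hm'; rewrite /= => <-.
  apply: m'0; rewrite -[s _]act1; exact: S'As.
have [//|[psi [[t0 S't0 pt0] pT pN pm]]] := dual_fixed S'c (fun g t => @S'N g t).
(* Pairing [psi] with the homomorphism z_i whose trace is the i-th basis homomorphism, and summing
   over N(A)-orbits, leaves exactly psi(s_i). Old members are then handled by [lift_delta]. *)
have ps i : psi (s i) = 0.
  have [hz z0 zE] := zP i; have := pm _ hz.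
  have [l [zl]] : exists l, (forall x, lpi l x = 1%g -> z i x = 0) /\ True.
    by case: hz => _ [l zl]; exists l.
  move=> _; have [r rP] := sconv l; pose R := undup r.
  have RP j n : z i (act n (s j)) != 0 -> j \in R.
    move=> h; rewrite mem_undup; apply: In_mem; apply: contrapT => /rP/(_ n)/zl e.
    by rewrite e eqxx in h.
  pose L := [seq act (repr X) (s j) |
    j : I0 <- R, X : coset_of A <- enum (N / A)%g].
  rewrite (@fsumE _ _ _ L).
  - rewrite big_allpairs_dep /=.
    have inner j : \sum_(X <- enum (N / A)%g) z i (act (repr X) (s j)) * psi (act (repr X) (s j))
        = sval i (s j) * psi (s j).
      rewrite zE// mulr_suml big_enum /=; apply: eq_bigr => X XN; rewrite pN//.
      exact: repr_coset_norm.
    rewrite (eq_bigr _ (fun j _ => inner j)).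
    have iR : i \in R.
      apply: contrapT => /negP iR; have := zE _ (sB i); rewrite s1 big1.
        by move/eqP; rewrite oner_eq0.
      by move=> X _; apply/eqP; apply: contraNT iR => /RP.
    rewrite (bigD1_seq i) ?undup_uniq//= s1 mul1r big1 ?addr0// => j /eqP ji.
    by rewrite s0 ?mul0r//; exact: nesym.
  - apply: allpairs_uniq; [exact: undup_uniq|exact: enum_uniq|].
    move=> [j X] [j' Y] /= _ _ e.
    have e2 : act ((repr Y)^-1 * repr X)%g (s j) = s j' by rewrite actG e actK.
    have [_ jj] := sgN _ _ _ e2; rewrite -jj in e2 *; congr pair.
    have hA := stabK _ _ e2.
    have := coset_id hA; rewrite morphM ?groupV ?repr_coset_norm//.
    rewrite morphV ?repr_coset_norm//= !coset_reprK => /(canRL (mulKg _)).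
    by rewrite invgK mulg1.
  - move=> t h; have pt : psi t <> 0 by move=> e; rewrite e mulr0 eqxx in h.
    have S't : S'A t by apply: contrapT => nS; apply: pt; exact: pT.
    have zt : z i t != 0 by apply: contra_neq h => ->; rewrite mul0r.
    have [At|[n [j [nN e]]]] := S'AE t S't; first by rewrite z0 ?eqxx in zt.
    apply/allpairsP; exists (j, coset A n); split=> /=.
    + by apply: (RP j n); rewrite -e.
    + by rewrite mem_enum mem_quotient.
    + rewrite e; apply: act_coset => //; first exact: repr_coset_norm.
      by rewrite coset_reprK.
have [At0|[n [i [nN e]]]] := S'AE t0 S't0; last by case: pt0; rewrite e pN// ps.
have [m [hm mt0]] := lift_delta At0.
case: pt0; rewrite -[RHS](pm m hm) (@fsum_point _ _ _ t0).
  by rewrite mt0// eqxx mul1r.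
move=> t tt0; have [S't|nS't] := pselect (S'A t); last by rewrite pT// mulr0.
have [At|[n [i [nN e]]]] := S'AE t S't; last by rewrite e pN// ps mulr0.
by rewrite mt0// (negPf tt0) mul0r.
Qed.

End Step.
Lemma stab_conj (A : {group gT}) g s : fx (A :^ g^-1)%g s -> fx A (act g^-1%g s).
Proof.
move=> As a aA; rewrite -actG; have -> : (a * g^-1 = g^-1 * a ^ g^-1)%g.
  by rewrite conjgE mulKVg.
by rewrite actG As// memJ_conjg.
Qed.

Lemma conj_stab (A : {group gT}) g s : fx A s -> fx (A :^ g^-1)%g (act g s).
Proof.
move=> As _ /imsetP[a aA ->]; by rewrite -actG conjgE invgK mulgA mulgKV actG As.
Qed.

Lemma ok_conj S A g : (forall h s, S s -> S (act h s)) -> ok S A -> ok S (A :^ g^-1)%G.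
Proof.
move=> S_act [SB inj lS]; split.
- move=> s Ss As; rewrite -(actVK g s); apply: Bf_act.
  by apply: SB; [exact: S_act|exact: stab_conj].
- move=> m hm m0 x Bx; rewrite -(actVK g x); apply: (inj (fun x => m (act g x))).
  + exact: lhom_act.
  + by move=> s Ss As; apply: m0; [exact: S_act|exact: conj_stab].
  + have := Bf_act g^-1%g Bx; rewrite invgK; congr (Bf _ _).
    by apply: val_inj; rewrite /= conjsgKV.
- move=> s [Ss As]; have [|m [hm ms]] := lS (act g^-1%g s).
    by split; [exact: S_act|exact: stab_conj].
  exists (fun x => m (act g^-1%g x)); split; first exact: lhom_act.
  move=> t [St At]; rewrite ms; last by split; [exact: S_act|exact: stab_conj].
  by rewrite (inj_eq (can_inj (actVK g))).
Qed.

Lemma ok_eq S S' A : (forall s, fx A s -> (S s <-> S' s)) -> ok S A -> ok S' A.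
Proof.
move=> SS [SB inj lS]; split.
- by move=> s S's As; apply: SB => //; exact/(SS s As).
- by move=> m hm m0; apply: inj => // s Ss As; apply: m0 => //; exact/(SS s As).
- move=> s [S's As]; have [|m [hm ms]] := lS s; first by split=> //; exact/(SS s As).
  by exists m; split=> // t [S't At]; apply: ms; split=> //; exact/(SS t At).
Qed.

Theorem permutation_basis : exists S : F -> Prop, [/\ forall g s, S s -> S (act g s),
  converging S, forall m, lhom m -> (forall s, S s -> m s = 0) -> forall x, m x = 0 &
  lifts S].
Proof.
pose inv (PP : {set {group gT}}) S := [/\ forall g s, S s -> S (act g s), converging S,
  forall D, D \in PP -> ok S D &
  forall s, S s -> exists2 E : {group gT}, E \in PP &
    forall h, (act h s == s) = (h \in E)].
suff go n (PP : {set {group gT}}) S : (#|~: PP| < n)%N -> inv PP S ->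
    (forall D g, D \in PP -> (D :^ g)%G \in PP) ->
    (forall D D' : {group gT}, D \in PP -> D \subset D' -> D' \in PP) ->
    exists S', inv finset.setT S'.
  have [||||S [S_act Sc S_ok _]] := go #|~: (finset.set0 : {set {group gT}})|.+1
    finset.set0 (fun=> False) => //.
  - by split=> // [i|D]; [exists [::]|rewrite finset.inE].
  - by move=> D g; rewrite finset.inE.
  - by move=> D D'; rewrite finset.inE.
  have [_ inj lS] := S_ok 1%G (finset.in_setT _).
  have fx1 s : fx 1%G s by move=> a /set1P ->; exact: act1.
  exists S; split=> // [m hm m0 x|s Ss]; first by apply: inj => // s Ss _; exact: m0.
  have [|m [hm ms]] := lS s; first by split.
  by exists m; split=> // t St; apply: ms; split.
elim: n PP S => // n IH PP S PPn [S_act Sc S_ok S_st] PPJ PPU.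
have [PPT|/finset.set0Pn[A0 A0P]] := eqVneq (~: PP) finset.set0.
  exists S; split=> // [D _|s /S_st[E EP Es]]; last by exists E => //; rewrite finset.inE.
  by apply: S_ok; have := finset.in_set0 D; rewrite -PPT finset.inE => /negbFE.
(* Maximal order makes every proper overgroup of A processed. New members have stabilizers conjugate
   to A, so no processed subgroup fixes them and earlier [ok] statements persist. *)
have [A AP Amax] := @arg_maxnP _ A0 (fun A => A \in ~: PP) (fun A => #|A|) A0P.
have PPA D : A \proper D -> D \in PP.
  move=> AD; apply: contraT => DP; have := Amax D; rewrite finset.inE => /(_ DP).
  by move/(leq_trans (proper_card AD)); rewrite ltnn.
have nAP : A \notin PP by rewrite finset.inE in AP.
have nAJ g : (A :^ g)%G \notin PP.
  apply: contra nAP => /(PPJ _ g^-1%g); congr (_ \in PP).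
  by apply: val_inj; rewrite /= conjsgK.
have Cst s (D : {group gT}) : S s -> fx D s -> exists2 E : {group gT}, E \in PP & D \subset E.
  move=> /S_st[E EP Es] Ds; exists E => //; apply/fintype.subsetP => d dD.
  by rewrite -Es Ds.
have [||||S1 [S1_act S1c S1st S1ok]] := @step_new A S.
- exact: S_act.
- exact: Sc.
- by move=> D /PPA; exact: S_ok.
- move=> s Ss As; have [E EP Es] := S_st s Ss; exists E; split.
    rewrite finset.properEneq; apply/andP; split.
      by apply: contraNneq nAP => /val_inj ->.
    by apply/fintype.subsetP => a aA; rewrite -Es As.
  by move=> a; rewrite -Es => /eqP.
pose PP' := PP :|: [set (A :^ g)%G | g : gT].
have S'_act g s : S s \/ S1 s -> S (act g s) \/ S1 (act g s).
  by move=> [/S_act|/S1_act]; [left|right].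
have PPup D g : D \in PP -> D \subset (A :^ g)%G -> False.
  by move=> /PPU h /h; exact/negP/nAJ.
apply: (IH PP' (fun s => S s \/ S1 s)).
- rewrite -ltnS; apply: leq_trans PPn; rewrite ltnS; apply: proper_card.
  rewrite finset.properC; apply/fintype.properP; split; first exact: finset.subsetUl.
  exists A => //; apply/finset.setUP; right; apply/imsetP; exists 1%g => //.
  by apply: val_inj; rewrite /= conjsg1.
- split=> //.
  + move=> l; have [r rP] := Sc l; have [r' r'P] := S1c l; exists (r ++ r') => t.
    by move=> [St|St] h; rewrite mem_cat; [rewrite rP|rewrite r'P ?orbT].
  + move=> D /finset.setUP[DP|/imsetP[g _ ->]]; last first.
      by rewrite -(invgK g); exact: ok_conj.
    apply: ok_eq (S_ok D DP) => s Ds; split=> [|[//|/S1st[g sg]]]; first by left.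
    case: (PPup D g DP); apply/fintype.subsetP => d dD; rewrite -sg Ds//.
  + move=> s [/S_st[E EP Es]|/S1st[g sg]].
      by exists E => //; rewrite finset.inE EP.
    by exists (A :^ g)%G => //; apply/finset.setUP; right; exact: imset_f.
- move=> D g /finset.setUP[/(PPJ D g) DP|/imsetP[h _ ->]]; first by rewrite finset.inE DP.
  apply/finset.setUP; right; apply/imsetP; exists (h * g)%g => //.
  by apply: val_inj; rewrite /= conjsgM.
- move=> D D' /finset.setUP[DP DD|/imsetP[g _ ->] AD].
    by rewrite finset.inE (PPU D D').
  have [AgD|AgD] := eqVneq (A :^ g)%G D'.
    by rewrite -AgD; apply/finset.setUP; right; exact: imset_f.
  have PD : (D' :^ g^-1)%G \in PP.
    apply: PPA; rewrite /= -(conjsgK g A) properJ finset.properEneq AD andbT.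
    by apply: contra_neq AgD => e; apply: val_inj.
  rewrite finset.inE; apply/orP; left; have := PPJ _ g PD; congr (_ \in PP).
  by apply: val_inj; rewrite /= conjsgKV.
Qed.

End PermBasis.

(** * Limits along ultrafilters *)

Section Ultra.
Local Open Scope classical_set_scope.

Lemma ultra_nonempty (T : Type) (U : set_system T) (A : set T) :
  UltraFilter U -> U A -> exists t, A t.
Proof.
by move=> UU UA; exact: (@filter_ex _ U _ A UA).
Qed.

Lemma ultra_fin (T : Type) (U : set_system T) (X : finType) (f : T -> X) :
  UltraFilter U -> exists a, U [set t | f t = a].
Proof.
move=> UU; apply: contrapT => /forallNP nU.
suff Ur (r : seq X) : U [set t | f t \notin r].
  have [t] := ultra_nonempty UU (Ur (enum X)).
  by rewrite /= mem_enum.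
elim: r => [|a r IH]; first by apply: filterS filterT => t.
have [/nU//|na] := in_ultra_setVsetC [set t | f t = a] UU.
apply: filterS (filterI na IH) => t [/= ta tr].
by rewrite inE negb_or tr andbT; apply/eqP.
Qed.

Lemma ultra_forall (T : Type) (U : set_system T) (X : finType) (A : X -> set T) :
  UltraFilter U -> (forall x, U (A x)) -> U [set t | forall x, A x t].
Proof.
move=> UU UA; have Ur (r : seq X) : U [set t | forall x, x \in r -> A x t].
  elim: r => [|a r IH]; first by apply: filterS filterT => t.
  apply: filterS (filterI (UA a) IH) => t [/= ta tr] x.
  by rewrite inE => /orP[/eqP ->|/tr].
by apply: filterS (Ur (enum X)) => t tr x; apply: tr; rewrite mem_enum.
Qed.

(** An ultrafilter that eventually refines every level; limits of families indexed by levels are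
    taken along it. *)
Lemma ultra_directed (L : Type) (R : L -> L -> Prop) : L ->
  (forall i, R i i) -> (forall i j k, R k j -> R j i -> R k i) ->
  (forall i j, exists k, R k i /\ R k j) ->
  exists U : set_system L, UltraFilter U /\ forall i, U [set j | R j i].
Proof.
move=> l0 Rr Rt Rd; pose B i := [set j | R j i].
have FB : Filter (filter_from [set: L] B).
  apply: filter_fromT_filter => [|i j]; first by exists l0.
  by have [k [ki kj]] := Rd i j; exists k => l lk; split; exact: Rt lk _.
have PB : ProperFilter (filter_from [set: L] B).
  by apply: filter_from_proper => i _; exists i; exact: Rr.
have [U [UU UB]] := ultraFilterLemma PB; exists U; split=> // i.
by apply: UB; exists i.
Qed.

Lemma lgroup_lim (p : nat) (F : lgroup p) (T : Type) (U : set_system T) (f : T -> F) :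
  UltraFilter U -> exists x, forall i, U [set t | lpi i (f t) = lpi i x].
Proof.
move=> UU; have /choice[t tP] : forall i, exists t, U [set s | lpi i (f s) = lpi i (f t)].
  move=> i; have [a Ua] := ultra_fin (fun t => lpi i (f t)) UU.
  by have [t ta] := ultra_nonempty UU Ua; exists t; rewrite ta.
have [x xP] := lpi_compact (fun i => f (t i)); exists x => i.
have [j [ji jx]] := xP i; apply: filterS (tP j) => s /= sj.
by rewrite -jx; exact: (finer_eq ji).
Qed.

End Ultra.

(** * Groups of order p, and regular representations *)

Section DiscreteLog.
Local Open Scope ring_scope.
Variables (p : nat) (p_pr : prime p) (gT : finGroupType) (C : {group gT}).
Hypothesis C_card : #|C| = p.

Lemma prime_exp : exists e : 'F_p -> gT, [/\ forall a, e a \in C,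
  forall a b, e (a + b) = (e a * e b)%g, injective e &
  forall x, x \in C -> exists a, e a = x].
Proof.
have /cyclicP[z Cz] : cyclic C by apply: prime_cyclic; rewrite C_card.
have oz : #[z]%g = p by rewrite orderE -Cz.
have vp (a : 'F_p) : (a < p)%N by rewrite -[X in (_ < X)%N](Fp_cast p_pr).
exists (fun a => z ^+ (a : nat))%g; split.
- by move=> a; rewrite Cz mem_cycle.
- move=> a b; have -> : (a + b)%R = (((a : nat) + b) %% p)%N :> nat.
    by rewrite /=; congr (_ %% _)%N; exact: Fp_cast.
  by rewrite -expgnDr expg_mod// -oz expg_order.
- move=> a b /eqP; rewrite eq_expg_mod_order oz !modn_small// => /eqP ab.
  exact: val_inj.
- move=> x; rewrite Cz => /cycleP[k ->]; exists k%:R.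
  by rewrite val_Fp_nat// expg_mod// -oz expg_order.
Qed.

Definition pexp := sval (cid prime_exp).
Definition plog (x : gT) : 'F_p := odflt 0 [pick a | pexp a == x].

Lemma pexp_in a : pexp a \in C. Proof. by case: (svalP (cid prime_exp)). Qed.

Lemma pexpD a b : pexp (a + b) = (pexp a * pexp b)%g.
Proof. by case: (svalP (cid prime_exp)). Qed.

Lemma pexpK : cancel pexp plog.
Proof.
move=> a; rewrite /plog; case: pickP => [b /eqP|/(_ a)]; last by rewrite eqxx.
by case: (svalP (cid prime_exp)) => _ _ inj _ /inj.
Qed.

Lemma plogK x : x \in C -> pexp (plog x) = x.
Proof.
by move=> xC; case: (svalP (cid prime_exp)) => _ _ _ /(_ x xC)[a <-]; rewrite pexpK.
Qed.

Lemma plogM x y : x \in C -> y \in C -> plog (x * y)%g = plog x + plog y.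
Proof. by move=> xC yC; rewrite -{1}(plogK xC) -{1}(plogK yC) -pexpD pexpK. Qed.

Lemma pexp0 : pexp 0 = 1%g.
Proof. by apply: (@mulgI _ (pexp 0)); rewrite -pexpD addr0 mulg1. Qed.

Lemma plog1 : plog 1%g = 0. Proof. by rewrite -pexp0 pexpK. Qed.

End DiscreteLog.

Section Regular.
Local Open Scope group_scope.
Variable gT : finGroupType.

Fact reg_inj (g : gT) : injective (fun k : 'I_#|gT| => enum_rank (enum_val k * g)).
Proof. by move=> k l /enum_rank_inj/mulIg/enum_val_inj. Qed.

(** The regular representation replaces an arbitrary finite group by a symmetric group, so that
    labels range over one fixed type of targets. *)
Definition reg (g : gT) : 'S_#|gT| := perm (@reg_inj g).
Definition unreg (s : 'S_#|gT|) : gT := enum_val (s (enum_rank 1)).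

Lemma regK : cancel reg unreg.
Proof. by move=> g; rewrite /unreg permE !enum_rankK mul1g. Qed.

Lemma regM : {morph reg : x y / x * y}.
Proof. by move=> x y; apply/permP => k; rewrite permM !permE enum_rankK mulgA. Qed.

Lemma reg1 : reg 1 = 1.
Proof. by apply/permP => k; rewrite permE mulg1 enum_valK perm1. Qed.

Lemma reg_group_set (W : {group gT}) : group_set [set reg x | x in W].
Proof.
apply/group_setP; split; first by apply/imsetP; exists 1; rewrite ?reg1.
by move=> _ _ /imsetP[x xW ->] /imsetP[y yW ->]; rewrite -regM imset_f ?groupM.
Qed.

Lemma reg_pgroup (p : nat) (W : {group gT}) : p.-group W ->
  p.-group (Group (reg_group_set W)).
Proof. by rewrite /pgroup /= card_imset//; exact: can_inj regK. Qed.

End Regular.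

(** * The universal pro-p group of path classes *)

Section Pi1.
Local Open Scope group_scope.
Variables (p : nat) (p_pr : prime p) (V L : Type) (l0 : L).
Variable rel : L -> seq V -> seq V -> Prop.
Hypothesis rel_directed : forall i j, exists k, forall s t,
  rel k s t -> rel i s t /\ rel j s t.

Definition transport (gT : finGroupType) (W : {group gT}) (q : V -> V -> gT) :=
  [/\ forall u v w, q u v * q v w = q u w,
      exists i, forall v w v' w', rel i [:: v; w] [:: v'; w'] -> q v w = q v' w',
      p.-group W & forall v w, q v w \in W].

(* A label is a p-group valued cocycle on the quotient of the full simplicial
   complex on V. *)
Record label := Label {
  lab_n : nat;
  lab_q : V -> V -> 'S_lab_n;
  lab_transport : exists W, transport W lab_q
}.

Definition lprod (s : seq (V * V)) (c : label) : 'S_(lab_n c) :=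
  \prod_(e <- s) lab_q c e.1 e.2.

(** Membership in the closure, inside the product over all labels, of the group generated by the
    edges: finitely many coordinates at a time are those of a product of edges. *)
Definition coherent (x : forall c, 'S_(lab_n c)) :=
  forall r : seq label, exists s, forall c, List.In c r -> x c = lprod s c.

Definition fpi := {x : forall c, 'S_(lab_n c) | coherent x}.
HB.instance Definition _ := gen_eqMixin fpi.
HB.instance Definition _ := gen_choiceMixin fpi.

Lemma fpiP (x y : fpi) : (forall c, sval x c = sval y c) -> x = y.
Proof.
case: x y => [x xc] [y yc] /= xy.
have {}xy : x = y by apply: functional_extensionality_dep.
by subst y; congr exist; exact: Prop_irrelevance.
Qed.

Lemma lab_qV c v w : lab_q c w v = (lab_q c v w)^-1.
Proof.
have [W [qM _ _ _]] := lab_transport c.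
have q1 u : lab_q c u u = 1 by apply: (@mulgI _ (lab_q c u u)); rewrite qM mulg1.
by apply: (@mulgI _ (lab_q c v w)); rewrite qM q1 mulgV.
Qed.

Lemma lprodV s c : lprod [seq (e.2, e.1) | e <- rev s] c = (lprod s c)^-1.
Proof.
elim: s => [|e s IH]; first by rewrite /lprod !big_nil invg1.
by rewrite rev_cons map_rcons /lprod big_rcons /= big_cons invMg -lab_qV -IH.
Qed.

Fact coherent1 : coherent (fun=> 1).
Proof. by move=> r; exists [::] => c _; rewrite /lprod big_nil. Qed.

Fact coherentM x y : coherent x -> coherent y -> coherent (fun c => x c * y c).
Proof.
move=> xc yc r; have [s sP] := xc r; have [t tP] := yc r; exists (s ++ t) => c cr.
by rewrite sP// tP// /lprod big_cat.
Qed.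

Fact coherentV x : coherent x -> coherent (fun c => (x c)^-1).
Proof.
move=> xc r; have [s sP] := xc r; exists [seq (e.2, e.1) | e <- rev s] => c cr.
by rewrite sP// lprodV.
Qed.

Definition fpi_one : fpi := exist _ _ coherent1.
Definition fpi_mul (x y : fpi) : fpi := exist _ _ (coherentM (svalP x) (svalP y)).
Definition fpi_inv (x : fpi) : fpi := exist _ _ (coherentV (svalP x)).

Fact fpi_mulA : associative fpi_mul.
Proof. by move=> x y z; apply: fpiP => c /=; rewrite mulgA. Qed.
Fact fpi_mul1 : left_id fpi_one fpi_mul.
Proof. by move=> x; apply: fpiP => c /=; rewrite mul1g. Qed.
Fact fpi_mulg1 : right_id fpi_one fpi_mul.
Proof. by move=> x; apply: fpiP => c /=; rewrite mulg1. Qed.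
Fact fpi_mulV : left_inverse fpi_one fpi_inv fpi_mul.
Proof. by move=> x; apply: fpiP => c /=; rewrite mulVg. Qed.
Fact fpi_mulgV : right_inverse fpi_one fpi_inv fpi_mul.
Proof. by move=> x; apply: fpiP => c /=; rewrite mulgV. Qed.
HB.instance Definition _ := isGroup.Build fpi
  fpi_mulA fpi_mul1 fpi_mulg1 fpi_mulV fpi_mulgV.

Definition fpi_at (c : label) (x : fpi) := sval x c.

Lemma fpi_atM c : {morph fpi_at c : x y / x * y}. Proof. by []. Qed.

Lemma transport_reg (gT : finGroupType) (W : {group gT}) q : transport W q ->
  exists W', transport W' (fun v w => reg (q v w)).
Proof.
move=> [qM [i qi] Wp qW]; exists (Group (reg_group_set W)); split.
- by move=> u v w; rewrite -regM qM.
- by exists i => v w v' w' /qi ->.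
- exact: reg_pgroup.
- by move=> v w; exact: imset_f.
Qed.

Definition reg_label (gT : finGroupType) (W : {group gT}) q (qW : transport W q) :=
  Label (transport_reg qW).

Lemma lprod_reg (gT : finGroupType) (W : {group gT}) q (qW : transport W q) s :
  lprod s (reg_label qW) = reg (\prod_(e <- s) q e.1 e.2).
Proof.
elim: s => [|e s IH]; first by rewrite /lprod !big_nil reg1.
by rewrite /lprod !big_cons regM -IH.
Qed.

Lemma fpi_pelt c (x : fpi) : exists k, fpi_at c x ^+ (p ^ k) = 1.
Proof.
have [W [_ _ Wp qW]] := lab_transport c; have [s sP] := svalP x [:: c].
have xW : fpi_at c x \in W.
  by rewrite /fpi_at sP; [apply: group_prod => e _; exact: qW|left].
have /p_natP[n yn] : p.-nat #[fpi_at c x] by exact: mem_p_elt xW.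
by exists n; rewrite -yn expg_order.
Qed.

(** The common refinement of two labels is their product, made into a label again by the regular
    representation. *)
Lemma fpi_directed c d : exists k, forall x, fpi_at k x = 1 ->
  fpi_at c x = 1 /\ fpi_at d x = 1.
Proof.
have [W [qM [i qi] Wp qW]] := lab_transport c.
have [W' [qM' [i' qi'] Wp' qW']] := lab_transport d.
have [j ji] := rel_directed i i'.
have qq : transport (setX_group W W') (fun v w => (lab_q c v w, lab_q d v w)).
  split.
  - by move=> u v w; rewrite -(qM u v w) -(qM' u v w).
  - by exists j => v w v' w' /ji[/qi -> /qi' ->].
  - by rewrite /pgroup /= cardsX pnatM; apply/andP.
  - by move=> v w; apply/finset.setXP.
exists (reg_label qq) => x; have [s sP] := svalP x [:: reg_label qq; c; d].
rewrite /fpi_at !sP /=; [|by auto..].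
rewrite lprod_reg -[RHS]reg1 => /(can_inj (@regK _)) e.
have pE : \prod_(e <- s) (lab_q c e.1 e.2, lab_q d e.1 e.2) = (lprod s c, lprod s d).
  by rewrite /lprod; elim: s {sP e} => [|e s IH]; rewrite ?big_nil// !big_cons IH.
by move: e; rewrite pE => -[].
Qed.

Lemma fpi_sep x : (forall c, fpi_at c x = 1) -> x = 1.
Proof. by move=> x1; exact: fpiP. Qed.

Lemma transport1 : exists W, transport W (fun _ _ => 1 : 'S_0).
Proof.
exists 1%G; split; [by move=> *; rewrite mulg1|by exists l0|exact: pgroup1|].
by move=> v w; exact: group1.
Qed.
Definition label0 := Label transport1.

Lemma fpi_compact (s : label -> fpi) : exists x, forall i, exists j,
  (forall y, fpi_at j y = 1 -> fpi_at i y = 1) /\ fpi_at i (s j) = fpi_at i x.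
Proof.
have [|//|||U [UU Ui]] := @ultra_directed label
    (fun j i => forall y, fpi_at j y = 1 -> fpi_at i y = 1).
- exact: label0.
- by move=> i j k kj ji y /kj/ji.
- by move=> i j; have [k kP] := fpi_directed i j; exists k; split=> y /kP[].
pose x c := sval (cid (ultra_fin (fun j => sval (s j) c) UU)).
have Ux c : U (fun j => sval (s j) c = x c).
  exact: (svalP (cid (ultra_fin (fun j => sval (s j) c) UU))).
have xc : coherent x.
  move=> r; have [j jr] : exists j, forall c, List.In c r -> sval (s j) c = x c.
    apply: (ultra_nonempty (UU)); elim: r => [|c r IH]; first by apply: filterS filterT.
    by apply: filterS (filterI (Ux c) IH) => j [jc jr] d /= [<-|/jr].
  have [t tP] := svalP (s j) r; exists t => c cr.
  by rewrite -jr// tP.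
exists (exist _ _ xc) => i; have [j [ji jx]] := ultra_nonempty UU (filterI (Ui i) (Ux i)).
by exists j.
Qed.

Definition pi_lgroup : lgroup p := @LGroup p fpi label label0
  (fun c => 'S_(lab_n c)) fpi_at fpi_atM fpi_pelt fpi_directed fpi_sep fpi_compact.
Local Notation F1 := pi_lgroup.

Fact coherent_edge v w : coherent (fun c => lab_q c v w).
Proof. by move=> r; exists [:: (v, w)] => c _; rewrite /lprod big_seq1. Qed.
Definition pl v w : F1 := (exist _ _ (coherent_edge v w) : fpi).

Lemma pl_at c v w : lpi c (pl v w) = lab_q c v w. Proof. by []. Qed.

Lemma plM u v w : pl u v * pl v w = pl u w.
Proof. by apply: fpiP => c /=; have [W [qM _ _ _]] := lab_transport c. Qed.

Lemma pl1 v : pl v v = 1.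
Proof. by apply: (@mulgI _ (pl v v)); rewrite plM mulg1. Qed.

Lemma plV v w : (pl v w)^-1 = pl w v.
Proof. by apply: (@mulgI _ (pl v w)); rewrite mulgV plM pl1. Qed.

Lemma pi_near c (x : F1) : exists s, lpi c x = lpi c (\prod_(e <- s) pl e.1 e.2).
Proof.
have [s sP] := svalP x [:: c]; exists s.
rewrite /= /fpi_at sP; last by left.
elim: s {sP} => [|e s IH]; first by rewrite /lprod !big_nil.
by rewrite [lprod _ _]big_cons [in RHS]big_cons -/(lprod s c) IH.
Qed.

Lemma pi_dense (gT : finGroupType) (th th' : F1 -> gT) : lcont th -> lcont th' ->
  (forall v w, th (pl v w) = th' (pl v w)) -> th =1 th'.
Proof.
move=> hth hth' e x; have [i ti] := lcont_eq hth; have [j tj] := lcont_eq hth'.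
have [k [ki kj]] := finer2 i j; have [s xs] := pi_near k x.
rewrite (ti _ _ (finer_eq ki xs)) (tj _ _ (finer_eq kj xs)).
have th1 (f : F1 -> gT) : lcont f -> f 1 = 1.
  by move=> [fM _]; apply: (@mulgI _ (f 1)); rewrite -fM !mulg1.
elim: s {xs} => [|a s IH]; first by rewrite big_nil !th1.
by rewrite big_cons hth.1 hth'.1 e IH.
Qed.

(** A transport is, up to the regular representation, one of the labels, so the homomorphism it
    induces is a coordinate. *)
Lemma pi_univ (gT : finGroupType) (W : {group gT}) q : transport W q ->
  exists th : F1 -> gT, [/\ lcont th, forall x, th x \in W & forall v w, th (pl v w) = q v w].
Proof.
move=> qW; pose c := reg_label qW; exists (fun x : F1 => unreg (lpi (c : level F1) x)).
have xE (x : F1) : exists s, lpi (c : level F1) x = reg (\prod_(e <- s) q e.1 e.2).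
  have [s sP] := svalP x [:: c]; exists s; rewrite -lprod_reg.
  by rewrite /= /fpi_at sP//; left.
split.
- split; last by exists (c : level F1) => x ->; rewrite -reg1 regK.
  move=> x y; rewrite lpiM; have [s ->] := xE x; have [t ->] := xE y.
  by rewrite -regM !regK.
- move=> x; have [s ->] := xE x; rewrite regK; apply: group_prod => e _.
  by case: (qW).
- by move=> v w; rewrite pl_at regK.
Qed.

Section Action.
Variable a : V -> V.
Hypothesis rel_a : forall i s t, rel i s t -> rel i (map a s) (map a t).

Lemma transport_pull (c : label) : exists W, transport W (fun v w => lab_q c (a v) (a w)).
Proof.
have [W [qM [i qi] Wp qW]] := lab_transport c; exists W; split=> //.
by exists i => v w v' w' /rel_a/qi.
Qed.
Definition pull c := Label (transport_pull c).

Fact coherent_pull (x : forall c, 'S_(lab_n c)) : coherent x ->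
  coherent (fun c => x (pull c)).
Proof.
move=> xc r; have [s sP] := xc (map pull r); exists [seq (a e.1, a e.2) | e <- s] => c cr.
rewrite sP; last exact: List.in_map.
by rewrite /lprod big_map.
Qed.
Definition pact (x : F1) : F1 := (exist _ _ (coherent_pull (svalP x)) : fpi).

Lemma pactM x y : pact (x * y) = pact x * pact y.
Proof. exact: fpiP. Qed.

Lemma pact_pl v w : pact (pl v w) = pl (a v) (a w).
Proof. exact: fpiP. Qed.

Lemma pact_at c (x : F1) : lpi c (pact x) = lpi (pull c : level F1) x.
Proof. by []. Qed.

End Action.

Lemma pact_comp (a b d : V -> V) (ra : forall i s t, rel i s t -> rel i (map a s) (map a t))
    (rb : forall i s t, rel i s t -> rel i (map b s) (map b t))
    (rd : forall i s t, rel i s t -> rel i (map d s) (map d t)) :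
  (forall v w, pl (d v) (d w) = pl (a (b v)) (a (b w))) ->
  forall x, pact rd x = pact ra (pact rb x).
Proof.
move=> dab x; apply: lpi_inj => c; rewrite !pact_at.
apply: (@pi_dense _ (@lpi p F1 (pull rd c)) (@lpi p F1 (pull rb (pull ra c)))).
- exact: (@lpi_lcont p F1 (pull rd c)).
- exact: (@lpi_lcont p F1 (pull rb (pull ra c))).
by move=> v w; have := congr1 (lpi c) (dab v w).
Qed.

Lemma pact_id (d : V -> V) (rd : forall i s t, rel i s t -> rel i (map d s) (map d t)) :
  (forall v w, pl (d v) (d w) = pl v w) -> forall x, pact rd x = x.
Proof.
move=> dd x; apply: lpi_inj => c; rewrite pact_at.
apply: (@pi_dense _ (@lpi p F1 (pull rd c)) (@lpi p F1 c)).
- exact: (@lpi_lcont p F1 (pull rd c)).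
- exact: (@lpi_lcont p F1 c).
by move=> v w; have := congr1 (lpi c) (dd v w).
Qed.

End Pi1.

(** * From a basis modulo p to free generation *)

Section FreeBasis.
Local Open Scope group_scope.
Variables (p : nat) (p_pr : prime p) (F : lgroup p) (S : F -> Prop).
(** Projectivity in its smallest case, central kernels of order p; for finite p-groups every
    embedding problem is a succession of these. *)
Hypothesis central_lift : forall (gU : finGroupType) (W C : {group gU})
  (th0 : F -> coset_of C), p.-group W -> C \subset 'Z(W) -> #|C| = p -> lcont th0 ->
  (forall x, th0 x \in W / C) ->
  exists th1 : F -> gU, [/\ lcont th1, forall x, th1 x \in W &
    forall x, coset C (th1 x) = th0 x].
Hypothesis S_conv : converging S.
Hypothesis S_inj : forall m : F -> 'F_p, lhom m -> (forall s, S s -> m s = 0%R) ->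
  forall x, m x = 0%R.
Hypothesis S_lifts : lifts S.

Let Z x := S x \/ x = 1.

Lemma lcont1 (gT : finGroupType) (th : F -> gT) : lcont th -> th 1 = 1.
Proof. by move=> [tM _]; apply: (@mulgI _ (th 1)); rewrite -tM !mulg1. Qed.

(** Induction on the order of W: solve modulo a central C of order p, lift, and multiply by a
    homomorphism into C that repairs the values on [S]. The repairs have finite support since [S]
    converges to 1, so dual homomorphisms combine to one realising them. *)
Lemma basis_extension n (gT : finGroupType) (W : {group gT}) (phi : F -> gT) :
  #|W| < n -> p.-group W -> (forall z, Z z -> phi z \in W) -> phi 1 = 1 ->
  (exists i, forall z z', Z z -> Z z' -> lpi i z = lpi i z' -> phi z = phi z') ->
  exists th, [/\ lcont th, forall x, th x \in W & forall z, Z z -> th z = phi z].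
Proof.
elim: n gT W phi => // n IH gT W phi Wn Wp phiW phi1 [i phii].
have [W1|W1] := eqVneq (W : {set gT}) 1.
  exists (fun=> 1); split=> [|x|z /phiW]; last by rewrite W1 => /set1P.
    by split=> [x y|]; [rewrite mulg1|exists (level0 F)].
  exact: group1.
have Z1 : 'Z(W) != 1 by rewrite center_nil_eq1 ?(pgroup_nil Wp).
have ZW := center_sub W.
have [_ pZ _] := pgroup_pdiv (pgroupS ZW Wp) Z1.
have [x xZ ox] := Cauchy p_pr pZ.
pose C := <[x]>%G; have Cp : #|C| = p by rewrite -ox.
have CZ : C \subset 'Z(W) by rewrite cycle_subG.
have CW := fintype.subset_trans CZ ZW.
have WN y : y \in W -> y \in 'N(C) by exact/fintype.subsetP/normal_norm/sub_center_normal.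
have Zone : Z 1 by right.
have [||z Zz|||th0 [t0c t0W t0E]] := IH _ (W / C)%G (fun z => coset C (phi z)).
- rewrite -ltnS (leq_trans _ Wn)// ltnS ltn_quotient//.
  by apply: contraTneq (prime_gt1 p_pr) => C1; rewrite -Cp C1 cards1.
- exact: quotient_pgroup.
- by rewrite mem_quotient// phiW.
- by rewrite phi1 morph1.
- by exists i => z z' Zz Zz' zz'; rewrite (phii z z').
have [th1 [t1c t1W t1E]] := central_lift Wp CZ Cp t0c t0W.
pose lg := plog p_pr Cp; pose ex := pexp p_pr Cp.
have dC z : Z z -> (th1 z)^-1 * phi z \in C.
  move=> Zz; apply: coset_idr; first by rewrite groupM ?groupV ?WN ?phiW.
  by rewrite morphM ?groupV ?WN ?phiW// morphV ?WN//= t1E t0E// mulVg.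
have [j t1j] := lcont_eq t1c; have [k [ki kj]] := finer2 i j.
have fs : finsupp (res S (fun z => lg ((th1 z)^-1 * phi z))).
  have [r rP] := S_conv k; exists r => t.
  have [St|St] := pselect (S t); last by rewrite resN// eqxx.
  rewrite resE// => h; apply: rP => // t1; case/eqP: h.
  have e : lpi k t = lpi k 1 by rewrite lpi1.
  rewrite (t1j t 1 (finer_eq kj e)) (phii t 1 _ _ (finer_eq ki e))//; last by left.
  by rewrite phi1 (lcont1 t1c) mulg1 invg1 /lg plog1.
have [m [hm mE]] := lift_comb S_lifts fs.
have exC a y : y \in W -> ex a * y = y * ex a.
  by move=> yW; have /(fintype.subsetP CZ)/centerP[_ /(_ y yW)] := pexp_in p_pr Cp a.
exists (fun x => th1 x * ex (m x)); split.
- split=> [a b|].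
    rewrite t1c.1 hm.1 /ex pexpD -/ex !mulgA; congr (_ * _).
    by rewrite -!mulgA exC.
  have [j' mj] := lhom_eq hm; have [l [lj lj']] := finer2 j j'; exists l => y y1.
  have e : lpi l y = lpi l 1 by rewrite lpi1.
  by rewrite (t1j _ _ (finer_eq lj e)) (mj _ _ (finer_eq lj' e)) (lcont1 t1c) lhom1// mul1g /ex pexp0.
- by move=> y; rewrite groupM// (fintype.subsetP CW)//; exact: pexp_in.
- move=> z [Sz|->]; last by rewrite (lcont1 t1c) lhom1// /ex pexp0 phi1 mulg1.
  by rewrite mE// /ex /lg plogK ?mulVKg//; apply: dC; left.
Qed.

(** A Frattini argument on the image P of the pair (th, th'): if P is not diagonal, its diagonal
    part lies in a maximal subgroup, and P modulo this subgroup gives a nonzero homomorphism to F_p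
    vanishing on [S]. *)
Lemma basis_unique (gT : finGroupType) (th th' : F -> gT) : lcont th -> lcont th' ->
  (forall z, Z z -> th z = th' z) -> th =1 th'.
Proof.
move=> ht ht' tt; have [i ti] := lcont_eq ht; have [j tj] := lcont_eq ht'.
have [k [ki kj]] := finer2 i j.
pose pr x := (th x, th' x).
have prM x y : pr (x * y) = pr x * pr y by rewrite /pr ht.1 ht'.1.
have pr1 : pr 1 = 1 by rewrite /pr (lcont1 ht) (lcont1 ht').
pose I := [set y | `[< exists x, pr x = y >]].
have prI x : pr x \in I by rewrite finset.inE; apply/asboolP; exists x.
have gI : group_set I.
  apply/group_setP; split; first by rewrite -pr1 prI.
  move=> y y'; rewrite !finset.inE => /asboolP[x <-] /asboolP[x' <-].
  by apply/asboolP; exists (x * x').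
pose P := Group gI.
have Pp : p.-group P.
  apply: pgroup_pelt => // y; rewrite finset.inE => /asboolP[x <-].
  have [e xe] := lpi_pelt k x; exists e.
  have prX m : pr x ^+ m = pr (x ^+ m).
    by elim: m => [|m IH]; rewrite ?pr1// !expgS IH prM.
  have lX m : lpi k (x ^+ m) = lpi k x ^+ m.
    by elim: m => [|m IH]; rewrite ?lpi1// !expgS lpiM IH.
  have e1 : lpi k (x ^+ (p ^ e)) = lpi k 1 by rewrite lX xe lpi1.
  by rewrite prX /pr (ti _ _ (finer_eq ki e1)) (tj _ _ (finer_eq kj e1)) (lcont1 ht) (lcont1 ht').
pose D := (P : {set _}) :&: [set y | y.1 == y.2].
have inD y : (y \in D) = (y \in P) && (y.1 == y.2).
  by rewrite finset.in_setI; congr (_ && _); rewrite finset.inE.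
have gD : group_set D.
  apply/group_setP; split; first by rewrite inD group1 eqxx.
  move=> y y'; rewrite !inD => /andP[yP /eqP e] /andP[yP' /eqP e'].
  by rewrite (groupM yP yP') /= e e' eqxx.
have DP : Group gD \subset P by apply/fintype.subsetP => y; rewrite inD => /andP[].
have [DPE|[M maxM DM]] := maximal_exists DP.
  by move=> x; have := prI x; rewrite -[I]/(P : {set _}) -DPE inD => /andP[_ /eqP].
have MP := p_maximal_normal Pp maxM; have iM := p_maximal_index Pp maxM.
have Cp : #|(P / M)%G| = p by rewrite card_quotient// normal_norm.
pose lg := plog p_pr Cp.
have PN y : y \in P -> y \in 'N(M) by exact/fintype.subsetP/normal_norm.
have cP x : coset M (pr x) \in (P / M)%G by rewrite mem_quotient.
have hm : lhom (fun x => lg (coset M (pr x))).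
  split=> [x y|]; first by rewrite prM morphM ?(PN _ (prI _))// /lg plogM ?cP.
  exists k => x x1; have e : lpi k x = lpi k 1 by rewrite lpi1.
  rewrite /pr (ti _ _ (finer_eq ki e)) (tj _ _ (finer_eq kj e)) -/(pr 1) pr1.
  by rewrite morph1 /lg plog1.
have m0 : forall x, lg (coset M (pr x)) = 0%R.
  apply: (S_inj hm) => s Ss; rewrite coset_id ?/lg ?plog1//.
  apply: (fintype.subsetP DM); rewrite inD [_ \in _]prI /= tt//.
  by left.
have : P \subset M.
  apply/fintype.subsetP => y yP; have := yP; rewrite finset.inE => /asboolP[x xy].
  apply: coset_idr; first exact: PN.
  by rewrite -xy -(plogK p_pr Cp (cP x)) -/lg m0 pexp0.
by have := maxgroupp maxM; rewrite fintype.properE => /andP[_ /negP PM] /PM.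
Qed.

Theorem basis_free : free_on Z.
Proof.
split; first by right.
- by move=> gT W phi; exact: basis_extension (ltnSn _).
- exact: basis_unique.
Qed.

(** A point other than 1 is separated from 1 at some level, where only finitely many members
    survive; a finer level then separates it from each of these unless it is one of them. *)
Lemma basis_closed : lclosed Z.
Proof.
move=> x xZ; apply: contrapT => nZ.
have [i0 xi] : exists i, lpi i x <> 1.
  apply: contrapT => no; apply: nZ; right; apply: lpi_separated => i.
  by apply: contrapT => h; apply: no; exists i.
have [r rP] := S_conv i0.
have [j [ji jr]] : exists j, finer j i0 /\ forall s, s \in r -> s <> x -> lpi j s <> lpi j x.
  elim: r {rP} => [|s r [j [ji jr]]].
    by exists i0; split=> // s; rewrite in_nil.
  have [sx|sx] := pselect (s = x).
    by exists j; split=> // t; rewrite inE => /orP[/eqP -> //|]; exact: jr.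
  have [l lx] : exists l, lpi l s <> lpi l x.
    apply: contrapT => no; apply: sx; apply: lpi_inj => l.
    by apply: contrapT => h; apply: no; exists l.
  have [k [kj kl]] := finer2 j l; exists k; split; first exact: finer_trans ji.
  move=> t; rewrite inE => /orP[/eqP -> _|tr tx] e; first exact/lx/(finer_eq kl).
  exact/(jr t tr tx)/(finer_eq kj).
have [y Zy yx] := xZ j; have := finer_eq ji yx => y0.
case: Zy => [Sy|y1]; last by rewrite y1 lpi1 in y0; apply: xi.
have yr : y \in r by apply: rP => //; rewrite y0.
have [yE|yE] := pselect (y = x); first by apply: nZ; left; rewrite -yE.
exact: (jr y yr yE).
Qed.

End FreeBasis.

Lemma alternating3 (E : zmodType) (x y z : E) : (- x - y + (y - (z - x)) = - z)%R.
Proof. by rewrite opprB -addrA addKr addKr. Qed.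

Lemma alternating4 (E : zmodType) (a b c d : E) :
  (a + b = c + d -> c - (b - (d - a)) = 0)%R.
Proof. by move=> e; rewrite opprB !addrA -e (addrC a) addrK subrr. Qed.

Lemma subr_swap (E : zmodType) (a b a' b' : E) : (b' - a' = b - a -> a' - a = b' - b)%R.
Proof.
move=> h; have -> : (b' = b - a + a')%R by rewrite -h subrK.
by rewrite [RHS]addrC !addrA addNr add0r addrC.
Qed.

(** * The quotient complex V/N and its fundamental group *)

Section Equivariant.
Variables (p : nat) (p_pr : prime p) (gT : finGroupType).
Variables (V : Type) (v0 : V) (N : Type) (nA : N -> V -> V).
Variables (L : Type) (l0 : L) (brel : L -> V -> V -> Prop).
Variables (act : gT -> V -> V) (ok : seq V -> Prop).
Hypothesis brel_refl : forall i v, brel i v v.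
Hypothesis brel_sym : forall i v w, brel i v w -> brel i w v.
Hypothesis brel_trans : forall i u v w, brel i u v -> brel i v w -> brel i u w.
Hypothesis brel_directed : forall i j, exists k, forall v w,
  brel k v w -> brel i v w /\ brel j v w.
Hypothesis brel_sep : forall v w, (forall i, brel i v w) -> v = w.
Hypothesis brel_lim : forall (U : set_system L) (f : L -> V), UltraFilter U ->
  exists x, forall i, U (fun l => brel i (f l) x).
Hypothesis brel_nA : forall i n v w, brel i v w -> brel i (nA n v) (nA n w).
Hypothesis brel_act : forall i g v w, brel i v w -> brel i (act g v) (act g w).
Hypothesis nA_1 : exists n, forall v, nA n v = v.
Hypothesis nA_M : forall n n', exists n'', forall v, nA n'' v = nA n (nA n' v).
Hypothesis nA_V : forall n, exists n', forall v, nA n' (nA n v) = v.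
Hypothesis act_nA : forall g n, exists n', forall v, act g (nA n v) = nA n' (act g v).
Hypothesis act_1' : exists n, forall v, act 1%g v = nA n v.
Hypothesis act_M' : forall g h, exists n, forall v, act (g * h)%g v = nA n (act g (act h v)).
Hypothesis ok_nA : forall n s, ok s -> ok (map (nA n) s).
Hypothesis ok_act : forall g s, ok s -> ok (map (act g) s).
Hypothesis ok_face : forall s t, face t s -> ok s -> ok t.
Hypothesis ok_closed : forall s, (forall i, exists2 t, ok t & srel (brel i) s t) -> ok s.

(** One [n] moves the entire list: classes are simplices of V/N, not lists of vertices of V/N. The
    action of the finite group is an action only up to this relation. *)
Definition qrel i s t := exists n, srel (brel i) (map (nA n) s) t.

Lemma srel_qrel i s t : srel (brel i) s t -> qrel i s t.
Proof.
have [n n1] := nA_1; move=> st; exists n.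
by have -> : map (nA n) s = s by rewrite -[RHS]map_id; apply: eq_map.
Qed.

Lemma qrel_refl i s : qrel i s s.
Proof. by apply: srel_qrel; exact: srel_refl. Qed.

Lemma qrel_nA i n s : qrel i s (map (nA n) s).
Proof. by exists n; exact: srel_refl. Qed.

Lemma qrel_sym i s t : qrel i s t -> qrel i t s.
Proof.
move=> [n st]; have [n' nK] := nA_V n; exists n'; apply: (srel_sym (@brel_sym i)).
have -> : s = map (nA n') (map (nA n) s).
  by rewrite -map_comp -[LHS]map_id; apply: eq_map => v /=; rewrite nK.
by apply: srel_map st; exact: brel_nA.
Qed.

Lemma qrel_trans i s t u : qrel i s t -> qrel i t u -> qrel i s u.
Proof.
move=> [n st] [n' tu]; have [n2 nM] := nA_M n' n; exists n2.
have -> : map (nA n2) s = map (nA n') (map (nA n) s).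
  by rewrite -map_comp; apply: eq_map => v /=; rewrite nM.
apply: (srel_trans (@brel_trans i)) tu.
by apply: srel_map st; exact: brel_nA.
Qed.

Lemma qrel_size i s t : qrel i s t -> size s = size t.
Proof. by move=> [n /srel_size]; rewrite size_map. Qed.

Lemma qrel_directed i j : exists k, forall s t, qrel k s t -> qrel i s t /\ qrel j s t.
Proof.
have [k kP] := brel_directed i j; exists k => s t [n st].
by split; exists n; apply: srel_sub st => x y /kP[].
Qed.

Lemma qrel_act i g s t : qrel i s t -> qrel i (map (act g) s) (map (act g) t).
Proof.
move=> [n st]; have [n' nn'] := act_nA g n; exists n'.
have -> : map (nA n') (map (act g) s) = map (act g) (map (nA n) s).
  by rewrite -!map_comp; apply: eq_map => v /=; rewrite nn'.
by apply: srel_map st; exact: brel_act.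
Qed.

Lemma qact_1 i s : qrel i (map (act 1%g) s) s.
Proof.
have [n n1] := act_1'; apply: qrel_sym; rewrite (eq_map n1); exact: qrel_nA.
Qed.

Lemma qact_M i g h s : qrel i (map (act (g * h)%g) s) (map (act g) (map (act h) s)).
Proof.
have [n nM] := act_M' g h; apply: qrel_sym.
have -> : map (act (g * h)%g) s = map (nA n) (map (act g) (map (act h) s)).
  by rewrite -!map_comp; apply: eq_map => v /=; rewrite nM.
exact: qrel_nA.
Qed.

Lemma qrel_cobd i (f : seq V -> 'F_p) : (forall s t, qrel i s t -> f s = f t) ->
  forall s t, qrel i s t -> cobd f s = cobd f t.
Proof.
move=> fi s t [n st]; transitivity (cobd f (map (nA n) s)).
  by rewrite cobd_map; congr (cobd _ s); apply/funext => u; exact/fi/qrel_nA.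
by apply: srel_cobd st _ => u v /srel_qrel/fi.
Qed.

Lemma srel_face (r : V -> V -> Prop) (h : V -> V) s t : face t s ->
  srel r (map h s) s -> srel r (map h t) t.
Proof. by elim=> /= [x u [] //|x u w _ IH [xx /IH]]. Qed.

Lemma qrel_face i g s t : face t s -> qrel i (map (act g) s) s ->
  qrel i (map (act g) t) t.
Proof.
move=> ts [n sn]; exists n; rewrite -map_comp; apply: (srel_face ts).
by rewrite map_comp.
Qed.

Lemma ultra_fine : exists U : set_system L, UltraFilter U /\
  forall i, U (fun j => forall v w, brel j v w -> brel i v w).
Proof.
apply: ultra_directed => //.
- by move=> i j k kj ji v w /kj/ji.
- by move=> i j; have [k kP] := brel_directed i j; exists k; split=> v w /kP[].
Qed.

Lemma seq_compact n (s : L -> seq V) : (forall i, size (s i) = n) ->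
  exists x, size x = n /\ forall i, exists j,
    (forall v w, brel j v w -> brel i v w) /\ srel (brel i) (s j) x.
Proof.
move=> sn; have [U [UU Ui]] := ultra_fine.
have /choice[x xP] : forall k : 'I_n, exists x, forall i,
    U (fun l => brel i (nth v0 (s l) k) x).
  by move=> k; exact: (brel_lim (fun l => nth v0 (s l) k)).
exists (mkseq (fun k => if insub k is Some k' then x k' else v0) n).
split=> [|i]; first by rewrite size_mkseq.
have Ux := ultra_forall UU (fun k : 'I_n => xP k i).
have [j [ij jx]] := ultra_nonempty UU (filterI (Ui i) Ux); exists j; split=> //.
apply: (@srel_nth _ _ v0) => [|k]; rewrite sn ?size_mkseq// => kn.
by rewrite nth_mkseq// (insubT (fun k => k < n) kn); exact: (jx (Ordinal kn)).
Qed.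

Lemma qrel_compact n (s : L -> seq V) : (forall i, size (s i) = n) ->
  exists x, size x = n /\ forall i, exists j,
    (forall s t, qrel j s t -> qrel i s t) /\ qrel i (s j) x.
Proof.
move=> /seq_compact[x [xn xP]]; exists x; split=> // i; have [j [ji jx]] := xP i.
exists j; split; last exact: srel_qrel.
by move=> u t [n' ut]; exists n'; exact: srel_sub ut.
Qed.

Lemma degenerate_nth (s : seq V) : degenerate s <->
  exists k, k.+1 < size s /\ nth v0 s k = nth v0 s k.+1.
Proof.
split=> [|[k []]].
  elim=> [x u|x u _ [k [ks e]]]; first by exists 0%N.
  by exists k.+1.
elim: s k => // x [//|y s] IH [_ /= ->|k ks e]; first exact: degenerate_head.
by apply: degenerate_tail; exact: IH e.
Qed.

(** The position of the repeated entry takes finitely many values, so one position works along an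
    ultrafilter, and entries close at all levels are equal. *)
Lemma qdegenerate_closed s :
  (forall i, exists2 t, degenerate t & qrel i s t) -> degenerate s.
Proof.
move=> sd; have /choice[k kP] : forall i, exists k : 'I_(size s), k.+1 < size s /\
    brel i (nth v0 s k) (nth v0 s k.+1).
  move=> i; have [t td st] := sd i; have [n ts] := qrel_sym st.
  have /degenerate_nth[k] : degenerate (map (nA n) t) by exact: degenerate_map.
  rewrite (srel_size ts) => -[ks e]; exists (Ordinal (ltnW ks)); split=> //=.
  have nthr (u w : seq V) l : srel (brel i) u w -> l < size u ->
      brel i (nth v0 u l) (nth v0 w l).
    by elim: u w l => [|a u IH] [|b w] [|l] //= [ab uw] lu //; exact: IH.
  apply: (brel_trans (brel_sym (nthr _ _ _ ts _))).
    by rewrite (srel_size ts) ltnW.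
  by rewrite e; apply: nthr => //; rewrite (srel_size ts).
have [U [UU Ui]] := ultra_fine; have [a Ua] := ultra_fin k UU.
have [j ja] := ultra_nonempty UU Ua; have [ks _] := kP j.
rewrite (ja : k j = a) in ks.
apply/degenerate_nth; exists a; split=> //; apply: brel_sep => i.
have [l [li la]] := ultra_nonempty UU (filterI (Ui i) Ua).
by apply: li; have [_] := kP l; rewrite (la : k l = a).
Qed.

Local Notation qcoch n f := (coch act qrel n 1%G ok (fun=> False) f).

(** A limit of counterexamples would be a simplex that is itself degenerate, hence no
    counterexample. *)
Lemma near_degenerate i n : exists j, (forall v w, brel j v w -> brel i v w) /\
  forall s d, ok s -> size s = n -> degenerate d -> srel (brel j) s d ->
  exists2 t, ok t /\ degenerate t & qrel i s t.
Proof.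
apply: contrapT => no.
have P j : (forall v w, brel j v w -> brel i v w) -> exists s, [/\ ok s, size s = n,
    exists2 d, degenerate d & srel (brel j) s d &
    ~ exists2 t, ok t /\ degenerate t & qrel i s t].
  move=> ji; apply: contrapT => ns; apply: no; exists j; split=> // s d os sn dd sd.
  by apply: contrapT => nt; apply: ns; exists s; split=> //; exists d.
have [s0 [os0 s0n _ _]] := P i (fun v w => id).
have /choice[s sP] : forall j, exists s, [/\ ok s, size s = n,
    (forall v w, brel j v w -> brel i v w) -> exists2 d, degenerate d & srel (brel j) s d &
    (forall v w, brel j v w -> brel i v w) ->
      ~ exists2 t, ok t /\ degenerate t & qrel i s t].
  move=> j; have [ji|nji] := pselect (forall v w, brel j v w -> brel i v w).
    by have [s [os sn sd snt]] := P j ji; exists s; split.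
  by exists s0.
have sn j : size (s j) = n by case: (sP j).
have [x [xn xP]] := seq_compact sn.
have ox : ok x.
  apply: ok_closed => l; have [j [_ jx]] := xP l; exists (s j); first by case: (sP j).
  exact: (srel_sym (@brel_sym _)).
have dx : degenerate x.
  apply: qdegenerate_closed => l; have [k kP] := brel_directed i l.
  have [j [jk jx]] := xP k.
  have ji v w : brel j v w -> brel i v w by move=> /jk/kP[].
  have [_ _ /(_ ji)[d dd sd] _] := sP j; exists d => //; apply: qrel_trans (srel_qrel (srel_sub _ sd)).
    apply/srel_qrel/(srel_sym (@brel_sym _)).
    by apply: srel_sub jx => v w /kP[].
  by move=> v w /jk/kP[].
have [j [ji jx]] := xP i; have [_ _ _ /(_ ji)] := sP j; apply.
by exists x => //; exact: srel_qrel.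
Qed.

(** Bridges the two notions of normalisation: [coch] asks for vanishing on degenerate simplices,
    [nice_cochain] on all degenerate lists. Setting [f] to 0 near degenerate lists changes nothing
    on simplices by [near_degenerate]. *)
Lemma nice_coch n (f : seq V -> 'F_p) : qcoch n f ->
  exists f', nice_cochain nA brel f' /\ forall s, ok s -> size s = n -> f' s = f s.
Proof.
move=> [[i fi] _ fd _]; have [j [ji jP]] := near_degenerate i n.
pose bad s := size s = n -> exists2 d, degenerate d & srel (brel j) s d.
pose f' s : 'F_p := if `[< bad s >] then 0%R else f s.
exists f'; split; last first.
  move=> s os sn; rewrite /f'; case: asboolP => // /(_ sn)[d dd sd].
  have [t [ot td] st] := jP s d os sn dd sd; rewrite (fi _ _ st) fd//.
  by rewrite -(qrel_size st).
have badn m s : bad s -> bad (map (nA m) s).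
  move=> bs; rewrite /bad size_map => /bs[d dd sd]; exists (map (nA m) d).
    exact: degenerate_map.
  by apply: srel_map sd; exact: brel_nA.
have badr s t : srel (brel j) s t -> bad s -> bad t.
  move=> st bs; rewrite /bad -(srel_size st) => /bs[d dd sd]; exists d => //.
  exact: (srel_trans (@brel_trans j) (srel_sym (@brel_sym j) st) sd).
split.
- move=> m s; rewrite /f' -(fi _ _ (qrel_nA i m s)).
  congr (if _ then _ else _); apply: asbool_equiv_eq; split; last exact: badn.
  have [m' mK] := nA_V m; move/(badn m'); rewrite -map_comp.
  by rewrite (eq_map (g := id)) ?map_id// => v /=; rewrite mK.
- exists j => s t st; rewrite /f'; rewrite (fi s t); last first.
    by apply/srel_qrel/srel_sub/st.
  congr (if _ then _ else _); apply: asbool_equiv_eq; split; first exact: badr.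
  by apply: badr; exact: (srel_sym (@brel_sym _)).
- move=> s sd; rewrite /f' asboolT// => _; exists s => //; exact: srel_refl.
Qed.

Lemma coch_nice n (f : seq V -> 'F_p) : nice_cochain nA brel f -> qcoch n f.
Proof.
move=> [fN [i fi] fd]; split=> //.
- by exists i => s t [m /fi <-]; rewrite fN.
- move=> b s /set1P -> _ _; have [m m1] := act_1'.
  by rewrite (eq_map m1) fN.
- by move=> s _ _; exact: fd.
Qed.

Lemma exact_on_at : (forall m, exact_at 'F_p nA brel ok m.+3) ->
  exact_on p act qrel 1%G ok (fun=> False).
Proof.
move=> ex n f hf fc; have [f' [f'n f'f]] := nice_coch hf.
have [|g [gn gf]] := ex n f' f'n.
  move=> s os sn; rewrite -(fc s os sn); apply: cobd_local => t ts.
  apply: f'f; first exact: ok_face ts os.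
  by apply: succn_inj; rewrite -sn (face_size ts).
exists g; split; first exact: coch_nice.
by move=> s os sn; rewrite -f'f// gf.
Qed.

Hypothesis gTp : (p.-group [set: gT])%g.
Hypothesis ok_dim : exists D, forall s, ok s -> (D < size s)%N -> degenerate s.
Hypothesis ok_exact : forall m, exact_at 'F_p nA brel ok m.+3.
Hypothesis ok_exact1 : exact_at 'F_p (fun (_ : unit) (v : V) => v) brel ok 2.
Hypothesis ok_connected : forall (T : Type) (u : V -> T),
  (exists i, forall v w, brel i v w -> u v = u w) ->
  (forall v w, ok [:: v; w] -> u v = u w) -> forall v w, u v = u w.

Local Notation F1 := (@pi_lgroup p V L l0 qrel qrel_directed).
Local Notation pl := (@pl p V L l0 qrel qrel_directed).
Local Notation fixed := (fixed act qrel ok).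

Lemma pl_qrel v w v' w' : (forall i, qrel i [:: v; w] [:: v'; w']) -> pl v w = pl v' w'.
Proof.
move=> vw; apply: lpi_inj => c /=; have [W [_ [i qi] _ _]] := lab_transport c.
exact/qi/vw.
Qed.

Lemma pl_nA n v w : pl (nA n v) (nA n w) = pl v w.
Proof. by apply: pl_qrel => i; exact/qrel_sym/(qrel_nA i n [:: v; w]). Qed.

Definition fact g : F1 -> F1 := pact (fun i s t => @qrel_act i g s t).

Lemma fact_pl g v w : fact g (pl v w) = pl (act g v) (act g w).
Proof. exact: pact_pl. Qed.

Lemma fact1 x : fact 1%g x = x.
Proof.
by apply: pact_id => v w; have [n n1] := act_1'; rewrite !n1 pl_nA.
Qed.

Lemma factG g h x : fact (g * h)%g x = fact g (fact h x).
Proof.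
by apply: pact_comp => v w; have [n nM] := act_M' g h; rewrite !nM pl_nA.
Qed.

Lemma factM g x y : fact g (x * y)%g = (fact g x * fact g y)%g.
Proof. exact: pactM. Qed.

Lemma fact_c g (i : level F1) : exists j : level F1, forall x,
  lpi j x = 1%g -> lpi i (fact g x) = 1%g.
Proof. by exists (pull (fun i s t => @qrel_act i g s t) i). Qed.

Lemma fact_eq g (i : level F1) : exists j : level F1, forall x y,
  lpi j x = lpi j y -> lpi i (fact g x) = lpi i (fact g y).
Proof. by exists (pull (fun i s t => @qrel_act i g s t) i). Qed.

(** The abstract subgroup generated by the edges of the A-fixed subcomplex; its closure [Bf A] is
    the group fed to the basis construction. *)
Inductive bgen (A : {set gT}) : F1 -> Prop :=
| bgen1 : bgen A 1%g
| bgen_edge x v w : bgen A x -> fixed A [:: v; w] -> bgen A (x * pl v w)%g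
| bgen_edgeV x v w : bgen A x -> fixed A [:: v; w] -> bgen A (x * pl w v)%g.

Lemma bgenM A x y : bgen A x -> bgen A y -> bgen A (x * y)%g.
Proof.
move=> gx; elim=> [|{}y v w _ IH vw|{}y v w _ IH vw]; first by rewrite mulg1.
- by rewrite mulgA; exact: bgen_edge.
- by rewrite mulgA; exact: bgen_edgeV.
Qed.

Lemma bgen_pl A v w : fixed A [:: v; w] -> bgen A (pl v w) /\ bgen A (pl w v).
Proof.
move=> vw; split; rewrite -[pl _ _]mul1g.
- by apply: bgen_edge vw; exact: bgen1.
- by apply: bgen_edgeV vw; exact: bgen1.
Qed.

Lemma bgenV A x : bgen A x -> bgen A x^-1%g.
Proof.
elim=> [|{}x v w _ IH /bgen_pl[? ?]|{}x v w _ IH /bgen_pl[? ?]].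
- by rewrite invg1; exact: bgen1.
- by rewrite invgM plV; exact: bgenM.
- by rewrite invgM plV; exact: bgenM.
Qed.

Definition Bf (A : {group gT}) (x : F1) := forall i : level F1, exists2 y, bgen A y & lpi i y = lpi i x.

Lemma bgen_Bf (A : {group gT}) x : bgen A x -> Bf A x.
Proof. by move=> gx i; exists x. Qed.

Lemma Bf_group A : lsubgroup (Bf A).
Proof.
split=> [|x y Bx By i|x Bx i]; first exact/bgen_Bf/bgen1.
- have [x' gx xx] := Bx i; have [y' gy yy] := By i.
  by exists (x' * y')%g; [exact: bgenM|rewrite !lpiM xx yy].
- have [x' gx xx] := Bx i; exists x'^-1%g; [exact: bgenV|by rewrite !lpiV xx].
Qed.

Lemma Bf_closed A : lclosed (Bf A).
Proof.
by move=> x Bx i; have [y By <-] := Bx i; exact: By.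
Qed.

Lemma Bf_eq (A : {group gT}) (T : Type) (u u' : F1 -> T) :
  (exists i : level F1, forall x y, lpi i x = lpi i y -> u x = u y) ->
  (exists i : level F1, forall x y, lpi i x = lpi i y -> u' x = u' y) ->
  (forall x, bgen A x -> u x = u' x) -> forall x, Bf A x -> u x = u' x.
Proof.
move=> [i ui] [j uj] uu x Bx; have [k [ki kj]] := finer2 i j.
have [y gy yx] := Bx k; rewrite -(ui y) -?(uj y) ?uu//; exact: finer_eq yx.
Qed.

Lemma lhom_Bf (A : {group gT}) (m m' : F1 -> 'F_p) : lhom m -> lhom m' ->
  (forall v w, fixed A [:: v; w] -> m (pl v w) = m' (pl v w)) ->
  forall x, Bf A x -> m x = m' x.
Proof.
move=> hm hm' mm; apply: Bf_eq => [||x]; [exact: lhom_eq|exact: lhom_eq|].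
elim=> [|{}x v w _ IH vw|{}x v w _ IH vw]; first by rewrite !lhom1.
- by rewrite hm.1 hm'.1 IH mm.
- by rewrite hm.1 hm'.1 IH -plV !lhomV// mm.
Qed.

Lemma fixed1 s : ok s -> fixed 1%g s.
Proof.
move=> os; split=> //; apply/fintype.subsetP => a /set1P ->.
by apply/stabP => i; exact: qact_1.
Qed.

(** Path classes between arbitrary vertices are approximated by products of edges because the
    complex is connected; this is where symbols [pl v w] for all pairs are reduced to those of
    edges. *)
Lemma Bf_all x : Bf 1%G x.
Proof.
move=> i; have edge v w : exists2 y, bgen 1%g y & lpi i y = lpi i (pl v w).
  pose u w : Prop := exists2 y, bgen 1%g y & lpi i y = lpi i (pl v w).
  have [W [_ [l ql] _ _]] := lab_transport i.
  have uv : u v by exists 1%g; [exact: bgen1|rewrite pl1].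
  rewrite -/(u w) -(ok_connected (u := u) _ _ v w)//.
    exists l => a b ab; apply/propext.
    have e : lpi i (pl v a) = lpi i (pl v b).
      by apply: ql; apply: srel_qrel => /=; split.
    by rewrite /u e.
  move=> a b ab; have [g1 g2] := bgen_pl (fixed1 ab).
  apply/propext; split=> -[y gy e].
    by exists (y * pl a b)%g; [exact: bgenM|rewrite lpiM e -lpiM plM].
  by exists (y * pl b a)%g; [exact: bgenM|rewrite lpiM e -lpiM plM].
have [s ->] := pi_near i x; elim: s => [|e s [y gy ye]].
  by exists 1%g; [exact: bgen1|rewrite big_nil].
have [z gz ze] := edge e.1 e.2; exists (z * y)%g; first exact: bgenM.
by rewrite big_cons !lpiM ye ze.
Qed.

Lemma Bf_fix (A : {group gT}) a x : Bf A x -> a \in A -> fact a x = x.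
Proof.
move=> Bx aA; apply: lpi_inj => i; apply: (Bf_eq (A := A)
  (u := fun x => lpi i (fact a x)) (u' := lpi i)) Bx => [||y].
- exact: fact_eq.
- by exists i.
elim=> [|{}y v w _ IH vw|{}y v w _ IH vw].
- by have [j _] := fact_c a i; congr (lpi i _); apply: fpiP.
- rewrite factM !lpiM IH fact_pl; congr (_ * lpi i _)%g; apply: pl_qrel => j.
  by have [_ /fintype.subsetP/(_ a aA)/stabP] := vw.
- rewrite factM !lpiM IH fact_pl; congr (_ * lpi i _)%g; rewrite -plV -[RHS]plV.
  congr (_^-1)%g; apply: pl_qrel => j.
  by have [_ /fintype.subsetP/(_ a aA)/stabP] := vw.
Qed.

Lemma Bf_act (A : {group gT}) g x : Bf A x -> Bf (A :^ g^-1)%G (fact g x).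
Proof.
move=> Bx i; have [j ij] := fact_eq g i; have [y gy yx] := Bx j.
exists (fact g y); last exact: ij.
have fx v w : fixed A [:: v; w] -> fixed (A :^ g^-1)%g [:: act g v; act g w].
  exact: (fixed_act qrel_sym qrel_trans qrel_act qact_1 qact_M ok_act g).
elim: gy => [|{yx}y v w _ IH /fx vw|{yx}y v w _ IH /fx vw].
- have -> : fact g 1%g = 1%g by apply: fpiP.
  exact: bgen1.
- by rewrite factM fact_pl; exact: bgen_edge.
- by rewrite factM fact_pl; exact: bgen_edgeV.
Qed.

Lemma Bf_sub (A A' : {group gT}) x : A \subset A' -> Bf A' x -> Bf A x.
Proof.
move=> AA Bx i; have [y gy <-] := Bx i; exists y => //.
elim: gy => [|{}y v w _ IH vw|{}y v w _ IH vw]; first exact: bgen1.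
- by apply: bgen_edge => //; apply: fixed_sub vw.
- by apply: bgen_edgeV => //; apply: fixed_sub vw.
Qed.

Lemma additive_lhom (q : V -> V -> 'F_p) :
  (forall u v w, q u v + q v w = q u w)%R ->
  (exists i, forall v w v' w', qrel i [:: v; w] [:: v'; w'] -> q v w = q v' w') ->
  exists m : F1 -> 'F_p, lhom m /\ forall v w, m (pl v w) = q v w.
Proof.
move=> qD qi; have qT : transport p qrel [set: 'F_p]%G q.
  split=> //; last by move=> v w; rewrite finset.inE.
  by rewrite /pgroup cardsT card_Fp// pnat_id.
have [th [[thM [i ti]] _ tq]] := pi_univ l0 qrel_directed qT.
by exists th; split=> //; split=> //; exists i.
Qed.

Lemma qrel2 i v w v' w' : qrel i [:: v; w] [:: v'; w'] ->
  exists n, brel i (nA n v) v' /\ brel i (nA n w) w'.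
Proof. by move=> [n /= [? [? _]]]; exists n. Qed.

(** Degree 1 cohomology of V vanishes without the group, so f is the increment of some [g] upstairs.
    [g] need not be N-invariant, but v |-> g(n v) - g(v) is constant by connectedness, so its
    increments are a transport on V/N. *)
Lemma integrate (f : seq V -> 'F_p) : qcoch 2 f -> cocycle 2 ok f ->
  exists m : F1 -> 'F_p, lhom m /\ forall v w, ok [:: v; w] -> m (pl v w) = f [:: v; w].
Proof.
move=> hf fc; have [f' [[fN [i fi] fd] ff]] := nice_coch hf.
have [|s os sn|g [[_ [j gj] _] gE]] := ok_exact1 (f := f').
- by split=> // [n s|]; [rewrite map_id|exists i].
- rewrite -(fc s os sn); apply: cobd_local => t ts; apply: ff; first exact: ok_face ts os.
  by apply: succn_inj; rewrite -sn (face_size ts).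
have fg v w : ok [:: v; w] -> f' [:: v; w] = (g [:: w] - g [:: v])%R.
  by move=> vw; rewrite gE//= subr0.
pose q v w := (g [:: w] - g [:: v])%R.
have qN n v w : q (nA n v) (nA n w) = q v w.
  rewrite /q; apply/esym/subr_swap/esym.
  apply: (ok_connected (u := fun v => g [:: nA n v] - g [:: v])%R) => [|a b ab].
  - by exists j => a b ab; congr (_ - _)%R; apply: gj => /=; split=> //; exact: brel_nA.
  - have := fN n [:: a; b]; rewrite /= !fg//; last exact: (ok_nA n ab).
    exact: subr_swap.
have [||m [hm mq]] := additive_lhom (q := q).
- by move=> u v w; rewrite /q addrC addrA subrK.
- exists j => v w v' w' /qrel2[n [nv nw]]; rewrite -(qN n).
  by congr (_ - _)%R; apply: gj.
by exists m; split=> // v w vw; rewrite mq -ff// fg.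
Qed.

Definition edge_cochain (m : F1 -> 'F_p) (s : seq V) : 'F_p :=
  if s is [:: v; w] then m (pl v w) else 0%R.

Lemma edge_cochain_lc m : lhom m -> lc qrel (edge_cochain m).
Proof.
move=> hm; have [c mc] := lhom_eq hm; have [W [_ [i qi] _ _]] := lab_transport c.
exists i => s t st; have := qrel_size st.
case: s st => [|v [|w [|? ?]]]; case: t => [|v' [|w' [|? ?]]] //= st _.
exact/mc/qi.
Qed.

Lemma edge_cochain_cocycle m R : lhom m -> cocycle 2 R (edge_cochain m).
Proof.
move=> hm [|u [|v [|w []]]] //= _ _.
by rewrite subr0 -(@plM p V L l0 qrel qrel_directed u v w) hm.1 addrAC subrr add0r subrr.
Qed.

Lemma edge_cochain_degenerate m s : lhom m -> degenerate s -> edge_cochain m s = 0%R.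
Proof.
move=> hm /degenerateP[s1 [x [s2 ->]]].
case: s1 => [|a [|b s1]] /=; last by case: s1.
  by case: s2 => //=; rewrite pl1 lhom1.
by [].
Qed.

Lemma ok_rclosed : rclosed qrel ok.
Proof.
move=> s sP; apply: ok_closed => i; have [t ot st] := sP i; have [n ts] := qrel_sym st.
by exists (map (nA n) t); [exact: ok_nA|exact: (srel_sym (@brel_sym i))].
Qed.

Lemma fixed_edge_act (A D : {group gT}) d v w : (D \subset 'N(A))%g -> d \in D ->
  fixed A [:: v; w] -> fixed A [:: act d v; act d w].
Proof.
move=> DA dD vw; exact: (fixed_stable qrel_sym qrel_trans qrel_act qact_1 qact_M ok_act DA dD vw).
Qed.

Lemma lhom_fact d (m : F1 -> 'F_p) : lhom m -> lhom (fun x => m (fact d x)).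
Proof.
move=> [mM [i mi]]; split=> [x y|]; first by rewrite factM mM.
by have [j ij] := fact_c d i; exists j => x /ij/mi.
Qed.

Lemma inv_on_edges (A D : {group gT}) (m : F1 -> 'F_p) : lhom m ->
  (forall d v w, d \in D -> fixed A [:: v; w] -> m (pl (act d v) (act d w)) = m (pl v w)) ->
  inv_on fact Bf D A m.
Proof.
move=> hm mD d x dD; apply: (lhom_Bf (lhom_fact d hm) hm) => v w vw.
by rewrite fact_pl mD.
Qed.

Lemma edge_cochain_fixed (A : {group gT}) (m : F1 -> 'F_p) : lhom m ->
  coch act qrel 2 1%G (fixed A) (fun=> False) (edge_cochain m).
Proof.
move=> hm; have hlc := edge_cochain_lc hm; split=> // [b s /set1P -> _ _|s _ _].
  by have [i mi] := hlc; apply: mi; exact: qact_1.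
exact: edge_cochain_degenerate.
Qed.

Lemma extend_inv (A D : {group gT}) (m : F1 -> 'F_p) : (A <| D)%g -> lhom m ->
  exists m', [/\ lhom m', inv_on fact Bf D A m' & forall x, Bf D x -> m' x = m x].
Proof.
move=> AD hm.
have [||h [hh hc hA hD]] := @cocycle_extend p p_pr gT V L act qrel ok l0 qrel_refl
  qrel_sym qrel_trans qrel_directed qrel_act qact_1 qact_M (@qrel_cobd) qrel_face
  (@qrel_compact) qdegenerate_closed ok_dim gTp ok_rclosed ok_face ok_act
  (exact_on_at ok_exact) 0 A D (edge_cochain m) AD.
- exact: edge_cochain_fixed.
- exact: edge_cochain_cocycle.
have [m' [hm' mh]] := integrate hh hc; exists m'; split=> //.
- apply: inv_on_edges => // d v w dD vw.
  rewrite !mh ?(hA d [:: v; w])//; first by case: vw.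
  by have [] := fixed_edge_act (normal_norm AD) dD vw.
- move=> x; apply: lhom_Bf => // v w vw.
  by rewrite mh ?hD//; case: vw.
Qed.

Lemma transfer_inv (A C D : {group gT}) b (m : F1 -> 'F_p) : A \subset C -> (C <| D)%g ->
  #|D : C|%g = p -> b \in D :\: C -> (D \subset 'N(A))%g -> lhom m -> inv_on fact Bf D A m ->
  (forall D' : {group gT}, A \proper D' -> D' \subset D -> forall x, Bf D' x -> m x = 0%R) ->
  exists y, [/\ lhom y, inv_on fact Bf C A y &
    forall x, Bf A x -> m x = (\sum_(i < p) y (fact (b ^+ i)%g x))%R].
Proof.
move=> AC CD iC bD DA hm mD m0; have bB := (finset.setDP bD).1.
have [||h [hh hc hC hS]] := @cocycle_transfer p p_pr gT V L act qrel ok l0 qrel_refl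
  qrel_sym qrel_trans qrel_directed qrel_act qact_1 qact_M (@qrel_cobd) qrel_face
  (@qrel_compact) qdegenerate_closed ok_dim gTp ok_rclosed ok_face ok_act
  (exact_on_at ok_exact) 0 A D C b (edge_cochain m) AC CD iC bD DA.
- split; first exact: edge_cochain_lc.
  + move=> d [|v [|w []]] //= dD vw _; rewrite -fact_pl mD//.
    by have [/bgen_Bf] := bgen_pl vw.
  + by move=> s _ _; exact: edge_cochain_degenerate.
  + move=> [|v [|w []]] //= _ _ [D' [AD' DD' vw]]; apply: (m0 D') => //.
    by have [/bgen_Bf] := bgen_pl vw.
- exact: edge_cochain_cocycle.
have [y [hy yh]] := integrate hh hc; exists y; split=> //.
- have CA := fintype.subset_trans (normal_sub CD) DA.
  apply: inv_on_edges => // c v w cC vw.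
  rewrite !yh ?(hC c [:: v; w])//; first by case: vw.
  by have [] := fixed_edge_act CA cC vw.
- apply: (lhom_Bf (m' := fun x => (\sum_(i < p) y (fact (b ^+ i)%g x))%R) hm) => [|v w vw].
    by apply: lhom_sum => i; exact: lhom_fact.
  have := hS [:: v; w] vw erefl; rewrite /= => ->.
  apply: eq_bigr => i _; rewrite fact_pl yh//.
  by have [] := fixed_edge_act DA (groupX i bB) vw.
Qed.

Theorem invariant_basis : exists S0 : F1 -> Prop, [/\ forall g s, S0 s -> S0 (fact g s),
  converging S0, forall m : F1 -> 'F_p, lhom m -> (forall s, S0 s -> m s = 0%R) ->
    forall x, m x = 0%R & lifts S0].
Proof.
exact: (permutation_basis p_pr gTp fact1 factG factM fact_c Bf_group Bf_closed Bf_all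
  Bf_fix Bf_act Bf_sub extend_inv transfer_inv).
Qed.

(** * Lifting through central extensions: the vanishing degree 2 obstruction *)

Section CentralLift.
Variables (gU : finGroupType) (W C : {group gU}) (th0 : F1 -> coset_of C).
Hypotheses (Wp : (p.-group W)%g) (CZ : C \subset 'Z(W)%g) (C_card : #|C| = p).
Hypotheses (th0_lc : lcont th0) (th0W : forall x, th0 x \in (W / C)%g).

Let lg := plog p_pr C_card.
Let ex := pexp p_pr C_card.
Let CW : C \subset W. Proof. exact: fintype.subset_trans CZ (center_sub W). Qed.
Let WN x : x \in W -> x \in ('N(C))%g.
Proof. exact/fintype.subsetP/normal_norm/sub_center_normal. Qed.
Let exW a : ex a \in W. Proof. exact: (fintype.subsetP CW _ (pexp_in p_pr C_card a)). Qed.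
Let exC a x : x \in W -> (ex a * x = x * ex a)%g.
Proof.
by move=> xW; have /(fintype.subsetP CZ)/centerP[_ /(_ x xW)] := pexp_in p_pr C_card a.
Qed.
Let kerC x : x \in W -> coset C x = 1%g -> x \in C.
Proof. by move=> /WN xN /coset_idr; exact. Qed.
Let cosM x y : x \in W -> y \in W -> coset C (x * y)%g = (coset C x * coset C y)%g.
Proof. by move=> /WN xN /WN yN; rewrite morphM. Qed.
Let cosV x : x \in W -> coset C (x^-1)%g = ((coset C x)^-1)%g.
Proof. by move=> /WN xN; rewrite morphV. Qed.

Let q0 v w := th0 (pl v w).
Let s v w : gU := repr (q0 v w).

Let th01 : th0 1%g = 1%g.
Proof. by apply: (@mulgI _ (th0 1%g)); rewrite -th0_lc.1 !mulg1. Qed.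

Let q0M u v w : (q0 u v * q0 v w = q0 u w)%g.
Proof. by rewrite -th0_lc.1 plM. Qed.

Let cos_s v w : coset C (s v w) = q0 v w. Proof. exact: coset_reprK. Qed.

Let sW v w : s v w \in W.
Proof.
have /morphimP[x xN xW e] := th0W (pl v w).
have : (s v w * x^-1)%g \in C.
  apply: coset_idr; first by rewrite groupM ?groupV// repr_coset_norm.
  by rewrite morphM ?groupV ?repr_coset_norm// morphV//= cos_s /q0 e mulgV.
by move/(fintype.subsetP CW); rewrite groupMr ?groupV.
Qed.

Let s1 v : s v v = 1%g. Proof. by rewrite /s /q0 pl1 th01 repr_coset1. Qed.

(** The factor set of the chosen lifts [s]. Its logarithm is a 2-cocycle of V/N with coefficients in
    F_p. *)
Let F u v w := (s u v * s v w * (s u w)^-1)%g.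

Let FC u v w : F u v w \in C.
Proof.
apply: kerC; first by rewrite !groupM ?groupV.
by rewrite !cosM ?groupM ?groupV// cosV// !cos_s q0M mulgV.
Qed.

Let sF u v w : (s u v * s v w = ex (lg (F u v w)) * s u w)%g.
Proof. by rewrite /ex /lg plogK// mulgKV. Qed.

Let q0_lc : exists l, forall v w v' w', qrel l [:: v; w] [:: v'; w'] -> q0 v w = q0 v' w'.
Proof.
have [c ic] := lcont_eq th0_lc; have [W' [_ [l ql] _ _]] := lab_transport c.
by exists l => v w v' w' /ql e; exact: ic.
Qed.

Let obstruction (t : seq V) : 'F_p := if t is [:: u; v; w] then lg (F u v w) else 0%R.

Let obstruction_coch : coch act qrel 3 1%G ok (fun=> False) obstruction.
Proof.
have [l ql] := q0_lc.
have olc a b : qrel l a b -> obstruction a = obstruction b.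
  move=> ab; have := qrel_size ab; move: ab => [n].
  case: a => [|u [|v [|w [|? ?]]]]; case: b => [|u' [|v' [|w' [|? ?]]]] //=.
  move=> [uu [vv [ww _]]] _.
  have q2 x y x' y' : brel l (nA n x) x' -> brel l (nA n y) y' -> q0 x y = q0 x' y'.
    by move=> xx yy; apply: ql; exists n.
  by rewrite /F /s (q2 u v u' v')// (q2 v w v' w')// (q2 u w u' w').
split; first by exists l.
- by move=> b t /set1P -> _ _; apply: olc; exact: qact_1.
- move=> t _ _ /degenerateP[s1' [x [s2 ->]]].
  case: s1' => [|a [|b s1']] /=; last by case: s1' => //= b' [].
    case: s2 => [|b [|? ?]] //=.
    by rewrite /F s1 mul1g mulgV /lg plog1.
  case: s2 => [|? ?] //=.
  by rewrite /F s1 mulg1 mulgV /lg plog1.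
- by [].
Qed.

Let obstruction_cocycle : cocycle 3 ok obstruction.
Proof.
move=> [|a [|b [|c [|d []]]]] //= _ _.
have e : (lg (F a b c) + lg (F a c d) = lg (F b c d) + lg (F a b d))%R.
  apply: (can_inj (pexpK p_pr C_card)); rewrite !pexpD -/ex.
  apply: (@mulIg _ (s a d)); rewrite -[LHS]mulgA -sF mulgA -sF -[RHS]mulgA -sF.
  by rewrite mulgA exC ?sW// -[RHS]mulgA -sF mulgA.
by rewrite subr0; exact: alternating4.
Qed.

Let exD a b : (ex a * ex b)%g = ex (a + b)%R. Proof. by rewrite /ex pexpD. Qed.

Theorem central_lift : exists th1 : F1 -> gU, [/\ lcont th1, forall x, th1 x \in W &
  forall x, coset C (th1 x) = th0 x].
Proof.
have [h0 [hh0 h0E]] := exact_on_at ok_exact obstruction_coch obstruction_cocycle.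
have [h [[hN [jh hj] hd] hE]] := nice_coch hh0.
have FE u v w : ok [:: u; v; w] ->
    lg (F u v w) = (h [:: v; w] - (h [:: u; w] - h [:: u; v]))%R.
  move=> o; have := h0E [:: u; v; w] o erefl; rewrite /= => ->.
  rewrite subr0 !hE//.
  - by apply: ok_face o; apply: face_tail; apply: face_tail; exact: face_head.
  - by apply: ok_face o; apply: face_tail; exact: face_head.
  - by apply: ok_face o; exact: face_head.
(* Correcting by the primitive [h] of the obstruction makes [r] multiplicative on simplices; it need
   not be so on arbitrary triples of vertices. *)
pose r v w := (s v w * ex (- h [:: v; w])%R)%g.
have rW v w : r v w \in W by rewrite groupM.
have rM u v w : ok [:: u; v; w] -> (r u v * r v w = r u w)%g.
  move=> o; rewrite /r mulgA -(mulgA (s u v)) exC ?sW// mulgA sF -!mulgA exD exC.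
    by rewrite -mulgA exD FE// alternating3.
  by rewrite groupM.
pose c1 v := s v0 v.
have c1W v : c1 v \in W by exact: sW.
have cosr v w : coset C (r v w) = q0 v w.
  by rewrite cosM// cos_s (coset_id (pexp_in p_pr C_card _)) mulg1.
(* The deviation of [r] from the globally multiplicative expression built from lifts of the classes
   of paths starting at [v0]. It lies in C and is additive on simplices, hence a 1-cocycle upstairs,
   and is integrated there by [eps]. *)
pose d v w := (((c1 v)^-1 * c1 w)^-1 * r v w)%g.
have dC v w : d v w \in C.
  apply: kerC; first by rewrite groupM ?groupV ?groupM ?groupV.
  rewrite /d cosM ?groupV ?groupM ?groupV// cosV ?groupM ?groupV// cosM ?groupV// cosV//.
  by rewrite cosr !cos_s -(q0M v0 v w) mulKg mulVg.
pose e v w := lg (d v w).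
have rE v w : r v w = ((c1 v)^-1 * c1 w * ex (e v w))%g.
  by rewrite /e /ex /lg plogK// /d mulKVg.
have eM u v w : ok [:: u; v; w] -> (e u v + e v w = e u w)%R.
  move=> /rM; rewrite !rE => h'; apply: (can_inj (pexpK p_pr C_card)).
  apply: (@mulgI _ ((c1 u)^-1 * c1 w)%g); rewrite -/ex -[RHS]h' -exD.
  rewrite mulgA -[in RHS](mulgA _ (ex (e u v))) -/ex (mulgA (ex (e u v))) exC ?groupM ?groupV//.
  by rewrite !mulgA mulgK.
have [l ql] := q0_lc; have [k kP] := brel_directed l jh.
have c1l v v' : brel k v v' -> c1 v = c1 v'.
  move=> /kP[a _]; rewrite /c1 /s (ql v0 v v0 v')//.
  by apply: srel_qrel => /=; split.
have rl v w v' w' : brel k v v' -> brel k w w' -> r v w = r v' w'.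
  move=> /kP[a a'] /kP[b b']; rewrite /r /s (ql v w v' w'); last first.
    by apply: srel_qrel => /=; split.
  by congr (_ * ex (- _)%R)%g; apply: hj.
pose E (t : seq V) : 'F_p := if t is [:: v; w] then e v w else 0%R.
have [||eps [[_ [j2 ej2] _] eE]] := ok_exact1 (f := E).
- split=> [n t||t /degenerateP[t1 [x [t2 ->]]]]; first by rewrite map_id.
    exists k => a b ab; have := srel_size ab; move: ab.
    case: a => [|u [|v [|? ?]]]; case: b => [|u' [|v' [|? ?]]] //=.
    by move=> [uu [vv _]] _; rewrite /e /d (c1l u u')// (c1l v v')// (rl u v u' v').
  case: t1 => [|? [|? []]] //=; case: t2 => //=.
  rewrite /e /d mulVg invg1 mul1g /r s1 mul1g hd; last exact: degenerate_head.
  by rewrite oppr0 /ex pexp0 /lg plog1.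
- move=> [|u [|v [|w []]]] //= o _; rewrite subr0 -(eM u v w)//.
  by rewrite addrAC subrr add0r subrr.
have {}eE v w : ok [:: v; w] -> e v w = (eps [:: w] - eps [:: v])%R.
  by move=> o; have := eE [:: v; w] o erefl; rewrite /= subr0.
(* The parallel transport of [r] from [v0], up to a constant: the increments of [c2] equal [r] on
   edges, are multiplicative on all triples, and inherit N-invariance from [r] through
   connectedness. *)
pose c2 v := (c1 v * ex (eps [:: v]))%g.
have c2W v : c2 v \in W by rewrite groupM.
have c2r v w : ok [:: v; w] -> (c2 w = c2 v * r v w)%g.
  move=> o; rewrite rE /c2 eE// -[RHS]mulgA [in RHS](mulgA (ex (eps [:: v]))).
  rewrite [in RHS](exC (eps [:: v])) ?groupM ?groupV//.
  rewrite -[in RHS](mulgA _ (ex (eps [:: v]))) exD addrC subrK.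
  by rewrite !mulgA mulgV mul1g.
have c2l : exists i, forall v w, brel i v w -> c2 v = c2 w.
  have [i iP] := brel_directed k j2; exists i => v w /iP[vw vw'].
  by rewrite /c2 (c1l v w)//; congr (_ * ex _)%g; apply: ej2.
have rN n v w : r (nA n v) (nA n w) = r v w.
  by rewrite /r /s /q0 pl_nA; congr (_ * ex (- _)%R)%g; exact: (hN n [:: v; w]).
have [i ci] := c2l.
have c2N n v w : ((c2 (nA n v))^-1 * c2 (nA n w) = (c2 v)^-1 * c2 w)%g.
  have cN a b : (c2 (nA n a) * (c2 a)^-1 = c2 (nA n b) * (c2 b)^-1)%g.
    apply: (ok_connected (u := fun v => c2 (nA n v) * (c2 v)^-1)%g).
      by exists i => x y xy; rewrite (ci x y)// (ci (nA n x) (nA n y))//; exact: brel_nA.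
    move=> x y xy; rewrite (c2r x y)// (c2r (nA n x) (nA n y)); last exact: (ok_nA n xy).
    rewrite rN; move: (c2 x) (c2 (nA n x)) (r x y) => X Y R.
    by rewrite invMg mulgA mulgK.
  have := cN v w; move: (c2 v) (c2 w) (c2 (nA n v)) (c2 (nA n w)) => X Y X' Y' e'.
  by apply: (@mulgI _ X'); rewrite mulKVg mulgA e' mulgKV.
have tr : transport p qrel W (fun v w => (c2 v)^-1 * c2 w)%g.
  split=> // [u v w||v w]; last by rewrite groupM ?groupV.
    by rewrite mulgA mulgK.
  exists i => v w v' w' /qrel2[n [vv ww]].
  by rewrite -(c2N n) (ci _ _ vv) (ci _ _ ww).
have [th1 [t1c t1W t1E]] := pi_univ l0 qrel_directed tr.
exists th1; split=> //; apply: (pi_dense _ th0_lc).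
  split=> [x y|]; first by rewrite t1c.1 cosM.
  by have [j tj] := t1c.2; exists j => x /tj ->; rewrite morph1.
move=> v w; rewrite t1E cosM ?groupV// cosV// !cosM// !(coset_id (pexp_in p_pr C_card _)).
by rewrite !mulg1 !cos_s -(q0M v0 v w) mulKg.
Qed.

End CentralLift.

(** The last clause keeps the part of the universal property needed later: maps [c] whose increments
    are N-invariant define homomorphisms, and this detects nontrivial elements of N in F. *)
Theorem fundamental_data : exists (F : lgroup p) (Z : F -> Prop) (e : V -> V -> F)
    (f : gT -> F -> F),
  [/\ free_on Z /\ lclosed Z, forall g z, Z z -> Z (f g z),
    forall g x y, f g (x * y)%g = (f g x * f g y)%g, forall x, f 1%g x = x &
    forall g h x, f (g * h)%g x = f g (f h x)] /\
  [/\ forall u v w, (e u v * e v w)%g = e u w,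
    forall g v w, f g (e v w) = e (act g v) (act g w),
    forall n v w, e (nA n v) (nA n w) = e v w,
    forall i, exists l, forall v w v' w', brel l v v' -> brel l w w' ->
      lpi i (e v w) = lpi i (e v' w') &
    forall g i, exists j, forall x y, lpi j x = lpi j y ->
      lpi i (f g x) = lpi i (f g y)] /\
  forall (gU : finGroupType) (W : {group gU}) (c : V -> gU), (p.-group W)%g ->
    (forall v, c v \in W) -> (exists i, forall v w, brel i v w -> c v = c w) ->
    (forall n v w, ((c (nA n v))^-1 * c (nA n w) = (c v)^-1 * c w)%g) ->
    exists th : F -> gU, lcont th /\ forall v w, th (e v w) = ((c v)^-1 * c w)%g.
Proof.
have [S [S_act Sc Si Sl]] := invariant_basis.
have cl := fun gU W C th0 Wp CZ Cp => @central_lift gU W C th0 Wp CZ Cp.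
exists F1, (fun x => S x \/ x = 1%g), pl, fact; split; last split.
- split.
  + by split; [exact: (basis_free p_pr cl Sc Si Sl)|exact: (basis_closed Sc)].
  + move=> g z [/(S_act g) Sz|->]; [by left|right].
    by apply: (@mulgI _ (fact g 1%g)); rewrite -factM !mulg1.
  + exact: factM.
  + exact: fact1.
  + exact: factG.
- split.
  + exact: plM.
  + exact: fact_pl.
  + exact: pl_nA.
  + move=> c; have [W [_ [l ql] _ _]] := lab_transport c; exists l => v w v' w' vv ww.
    by apply: ql; apply: srel_qrel => /=.
  + exact: fact_eq.
- move=> gU W c Wp cW [i ci] cN.
  have tr : transport p qrel W (fun v w => (c v)^-1 * c w)%g.
    split=> // [u v w||v w]; last by rewrite groupM ?groupV.
      by rewrite mulgA mulgK.
    exists i => v w v' w' /qrel2[n [vv ww]].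
    by rewrite -(cN n) (ci _ _ vv) (ci _ _ ww).
  by have [th [thc _ thE]] := pi_univ l0 qrel_directed tr; exists th.
Qed.

End Equivariant.

(** * Compactness and clopen separation *)

Section Topology.
Local Open Scope classical_set_scope.

Lemma fin_card (T : finType) (A : {set T}) :
  ([set x | (x \in A) = true] #= `I_#|A|)%card.
Proof.
have [->|/finset.set0Pn[x0 x0A]] := eqVneq A finset.set0.
  rewrite cards0 II0; have -> : [set x | (x \in finset.set0) = true] = set0 :> set T.
    by apply/seteqP; split=> // x /=; rewrite finset.inE.
  exact: card_eq00.
have <- : nth x0 (enum A) @` `I_#|A| = [set x | (x \in A) = true].
  apply/seteqP; split=> [_ [k kA <-]|x xA] /=.
    by rewrite -mem_enum mem_nth// -cardE.
  by exists (index x (enum A)); rewrite /= ?cardE ?index_mem ?nth_index ?mem_enum.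
apply: inj_card_eq => i j; rewrite !classical_sets.inE /= => iA jA /eqP.
by rewrite nth_uniq ?enum_uniq -?cardE// => /eqP.
Qed.

Lemma near_fin (T : Type) (U : set_system T) (X : finType) (A : X -> set T) :
  Filter U -> (forall x, U (A x)) -> U [set t | forall x, A x t].
Proof.
move=> UU UA; have Ur (r : seq X) : U [set t | forall x, x \in r -> A x t].
  elim: r => [|a r IH]; first by apply: filterS filterT => t.
  apply: filterS (filterI (UA a) IH) => t [/= ta tr] x.
  by rewrite seq.inE => /orP[/eqP ->|/tr].
by apply: filterS (Ur (enum X)) => t tr x; apply: tr; rewrite mem_enum.
Qed.

Lemma finite_cover (T : topologicalType) (R : T -> T -> Prop) :
  compact [set: T] -> (forall y, \forall g \near y, R y g) ->
  exists r : seq T, forall g, exists2 y, y \in r & R y g.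
Proof.
move=> Tc Ro; apply: contrapT => no.
pose B (r : seq T) := [set g | forall y, y \in r -> ~ R y g].
have FB : Filter (filter_from [set: seq T] B).
  apply: filter_fromT_filter => [|r r']; first by exists [::].
  exists (r ++ r') => g gB; split=> y yr; apply: gB; rewrite mem_cat yr ?orbT//.
have PB : ProperFilter (filter_from [set: seq T] B).
  apply: filter_from_proper => r _; apply: contrapT => rB; apply: no; exists r => g.
  by apply: contrapT => gr; apply: rB; exists g => y yr yg; apply: gr; exists y.
have [y [_ /(_ (B [:: y]) [set g | R y g])]] := Tc _ PB filterT.
case=> [||g [gB yg]]; [by exists [:: y]|exact: Ro|].
by apply: (gB y); rewrite ?seq.inE.
Qed.

(** Indices not met by any point are discarded through the set [J], so that [idx] is onto with
    section [rho]. *)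
Lemma finite_classes (T : topologicalType) (R : T -> T -> Prop) :
  compact [set: T] -> (forall y, \forall g \near y, R y g) ->
  (forall x, R x x) -> (forall x y, R x y -> R y x) ->
  (forall x y z, R x y -> R y z -> R x z) ->
  exists n (rho : 'I_n -> T) (idx : T -> 'I_n), [/\ forall g, R (rho (idx g)) g,
    forall g g', R g g' -> idx g = idx g' & forall k, idx (rho k) = k].
Proof.
move=> Tc Ro Rr Rs Rt; have [r rP] := finite_cover Tc Ro.
pose ix g := find (fun y => `[< R y g >]) r.
have ixr g : (ix g < size r)%N.
  by rewrite -has_find; apply/hasP; have [y yr yg] := rP g; exists y => //; exact/asboolP.
have ixE g g' : R g g' -> ix g = ix g'.
  move=> gg; apply: eq_find => y; apply: asbool_equiv_eq.
  by split=> h; [exact: Rt h gg|exact: Rt h (Rs _ _ gg)].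
pose ixo g : 'I_(size r) := Ordinal (ixr g).
have ixN g : R (nth g r (ix g)) g.
  apply/asboolP; apply: (@nth_find _ g (fun y => `[< R y g >])).
  by rewrite has_find; exact: ixr.
pose J : {set 'I_(size r)} := [set k | `[< exists g, ixo g = k >]]%SET.
have ixJ g : ixo g \in J by rewrite finset.inE; apply/asboolP; exists g.
have JP k : exists g, ixo g = enum_val (k : 'I_#|J|).
  by have := enum_valP k; rewrite finset.inE => /asboolP.
exists #|J|, (fun k => sval (cid (JP k))), (fun g => enum_rank_in (ixJ g) (ixo g)).
have idxE g g' : ixo g = ixo g' ->
    enum_rank_in (ixJ g) (ixo g) = enum_rank_in (ixJ g') (ixo g').
  by move=> e; apply: enum_val_inj; rewrite !enum_rankK_in.
have sameR g g' : ixo g = ixo g' -> R g g'.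
  move=> /(congr1 val) /= e; apply: (Rt _ (nth g r (ix g))); first exact/Rs/ixN.
  by rewrite e (set_nth_default g')//; exact: ixN.
split.
- move=> g; apply: sameR; case: cid => g' /= ->.
  by rewrite enum_rankK_in.
- by move=> g g' /ixE e; apply: idxE; apply: val_inj.
- by move=> k; apply: enum_val_inj; rewrite enum_rankK_in//; case: cid.
Qed.

(** In a compact Hausdorff space the quasi-component [Q] of a point is connected, hence a point
    here; so clopen sets separate points. *)
Lemma compact_zero_dimensional (T : topologicalType) :
  profinite_space T -> zero_dimensional T.
Proof.
move=> [Tc Th Td] x y xy; apply: contrapT => no.
pose Q := [set z | forall D : set T, clopen D -> D x -> D z].
have Qx : Q x by [].
have Qy : Q y by move=> D Dc Dx; apply: contrapT => Dy; apply: no; exists D.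
have Qc : closed Q.
  have -> : Q = \bigcap_(D in [set D : set T | clopen D /\ D x]) D.
    by apply/seteqP; split=> z Qz D => [[]|? ?]; [exact: Qz|apply: Qz].
  by apply: closed_bigI => D [[]].
(* Normality gives an open U' containing A with closure missing C; the leftover R misses [Q], so by
   compactness a clopen D around x misses R, and D cut by U' is clopen, contains x and excludes
   C. *)
have sep (A C : set T) : closed A -> closed C -> A `&` C = set0 -> Q = A `|` C -> A x -> C = set0.
  move=> Ac Cc AC QAC Ax.
  have nAC : set_nbhs A (~` C).
    move=> z Az; apply: open_nbhs_nbhs; split; first exact: closed_openC.
    by move=> Cz; have : (A `&` C) z by []; rewrite AC.
  have [U AU UC] := compact_normal Th Tc Ac nAC; pose U' := interior U.
  have U'o : open U' by exact: open_interior.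
  have AU' : A `<=` U' by move=> z /AU.
  have U'U : U' `<=` U by exact: interior_subset.
  pose R := ~` (U' `|` ~` closure U).
  have Rc : closed R.
    by apply: open_closedC; apply: openU => //; apply: closed_openC; exact: closed_closure.
  have RQ z : R z -> ~ Q z.
    move=> Rz; rewrite QAC => -[/AU' Uz|Cz]; apply: Rz; [by left|right].
    by move=> /UC; apply.
  have [D [[Dcl Dx] DR]] : exists D : set T, (clopen D /\ D x) /\ D `&` R = set0.
    apply: contrapT => nD; pose B (D : set T) := D `&` R.
    have FB : Filter (filter_from [set D : set T | clopen D /\ D x] B).
      apply: filter_from_filter; first by exists setT; split=> //; exact: clopenT.
      move=> D E [Dc Dx] [Ec Ex]; exists (D `&` E); last by move=> z [[]].
      by split=> //; exact: clopenI.
    have PB : ProperFilter (filter_from [set D : set T | clopen D /\ D x] B).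
      apply: filter_from_proper => D DP; apply: contrapT => nDR; apply: nD; exists D.
      split=> //; apply/seteqP; split=> // z zDR; apply: nDR; by exists z.
    have [z [_ zB]] := Tc _ PB filterT.
    have zcl (E : set T) : closed E -> (exists2 D, clopen D /\ D x & B D `<=` E) -> E z.
      move=> Ec [D DP DE]; have /closure_id -> := Ec => N Nz.
      by have [w [wE wN]] := zB E N (ex_intro2 _ _ D DP DE) Nz; exists w.
    have Rz : R z by apply: zcl Rc _; exists setT; [split=> //; exact: clopenT|move=> w []].
    apply: (RQ z Rz) => E Ecl Ex; apply: (zcl E); first by case: Ecl.
    by exists E => // w [].
  have DU : clopen (D `&` U').
    split; first by apply: openI => //; case: Dcl.
    have -> : D `&` U' = D `&` closure U.
      apply/seteqP; split=> z [Dz Uz]; split=> //.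
        by apply: subset_closure; exact: U'U.
      apply: contrapT => U'z; have : (D `&` R) z; last by rewrite DR.
      by split=> // -[|].
    by apply: closedI; [case: Dcl|exact: closed_closure].
  apply/seteqP; split=> // z Cz; have Qz : Q z by rewrite QAC; right.
  have [_ U'z] := Qz _ DU (conj Dx (AU' _ Ax)).
  by have /UC := subset_closure (U'U _ U'z); apply.
have Qcon : connected Q.
  move=> B [b Bb] [C Co BC] [E Ec BE].
  have Bc : closed B by rewrite BE; exact: closedI.
  have QBc : closed (Q `\` B).
    have -> : Q `\` B = Q `&` ~` C.
      apply/seteqP; split=> z [Qz h]; split=> //; last by rewrite BC => -[].
      by move=> Cz; apply: h; rewrite BC.
    by apply: closedI => //; exact: open_closedC.
  have BQ : B `<=` Q by rewrite BC => z [].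
  have [Bx|Bx] := pselect (B x).
    have QE : Q `\` B = set0.
      apply: (sep B) => //; first by apply/seteqP; split=> // z [? []].
      by apply/seteqP; split=> [z Qz|z [/BQ//|[]//]]; have [|] := pselect (B z); [left|right].
    apply/seteqP; split=> // z Qz; apply: contrapT => Bz.
    by have : (Q `\` B) z by []; rewrite QE.
  have B0 : B = set0.
    apply: (sep (Q `\` B)) => //; first by apply/seteqP; split=> // z [[]].
    by apply/seteqP; split=> [z Qz|z [[]|/BQ]//]; have [|] := pselect (B z); [right|left].
  by move: Bb; rewrite B0.
have : connected_component [set: T] x y by exists Q.
by rewrite Td// => /= yx; rewrite yx eqxx in xy.
Qed.

End Topology.

(** * Open subgroups and permutation representations *)

Section OpenSubgroups.
Local Open Scope classical_set_scope.
Variable (G : topGroupType).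
Hypothesis G_pf : profinite_space G.

Lemma near_mul (x y : G) (A : set G) : nbhs (x * y)%g A ->
  \forall a \near x & b \near y, A (a * b)%g.
Proof. by move=> /(@mulg_continuous G (x, y)). Qed.

Lemma near_mulr (x y : G) (A : set G) : nbhs (x * y)%g A ->
  \forall b \near y, A (x * b)%g.
Proof.
move=> /near_mul[[P Q] /= [Px Qy] PQ]; apply: filterS Qy => b Qb.
by apply: (PQ (x, b)); split=> //; exact: nbhs_singleton.
Qed.

Lemma near_mull (x y : G) (A : set G) : nbhs (x * y)%g A ->
  \forall a \near x, A (a * y)%g.
Proof.
move=> /near_mul[[P Q] /= [Px Qy] PQ]; apply: filterS Px => a Pa.
by apply: (PQ (a, y)); split=> //; exact: nbhs_singleton.
Qed.

Definition nbhs_subgroup (K : G -> Prop) := [/\ nbhs (1%g : G) K,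
  forall x y, K x -> K y -> K (x * y)%g & forall x, K x -> K x^-1%g].

(** The right stabilizer of a clopen W that contains 1 but not x; compactness of W and of its
    complement makes it a neighbourhood of 1. *)
Lemma small_subgroup x : x <> 1%g -> exists K, nbhs_subgroup K /\ ~ K x.
Proof.
move=> /eqP; rewrite eq_sym => x1.
have [W [[Wo Wc] W1 Wx]] := compact_zero_dimensional G_pf x1.
pose K g := forall w, W w <-> W (w * g)%g.
exists K; split; last by move=> /(_ 1%g); rewrite mul1g => -[/(_ W1)].
split.
- have [Gc _ _] := G_pf; have cov := (compact_near_coveringP _).1 Gc.
  have h := cov _ (nbhs (1%g : G)) (fun g w => W w <-> W (w * g)%g) _.
  suff : \forall g \near (1%g : G), [set: G] `<=` (fun w => W w <-> W (w * g)%g).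
    by apply: filterS => g hg w; exact: hg.
  apply: h => w _.
  have key (A : set G) : open A -> A w ->
      \forall w' \near w & g \near (1%g : G), A w' /\ A (w' * g)%g.
    move=> Ao Aw; have Aw1 : nbhs (w * 1)%g A by rewrite mulg1; exact: open_nbhs_nbhs.
    have [[P Q] /= [Pw Q1] PQ] := near_mul Aw1.
    exists (P `&` A, Q) => /=; first by split=> //; apply: filterI => //; exact: open_nbhs_nbhs.
    by move=> [a b] /= [[Pa Aa] Qb]; split=> //; exact: (PQ (a, b)).
  have [Ww|Ww] := pselect (W w).
    by apply: filterS (key W Wo Ww) => -[a b] /= [].
  by apply: filterS (key (~` W) (closed_openC Wc) Ww) => -[a b] /= [].
- by move=> a b Ka Kb w; rewrite Ka Kb mulgA.
- by move=> a Ka w; rewrite (Ka (w * a^-1)%g) mulgKV.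
Qed.

Lemma near_fiber (n : nat) (th : G -> 'S_n) : {morph th : x y / (x * y)%g} ->
  (\forall g \near (1%g : G), th g = 1%g) -> forall x, \forall g \near x, th g = th x.
Proof.
move=> thM th1 x; have h : nbhs (x^-1 * x)%g [set g | th g = 1%g] by rewrite mulVg.
apply: filterS (near_mulr h) => g /= e; apply: (@mulgI _ (th x^-1%g)).
by rewrite -!thM e mulVg; apply: (@mulgI _ (th 1%g)); rewrite -thM !mulg1.
Qed.

Lemma coset_action K : nbhs_subgroup K -> exists n (th : G -> 'S_n),
  [/\ {morph th : x y / (x * y)%g}, \forall g \near (1%g : G), th g = 1%g &
    forall g, th g = 1%g -> K g].
Proof.
move=> [K1 KM KV]; pose R (x y : G) := K (x^-1 * y)%g.
have K11 : K 1%g by exact: nbhs_singleton.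
have [Gc _ _] := G_pf.
have [n [rho [idx [rhoR idxR idxK]]]] : exists n (rho : 'I_n -> G) (idx : G -> 'I_n),
    [/\ forall g, R (rho (idx g)) g, forall g g', R g g' -> idx g = idx g' &
      forall k, idx (rho k) = k].
  apply: finite_classes => //.
  - by move=> y; apply: near_mulr; rewrite mulVg.
  - by move=> x; rewrite /R mulVg.
  - by move=> x y /KV; rewrite /R invMg invgK.
  - by move=> x y z xy yz; have := KM _ _ xy yz; rewrite /R mulgA mulgK.
have idxM g y : idx (g * rho (idx y))%g = idx (g * y)%g.
  by apply: idxR; rewrite /R invMg mulgA mulgKV; exact: rhoR.
have inj g : injective (fun k => idx (g^-1 * rho k)%g).
  move=> k l /(congr1 (fun i => idx (g * rho i)%g)).
  by rewrite !idxM !mulKVg !idxK.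
(* The inverse in [inj] is there because products of permutations compose from left to right. *)
pose th g := perm (inj g).
exists n, th; split.
- move=> g h; apply/permP => k; by rewrite permM !permE idxM mulgA -invMg.
- have : \forall g \near (1%g : G), forall k, R (g^-1 * rho k)%g (rho k).
    apply: near_fin => k; rewrite /R /=.
    have h : nbhs ((rho k)^-1 * 1)%g [set g | K (g * rho k)%g].
      by apply: near_mull; rewrite mulg1 mulVg.
    by apply: filterS (near_mulr h) => g /=; rewrite invMg invgK.
  apply: filterS => g gk; apply/permP => k; rewrite permE perm1.
  by rewrite (idxR _ _ (gk k)) idxK.
- move=> g /permP/(_ (idx 1%g)); rewrite permE perm1 idxM mulg1 => e.
  have := rhoR g^-1%g; rewrite e => r1.
  have := rhoR 1%g; rewrite /R mulg1 => r2.
  have := KM _ _ (KV _ r1) r2; rewrite invMg !invgK -mulgA mulgV mulg1.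
  by [].
Qed.

End OpenSubgroups.

(** * Finite p-groups as discrete topological groups *)

Definition dgroup (gT : finGroupType) (W : {group gT}) : Type := discrete_topology (subg_of W).

Section DiscreteGroup.
Local Open Scope classical_set_scope.
Variables (gT : finGroupType) (W : {group gT}).
Local Notation D := (dgroup W).

HB.instance Definition _ := Choice.copy D (subg_of W).
HB.instance Definition _ := Group.copy D (subg_of W).
HB.instance Definition _ := Topological.copy D (discrete_topology (subg_of W)).

Lemma dgroup_nbhs (x : D) (A : set D) : A x -> nbhs x A.
Proof.
by move=> Ax; apply/(@principal_filterP (subg_of W) x A).
Qed.

Fact dgroup_mul_continuous : continuous (fun xy : D * D => (xy.1 * xy.2)%g).
Proof.
move=> [x y] A /nbhs_singleton /= Axy; exists ([set x], [set y]).
  by split; exact: dgroup_nbhs.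
by move=> [a b] /= [-> ->].
Qed.

Fact dgroup_inv_continuous : continuous (fun x : D => (x^-1)%g).
Proof. by move=> x A /nbhs_singleton /= Ax; exact: dgroup_nbhs. Qed.

HB.instance Definition _ := isTopologicalGroup.Build D
  dgroup_mul_continuous dgroup_inv_continuous.

Lemma dgroup_profinite : profinite_space D.
Proof.
split.
- apply: finite_compact.
  have -> : [set: D] = [set x | (x \in [set: subg_of W]%SET) = true].
    by apply/seteqP; split=> x _ //=; rewrite finset.in_setT.
  by apply/finite_setP; exists #|[set: subg_of W]%SET|; exact: fin_card.
- exact: (@discrete_hausdorff (discrete_topology (subg_of W))).
- exact/zero_dimension_totally_disconnected/(@discrete_zero_dimension (discrete_topology (subg_of W))).
Qed.

Lemma dgroup_pro_p (p : nat) : (p.-group W)%g -> pro_p_group p (D : topGroupType).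
Proof.
move=> Wp; split; first exact: dgroup_profinite.
move=> N _ _; pose N' : {set subg_of W} := [set x | `[< elts N (x : D) >]]%SET.
have inN x : (x \in N') = `[< elts N (x : D) >] by rewrite finset.inE.
have N1 := subgroup1 N.
have NV x : elts N x -> elts N (x^-1)%g.
  by move=> Nx; have := subgroupF N1 Nx; rewrite mul1g.
have gN : group_set N'.
  apply/group_setP; split; first by rewrite inN; exact/asboolP.
  move=> x y; rewrite !inN => /asboolP Nx /asboolP Ny; apply/asboolP.
  by have := subgroupF Nx (NV y Ny); rewrite invgK.
pose M := Group gN.
have /p_natP[k Mk] : p.-nat #|[set: subg_of W]%SET : M|%g.
  have cW : #|[set: subg_of W]%SET| = #|W| by rewrite cardsT card_sub; exact: eq_card.
  by apply: pnat_dvd (dvdn_indexg _ _) _; rewrite /= cW; exact: Wp.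
exists k; rewrite -Mk.
pose f (A : {set subg_of W}) : set D := [set x : D | (x : subg_of W) \in A].
have -> : Defs.lcosets N = f @` [set A | (A \in fingroup.lcosets M [set: subg_of W]%SET) = true].
  have fE x : [set (x * h)%g | h in N] = f (x *: M)%g.
    apply/seteqP; split=> [_ [h Nh <-]|y] /=.
      rewrite /f /= mem_lcoset; have -> : (x^-1 * (x * h))%g = h by exact: mulKg.
      by rewrite inN; exact/asboolP.
    rewrite /f /= mem_lcoset inN => /asboolP h; exists (x^-1 * y)%g => //.
    exact: mulKVg.
  apply/seteqP; split=> [_ [x _ <-]|_ [A /lcosetsP[x _ ->] <-]].
    by rewrite fE; exists (x *: M)%g => //; apply/lcosetsP; exists x; rewrite ?finset.inE.
  by exists x; rewrite ?fE.
apply: card_eq_trans (inj_card_eq _) _.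
  move=> A B _ _ /seteqP[AB BA]; apply/setP => x.
  by apply/idP/idP; [exact: AB|exact: BA].
rewrite -card_lcosets; exact: fin_card.
Qed.

End DiscreteGroup.

Lemma srel_nthP (V : Type) (r : V -> V -> Prop) (x y : V) s t k : srel r s t ->
  (k < size s)%N -> r (nth x s k) (nth y t k).
Proof. by elim: s t k => [|a s IH] [|b t] [|k] //= [ab st] ks //; exact: IH. Qed.

Lemma jump_closed (p : nat) (F : lgroup p) (Z : F -> Prop) s : lclosed Z ->
  (forall i : level F, exists2 t, jump Z t & srel (fun x y => lpi i x = lpi i y) s t) ->
  jump Z s.
Proof.
move=> Zc sP; have [_ [_ [z0 [_ [_ [Zz0 _]]]]] _] := sP (level0 F).
case: s sP => [|x s] sP; first by exists 1%g, z0, 0%N, 0%N.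
pose n := (size s).+1.
have /choice[a aP] : forall i : level F, exists a : 'I_n.+1, exists t z, Z z /\
    srel (fun x y => lpi i x = lpi i y) (x :: s) (nseq a t ++ nseq (n - a) (t * z)%g).
  move=> i; have [_ [t [z [k [l [Zz ->]]]]] st] := sP i.
  have := srel_size st; rewrite /= size_cat !size_nseq -/n => nkl.
  have kn : (k < n.+1)%N by rewrite ltnS nkl leq_addr.
  by exists (Ordinal kn), t, z; split=> //=; rewrite nkl addKn.
have [U [UU Ui]] := @ultra_directed (level F) (fun j i => finer j i) (level0 F)
  (@finer_refl p F) (fun i j k kj ji => finer_trans kj ji) (@finer2 p F).
have [A UA] := ultra_fin a UU.
have sA i : exists t z, Z z /\
    srel (fun x y => lpi i x = lpi i y) (x :: s) (nseq A t ++ nseq (n - A) (t * z)%g).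
  have [l [li la]] := ultra_nonempty UU (filterI (Ui i) UA).
  have [t [z [Zz st]]] := aP l; exists t, z; split=> //; rewrite -(la : a l = A).
  by apply: srel_sub st => u w; exact: finer_eq.
have An : (A <= n)%N by rewrite -ltnS.
pose y := last x s.
have near i : exists t z, [/\ Z z, (0 < A)%N -> lpi i x = lpi i t,
    (A < n)%N -> lpi i y = lpi i (t * z)%g &
    forall k, (k < n)%N -> lpi i (nth x (x :: s) k) = lpi i (if (k < A)%N then t else (t * z)%g)].
  have [t [z [Zz st]]] := sA i; exists t, z.
  have key k : (k < n)%N -> lpi i (nth x (x :: s) k) = lpi i (if (k < A)%N then t else (t * z)%g).
    move=> kn; rewrite (srel_nthP x x st kn) nth_cat size_nseq !nth_nseq.
    by case: ltnP => // Ak; rewrite ltn_sub2r// (leq_ltn_trans Ak).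
  split=> //.
  - by move=> A0; have := key 0%N isT; rewrite A0.
  - move=> ltAn; have := key (size s) (ltnSn _); rewrite nth_last /=.
    by rewrite ltnNge -ltnS ltAn.
have sE : x :: s = nseq A x ++ nseq (n - A) y.
  apply: (@eq_from_nth _ x); first by rewrite size_cat !size_nseq subnKC.
  move=> k kn; rewrite nth_cat size_nseq !nth_nseq; apply: lpi_inj => i.
  have [t [z [_ xt yt kP]]] := near i; rewrite kP//; case: ltnP => [kA|Ak].
    by rewrite xt// (leq_ltn_trans _ kA).
  rewrite ltn_sub2r//; last by rewrite (leq_ltn_trans Ak).
  by rewrite yt// (leq_ltn_trans Ak).
have Z1' : A = 0%N :> nat \/ A = n :> nat -> jump Z (x :: s).
  move=> A0n; have [w ->] : exists w, x :: s = nseq n w.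
    by case: A0n => e; move: sE; rewrite e ?subn0 ?subnn ?cats0 => ->; [exists y|exists x].
  by exists w, z0, n, 0%N; rewrite cats0.
have [A0|A0] := posnP A; first by apply: Z1'; left.
have [An'|nA] := ltnP A n; last by apply: Z1'; right; apply/eqP; rewrite eqn_leq An nA.
exists x, (x^-1 * y)%g, (A : nat), (n - A)%N; split; last by rewrite mulKVg.
apply: Zc => i; have [t [z [Zz xt yt _]]] := near i; exists z => //.
by rewrite lpiM lpiV xt// yt// lpiM mulKg.
Qed.

Lemma box_nth_act (p : nat) (F : lgroup p) (N : Type) (nF : nat -> N -> F -> F) k n
    (v : box F k) j : (j < k)%N -> box_nth (box_act nF n v) j = nF j n (box_nth v j).
Proof.
elim: k v => //= k IH v; rewrite ltnS leq_eqVlt; case: eqP => [->//|_] /= jk.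
exact: IH.
Qed.

(** * Levels of G, freeness of H, and the coinduced box *)

Section Levels.
Local Open Scope classical_set_scope.
Variables (p : nat) (p_pr : prime p) (G : topGroupType) (G_pro : pro_p_group p G).
Variables (H : subgroup G) (H_open : open (elts H)).
Variables (n0 : nat) (th0 : G -> 'S_n0).
Hypothesis th0M : {morph th0 : x y / (x * y)%g}.
Hypothesis th0_open : \forall g \near (1%g : G), th0 g = 1%g.
Hypothesis th0H : forall g, th0 g = 1%g -> elts H g.
Local Notation FH := (subgroup_type H).

Lemma perm_hom1 (n : nat) (th : G -> 'S_n) : {morph th : x y / (x * y)%g} -> th 1%g = 1%g.
Proof. by move=> thM; apply: (@mulgI _ (th 1%g)); rewrite -thM !mulg1. Qed.

Lemma perm_homV (n : nat) (th : G -> 'S_n) x : {morph th : x y / (x * y)%g} ->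
  th x^-1%g = (th x)^-1%g.
Proof. by move=> thM; apply: (@mulgI _ (th x)); rewrite -thM !mulgV perm_hom1. Qed.

(** The image of [th] is in bijection with the cosets of its open kernel, whose number is a power of
    p since G is pro-p. *)
Lemma perm_hom_pelt (n : nat) (th : G -> 'S_n) : {morph th : x y / (x * y)%g} ->
  (\forall g \near (1%g : G), th g = 1%g) -> forall x, exists k, (th x ^+ (p ^ k) = 1)%g.
Proof.
move=> thM th1 x; have t1 := perm_hom1 thM.
have tV y : th y^-1%g = (th y)^-1%g by exact: perm_homV.
have N1 : [set g | th g = 1%g] 1%g by [].
have NF a b : [set g | th g = 1%g] a -> [set g | th g = 1%g] b ->
    [set g | th g = 1%g] (a * b^-1)%g.
  by move=> /= ta tb; rewrite thM tV ta tb invg1 mulg1.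
pose N := Subgroup N1 NF.
have No : open (elts N).
  by rewrite openE => g /= tg; apply: filterS (near_fiber thM th1 g) => h /= ->.
have Nn : normal_subgroup N.
  by move=> a g /= ta; rewrite conjgE !thM ta mul1g -thM mulVg.
have [k kE] := G_pro.2 N No Nn; exists k.
pose I : {set 'S_n} := [set s | `[< exists g, th g = s >]]%SET.
have inI s : (s \in I) = `[< exists g, th g = s >] by rewrite finset.inE.
have gI : group_set I.
  apply/group_setP; split; first by rewrite inI; apply/asboolP; exists 1%g.
  move=> a b; rewrite !inI => /asboolP[g <-] /asboolP[h <-].
  by apply/asboolP; exists (g * h)%g.
suff <- : #|I| = (p ^ k)%N.
  by apply: (@expg_cardG _ (Group gI)); rewrite /= inI; apply/asboolP; exists x.
pose f (s : 'S_n) := [set g | th g = s].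
have fE g : [set (g * h)%g | h in elts N] = f (th g).
  apply/seteqP; split=> [_ [h /= Nh <-]|y /= yg]; first by rewrite /f /= thM Nh mulg1.
  by exists (g^-1 * y)%g; rewrite /= ?mulKVg// thM tV yg mulVg.
have LE : Defs.lcosets N = f @` [set s | (s \in I) = true].
  apply/seteqP; split=> [_ [g _ <-]|_ [s /= sI <-]].
    by exists (th g); rewrite ?fE//= inI; apply/asboolP; exists g.
  by move: sI; rewrite inI => /asboolP[g <-]; exists g.
apply/card_eq_II; apply: card_eq_trans kE; rewrite card_eq_sym LE.
apply: card_eq_trans (inj_card_eq _) (fin_card _).
move=> s t; rewrite !classical_sets.inE /= inI => /asboolP[g <-] _ /seteqP[fst _].
exact: (fst g).
Qed.

(** Only representations with kernel inside that of [th0] are kept: their kernels then lie in H, so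
    the levels of G are levels of H at the same time. *)
Record glevel := GLevel {
  gl_n : nat;
  gl_th : G -> 'S_gl_n;
  gl_M : {morph gl_th : x y / (x * y)%g};
  gl_open : \forall g \near (1%g : G), gl_th g = 1%g;
  gl_fine : forall g, gl_th g = 1%g -> th0 g = 1%g
}.

Lemma glevel_refine (n : nat) (th : G -> 'S_n) : {morph th : x y / (x * y)%g} ->
  (\forall g \near (1%g : G), th g = 1%g) ->
  exists i : glevel, forall g, gl_th i g = 1%g -> th g = 1%g.
Proof.
move=> thM th1; pose t g := reg (th g, th0 g).
have tM : {morph t : x y / (x * y)%g} by move=> x y; rewrite /t thM th0M -regM.
have t1 : \forall g \near (1%g : G), t g = 1%g.
  by apply: filterS (filterI th1 th0_open) => g [/= a b]; rewrite /t a b -reg1.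
have tI g : t g = 1%g -> th g = 1%g /\ th0 g = 1%g.
  by rewrite /t -[RHS]reg1 => /(can_inj (@regK _)) [].
by exists (GLevel tM t1 (fun g h => (tI g h).2)) => g /= /tI[].
Qed.

Definition gpi (i : glevel) (h : FH) := gl_th i (\val h).

Lemma gpiM i : {morph gpi i : x y / (x * y)%g}.
Proof. by move=> x y; rewrite /gpi -gl_M. Qed.

Lemma gpi_pelt i x : exists k, (gpi i x ^+ (p ^ k) = 1)%g.
Proof. exact: (perm_hom_pelt (@gl_M i) (gl_open i)). Qed.

Lemma glevel_directed i j : exists k, forall g, gl_th k g = 1%g ->
  gl_th i g = 1%g /\ gl_th j g = 1%g.
Proof.
have [||k kP] := @glevel_refine _ (fun g => reg (gl_th i g, gl_th j g)).
- by move=> x y; rewrite !gl_M -regM.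
- by apply: filterS (filterI (gl_open i) (gl_open j)) => g [/= a b]; rewrite a b -reg1.
by exists k => g /kP; rewrite -[RHS]reg1 => /(can_inj (@regK _)) [].
Qed.

Lemma glevel_sep g : (forall i, gl_th i g = 1%g) -> g = 1%g.
Proof.
move=> gi; apply: contrapT => /(small_subgroup G_pro.1)[K [Ks Kg]].
have [n [th [thM th1 thK]]] := coset_action G_pro.1 Ks.
by have [i iP] := glevel_refine thM th1; exact/Kg/thK/iP.
Qed.

Lemma gpi_sep (x : FH) : (forall i, gpi i x = 1%g) -> x = 1%g.
Proof. by move=> /glevel_sep h; apply: val_inj. Qed.

Lemma glevel_near i (x : G) : \forall g \near x, gl_th i g = gl_th i x.
Proof. exact: near_fiber (@gl_M i) (gl_open i) x. Qed.

Definition glevel0 := GLevel th0M th0_open (fun g h => h).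

Lemma glevel_limit (T : Type) (s : T -> G) (B : glevel -> set T) :
  (forall i j, exists k, B k `<=` B i `&` B j) -> (forall i, B i !=set0) ->
  exists x, forall i j, exists2 t, B i t & gl_th j (s t) = gl_th j x.
Proof.
move=> Bd Bn; have FB : Filter (filter_from [set: glevel] (fun i => s @` B i)).
  apply: filter_fromT_filter => [|i j]; first by exists glevel0.
  by have [k kB] := Bd i j; exists k => _ [t /kB[ti tj] <-]; split; exists t.
have PB : ProperFilter (filter_from [set: glevel] (fun i => s @` B i)).
  by apply: filter_from_proper => i _; have [t it] := Bn i; exists (s t); exists t.
have [[Gc _ _] _] := G_pro.
have [x [_ xc]] := Gc _ PB filterT; exists x => i j.
have [|_ [[t it <-] tx]] := xc (s @` B i) _ _ (glevel_near j x); first by exists i.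
by exists t.
Qed.

Definition toH (g : G) : FH := insubd (1%g : FH) g.

Lemma toHK g : elts H g -> \val (toH g) = g.
Proof. by move=> Hg; rewrite /toH insubdK// mem_set. Qed.

Lemma valH (h : FH) : elts H (\val h).
Proof. exact: set_valP. Qed.

Lemma gpi_compact (s : glevel -> FH) : exists x, forall i, exists j,
  (forall y, gpi j y = 1%g -> gpi i y = 1%g) /\ gpi i (s j) = gpi i x.
Proof.
pose B i := [set j | forall g, gl_th j g = 1%g -> gl_th i g = 1%g].
have [||x xP] := @glevel_limit _ (fun j => \val (s j)) B.
- move=> i j; have [k kP] := glevel_directed i j; exists k => l lk.
  by split=> g /lk/kP[].
- by move=> i; exists i.
have Hx : elts H x.
  have [j _ jx] := xP glevel0 glevel0.
  have : elts H ((\val (s j))^-1 * x)%g.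
    have jx' : th0 (\val (s j)) = th0 x := jx.
    by apply: th0H; rewrite th0M (perm_homV _ th0M) jx' mulVg.
  by move=> h; have := subgroupF (subgroup1 H) h => /(subgroupF (valH (s j)));
    rewrite mul1g invgK mulKVg.
exists (toH x) => i; have [j ji jx] := xP i i; exists j; split.
  by move=> y; exact: ji.
by rewrite /gpi toHK.
Qed.

Lemma gpi_directed i j : exists k, forall x, gpi k x = 1%g ->
  gpi i x = 1%g /\ gpi j x = 1%g.
Proof. by have [k kP] := glevel_directed i j; exists k => x /kP. Qed.

Definition open_lgroup : lgroup p := @LGroup p FH glevel glevel0
  (fun i => 'S_(gl_n i)) gpi gpiM gpi_pelt gpi_directed gpi_sep gpi_compact.

Variables (X : topologicalType) (x0 : X) (iota : X -> FH).
Hypotheses (X_pf : profinite_space X) (iota_free : free_pro_p_on p x0 iota).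

Definition iota_image (h : open_lgroup) := exists x, iota x = h.

Lemma near_iota i x : \forall y \near x, gpi i (iota y) = gpi i (iota x).
Proof.
have [ic _ _] := iota_free.
have vc : {for iota x, continuous (\val : FH -> G)}.
  by apply: initial_continuous.
have := glevel_near i (\val (iota x)) => /vc/ic.
by [].
Qed.

Lemma iota_image_closed : lclosed iota_image.
Proof.
move=> h hP; pose B i := [set x | gpi i (iota x) = gpi i h].
have FB : Filter (filter_from [set: glevel] B).
  apply: filter_fromT_filter => [|i j]; first by exists glevel0.
  have [k kP] := @finer2 p open_lgroup i j; exists k => x kx.
  by split; [exact: (finer_eq kP.1)|exact: (finer_eq kP.2)].
have PB : ProperFilter (filter_from [set: glevel] B).
  apply: filter_from_proper => i _; have [_ [x <-] xi] := hP i.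
  by exists x.
have [Xc _ _] := X_pf; have [x [_ xc]] := Xc _ PB filterT; exists x.
apply: (@lpi_inj p open_lgroup) => i.
have [|y [yB /= yx]] := xc (B i) _ _ (near_iota i x); first by exists i.
by rewrite /= -yx.
Qed.

(* A neighbourhood of 1 in H contains the kernel of a level, by compactness. *)
Lemma gpi_basis (A : set FH) : nbhs (1%g : FH) A ->
  exists i, forall h, gpi i h = 1%g -> A h.
Proof.
move=> A1; apply: contrapT => no.
have /choice[s sP] : forall i, exists h, gpi i h = 1%g /\ ~ A h.
  move=> i; apply: contrapT => nh; apply: no; exists i => h hi.
  by apply: contrapT => Ah; apply: nh; exists h.
have [C [Co C1 CA]] : exists C : set G, [/\ open C, C 1%g & forall h : FH, C (\val h) -> A h].
  move: A1; rewrite nbhsE => -[_ [[C Co <-] C1] CA].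
  by exists C; split=> // h Ch; exact: CA.
have sC i : ~ C (\val (s i)) by move=> h; case: (sP i) => _; apply; exact: CA.
have FB : Filter (filter_from [set: glevel] (fun i => [set g | ~ C g /\ gl_th i g = 1%g])).
  apply: filter_fromT_filter => [|i j]; first by exists glevel0.
  have [k kP] := glevel_directed i j; exists k => g [Cg /kP[gi gj]].
  by split; split.
have PB : ProperFilter (filter_from [set: glevel] (fun i => [set g | ~ C g /\ gl_th i g = 1%g])).
  apply: filter_from_proper => i _; exists (\val (s i)); split=> //.
  by case: (sP i).
have [[Gc _ _] _] := G_pro; have [x [_ xc]] := Gc _ PB filterT.
have x1 : x = 1%g.
  apply: glevel_sep => i.
  have [|y [[_ yi] yx]] := xc [set g | ~ C g /\ gl_th i g = 1%g] _ _ (glevel_near i x).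
    by exists i.
  by rewrite -yx.
have Cx : nbhs x C by apply: open_nbhs_nbhs; split=> //; rewrite x1.
have [|y [[Cy _] Cy']] := xc [set g | ~ C g /\ gl_th glevel0 g = 1%g] _ _ Cx.
  by exists glevel0.
exact: Cy.
Qed.

(** The topological universal property is applied to discrete finite p-groups. For uniqueness into
    an arbitrary finite group, the image of the pair (th, th') is a p-group; on generators it takes
    values in the diagonal, so an extension into the diagonal exists, and uniqueness into the image
    identifies the pair with it. *)
Lemma iota_free_on : free_on iota_image.
Proof.
have [ic i1 univ] := iota_free.
have ext (gT : finGroupType) (W : {group gT}) (phi : X -> gT) : (p.-group W)%g ->
    (forall x, phi x \in W) -> phi x0 = 1%g ->
    (forall x, \forall y \near x, phi y = phi x) ->
    exists psi : {multiplicative FH -> dgroup W}, [/\ continuous psi,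
      forall x, sgval (psi (iota x)) = phi x & forall psi' : {multiplicative FH -> dgroup W},
      continuous psi' -> (forall x, sgval (psi' (iota x)) = phi x) -> psi' =1 psi].
  move=> Wp pW p1 pc; pose ph x : dgroup W := subg W (phi x).
  have phE x : sgval (ph x) = phi x by exact: subgK.
  have [|||psi [pc' pi pu]] := univ (dgroup W) ph.
  - exact: dgroup_pro_p.
  - move=> x A /nbhs_singleton Ax; apply: filterS (pc x) => y /= yx.
    by rewrite /ph yx.
  - by apply: val_inj; rewrite /= phE p1.
  exists psi; split=> // [x|psi' c' i']; first by rewrite pi.
  by apply: pu => // x; apply: val_inj; rewrite /= i' phE.
have cts_lcont (gT : finGroupType) (W : {group gT}) (psi : {multiplicative FH -> dgroup W}) :
    continuous psi -> lcont (fun x : open_lgroup => sgval (psi x)).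
  move=> pc; split=> [x y|]; first by rewrite gmulfM.
  have p1 : psi 1%g = 1%g by apply: (@mulgI _ (psi 1%g)); rewrite -gmulfM !mulg1.
  have [|i iP] := @gpi_basis (psi @^-1` [set 1%g]).
    by apply: (pc 1%g); apply: dgroup_nbhs.
  by exists i => x /iP /= ->.
have lcont_cts (gT : finGroupType) (W : {group gT}) (th : open_lgroup -> gT) : lcont th ->
    (forall x, th x \in W) -> exists psi : {multiplicative FH -> dgroup W},
    continuous psi /\ forall x, sgval (psi x) = th x.
  move=> ht tW; pose f (x : FH) : dgroup W := subg W (th x).
  have fE x : sgval (f x) = th x by exact: subgK.
  have fM : {morph f : x y / (x * y)%g}.
    by move=> x y; apply: val_inj; rewrite /= !fE ht.1.
  pose psi : {multiplicative FH -> dgroup W} :=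
    HB.pack f (isMultiplicative.Build _ _ f fM).
  exists psi; split=> // x A /nbhs_singleton Ax.
  have [i ti] := lcont_eq ht.
  have vc : {for x, continuous (\val : FH -> G)} by apply: initial_continuous.
  have h := glevel_near i (\val x).
  have h' : nbhs x [set y | gl_th i (\val y) = gl_th i (\val x)] := vc _ h.
  suff : nbhs x (f @^-1` A) by [].
  apply: filterS h' => y yx; have e : th y = th x by apply: ti.
  by rewrite /= /f e.
split; first by exists x0.
- move=> gT W phi Wp pW p1 [i pi].
  have [||x|psi [pc pE _]] := ext gT W (fun x => phi (iota x)) Wp.
  + by move=> x; apply: pW; exists x.
  + by rewrite i1.
  + apply: filterS (near_iota i x) => y yx; apply: pi => //; by [exists y|exists x].
  exists (fun x => sgval (psi x)); split=> [|x|_ [x <-]]; last exact: pE.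
    exact: cts_lcont.
  exact: subgP.
- move=> gT th th' ht ht' tt.
  pose pr (x : open_lgroup) := (th x, th' x).
  have hpr : lcont pr.
    split=> [x y|]; first by rewrite /pr ht.1 ht'.1.
    have [i ti] := lcont_eq ht; have [j tj] := lcont_eq ht'.
    have [k [ki kj]] := finer2 i j; exists k => x x1.
    have e : lpi k x = lpi k 1%g by rewrite lpi1.
    rewrite /pr (ti _ _ (finer_eq ki e)) (tj _ _ (finer_eq kj e)).
    by rewrite (lcont1 ht) (lcont1 ht').
  pose P : {set gT * gT} := [set y | `[< exists x, pr x = y >]]%SET.
  have inP y : (y \in P) = `[< exists x, pr x = y >] by rewrite finset.inE.
  have gP : group_set P.
    apply/group_setP; split; first by rewrite inP; apply/asboolP; exists 1%g; exact: lcont1.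
    move=> a b; rewrite !inP => /asboolP[x <-] /asboolP[y <-]; apply/asboolP.
    by exists (x * y)%g; rewrite hpr.1.
  have Pp : (p.-group (Group gP))%g.
    apply: pgroup_pelt => // y; rewrite /= inP => /asboolP[x <-].
    have [i ti] := lcont_eq hpr; have [e xe] := lpi_pelt i x; exists e.
    have prX m : (pr x ^+ m)%g = pr (x ^+ m)%g.
      by elim: m => [|m IH]; rewrite ?(lcont1 hpr)// !expgS IH hpr.1.
    have lX m : lpi i (x ^+ m)%g = (lpi i x ^+ m)%g.
      by elim: m => [|m IH]; rewrite ?lpi1// !expgS lpiM IH.
    by rewrite prX (ti _ 1%g) ?(lcont1 hpr)// lX xe lpi1.
  have prP x : pr x \in Group gP by rewrite /= inP; apply/asboolP; exists x.
  pose D := (Group gP :&: [set y : gT * gT | y.1 == y.2])%SET.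
  have inD y : (y \in D) = (y \in Group gP) && (y.1 == y.2).
    by rewrite finset.in_setI; congr (_ && _); rewrite finset.inE.
  have gD : group_set D.
    apply/group_setP; split; first by rewrite inD group1 eqxx.
    move=> y y'; rewrite !inD => /andP[yP /eqP e] /andP[yP' /eqP e'].
    by rewrite (groupM yP yP') /= e e' eqxx.
  have DP : Group gD \subset Group gP by apply/fintype.subsetP => y; rewrite inD => /andP[].
  have [i ti] := lcont_eq hpr.
  have pri x : \forall y \near x, pr (iota y) = pr (iota x).
    by apply: filterS (near_iota i x) => y yx; exact: ti.
  have [||psiD [pDc pDE _]] := ext _ (Group gD) (fun x => pr (iota x)) (pgroupS DP Pp) _ _ pri.
  + by move=> x; rewrite inD prP /= tt//; exists x.
  + by rewrite i1 (lcont1 hpr).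
  have [||psiP [pPc pPE pPu]] := ext _ (Group gP) (fun x => pr (iota x)) Pp _ _ pri.
  + by move=> x; exact: prP.
  + by rewrite i1 (lcont1 hpr).
  have [psi1 [c1 E1]] := lcont_cts _ (Group gP) pr hpr prP.
  have DW x : sgval (psiD x) \in Group gP.
    by apply: (fintype.subsetP DP); exact: subgP.
  have [psi2 [c2 E2]] := lcont_cts _ (Group gP) _ (cts_lcont _ _ psiD pDc) DW.
  move=> x; have : sgval (psi1 x) = sgval (psi2 x).
    have P1 : psi1 =1 psiP by apply: pPu => // y; exact: E1.
    have P2 : psi2 =1 psiP by apply: pPu => // y; exact: etrans (E2 _) (pDE _).
    exact: etrans (congr1 _ (P1 x)) (congr1 _ (esym (P2 x))).
  rewrite E1 E2 => e.
  have : pr x \in Group gD by rewrite e; exact: subgP.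
  by rewrite inD => /andP[_ /eqP].
Qed.

Local Notation FL := open_lgroup.
Local Notation Z := iota_image.
Variables (k : nat) (rho : 'I_k.+1 -> G) (idx : G -> 'I_k.+1).
Hypothesis rhoR : forall g, elts H (g * (rho (idx g))^-1)%g.
Hypothesis idxR : forall h g, elts H h -> idx (h * g)%g = idx g.
Hypothesis idxK : forall j, idx (rho j) = j.
Local Notation V := (box FL k.+1).

Let H1 : elts H 1%g. Proof. exact: subgroup1. Qed.
Let HV x : elts H x -> elts H x^-1%g.
Proof. by move=> Hx; have := subgroupF H1 Hx; rewrite mul1g. Qed.
Let HM x y : elts H x -> elts H y -> elts H (x * y)%g.
Proof. by move=> Hx /HV Hy; have := subgroupF Hx Hy; rewrite invgK. Qed.

Lemma toHM x y : elts H x -> elts H y -> toH (x * y)%g = (toH x * toH y)%g :> FL.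
Proof.
move=> Hx Hy; apply: val_inj; transitivity (\val (toH x) * \val (toH y))%g => //.
by rewrite !toHK//; exact: HM.
Qed.

Lemma toH1 : toH 1%g = 1%g :> FL. Proof. by apply: val_inj; rewrite toHK. Qed.

Lemma lpi_toH (i : level FL) g : elts H g -> lpi i (toH g : FL) = gl_th i g.
Proof. by move=> Hg; rewrite /= /gpi toHK. Qed.

(** A point of the box is an H-equivariant map from G to H, stored by its values at representatives
    of the cosets H g; [ev] recovers the map. G acts by right translation of the argument, the usual
    coinduced action. *)
Definition ev (v : V) (g : G) : FL := (toH (g * (rho (idx g))^-1) * box_nth v (idx g))%g.

Lemma ev_mul v h g : elts H h -> ev v (h * g)%g = (toH h * ev v g)%g.
Proof. by move=> Hh; rewrite /ev idxR// -mulgA toHM// mulgA. Qed.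

Lemma ev_rho v j : ev v (rho j) = box_nth v j.
Proof. by rewrite /ev idxK mulgV toH1 mul1g. Qed.

Definition gact (x : G) (v : V) : V := box_mk k.+1 (fun j => ev v (rho (inord j) * x)%g).

Lemma box_nth_gact x v (j : 'I_k.+1) : box_nth (gact x v) j = ev v (rho j * x)%g.
Proof. by rewrite box_nth_mk// inord_val. Qed.

Lemma ev_gact x v g : ev (gact x v) g = ev v (g * x)%g.
Proof.
by rewrite {1}/ev box_nth_gact -ev_mul// mulgA mulgVK.
Qed.

Lemma box_ext_ord (v w : V) : (forall j : 'I_k.+1, box_nth v j = box_nth w j) -> v = w.
Proof. by move=> vw; apply: box_ext => j jk; exact: (vw (Ordinal jk)). Qed.

Lemma ev_ext v w : (forall g, ev v g = ev w g) -> v = w.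
Proof. by move=> vw; apply: box_ext_ord => j; rewrite -!ev_rho. Qed.

Lemma gact1 v : gact 1%g v = v.
Proof. by apply: ev_ext => g; rewrite ev_gact mulg1. Qed.

Lemma gactM x y v : gact (x * y)%g v = gact x (gact y v).
Proof. by apply: ev_ext => g; rewrite !ev_gact mulgA. Qed.

Let N := {n : G | th0 n = 1%g}.
Let rhoN j := rho (inord j).
Definition nF (j : nat) (n : N) (x : FL) : FL :=
  (toH (rhoN j * sval n * (rhoN j)^-1) * x)%g.

Let th0V x : th0 x^-1%g = (th0 x)^-1%g. Proof. exact: perm_homV. Qed.
Let th01 : th0 1%g = 1%g. Proof. exact: perm_hom1. Qed.

Let conjN g n : th0 n = 1%g -> th0 (g * n * g^-1)%g = 1%g.
Proof. by move=> n1; rewrite !th0M n1 mulg1 th0V mulgV. Qed.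

Lemma nact_gact n (v : V) : box_act nF n v = gact (sval n) v.
Proof.
apply: box_ext_ord => j; rewrite box_nth_act// box_nth_gact /nF /rhoN inord_val.
have e : (rho j * sval n = rho j * sval n * (rho j)^-1 * rho j)%g by rewrite mulgVK.
rewrite [in RHS]e ev_mul; first by rewrite ev_rho.
by apply: th0H; apply: conjN; exact: (svalP n).
Qed.

Let I0 : {set 'S_n0} := [set s | `[< exists g, th0 g = s >]]%SET.
Let inI s : (s \in I0) = `[< exists g, th0 g = s >]. Proof. by rewrite finset.inE. Qed.
Let gI : group_set I0.
Proof.
apply/group_setP; split; first by rewrite inI; apply/asboolP; exists 1%g.
move=> a b; rewrite !inI => /asboolP[g <-] /asboolP[h <-].
by apply/asboolP; exists (g * h)%g.
Qed.
Let KG := Group gI.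
Let gT : finGroupType := subg_of KG.

Let r_ex (y : gT) : exists g, th0 g = sgval y.
Proof. by have := subgP y; rewrite /= inI => /asboolP. Qed.
Let r (y : gT) : G := sval (cid (r_ex y)).
Let rE y : th0 (r y) = sgval y. Proof. exact: (svalP (cid (r_ex y))). Qed.
Let q (g : G) : gT := subg KG (th0 g).
Let qE g : sgval (q g) = th0 g.
Proof. by apply: subgK; rewrite /= inI; apply/asboolP; exists g. Qed.
Let sgM (x y : gT) : sgval (x * y)%g = (sgval x * sgval y)%g. Proof. by []. Qed.

Let gTp : (p.-group [set: gT]%SET)%g.
Proof.
apply: pgroup_pelt => // x _; have [e xe] := perm_hom_pelt th0M th0_open (r x).
exists e; apply: val_inj; rewrite -[RHS]/(1%g : 'S_n0) -xe rE.
by elim: (p ^ e)%N => [|m IH] //; rewrite !expgS -IH.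
Qed.

Let mkN n (n1 : th0 n = 1%g) : N := exist _ n n1.

Let ratio x y : th0 x = th0 y -> exists n : N, forall v, gact x v = box_act nF n (gact y v).
Proof.
move=> xy; have n1 : th0 (x * y^-1)%g = 1%g by rewrite th0M th0V xy mulgV.
by exists (mkN n1) => v; rewrite nact_gact /= -gactM mulgVK.
Qed.

Lemma gact_rel (i : level FL) x (v w : V) : box_rel i v w -> box_rel i (gact x v) (gact x w).
Proof.
move=> /box_relP vw; apply/box_relP => j jk.
rewrite -[j]/(nat_of_ord (Ordinal jk)) !box_nth_gact /ev !lpiM vw//.
Qed.

Lemma gact_near (i : level FL) x y v : gl_th i x = gl_th i y -> box_rel i (gact x v) (gact y v).
Proof.
move=> xy; apply/box_relP => j jk; rewrite -[j]/(nat_of_ord (Ordinal jk)) !box_nth_gact.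
set g := rho _; have u1 : gl_th i (g * (x * y^-1) * g^-1)%g = 1%g.
  by rewrite !gl_M !(perm_homV _ (@gl_M i)) xy mulgV mulg1 mulgV.
have -> : (g * x = g * (x * y^-1) * g^-1 * (g * y))%g by rewrite !mulgA !mulgVK.
by rewrite ev_mul ?lpiM ?lpi_toH ?u1 ?mul1g//; by apply: th0H; exact: (gl_fine u1).
Qed.

(** G permutes the coordinates and multiplies them on the left by elements of H, while edges of the
    tree are right multiplications by [Z]. *)
Lemma gact_simp x (s : seq V) : box_simp Z s -> box_simp Z (map (gact x) s).
Proof.
move=> /box_simpP sZ; apply/box_simpP => j jk; rewrite -map_comp.
pose j' := idx (rho (Ordinal jk) * x)%g.
have := jump_mul (toH (rho (Ordinal jk) * x * (rho j')^-1)%g : FL) (sZ j' (ltn_ord _)).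
rewrite -map_comp; congr (jump _ _); apply: eq_map => v.
exact: (esym (box_nth_gact x v (Ordinal jk))).
Qed.

Let FL_free : free_on Z. Proof. exact: iota_free_on. Qed.

Lemma box_simp_closed (s : seq V) :
  (forall i : level FL, exists2 t, box_simp Z t & srel (box_rel i) s t) -> box_simp Z s.
Proof.
move=> sP; apply/box_simpP => j jk; apply: jump_closed; first exact: iota_image_closed.
move=> i; have [t /box_simpP tZ st] := sP i; exists (map (fun x => box_nth x j) t).
  exact: tZ.
by apply: srel_map st => x y /box_relP; exact.
Qed.

Let nu_ex (s : 'S_n0) : exists g, (exists g', th0 g' = s) -> th0 g = s.
Proof. by have [[g gs]|no] := pselect (exists g', th0 g' = s); [exists g|exists 1%g => /no]. Qed.
Let tau (s : 'S_n0) : G := sval (cid (nu_ex s)).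
Let tauE g : th0 (tau (th0 g)) = th0 g.
Proof. by apply: (svalP (cid (nu_ex (th0 g)))); exists g. Qed.
Let nu (x : FL) : G := (\val x * (tau (th0 (\val x)))^-1)%g.
Let nu1 x : th0 (nu x) = 1%g. Proof. by rewrite /nu th0M th0V tauE mulgV. Qed.
Let nuM m x : th0 m = 1%g -> nu (toH m * x)%g = (m * nu x)%g.
Proof.
move=> m1; have e : \val (toH m * x)%g = (m * \val x)%g.
  by transitivity (\val (toH m) * \val x)%g => //; rewrite toHK//; exact: th0H.
by rewrite /nu e th0M m1 mul1g mulgA.
Qed.

(** [nu] strips a chosen representative of the class modulo N and is an N-equivariant map to N.
    Conjugation by rho_j rho_0^(-1) converts the action on coordinate 0 into that on coordinate [j].
    This is the equivariant map required by [box_exact_act]. *)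
Definition sk (j : nat) (x : FL) : FL :=
  toH ((rhoN j * (rhoN 0)^-1) * nu x * (rhoN j * (rhoN 0)^-1)^-1)%g.

Lemma box_cochain_exact m : exact_at 'F_p (box_act nF (k := k.+1)) (@box_rel p FL k.+1)
  (@box_simp p FL Z k.+1) m.+3.
Proof.
have Ep : exists l, forall e : 'F_p, (e *+ (p ^ l) = 0)%R.
  by exists 1%N => e; rewrite expn1 -mulr_natr pchar_Fp_0// mulr0.
apply: (box_exact_act p_pr FL_free Ep (sk := sk)) => [j n x y|j n x|j i x y xy].
- by rewrite /nF mulgA.
- rewrite /nF /sk nuM; last by apply: conjN; exact: (svalP n).
  rewrite -toHM; [|apply: th0H; apply: conjN; exact: (svalP n)|apply: th0H; apply: conjN; exact: nu1].
  by congr toH; rewrite !invMg !invgK !mulgA !mulgVK.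
- have e0 : th0 (\val x) = th0 (\val y).
    have := gl_fine (_ : gl_th i ((\val x)^-1 * \val y)%g = 1%g).
    rewrite gl_M (perm_homV _ (@gl_M i)) (_ : gl_th i (\val x) = gl_th i (\val y))// mulVg.
    move=> /(_ erefl); rewrite th0M th0V => h.
    by apply/esym/(@mulgI _ (th0 (\val x))^-1%g); rewrite h mulVg.
  rewrite /sk !lpi_toH; [|apply: th0H; apply: conjN; exact: nu1|apply: th0H; apply: conjN; exact: nu1].
  have en : gl_th i (nu x) = gl_th i (nu y).
    by rewrite /nu e0 !gl_M; congr (_ * _)%g; exact: xy.
  by rewrite gl_M [in RHS]gl_M; congr (_ * _)%g; rewrite gl_M en -gl_M.
Qed.

(** G acts on F through the finite group G/N by [a], and [t] is a cocycle for this action, the class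
    of the path from a base vertex to its translate. The last clause says that the twisted action
    has finite stabilizers. *)
Theorem action_data : exists (F : lgroup p) (Z1 : F -> Prop) (a : G -> F -> F) (t : G -> F),
  [/\ free_on Z1 /\ lclosed Z1, forall g z, Z1 z -> Z1 (a g z),
    forall g x y, a g (x * y)%g = (a g x * a g y)%g, forall x, a 1%g x = x &
    forall g h x, a (g * h)%g x = a g (a h x)] /\
  [/\ forall g h, t (g * h)%g = (t g * a g (t h))%g,
    forall i g, \forall g' \near g, lpi i (t g') = lpi i (t g),
    forall i g, exists j, \forall g' \near g, forall x y, lpi j x = lpi j y ->
      lpi i (a g' x) = lpi i (a g y) &
    forall f, finite_set [set g | (t g * a g f)%g = f]].
Proof.
pose v0 : V := box_mk k.+1 (fun=> 1%g : FL).
have b_sym i (v w : V) : box_rel i v w -> box_rel i w v.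
  by move=> /box_relP vw; apply/box_relP => j jk; rewrite vw.
have b_trans i (u v w : V) : box_rel i u v -> box_rel i v w -> box_rel i u w.
  by move=> /box_relP uv /box_relP vw; apply/box_relP => j jk; rewrite uv ?vw.
have b_dir (i j : level FL) : exists l, forall v w : V,
    box_rel l v w -> box_rel i v w /\ box_rel j v w.
  have [l [li lj]] := finer2 i j; exists l => v w vw.
  by split; [exact: box_rel_finer li vw|exact: box_rel_finer lj vw].
have b_sep (v w : V) : (forall i, box_rel i v w) -> v = w.
  move=> vw; apply: box_ext_ord => j; apply: lpi_inj => i.
  exact: ((box_relP i v w).1 (vw i)).
have b_lim (U : set_system glevel) (f : glevel -> V) : UltraFilter U ->
    exists x : V, forall i : level FL, U (fun l => box_rel i (f l) x).
  move=> UU; have /choice[c cP] : forall j : 'I_k.+1, exists c : FL, forall i : level FL,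
      U (fun l => lpi i (box_nth (f l) j) = lpi i c).
    by move=> j; exact: (lgroup_lim (fun l => box_nth (f l) j) UU).
  exists (box_mk k.+1 (fun j => c (inord j))) => i.
  have := ultra_forall UU (fun j : 'I_k.+1 => cP j i); apply: filterS => l lP.
  apply/box_relP => j jk; rewrite box_nth_mk// -[j]/(nat_of_ord (Ordinal jk)) lP.
  by rewrite inord_val.
have b_nA i (n : N) (v w : V) : box_rel i v w -> box_rel i (box_act nF n v) (box_act nF n w).
  by rewrite !nact_gact; exact: gact_rel.
have nA_1 : exists n : N, forall v : V, box_act nF n v = v.
  by exists (mkN th01) => v; rewrite nact_gact gact1.
have nA_M (n n' : N) : exists n2 : N, forall v : V,
    box_act nF n2 v = box_act nF n (box_act nF n' v).
  have n1 : th0 (sval n * sval n')%g = 1%g by rewrite th0M (svalP n) (svalP n') mulg1.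
  by exists (mkN n1) => v; rewrite !nact_gact gactM.
have nA_V (n : N) : exists n' : N, forall v : V, box_act nF n' (box_act nF n v) = v.
  have n1 : th0 (sval n)^-1%g = 1%g by rewrite th0V (svalP n) invg1.
  by exists (mkN n1) => v; rewrite !nact_gact -gactM mulVg gact1.
have act_nA (g : gT) (n : N) : exists n' : N, forall v : V,
    gact (r g) (box_act nF n v) = box_act nF n' (gact (r g) v).
  exists (mkN (conjN (r g) (svalP n))) => v; rewrite !nact_gact -!gactM /=.
  by rewrite mulgVK.
have act_1 : exists n : N, forall v : V, gact (r 1%g) v = box_act nF n v.
  have n1 : th0 (r 1%g) = 1%g by rewrite rE.
  by exists (mkN n1) => v; rewrite nact_gact.
have act_M (g h : gT) : exists n : N, forall v : V,
    gact (r (g * h)%g) v = box_act nF n (gact (r g) (gact (r h) v)).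
  have e : th0 (r (g * h)%g) = th0 (r g * r h)%g by rewrite th0M !rE.
  by have [n nE] := ratio e; exists n => v; rewrite nE gactM.
have s_nA (n : N) (s : seq V) : box_simp Z s -> box_simp Z (map (box_act nF n) s).
  move=> sZ; rewrite (eq_map (g := gact (sval n))); first exact: gact_simp.
  by move=> v; rewrite nact_gact.
have s_dim : exists D, forall s : seq V, box_simp Z s -> (D < size s)%N -> degenerate s.
  by exists k.+2 => s; exact: box_dim.
have s_exact1 : exact_at 'F_p (fun (_ : unit) (v : V) => v) (@box_rel p FL k.+1)
    (@box_simp p FL Z k.+1) 2.
  have -> : (fun (_ : unit) (v : V) => v) = box_act (fun _ _ x => x) (k := k.+1).
    by apply/funext => u; apply/funext => v; apply: box_ext_ord => j; rewrite box_nth_act.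
  have Ep : exists l, forall e : 'F_p, (e *+ (p ^ l) = 0)%R.
    by exists 1%N => e; rewrite expn1 -mulr_natr pchar_Fp_0// mulr0.
  exact: (@box_exact p p_pr FL Z FL_free 'F_p Ep k.+1 0).
have [F [Z1 [e [f [[[Zf Zc] fZ fM f1 fG] [[eM fe eN ec fc] eu]]]]]] :=
  @fundamental_data p p_pr gT V v0 N (box_act nF (k := k.+1)) glevel glevel0
    (@box_rel p FL k.+1) (fun g => gact (r g)) (@box_simp p FL Z k.+1)
    (@box_rel_refl p FL k.+1) b_sym b_trans b_dir b_sep b_lim b_nA
    (fun i g v w => @gact_rel i (r g) v w) nA_1 nA_M nA_V act_nA act_1 act_M s_nA
    (fun g s => @gact_simp (r g) s) (fun s t => @box_simp_face p FL Z k.+1 t s) box_simp_closed gTp s_dim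
    box_cochain_exact s_exact1 (fun T u => @box_connected p FL Z FL_free k.+1 T u).
have er g v w : e (gact (r (q g)) v) (gact (r (q g)) w) = e (gact g v) (gact g w).
  have [|n nE] := @ratio g (r (q g)); first by rewrite rE qE.
  by rewrite !nE eN.
have qM g h : q (g * h)%g = (q g * q h)%g by apply: val_inj; rewrite /= !qE th0M.
have q1 : q 1%g = 1%g by apply: val_inj; rewrite /= qE th01.
exists F, Z1, (fun g => f (q g)), (fun g => e v0 (gact g v0)); split; split.
- by [].
- by move=> g z; exact: fZ.
- by move=> g x y; exact: fM.
- by move=> x; rewrite /= q1.
- by move=> g h x; rewrite /= qM.
- by move=> g h; rewrite fe er gactM eM.
- move=> i g; have [l lP] := ec i; apply: filterS (glevel_near l g) => g' g'g.
  apply: lP; first exact: box_rel_refl.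
  exact: gact_near.
- move=> i g; have [j jP] := fc (q g) i; exists j; apply: filterS (glevel_near glevel0 g) => g' g'g.
  have -> : q g' = q g by apply: val_inj; rewrite /= !qE.
  exact: jP.
(* The value of a vertex at 1 is multiplied by [n] on the left when [n] acts, so its increments are
   N-invariant and define a homomorphism on F at each level. It sends the path class from w to n w
   to a conjugate of the image of [n]. *)
have trivial_N n w : th0 n = 1%g -> e w (gact n w) = 1%g -> n = 1%g.
  move=> n1 en; have Hn := th0H n1.
  suff : toH n = 1%g :> FL by move=> /(congr1 \val); rewrite toHK.
  apply: (@lpi_separated p FL) => i.
  pose c v := lpi i (ev v 1%g).
  have cN (m : N) v : c (box_act nF m v) = (lpi i (toH (sval m) : FL) * c v)%g.
    rewrite /c nact_gact ev_gact mul1g -{1}[sval m]mulg1 ev_mul ?lpiM//.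
    exact/th0H/(svalP m).
  have [||||th [[thM _] thE]] := eu _ (limage_group i) c.
  - exact: limage_pgroup.
  - by move=> v; exact: mem_limage.
  - by exists i => v w' /box_relP vw; rewrite /c /ev !lpiM vw.
  - by move=> m v w'; rewrite !cN invMg mulgA mulgKV.
  have := thE w (gact n w); rewrite en.
  have -> : th 1%g = 1%g by apply: (@mulgI _ (th 1%g)); rewrite -thM !mulg1.
  have := cN (mkN n1) w; rewrite nact_gact /= => -> h.
  apply: (@mulgI _ (c w)^-1%g); apply: (@mulIg _ (c w)).
  by rewrite mulg1 mulVg -mulgA -h.
move=> x; pose A := [set g | (e v0 (gact g v0) * f (q g) x)%g = x].
(* If g and h fix [x] and agree modulo N, then the path class from g v0 to h v0 is trivial, and
   [trivial_N] applies to h g^(-1). *)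
have qinj : {in A &, injective q}.
  move=> g h; rewrite !classical_sets.inE /A /= => gA hA qgh.
  have te : e v0 (gact g v0) = e v0 (gact h v0).
    by apply: (@mulIg _ (f (q g) x)); rewrite gA qgh hA.
  have n1 : th0 (h * g^-1)%g = 1%g by rewrite th0M th0V -!qE qgh mulgV.
  have ghe : e (gact g v0) (gact (h * g^-1)%g (gact g v0)) = 1%g.
    by apply: (@mulgI _ (e v0 (gact g v0))); rewrite eM mulg1 -gactM mulgVK te.
  have := trivial_N _ _ n1 ghe => /(canRL (mulgK _)).
  by rewrite invgK mul1g => ->.
rewrite -(eq_finite_set (inj_card_eq qinj)).
apply: (@sub_finite_set _ _ [set y : gT | (y \in [set: gT]%SET) = true]).
  by move=> y _ /=; rewrite finset.in_setT.
by apply/finite_setP; exists #|[set: gT]%SET|; exact: fin_card.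
Qed.

End Levels.

(** * Locally constant functions and integration against measures *)

Section LocallyConstant.
Local Open Scope classical_set_scope.

Definition loc_const (X : topologicalType) (T : Type) (f : X -> T) :=
  forall x, \forall y \near x, f y = f x.

Lemma loc_const_pair (X : topologicalType) (T T' : Type) (f : X -> T) (g : X -> T') :
  loc_const f -> loc_const g -> loc_const (fun x => (f x, g x)).
Proof. by move=> fc gc x; apply: filterS (filterI (fc x) (gc x)) => y [/= -> ->]. Qed.

Lemma loc_const_comp (X : topologicalType) (T T' : Type) (h : T -> T') (f : X -> T) :
  loc_const f -> loc_const (fun x => h (f x)).
Proof. by move=> fc x; apply: filterS (fc x) => y /= ->. Qed.

Lemma loc_const_cont (X Y : topologicalType) (T : Type) (f : X -> Y) (g : Y -> T) :
  continuous f -> loc_const g -> loc_const (fun x => g (f x)).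
Proof. by move=> fc gc x; exact: (fc x _ (gc (f x))). Qed.

Lemma quotient_loc_const (X : topologicalType) (q : finite_quotient X) : loc_const q.
Proof.
by move=> x; apply: (@quo_continuous X q x [set y | y = q x]); apply/principal_filterP.
Qed.

(** A finite quotient must be onto, so the values of [f] are cut down to its image [J]. *)
Lemma quotient_exists (X : topologicalType) (T : finType) (f : X -> T) : loc_const f ->
  exists (q : finite_quotient X) (j : 'I_(quo_card q) -> T), forall x, f x = j (q x).
Proof.
move=> fc; pose J : {set T} := [set t | `[< exists x, f x = t >]]%SET.
have fJ x : f x \in J by rewrite finset.inE; apply/asboolP; exists x.
pose m x := enum_rank_in (fJ x) (f x).
have mE x y : f x = f y -> m x = m y.
  by move=> e; apply: enum_val_inj; rewrite !enum_rankK_in.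
have mc : continuous (m : X -> discrete_topology 'I_#|J|).
  move=> x A /principal_filterP Ax.
  suff : nbhs x [set y | A (m y)] by [].
  by apply: filterS (fc x) => y /mE /= ->.
have ms : range m = setT.
  apply/seteqP; split=> // k _; have := enum_valP k; rewrite finset.inE => /asboolP[x xk].
  by exists x => //; apply: enum_val_inj; rewrite enum_rankK_in.
exists (FiniteQuotient mc ms), enum_val => x /=.
by rewrite enum_rankK_in.
Qed.

Lemma continuous_prod (I : Type) (T : I -> topologicalType) (Y : topologicalType)
    (f : Y -> prod_topology T) :
  (forall i, continuous (fun y => f y i)) -> continuous f.
Proof.
move=> fc y; apply/cvg_sup => i U [_ [[W oW <-] Wf] WU].
have h : nbhs y [set z | W (f z i)] := fc i y W (open_nbhs_nbhs (conj oW Wf)).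
suff : nbhs y (f @^-1` U) by [].
by apply: filterS h => z; exact: WU.
Qed.

Lemma padic_continuous (p : nat) (Y : topologicalType) (f : Y -> padic p) :
  (forall n, loc_const (fun y => f y n)) -> continuous f.
Proof.
move=> fc; apply: (@continuous_comp_initial _ _ _ (@residue p : padic p ->
  prod_topology (fun n => discrete_topology 'Z_(p ^ n.+1)))).
apply: continuous_prod => n y A /principal_filterP Ay.
suff : nbhs y [set z | A (f z n)] by [].
by apply: filterS (fc n y) => z /= ->.
Qed.

Lemma module_continuous (p : nat) (X : topologicalType) (base : option X)
    (Y : topologicalType) (f : Y -> completed_module p base) :
  (forall q k n, loc_const (fun y => f y q k n)) -> continuous f.
Proof.
move=> fc; apply: (@continuous_comp_initial _ _ _ (@coef p X base : completed_module p base ->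
  prod_topology (fun q : finite_quotient X => prod_topology (fun _ : 'I_(quo_card q) => padic p)))).
apply: continuous_prod => q; apply: continuous_prod => k.
by apply: padic_continuous => n; exact: fc.
Qed.

Lemma near_proj (I : Type) (T : I -> topologicalType) (f : prod_topology T) i A :
  nbhs (f i) A -> nbhs f [set g : prod_topology T | A (g i)].
Proof.
move=> fA; have /cvg_sup/(_ i) h : f --> f by apply: cvg_id.
apply: h.
exact: (@initial_continuous _ _ (fun g : (forall i, T i) => g i) f _ fA).
Qed.

Lemma coef_loc_const (p : nat) (X : topologicalType) (base : option X)
    (q : finite_quotient X) k n : loc_const (fun u : completed_module p base => u q k n).
Proof.
move=> u; have c1 := @initial_continuous _ _ (@coef p X base : completed_module p base ->
  prod_topology (fun q : finite_quotient X => prod_topology (fun _ : 'I_(quo_card q) => padic p))) u.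
have c3 := @initial_continuous _ _ (@residue p : padic p ->
  prod_topology (fun n => discrete_topology 'Z_(p ^ n.+1))) (u q k).
have h0 : nbhs (u q k n : discrete_topology 'Z_(p ^ n.+1)) [set x | x = u q k n].
  exact/principal_filterP.
have h1 := c3 _ (@near_proj _ (fun n => discrete_topology 'Z_(p ^ n.+1)) _ n _ h0).
have h2 := @near_proj _ (fun _ : 'I_(quo_card q) => padic p) _ k _ h1.
exact: (c1 _ (@near_proj _ (fun q : finite_quotient X =>
  prod_topology (fun _ : 'I_(quo_card q) => padic p)) _ q _ h2)).
Qed.

End LocallyConstant.

Section Integral.
Local Open Scope classical_set_scope.
Local Open Scope ring_scope.
Variables (p : nat) (X : topologicalType) (base : option X).
Local Notation M := (completed_module p base).
Implicit Types (u v : M) (n : nat).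

Lemma residue_sum (I : Type) (s : seq I) (P : pred I) (F : I -> padic p) n :
  (\sum_(i <- s | P i) F i) n = \sum_(i <- s | P i) F i n.
Proof. exact: (big_morph (fun x : padic p => x n)). Qed.

(** On a pointed space the coefficient at the base point is set to 0 by convention and is not
    additive under refinement, so only integrands vanishing there have a well-defined integral. *)
Definition vanish n (f : X -> 'Z_(p ^ n.+1)) := if base is Some x0 then f x0 = 0 else True.

Lemma coef_refine u (q r : finite_quotient X) f n (h : 'I_(quo_card r) -> 'Z_(p ^ n.+1)) :
  (forall x, f (q x) = r x) -> (forall k, is_base base k -> h k = 0) ->
  \sum_k h k * u r k n = \sum_j h (f j) * u q j n.
Proof.
move=> fqr hb; rewrite [RHS](partition_big f predT)//=; apply: eq_bigr => k _.
rewrite (eq_bigr (fun j => h k * u q j n)) => [|j /eqP -> //].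
rewrite -mulr_sumr; have [kb|kb] := boolP (is_base base k); first by rewrite hb// !mul0r.
by rewrite (coef_compat u fqr kb) residue_sum.
Qed.

(* The integral of a locally constant f with respect to the measure u, modulo p^(n+1). *)
Definition integ n u (f : X -> 'Z_(p ^ n.+1)) : 'Z_(p ^ n.+1) :=
  if pselect (exists qh : {q : finite_quotient X & 'I_(quo_card q) -> 'Z_(p ^ n.+1)},
      forall x, f x = projT2 qh (projT1 qh x)) is left e
  then \sum_k projT2 (sval (cid e)) k * u (projT1 (sval (cid e))) k n else 0.

Lemma quo_surjP (q : finite_quotient X) k : exists x, q x = k.
Proof.
have : range q k by rewrite (quo_surj q).
by move=> [x _ <-]; exists x.
Qed.

(** Independence of the finite quotient: two of them are compared on a common refinement. *)
Lemma integE n u f (q : finite_quotient X) h : (forall x, f x = h (q x)) -> @vanish n f ->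
  integ u f = \sum_k h k * u q k n.
Proof.
move=> fh f0; rewrite /integ; case: pselect => [e|[]]; last first.
  by exists (existT _ q h).
case: (cid e) => -[q' h'] /= fh'.
have [s [j jP]] := quotient_exists (loc_const_pair (quotient_loc_const q) (quotient_loc_const q')).
have hb (r : finite_quotient X) (g : 'I_(quo_card r) -> 'Z_(p ^ n.+1)) :
    (forall x, f x = g (r x)) -> forall k, is_base base k -> g k = 0.
  move=> fg k; rewrite /is_base; move: f0; rewrite /vanish; case: base => // x0 f0 /eqP <-.
  by rewrite -fg.
rewrite (@coef_refine u s q' (fun l => (j l).2))//; last 2 first.
- by move=> x; rewrite -jP.
- exact: hb.
rewrite (@coef_refine u s q (fun l => (j l).1))//; last 2 first.
- by move=> x; rewrite -jP.
- exact: hb.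
apply: eq_bigr => l _; have [x <-] := quo_surjP l.
by rewrite -jP /= -fh -fh'.
Qed.

Lemma integD n u f g : loc_const f -> loc_const g -> @vanish n f -> @vanish n g ->
  integ u (fun x => f x + g x) = integ u f + integ u g.
Proof.
move=> fc gc f0 g0; have [q [j jP]] := quotient_exists (loc_const_pair fc gc).
have fj x : f x = (j (q x)).1 by rewrite -jP.
have gj x : g x = (j (q x)).2 by rewrite -jP.
rewrite (integE u (h := fun k => (j k).1) fj f0) (integE u (h := fun k => (j k).2) gj g0).
rewrite (integE u (q := q) (h := fun k => (j k).1 + (j k).2)).
- by rewrite -big_split; apply: eq_bigr => k _; rewrite mulrDl.
- by move=> x; rewrite fj gj.
- by move: f0 g0; rewrite /vanish; case: base => // x0 -> ->; rewrite addr0.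
Qed.

Lemma integZ n u c f : loc_const f -> @vanish n f ->
  integ u (fun x => c * f x) = c * integ u f.
Proof.
move=> fc f0; have [q [j jP]] := quotient_exists fc.
rewrite (integE u jP f0) (integE u (q := q) (h := fun k => c * j k)).
- by rewrite mulr_sumr; apply: eq_bigr => k _; rewrite mulrA.
- by move=> x; rewrite jP.
- by move: f0; rewrite /vanish; case: base => // x0 ->; rewrite mulr0.
Qed.

Lemma integ0 n u : integ u (fun=> 0 : 'Z_(p ^ n.+1)) = 0.
Proof.
have c0 : loc_const (fun _ : X => 0 : 'Z_(p ^ n.+1)) by move=> x; exact: filterE.
have v0 : vanish (fun=> 0 : 'Z_(p ^ n.+1)) by rewrite /vanish; case: base.
have [q [j jP]] := quotient_exists c0; rewrite (integE u (q := q) (h := fun=> 0))//.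
by rewrite big1// => k _; rewrite mul0r.
Qed.

Lemma integ_sum n u (I : Type) (s : seq I) (P : pred I) (F : I -> X -> 'Z_(p ^ n.+1)) :
  (forall i, loc_const (F i)) -> (forall i, vanish (F i)) ->
  integ u (fun x => \sum_(i <- s | P i) F i x) = \sum_(i <- s | P i) integ u (F i).
Proof.
move=> Fc F0.
suff [-> _ _] : [/\ integ u (fun x => \sum_(i <- s | P i) F i x) =
    \sum_(i <- s | P i) integ u (F i), loc_const (fun x => \sum_(i <- s | P i) F i x) &
    vanish (fun x => \sum_(i <- s | P i) F i x)] by [].
elim: s => [|i s [IH c0 v0]].
  have -> : (fun x => \sum_(i <- [::] | P i) F i x) = fun=> 0.
    by apply/funext => x; rewrite big_nil.
  rewrite big_nil integ0; split=> //; first by move=> x; exact: filterE.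
  by rewrite /vanish; case: base.
rewrite big_cons; case: ifP => Pi.
  have -> : (fun x => \sum_(j <- i :: s | P j) F j x) =
      fun x => F i x + \sum_(j <- s | P j) F j x.
    by apply/funext => x; rewrite big_cons Pi.
  rewrite integD// IH; split=> //.
    exact: (loc_const_comp (fun y => y.1 + y.2) (loc_const_pair (Fc i) c0)).
  by move: (F0 i) v0; rewrite /vanish; case: base => // x0 -> ->; rewrite addr0.
suff -> : (fun x => \sum_(j <- i :: s | P j) F j x) = fun x => \sum_(j <- s | P j) F j x by [].
by apply/funext => x; rewrite big_cons Pi.
Qed.

Lemma integ_linear n (a : padic p) u v f : loc_const f -> @vanish n f ->
  integ (a *: u + v) f = a n * integ u f + integ v f.
Proof.
move=> fc f0; have [q [j jP]] := quotient_exists fc.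
rewrite !(integE _ jP f0) mulr_sumr -big_split; apply: eq_bigr => k _ /=.
by rewrite mulrDr mulrCA.
Qed.

Lemma integ_basis n x f : loc_const f -> @vanish n f -> integ (basis_elt x : M) f = f x.
Proof.
move=> fc f0; have [q [j jP]] := quotient_exists fc.
rewrite (integE _ jP f0) (bigD1 (q x))//= eqxx big1 => [|k kx].
  rewrite addr0 jP; case: ifP => [qb|_]; last exact: mulr1.
  rewrite [X in _ * X](_ : _ = 0)// mulr0; apply/esym; move: qb f0; rewrite /is_base /vanish.
  by case: base => // x0 /eqP <-; rewrite jP.
case: ifP => _; first exact: mulr0.
by rewrite eq_sym (negPf kx); exact: mulr0.
Qed.

Lemma integ_indicator n u (q : finite_quotient X) k : ~~ is_base base k ->
  integ u (fun x => (q x == k)%:R : 'Z_(p ^ n.+1)) = u q k n.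
Proof.
move=> kb; rewrite (integE u (q := q) (h := fun l => (l == k)%:R))//.
  rewrite (bigD1 k)//= eqxx mul1r big1 ?addr0// => l lk.
  by rewrite (negPf lk) mul0r.
by move: kb; rewrite /is_base /vanish; case: base => // x0 /negPf ->.
Qed.

Lemma integ_loc_const n f : loc_const f -> @vanish n f -> loc_const (fun u => integ u f).
Proof.
move=> fc f0 u; have [q [j jP]] := quotient_exists fc.
have h : nbhs u [set v : M | forall k, v q k n = u q k n].
  by apply: near_fin => k; exact: coef_loc_const.
apply: filterS h => v vu; rewrite !(integE _ jP f0); apply: eq_bigr => k _.
by rewrite (vu k).
Qed.

Definition reduce n (x : 'Z_(p ^ n.+2)) : 'Z_(p ^ n.+1) := inZp x.

Lemma integ_reduce n u f : loc_const f -> @vanish n.+1 f ->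
  integ u (fun x => reduce (f x)) = reduce (integ u f).
Proof.
move=> fc f0; have [q [j jP]] := quotient_exists fc.
have r0 : reduce (0 : 'Z_(p ^ n.+2)) = 0 by exact: padic0_compat.
have rD x y : reduce (x + y) = reduce x + reduce y :> 'Z_(p ^ n.+1).
  exact: (redD (@Zp_trunc_dvd p n)).
have rM x y : reduce (x * y) = reduce x * reduce y :> 'Z_(p ^ n.+1).
  exact: (redM (@Zp_trunc_dvd p n)).
rewrite (integE u jP f0) (integE u (q := q) (h := fun k => reduce (j k))).
- rewrite (big_morph (@reduce n) rD r0); apply: eq_bigr => k _.
  by rewrite rM -(residue_compat (u q k) n).
- by move=> x; rewrite jP.
- by move: f0; rewrite /vanish; case: base => // x0 ->.
Qed.

End Integral.

(** * The Cayley graph as a profinite graph *)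

Section GraphSpace.
Local Open Scope classical_set_scope.
Variables (p : nat) (F : lgroup p) (Z : F -> Prop).

(** The pair (f, z) is the edge from f to f z. Since 1 belongs to [Z], the pairs (f, 1) are loops
    that serve as the vertices, as a profinite graph contains its vertices. *)
Definition edge_pair : Type := {x : F * F | Z x.2}.
HB.instance Definition _ := gen_eqMixin edge_pair.
HB.instance Definition _ := gen_choiceMixin edge_pair.

Definition near_level i (x y : edge_pair) :=
  lpi i (sval x).1 = lpi i (sval y).1 /\ lpi i (sval x).2 = lpi i (sval y).2.

Definition edge_nbhs (x : edge_pair) : set_system edge_pair :=
  filter_from [set: level F] (fun i => [set y | near_level i x y]).

HB.instance Definition _ := hasNbhs.Build edge_pair edge_nbhs.

Fact edge_nbhs_filter (x : edge_pair) : ProperFilter (edge_nbhs x).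
Proof.
apply: filter_from_proper => [|i _]; last by exists x.
apply: filter_fromT_filter => [|i j]; first by exists (level0 F).
have [k [ki kj]] := finer2 i j; exists k => y [e1 e2].
by split; split; [exact: (finer_eq ki e1)|exact: (finer_eq ki e2)|
  exact: (finer_eq kj e1)|exact: (finer_eq kj e2)].
Qed.

Fact edge_nbhs_singleton (x : edge_pair) (A : set edge_pair) : edge_nbhs x A -> A x.
Proof. by move=> [i _]; exact. Qed.

Fact edge_nbhs_nbhs (x : edge_pair) (A : set edge_pair) :
  edge_nbhs x A -> edge_nbhs x (edge_nbhs^~ A).
Proof.
move=> [i _ iA]; exists i => // y [e1 e2]; exists i => // z [e3 e4].
by apply: iA; split; [rewrite e1|rewrite e2].
Qed.

HB.instance Definition _ := Nbhs_isNbhsTopological.Build edge_pair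
  edge_nbhs_filter edge_nbhs_singleton edge_nbhs_nbhs.

Lemma nbhs_level i (x : edge_pair) : nbhs x [set y | near_level i x y].
Proof. by exists i. Qed.

Lemma edge_pairP (x y : edge_pair) : sval x = sval y -> x = y.
Proof. by case: x y => [x xZ] [y yZ] /= e; subst y; congr exist; exact: Prop_irrelevance. Qed.

Lemma edge_pair_sep (x y : edge_pair) : (forall i, near_level i x y) -> x = y.
Proof.
move=> xy; apply: edge_pairP; case: x y xy => [[x1 x2] xZ] [[y1 y2] yZ] /= xy.
by congr pair; apply: lpi_inj => i; case: (xy i).
Qed.

Hypothesis Z_closed : lclosed Z.

Lemma edge_pair_profinite : profinite_space edge_pair.
Proof.
split.
- move=> B PB _; have [U [UU BU]] := ultraFilterLemma PB.
  have [x1 h1] := lgroup_lim (fun y : edge_pair => (sval y).1) UU.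
  have [x2 h2] := lgroup_lim (fun y : edge_pair => (sval y).2) UU.
  have Zx : Z (x1, x2).2.
    apply: Z_closed => i; have [y yi] := ultra_nonempty UU (h2 i).
    by exists (sval y).2 => //; exact: (svalP y).
  exists (exist (fun x : F * F => Z x.2) (x1, x2) Zx); split=> // A C BA [i _ iC].
  have [y [yA [y1 y2]]] := ultra_nonempty UU (filterI (BU A BA) (filterI (h1 i) (h2 i))).
  by exists y; split=> //; apply: iC; split; apply/esym.
- move=> x y xy; apply: edge_pair_sep => i.
  have [z [[x1 x2] [y1 y2]]] := xy _ _ (nbhs_level i x) (nbhs_level i y).
  by split; [rewrite x1 y1|rewrite x2 y2].
- apply: zero_dimension_totally_disconnected => x y /eqP xy.
  have [i ni] : exists i, ~ near_level i x y.
    apply: contrapT => no; apply: xy; apply: edge_pair_sep => i.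
    by apply: contrapT => h; apply: no; exists i.
  exists [set z | near_level i x z]; split=> //; split.
    rewrite openE => z [z1 z2]; exists i => // w [w1 w2].
    by split; [rewrite z1|rewrite z2].
  rewrite -[X in closed X]setCK; apply: open_closedC.
  rewrite openE => z nz; exists i => // w [w1 w2] [x1 x2]; apply: nz.
  by split; [rewrite x1|rewrite x2].
Qed.

Hypothesis Z1 : Z 1%g.

Definition trivial_pair : set edge_pair := [set x | (sval x).2 = 1%g].

Definition vpair (f : F) : edge_pair := exist (fun x : F * F => Z x.2) (f, 1%g) Z1.

Fact trivial_pair_closed : closed trivial_pair.
Proof.
rewrite -[X in closed X]setCK; apply: open_closedC.
rewrite openE => x nx; have [i ni] : exists i, lpi i (sval x).2 <> 1%g.
  apply: contrapT => no; apply: nx; apply: lpi_separated => i.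
  by apply: contrapT => h; apply: no; exists i.
by exists i => // y [_ y2] y1; apply: ni; rewrite y2 y1 lpi1.
Qed.

Fact trivial_pair_nonempty : trivial_pair !=set0.
Proof. by exists (vpair 1%g). Qed.

Definition vtx (f : F) : set_type trivial_pair :=
  exist _ (vpair f) (mem_set (erefl : trivial_pair (vpair f))).

Definition origin (v : set_type trivial_pair) : F := (sval (\val v)).1.

Lemma originK v : vtx (origin v) = v.
Proof.
apply: val_inj; apply: edge_pairP => /=; have := set_valP v; rewrite /origin /trivial_pair /=.
by move: (\val v) => [[x1 x2] xZ] /= ->.
Qed.

Definition gd0 (x : edge_pair) := vtx (sval x).1.
Definition gd1 (x : edge_pair) := vtx ((sval x).1 * (sval x).2)%g.

Fact gd0_continuous : continuous gd0.
Proof.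
apply: (@continuous_comp_initial (set_type trivial_pair) _ _ \val) => x A [i _ iA].
by exists i => // y [e1 e2]; apply: iA.
Qed.

Fact gd1_continuous : continuous gd1.
Proof.
apply: (@continuous_comp_initial (set_type trivial_pair) _ _ \val) => x A [i _ iA].
by exists i => // y [e1 e2]; apply: iA; split=> //=; rewrite !lpiM e1 e2.
Qed.

Fact gd0_vertex (v : set_type trivial_pair) : gd0 (\val v) = v.
Proof. exact: originK. Qed.

Fact gd1_vertex (v : set_type trivial_pair) : gd1 (\val v) = v.
Proof.
have e : (sval (\val v)).2 = 1%g by exact: (set_valP v).
by rewrite /gd1 e mulg1; exact: originK.
Qed.

Definition cayley_graph := ProfiniteGraph edge_pair_profinite trivial_pair_closed
  trivial_pair_nonempty gd0_continuous gd1_continuous gd0_vertex gd1_vertex.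

(** Compactness turns local constancy into dependence on one level, the form in which freeness of F
    is used. *)
Lemma level_uniform (T : Type) (g : edge_pair -> T) : loc_const g ->
  exists i, forall x y, near_level i x y -> g x = g y.
Proof.
move=> gc; have /choice[l lP] : forall y, exists i, forall z, near_level i y z -> g z = g y.
  by move=> y; have [i _ iP] := gc y; exists i.
have [Gc _ _] := edge_pair_profinite.
have [r rP] := @finite_cover _ (fun y z => near_level (l y) y z) Gc (fun y => nbhs_level (l y) y).
have [i iP] : exists i, forall y, y \in r -> finer i (l y).
  elim: r {rP} => [|y r [i iP]]; first by exists (level0 F).
  have [k [ki kl]] := finer2 i (l y); exists k => z.
  by rewrite seq.inE => /orP[/eqP ->|/iP/(finer_trans ki)].
exists i => x y [e1 e2]; have [z zr [z1 z2]] := rP x.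
rewrite (lP z x)// (lP z y)//; split.
  by rewrite z1; exact: finer_eq (iP z zr) e1.
by rewrite z2; exact: finer_eq (iP z zr) e2.
Qed.

End GraphSpace.

From mathcomp Require Import generic_quotient.

(** * Exactness of the sequence of the Cayley graph *)

Section CayleyTree.
Local Open Scope classical_set_scope.
Local Open Scope ring_scope.
Variables (p : nat) (p_pr : prime p) (F : lgroup p) (Z : F -> Prop).
Hypotheses (Z_free : free_on Z) (Z_closed : lclosed Z) (Z1 : Z 1%g).
Local Notation Gamma := (cayley_graph Z_closed Z1).
Local Notation V := (set_type (@vertices Gamma)).
Local Notation Es := (edge_space Gamma).
Local Notation eb := (edge_base Gamma).
Local Notation ME := (Zp_free_pointed p eb).
Local Notation MV := (Zp_free p V).
Local Notation "'R_ n" := ('Z_(p ^ n.+1)) (at level 8, n at level 2).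
Local Notation o := (@origin p F Z : V -> F).
Local Notation rep y := (repr (y : {eq_quot (collapse_rel (@vertices Gamma))}%qT) : Gamma).
Implicit Types (x : Gamma) (n : nat).

Lemma class_vertex x y : vertices x -> vertices y -> edge_class x = edge_class y.
Proof.
move=> vx vy; apply/eqmodP; rewrite /= /collapse_rel; apply/orP; right.
by apply/andP; split; exact: mem_set.
Qed.

Lemma class_eq x y : edge_class x = edge_class y -> x = y \/ vertices x /\ vertices y.
Proof.
move/eqmodP => /orP[/eqP|/andP[vx vy]]; first by left.
by right; split; exact: set_mem.
Qed.

Lemma class_rep (y : Es) : edge_class (rep y) = y.
Proof. exact: reprK. Qed.

Lemma rep_class (T : Type) (g : Gamma -> T) x :
  (forall y z, vertices y -> vertices z -> g y = g z) -> g (rep (edge_class x)) = g x.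
Proof. by move=> gv; have [->//|[vx vy]] := class_eq (class_rep (edge_class x)); exact: gv. Qed.

Lemma base_class x : vertices x -> eb = edge_class x.
Proof. by apply: class_vertex; case: cid. Qed.

Lemma rep_loc_const (T : choiceType) (g : Gamma -> T) : loc_const g ->
  (forall y z, vertices y -> vertices z -> g y = g z) -> loc_const (fun y : Es => g (rep y)).
Proof.
move=> gc gv y; pose A : set Es := [set z | g (rep z) = g (rep y)].
suff Ao : open A by exact: open_nbhs_nbhs.
suff : open ((@edge_class Gamma) @^-1` A) by [].
rewrite openE => x xA; have gx : g x = g (rep y) by rewrite -xA (rep_class x gv).
apply: filterS (gc x) => z zx.
by rewrite /A /= (rep_class z gv) -gx.
Qed.

Lemma class_loc_const (T : Type) (f : Es -> T) : loc_const f ->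
  loc_const (fun x => f (edge_class x)).
Proof. by apply: loc_const_cont; exact: pi_continuous. Qed.

Definition level_const (T : Type) (c : F -> T) :=
  exists i : level F, forall s t : F, lpi i s = lpi i t -> c s = c t.

Lemma origin_loc_const (T : Type) (c : F -> T) : level_const c -> loc_const (fun v : V => c (o v)).
Proof.
move=> [i ci]; apply: (@loc_const_cont V Gamma T \val (fun x => c (sval x).1)).
  exact: initial_continuous.
by move=> x; exists i => // y [e1 _]; exact/esym/ci.
Qed.

Lemma level_const_sum n (I : Type) (s : seq I) (P : pred I) (h : I -> 'R_n) (c : I -> F -> 'R_n) :
  (forall j, level_const (c j)) -> level_const (fun t => \sum_(j <- s | P j) h j * c j t).
Proof.
move=> cc; elim: s => [|j s [i ci]].
  by exists (level0 F) => x y _; rewrite !big_nil.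
have [i' ci'] := cc j; have [k [ki ki']] := finer2 i i'; exists k => x y xy.
rewrite !big_cons (ci' x y (finer_eq ki' xy)).
by have := ci x y (finer_eq ki xy) => ->.
Qed.

(** The dual of the exact sequence modulo p^(n+1): every continuous function on the edges vanishing
    at the base is an increment, by [tree_exact]. The sequence of measures is deduced from it by
    duality. *)
Lemma potential n (f : Es -> 'R_n) : loc_const f -> f eb = 0 ->
  exists c : F -> 'R_n, level_const c /\
    forall x, c ((sval x).1 * (sval x).2)%g - c (sval x).1 = f (edge_class x).
Proof.
move=> fc f0; pose psi (t z : F) : 'R_n :=
  if pselect (Z z) is left h then f (edge_class (exist (fun x : F * F => Z x.2) (t, z) h : Gamma))
  else 0.
have psiE t z (h : Z z) :
    psi t z = f (edge_class (exist (fun x : F * F => Z x.2) (t, z) h : Gamma)).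
  by rewrite /psi; case: pselect => // h'; rewrite (Prop_irrelevance h' h).
have p1 : (1 < p ^ n.+1)%N by rewrite -(expn0 p) ltn_exp2l// prime_gt1.
have [|||c [cl cE]] := @tree_exact p p_pr F Z Z_free ('R_n : finZmodType) psi.
- by exists n.+1 => e; rewrite -(mulr_natr (e : 'R_n)) pchar_Zp// mulr0.
- have [i iP] := level_uniform Z_closed (class_loc_const fc); exists i.
  by move=> t t' z z' Zz Zz' tt zz; rewrite !psiE; apply: iP.
- by move=> t; rewrite psiE -f0 (base_class (x := vpair Z1 t)).
exists c; split=> // -[[t z] Zz] /=; rewrite -psiE; exact: cE.
Qed.

Lemma potential_unique n (c c' : F -> 'R_n) : level_const c -> level_const c' ->
  (forall x, c ((sval x).1 * (sval x).2)%g - c (sval x).1 =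
             c' ((sval x).1 * (sval x).2)%g - c' (sval x).1) ->
  exists a, forall t, c t = c' t + a.
Proof.
move=> [i ci] [j cj] cc; exists (c 1%g - c' 1%g) => t.
have [k [ki kj]] := finer2 i j.
rewrite addrC; apply/(canRL (subrK _)).
apply: (tree_connected Z_free (u := fun t => c t - c' t)).
  by exists k => x y xy; rewrite (ci x y (finer_eq ki xy)) (cj x y (finer_eq kj xy)).
move=> s z Zz; have := cc (exist (fun x : F * F => Z x.2) (s, z) Zz : Gamma) => /= h.
exact/esym/subr_swap/esym.
Qed.

(** The function on edges whose integral against a measure u is the coefficient at [k] of delta(u).
    It vanishes on vertices and hence descends to the collapsed edge space. *)
Definition boundary (r : finite_quotient V) k n x : 'R_n :=
  (r (d1 x) == k)%:R - (r (d0 x) == k)%:R.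
Arguments boundary : clear implicits.

Lemma boundary_vertex (r : finite_quotient V) k n x : vertices x -> boundary r k n x = 0.
Proof.
move=> vx; rewrite /boundary; have -> : d1 x = d0 x; last by rewrite subrr.
by rewrite /= /gd1 (vx : (sval x).2 = 1%g) mulg1.
Qed.

Lemma boundary_vertices (r : finite_quotient V) k n y z : vertices y -> vertices z ->
  boundary r k n y = boundary r k n z.
Proof. by move=> vy vz; rewrite !boundary_vertex. Qed.

Lemma boundary_class (r : finite_quotient V) k n x : boundary r k n (rep (edge_class x)) = boundary r k n x.
Proof. by apply: rep_class => y z; exact: boundary_vertices. Qed.

Lemma diff_loc_const (T : Type) n (h : T -> 'R_n) (f : V -> T) : loc_const f ->
  loc_const (fun x : Gamma => h (f (d1 x)) - h (f (d0 x))).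
Proof.
move=> fc; have c1 := loc_const_cont (@d1_continuous Gamma) fc.
have c0 := loc_const_cont (@d0_continuous Gamma) fc.
exact: (loc_const_comp (fun y => h y.1 - h y.2) (loc_const_pair c1 c0)).
Qed.

Lemma boundary_lc (r : finite_quotient V) k n : loc_const (fun y : Es => boundary r k n (rep y)).
Proof.
apply: (rep_loc_const (g := boundary r k n)); last by move=> y z; exact: boundary_vertices.
exact: (diff_loc_const (fun l => (l == k)%:R) (quotient_loc_const r)).
Qed.

Lemma boundary_base (r : finite_quotient V) k n : vanish (Some eb) (fun y : Es => boundary r k n (rep y)).
Proof. by rewrite /= (base_class (x := vpair Z1 1%g))// boundary_class boundary_vertex. Qed.

Lemma reduceB n (b b' : bool) : reduce (b%:R - b'%:R : 'Z_(p ^ n.+2)) = b%:R - b'%:R :> 'R_n.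
Proof.
have r0 : reduce (0 : 'Z_(p ^ n.+2)) = 0 by exact: padic0_compat.
have r1 : reduce (1 : 'Z_(p ^ n.+2)) = 1 by exact: padic1_compat.
have rN (x : 'Z_(p ^ n.+2)) : reduce (- x) = - reduce x by exact: (redN (@Zp_trunc_dvd p n)).
by case: b b' => -[]; rewrite ?subrr ?subr0 ?sub0r ?rN ?r0 ?r1.
Qed.

Lemma boundary_compat (u : ME) (r : finite_quotient V) k n :
  inZp (integ u (fun y => boundary r k n.+1 (rep y))) = integ u (fun y => boundary r k n (rep y)).
Proof.
have := integ_reduce u (@boundary_lc r k n.+1) (@boundary_base r k n.+1).
rewrite /reduce => <-; congr (integ u _); apply/funext => y.
exact: reduceB.
Qed.

Lemma indicator_sum n (a b : nat) (f : 'I_a -> 'I_b) (l : 'I_a) k :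
  \sum_(j | f j == k) (l == j)%:R = (f l == k)%:R :> 'R_n.
Proof.
have [lk|lk] := boolP (f l == k).
  rewrite (bigD1 l)//= eqxx big1 ?addr0// => j /andP[_ jl].
  by rewrite eq_sym (negPf jl).
rewrite big1// => j jk; case: eqP => // lj; by rewrite lj jk in lk.
Qed.

Program Definition delta_fun (u : ME) : MV := @CompletedModule p V None
  (fun r k => @Padic p (fun n => integ u (fun y => boundary r k n (rep y))) _) _ _.
Next Obligation. by move=> u r k n; exact: boundary_compat. Qed.
Next Obligation. by []. Qed.
Next Obligation.
move=> u q r f fqr k _; apply: padicP => n; rewrite residue_sum /=.
rewrite -integ_sum; [|by move=> j; exact: boundary_lc|by move=> j; exact: boundary_base].
congr (integ u _); apply/funext => y; rewrite /boundary sumrB.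
by rewrite !indicator_sum !fqr.
Qed.

Program Definition eps_fun (v : MV) : padic p := @Padic p (fun n => integ v (fun=> 1 : 'R_n)) _.
Next Obligation.
move=> v n; have c1 : loc_const (fun _ : V => 1 : 'R_n.+1) by move=> x; exact: filterE.
have := integ_reduce v c1 I; by rewrite /reduce => <-; congr (integ v _).
Qed.

Lemma const_lc (X : topologicalType) (T : Type) (a : T) : loc_const (fun _ : X => a).
Proof. by move=> x; exact: filterE. Qed.

Lemma delta_linear (a : padic p) (u v : ME) :
  delta_fun (a *: u + v) = a *: delta_fun u + delta_fun v.
Proof.
apply: completed_moduleP => r k; apply: padicP => n /=.
by rewrite integ_linear//; [exact: boundary_lc|exact: boundary_base].
Qed.

Lemma eps_linear (a : padic p) (u v : MV) : eps_fun (a *: u + v) = a * eps_fun u + eps_fun v.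
Proof. by apply: padicP => n /=; rewrite integ_linear//; exact: const_lc. Qed.

(** The adjunction between [delta_fun] and the increment of functions, by linearity from the case of
    indicators. *)
Lemma integ_delta n (w : ME) (c : F -> 'R_n) : level_const c ->
  integ (delta_fun w) (fun v => c (o v)) =
  integ w (fun y => c (o (d1 (rep y))) - c (o (d0 (rep y)))).
Proof.
move=> /origin_loc_const cc; have [r [h hP]] := quotient_exists cc.
rewrite (integE (base := None) _ hP I) /=.
transitivity (\sum_k integ w (fun y => h k * boundary r k n (rep y))).
  by apply: eq_bigr => k _; rewrite integZ//; [exact: boundary_lc|exact: boundary_base].
rewrite -integ_sum.
- congr (integ w _); apply/funext => y; rewrite !hP.
  have pick l : \sum_k h k * (l == k)%:R = h l.
    rewrite (bigD1 l)//= eqxx mulr1 big1 ?addr0// => k kl.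
    by rewrite eq_sym (negPf kl) mulr0.
  by rewrite -[X in _ = X - _]pick -[X in _ = _ - X]pick -sumrB; apply: eq_bigr => k _; rewrite mulrBr.
- by move=> k; apply: (loc_const_comp (fun a => h k * a)); exact: boundary_lc.
- by move=> k; have := @boundary_base r k n; rewrite /vanish => ->; rewrite mulr0.
Qed.

Lemma integ_null (X : topologicalType) (base : option X) n (f : X -> 'R_n) :
  loc_const f -> vanish base f -> integ (0 : completed_module p base) f = 0.
Proof.
move=> fc f0; have [q [h hP]] := quotient_exists fc.
by rewrite (integE _ hP f0) big1// => k _; exact: mulr0.
Qed.

Lemma integ_potential n (v : MV) (c c' : F -> 'R_n) : eps_fun v = 0 ->
  level_const c -> level_const c' ->
  (forall x, c ((sval x).1 * (sval x).2)%g - c (sval x).1 =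
             c' ((sval x).1 * (sval x).2)%g - c' (sval x).1) ->
  integ v (fun w => c (o w)) = integ v (fun w => c' (o w)).
Proof.
move=> ev hc hc' cc; have [a aE] := potential_unique hc hc' cc.
have e1 : integ v (fun=> 1 : 'R_n) = 0 by have := congr1 (fun x : padic p => x n) ev.
have -> : (fun w => c (o w)) = fun w => c' (o w) + a * 1.
  by apply/funext => w; rewrite aE mulr1.
rewrite integD//; [|exact: origin_loc_const|exact: const_lc].
by rewrite integZ ?e1 ?mulr0 ?addr0//; exact: const_lc.
Qed.

Definition indicator (q : finite_quotient Es) k n (y : Es) : 'R_n := (q y == k)%:R.
Arguments indicator : clear implicits.

Lemma indicator_lc (q : finite_quotient Es) k n : loc_const (@indicator q k n).
Proof. exact: (loc_const_comp (fun l => (l == k)%:R) (quotient_loc_const q)). Qed.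

Lemma indicator_base (q : finite_quotient Es) k n : ~~ is_base (Some eb) k ->
  @indicator q k n eb = 0.
Proof. by rewrite /indicator /is_base => /negPf ->. Qed.

Definition indicator_potential (q : finite_quotient Es) k n (c : F -> 'R_n) := level_const c /\
  forall x, c ((sval x).1 * (sval x).2)%g - c (sval x).1 = indicator q k n (edge_class x).
Arguments indicator_potential : clear implicits.

(** A coefficient of [w] is the integral of an indicator, which is the increment of a potential c;
    by adjunction it equals the integral of c against [delta_fun w]. *)
Lemma delta_injective (w : ME) : delta_fun w = 0 -> w = 0.
Proof.
move=> w0; apply: completed_moduleP => q k; apply: padicP => n.
have [kb|kb] := boolP (is_base (Some eb) k); first by rewrite !coef_base.
rewrite -(integ_indicator n w kb).
have [c [cl cE]] := potential (@indicator_lc q k n) (indicator_base n kb).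
transitivity (integ (delta_fun w) (fun v => c (o v))); last first.
  by rewrite w0 integ_null//; exact: origin_loc_const.
rewrite integ_delta//; congr (integ w _); apply/funext => y.
have := cE (rep y); rewrite class_rep /indicator => <-.
by [].
Qed.

(** The coefficient of a preimage of [v] that the adjunction forces: the integral against [v] of a
    potential of the indicator. The potential is unique up to a constant, which integrates to 0 when
    [eps_fun v = 0]. *)
Definition primitive (v : MV) (q : finite_quotient Es) k n : 'R_n :=
  if is_base (Some eb) k then 0 else
  if pselect (exists c, indicator_potential q k n c) is left e
  then integ v (fun w => sval (cid e) (o w)) else 0.
Arguments primitive : clear implicits.

Lemma primitiveE (v : MV) (q : finite_quotient Es) k n (c : F -> 'R_n) : eps_fun v = 0 -> ~~ is_base (Some eb) k ->
  indicator_potential q k n c -> primitive v q k n = integ v (fun w => c (o w)).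
Proof.
move=> ev kb hc; rewrite /primitive (negPf kb); case: pselect => [e|[]]; last by exists c.
case: (cid e) => c' [cl' cE'] /=; case: hc => cl cE.
by apply: integ_potential => // x; rewrite cE cE'.
Qed.

Lemma indicator_potential_exists (q : finite_quotient Es) k n : ~~ is_base (Some eb) k ->
  exists c, @indicator_potential q k n c.
Proof. by move=> kb; exact: (potential (@indicator_lc q k n) (indicator_base n kb)). Qed.

(** All compatibilities come from the independence of the potential: reductions of potentials are
    potentials modulo a smaller power, and sums over a fibre of a transition map are potentials of
    the indicator downstairs. *)
Lemma delta_surjective (v : MV) : eps_fun v = 0 -> exists u, delta_fun u = v.
Proof.
move=> ev.
have compat q k n : inZp (primitive v q k n.+1) = primitive v q k n.
  have [kb|kb] := boolP (is_base (Some eb) k).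
    by rewrite /primitive kb; exact: padic0_compat.
  have [c hc] := @indicator_potential_exists q k n.+1 kb; have [[i ci] cE] := hc.
  rewrite (primitiveE ev kb hc) (primitiveE (c := fun t => reduce (c t)) ev kb).
    by rewrite integ_reduce//; apply: origin_loc_const; exists i.
  split; first by exists i => x y /ci ->.
  have rB (a b : 'Z_(p ^ n.+2)) : reduce (a - b) = reduce a - reduce b.
    rewrite /reduce (redD (@Zp_trunc_dvd p n)); congr (_ + _).
    exact: (redN (@Zp_trunc_dvd p n)).
  move=> x; rewrite -rB cE /indicator.
  by have := reduceB n (q (edge_class x) == k) false; rewrite !subr0.
have cb (q : finite_quotient Es) k : is_base (Some eb) k -> Padic (compat q k) = 0.
  by move=> kb; apply: padicP => n; rewrite /= /primitive kb.
have cc (q r : finite_quotient Es) (f : 'I_(quo_card q) -> 'I_(quo_card r)) :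
    (forall y, f (q y) = r y) -> forall k, ~~ is_base (Some eb) k ->
    Padic (compat r k) = \sum_(j | f j == k) Padic (compat q j).
  move=> fqr k kb; apply: padicP => n; rewrite residue_sum /=.
  have jb j : f j == k -> ~~ is_base (Some eb) j.
    move=> /eqP fj; apply: contra kb; rewrite /is_base => /eqP qj.
    by rewrite -fqr qj fj.
  have /choice[c cP] : forall j, exists c : F -> 'R_n, level_const c /\
      (f j == k -> indicator_potential q j n c).
    move=> j; have [fj|fj] := boolP (f j == k); last first.
      by exists (fun=> 0); split=> //; exists (level0 F).
    by have [c hc] := @indicator_potential_exists q j n (jb j fj); exists c; split=> //; case: hc.
  rewrite (eq_bigr (fun j => integ v (fun w => c j (o w)))) => [|j fj]; last first.
    by rewrite (primitiveE ev (jb j fj) ((cP j).2 fj)).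
  rewrite -integ_sum//; last by move=> j; apply: origin_loc_const; case: (cP j).
  rewrite (primitiveE (c := fun t => \sum_(j | f j == k) c j t) ev kb)//; split.
    have [i iP] := level_const_sum (index_enum _) (fun j => f j == k) (fun=> 1) (fun j => (cP j).1).
    by exists i => x y /iP; under eq_bigr do rewrite mul1r; under [in RHS]eq_bigr do rewrite mul1r.
  move=> x; rewrite -sumrB (eq_bigr (fun j => (q (edge_class x) == j)%:R)).
    by rewrite indicator_sum fqr.
  by move=> j fj; case: ((cP j).2 fj) => _ ->.
pose u : ME := CompletedModule cb cc.
exists u; apply: completed_moduleP => r k; apply: padicP => n /=.
(* The function [boundary] is a combination of indicators with coefficients [h]. The same
   combination of their potentials and the indicator of [k] on vertices have equal increments, hence
   equal integrals against [v]. *)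
have [q [h hP]] := quotient_exists (@boundary_lc r k n).
rewrite (integE u hP (@boundary_base r k n)) /=.
have /choice[c cP] : forall j, exists c : F -> 'R_n, level_const c /\
    (~~ is_base (Some eb) j -> indicator_potential q j n c).
  move=> j; have [jb|jb] := boolP (is_base (Some eb) j).
    by exists (fun=> 0); split=> //; exists (level0 F).
  by have [c hc] := @indicator_potential_exists q j n jb; exists c; split=> //; case: hc.
have hb j : is_base (Some eb) j -> h j = 0.
  by rewrite /is_base => /eqP <-; rewrite -hP; exact: boundary_base.
rewrite (eq_bigr (fun j => integ v (fun w => h j * c j (o w)))) => [|j _]; last first.
  rewrite integZ//; last by apply: origin_loc_const; case: (cP j).
  have [jb|jb] := boolP (is_base (Some eb) j); first by rewrite hb// !mul0r.
  by rewrite (primitiveE ev jb ((cP j).2 jb)).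
rewrite -integ_sum//; last first.
  by move=> j; apply: (loc_const_comp (fun a => h j * a)); apply: origin_loc_const; case: (cP j).
have lc := level_const_sum (index_enum _) predT h (fun j => (cP j).1).
have rl : level_const (fun t => (r (vtx Z1 t) == k)%:R : 'R_n).
  have [i iP] := level_uniform Z_closed (loc_const_cont (@d0_continuous Gamma)
    (quotient_loc_const r)).
  exists i => s t st; have := iP (vpair Z1 s) (vpair Z1 t) (conj st erefl).
  by rewrite /= /gd0 /= => ->.
rewrite (@integ_potential n v (fun t => \sum_j h j * c j t) _ ev lc rl).
  rewrite -[RHS](integ_indicator (base := None) n v (q := r) (k := k))//.
  by congr (integ v _); apply/funext => w; rewrite originK.
move=> x; rewrite -sumrB.
transitivity (h (q (edge_class x))); last first.
  by rewrite -hP boundary_class.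
rewrite (bigD1 (q (edge_class x)))//= big1 => [|j jq].
  rewrite addr0 -mulrBr; have [jb|jb] := boolP (is_base (Some eb) (q (edge_class x))).
    by rewrite hb// mul0r.
  by have [_ ->] := (cP _).2 jb; rewrite /indicator eqxx mulr1.
rewrite -mulrBr; have [jb|jb] := boolP (is_base (Some eb) j); first by rewrite hb// mul0r.
by have [_ ->] := (cP _).2 jb; rewrite /indicator eq_sym (negPf jq) mulr0.
Qed.

Lemma eps_delta (u : ME) : eps_fun (delta_fun u) = 0.
Proof.
apply: padicP => n /=; have l1 : level_const (fun _ : F => 1 : 'R_n) by exists (level0 F).
rewrite (integ_delta u l1); rewrite (_ : (fun _ => _) = fun=> 0) ?integ0//.
by apply/funext => y; rewrite subrr.
Qed.

Theorem cayley_graph_tree : pro_p_tree p Gamma.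
Proof.
pose delta : {linear ME -> MV} :=
  HB.pack delta_fun (GRing.isLinear.Build (padic p) ME MV _ delta_fun delta_linear).
pose eps : {scalar MV} :=
  HB.pack eps_fun (GRing.isLinear.Build (padic p) MV (padic p) _ eps_fun eps_linear).
have basis_at (v : V) r k n : (basis_elt v : MV) r k n = (r v == k)%:R :> 'R_n.
  by rewrite /=; case: eqP.
exists delta, eps; split.
- split.
    apply: module_continuous => r k n.
    exact: (integ_loc_const (@boundary_lc r k n) (@boundary_base r k n)).
  move=> e _; apply: completed_moduleP => r k; apply: padicP => n.
  transitivity (boundary r k n e).
    rewrite -boundary_class.
    exact: (integ_basis (edge_class e) (@boundary_lc r k n) (@boundary_base r k n)).
  by rewrite /boundary -!basis_at.
- split.
    have h n : loc_const (fun v : MV => eps_fun v n).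
      exact: (@integ_loc_const p V None n (fun=> 1) (@const_lc V _ 1) I).
    exact: (padic_continuous h).
  move=> v; apply: padicP => n; transitivity (1 : 'R_n); last by [].
  exact: (@integ_basis p V None n v (fun=> 1) (@const_lc V _ (1 : _)) I).
- move=> u u' uu; apply/eqP; rewrite -subr_eq0; apply/eqP/delta_injective.
  have -> : u - u' = -1 *: u' + u by rewrite scaleN1r addrC.
  by rewrite delta_linear scaleN1r (uu : delta_fun u = delta_fun u') addNr.
- apply/seteqP; split=> [_ [u _ <-]|v /= v0]; first exact: eps_delta.
  by have [u <-] := delta_surjective v0; exists u.
(* Any single vertex gives surjectivity of [eps], here the one at 1. *)
- apply/seteqP; split=> // a _; exists (a *: basis_elt (vtx Z1 1%g)) => //.
  apply: padicP => n; rewrite -[_ *: _]addr0.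
  transitivity (a n * integ (basis_elt (vtx Z1 1%g) : MV) (fun=> 1 : 'R_n) +
    integ (0 : MV) (fun=> 1 : 'R_n)).
    exact: (@integ_linear p V None n a _ _ (fun=> 1) (@const_lc V _ (1 : _)) I).
  rewrite (@integ_basis p V None n _ (fun=> 1) (@const_lc V _ (1 : _)) I).
  rewrite (@integ_null V None n (fun=> 1) (@const_lc V _ (1 : _)) I).
  by rewrite mulr1 addr0.
Qed.

End CayleyTree.

Local Open Scope classical_set_scope.

Theorem theorem1p1 (p : nat) (p_prime : prime p) (G : topGroupType)
    (G_vfree : virtually_free_pro_p_group p G) :
  exists (Gamma : profinite_graph) (act : G -> Gamma -> Gamma),
    [/\ pro_p_tree p Gamma,
        graph_action act &
        forall v : Gamma, vertices v ->
          finite_set [set g : G | act g v = v]].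
Proof.
have [G_pro [H [H_open [_ [X [x0 [iota [X_pf iota_free]]]]]]]] := G_vfree.
have Hn : nbhs_subgroup (elts H).
  have HV x : elts H x -> elts H x^-1%g.
    by move=> Hx; have := subgroupF (subgroup1 H) Hx; rewrite mul1g.
  split=> // [|x y Hx /HV Hy]; first by apply: open_nbhs_nbhs; split=> //; exact: subgroup1.
  by have := subgroupF Hx Hy; rewrite invgK.
have [n0 [th0 [th0M th0_open th0H]]] := coset_action G_pro.1 Hn.
have [H1 HM HV] := Hn; have [[Gc _ _] _] := G_pro.
(* Cosets H g, on the side required for H-equivariant functions on G. *)
pose R (x y : G) := elts H (y * x^-1)%g.
have [m [rho [idx [rhoR idxR idxK]]]] : exists m (rho : 'I_m -> G) (idx : G -> 'I_m),
    [/\ forall g, R (rho (idx g)) g, forall g g', R g g' -> idx g = idx g' &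
      forall k, idx (rho k) = k].
  apply: finite_classes => //.
  - by move=> y; apply: near_mull; rewrite mulgV.
  - by move=> x; rewrite /R mulgV; exact: subgroup1.
  - by move=> x y /HV; rewrite /R invMg invgK.
  - by move=> x y z xy yz; have := HM _ _ yz xy; rewrite /R mulgA mulgVK.
(* There is at least one coset, so the box has [k.+1] coordinates and coordinate 0 exists. *)
case: m rho idx rhoR idxR idxK => [rho idx|k rho idx rhoR idxR idxK]; first by case: (idx 1%g).
have idxM h g : elts H h -> idx (h * g)%g = idx g.
  by move=> Hh; apply/esym/idxR; rewrite /R mulgK.
have [F [Z [a [t [[[Zf Zc] aZ aM a1 aG] [tM tc ac fin]]]]]] :=
  action_data p_prime G_pro th0M th0_open th0H X_pf iota_free rhoR idxM idxK.
have Z1 : Z 1%g by case: Zf.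
(* Origins move by the twisted action, labels of edges by the plain one. This respects endpoints
   because [a g] is multiplicative, and the cocycle rule for [t] makes it an action. *)
pose act (g : G) (x : cayley_graph Zc Z1) : cayley_graph Zc Z1 :=
  exist (fun x : F * F => Z x.2) ((t g * a g (sval x).1)%g, a g (sval x).2) (aZ g _ (svalP x)).
have t1 : t 1%g = 1%g.
  by apply: (@mulgI _ (t 1%g)); have := tM 1%g 1%g; rewrite !mulg1 a1 => /esym.
have aone g : a g 1%g = 1%g by apply: (@mulgI _ (a g 1%g)); rewrite -aM !mulg1.
exists (cayley_graph Zc Z1), act; split; first exact: cayley_graph_tree.
- split.
  + by move=> x; apply: edge_pairP; rewrite /= t1 !a1 mul1g; case: (sval x).
  + by move=> g h x; apply: edge_pairP; rewrite /= tM !aG aM mulgA.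
  + move=> [g x] A [i _ iA].
    have [j jP] := ac i g.
    exists ([set g' | lpi i (t g') = lpi i (t g) /\
        forall x y, lpi j x = lpi j y -> lpi i (a g' x) = lpi i (a g y)],
      [set y | near_level j x y]).
      by split; [exact: filterI (tc i g) jP|exact: nbhs_level].
    move=> [g' y] /= [[tg ag] [xy1 xy2]]; apply: iA; split=> /=.
      by rewrite !lpiM tg (ag (sval y).1 (sval x).1).
    by rewrite (ag (sval y).2 (sval x).2).
  + by move=> g x; apply: edge_pairP; rewrite /= aone.
  + by move=> g x; apply: edge_pairP; rewrite /= aone aM mulgA.
(* A group element fixing a vertex fixes its element of F under the twisted action. *)
- move=> v vv; apply: sub_finite_set (fin (sval v).1) => g /= gv.
  by have := congr1 (fun x => (sval x).1) gv.
Qed.
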